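(* Assume hypotheses (A1)–(A10) listed in the context hold. For each $\epsilon>0$ let $(u^\epsilon,m^\epsilon)$ be a solution of the regularized system described in the context. Then $Du^\epsilon\in L^\infty(\mathbb{T}^d\times[0,T])$, and there is a constant $C$ independent of $\epsilon$ such that $\|Du^\epsilon\|_{L^\infty(\mathbb{T}^d\times[0,T])}\le C$.
   Context: $\mathbb{T}^d$ is the $d$-dimensional flat torus, $T>0$ fixed. Data: $H:\mathbb{T}^d\times\mathbb{R}^d\to\mathbb{R}$, $g:[0,\infty)\to\mathbb{R}$, $u_T,m_0:\mathbb{T}^d\to\mathbb{R}$. Hypotheses: (A1) $H$ is $C^\infty$; $p\mapsto H(x,p)$ strictly convex; $\lim_{|p|\to\infty}H(x,p)/|p|=+\infty$; $H\ge1$. (A2) $g$ non-negative and increasing; $u_T,m_0\in C^\infty(\mathbb{T}^d)$, $m_0\ge0$, $\int m_0=1$. (A3) With $\hat L(x,p)=D_pH(x,p)\cdot p-H(x,p)$, there are $c,C>0$ with $\hat L\ge cH-C$. (A4) $g(z)=z^\alpha$, $\alpha>0$. (A5) $|D_xH|,|D^2_{xx}H|\le CH+C$, and for every symmetric matrix $M$ and $\delta>0$ there is $C_\delta$ with $\operatorname{tr}(D^2_{px}H M)\le\delta\operatorname{tr}(D^2_{pp}HM^2)+C_\delta H$. (A6) $m_0\ge\kappa_0>0$ for a constant $\kappa_0$. (A7) For some $0<\mu<1$ and non-negative constants: $c_1|p|^{2+\mu}+C_1\le H\le c_2|p|^{2+\mu}+C_2$. (A8) $|D_pH(x,p)|^2\le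 C|p|^\mu H(x,p)+C$. (A9) $|D^2_{xp}H|^2\le CH^{\frac{2+2\mu}{2+\mu}}$ and, for every symmetric $M$, $|D^2_{pp}HM|^2\le CH^{\frac{\mu}{2+\mu}}\operatorname{tr}(D^2_{pp}HMM)$. (A10) $\alpha<\frac{2}{d(1+\mu)-2}$. Regularized system: $\eta_\epsilon$ is a standard symmetric mollifying kernel and $g_\epsilon(m)=\eta_\epsilon*g(\eta_\epsilon*m)$. A solution is a pair of smooth functions $u^\epsilon,m^\epsilon$ on $\mathbb{T}^d\times[0,T]$ with $-u^\epsilon_t+H(x,Du^\epsilon)=\Delta u^\epsilon+g_\epsilon(m^\epsilon)$, $m^\epsilon_t-\operatorname{div}(D_pH(x,Du^\epsilon)m^\epsilon)=\Delta m^\epsilon$, $u^\epsilon(x,T)=u_T(x)$, $m^\epsilon(x,0)=m_0(x)$. *)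

(* Defs.v *)
From HB Require Import structures.
From mathcomp Require Import all_boot all_order all_algebra.
From mathcomp Require Import all_classical all_reals all_analysis.
Set Implicit Arguments. Unset Strict Implicit. Unset Printing Implicit Defensive.
Import Order.TTheory GRing.Theory Num.Theory.
Import numFieldNormedType.Exports.
Local Open Scope classical_set_scope.
Local Open Scope ring_scope.

Section Defs.
Variable R : realType.

Definition e_ {d : nat} (i : 'I_d) : 'rV[R]_d := delta_mx 0 i.

Definition enorm {d : nat} (v : 'rV[R]_d) : R := Num.sqrt (\sum_i v 0 i ^+ 2).
Definition fnorm {d : nat} (M : 'M[R]_d) : R :=
  Num.sqrt (\sum_i \sum_j M i j ^+ 2).

Fixpoint Ck {E : normedModType R} (k : nat) (f : E -> R) : Prop :=
  continuous f /\
  match k with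
  | 0 => True
  | k'.+1 => (forall z, differentiable f z) /\ forall v : E, Ck k' ('D_v f)
  end.
Definition smooth {E : normedModType R} (f : E -> R) : Prop := forall k, Ck k f.

(** 1-periodicity in every space variable (functions on the flat torus T^d). *)
Definition periodicT {d : nat} (f : 'rV[R]_d -> R) : Prop :=
  forall x i, f (x + e_ i) = f x.

Definition cons_row {n : nat} (a : R) (y : 'rV[R]_n) : 'rV[R]_n.+1 :=
  \row_(i < n.+1) (if unlift ord0 i is Some j then y 0 j else a).
Fixpoint iint (A : set R) (n : nat) : ('rV[R]_n -> R) -> R :=
  match n return ('rV[R]_n -> R) -> R with
  | 0 => fun f => f 0
  | n'.+1 => fun f : 'rV[R]_n'.+1 -> R =>
      \int[lebesgue_measure]_(a in A) @iint A n' (fun y => f (cons_row (a : R) y))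
  end.
Definition int_Rd {d : nat} (f : 'rV[R]_d -> R) : R := @iint setT d f.
Definition int_Td {d : nat} (f : 'rV[R]_d -> R) : R := @iint `[0, 1] d f.

Definition mollifier {d : nat} (eta : 'rV[R]_d -> R) : Prop :=
  [/\ smooth eta, (forall x, 0 <= eta x),
      (forall x, 1 < enorm x -> eta x = 0),
      (forall x, eta (- x) = eta x) & int_Rd eta = 1].
Definition eta_eps {d : nat} (eta : 'rV[R]_d -> R) (eps : R) (x : 'rV[R]_d) : R :=
  eps ^- d * eta (eps^-1 *: x).
Definition mconv {d : nat} (eta : 'rV[R]_d -> R) (eps : R) (f : 'rV[R]_d -> R)
  (x : 'rV[R]_d) : R := int_Rd (fun y => eta_eps eta eps y * f (x - y)).
Definition g_eps {d : nat} (g : R -> R) (eta : 'rV[R]_d -> R) (eps : R)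
  (m : 'rV[R]_d -> R) : 'rV[R]_d -> R :=
  mconv eta eps (fun y => g (mconv eta eps m y)).

Section Ham.
Variable d : nat.
Variable H : 'rV[R]_d -> 'rV[R]_d -> R.
Let Hc (z : ('rV[R]_d * 'rV[R]_d)%type) : R := H z.1 z.2.
Let ex (i : 'I_d) : ('rV[R]_d * 'rV[R]_d)%type := (e_ i, 0).
Let ep (i : 'I_d) : ('rV[R]_d * 'rV[R]_d)%type := (0, e_ i).
Definition DxH (x p : 'rV[R]_d) : 'rV[R]_d := \row_i derive Hc (x, p) (ex i).
Definition DpH (x p : 'rV[R]_d) : 'rV[R]_d := \row_i derive Hc (x, p) (ep i).
Definition DxxH (x p : 'rV[R]_d) : 'M[R]_d :=
  \matrix_(i, j) derive ('D_(ex j) Hc) (x, p) (ex i).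
Definition DppH (x p : 'rV[R]_d) : 'M[R]_d :=
  \matrix_(i, j) derive ('D_(ep j) Hc) (x, p) (ep i).
Definition DpxH (x p : 'rV[R]_d) : 'M[R]_d :=
  \matrix_(i, j) derive ('D_(ex j) Hc) (x, p) (ep i).
Definition DxpH (x p : 'rV[R]_d) : 'M[R]_d :=
  \matrix_(i, j) derive ('D_(ep j) Hc) (x, p) (ex i).
Definition Lhat (x p : 'rV[R]_d) : R := \sum_i DpH x p 0 i * p 0 i - H x p.
End Ham.

(** Functions on T^d x [0,T] are represented as functions on R^d x R. *)
Section Sol.
Variable d : nat.
Local Notation E := ('rV[R]_d * R)%type.
Definition dx (i : 'I_d) : E := (e_ i, 0).
Definition dt : E := (0, 1).
Definition Dx (u : E -> R) (z : E) : 'rV[R]_d := \row_i derive u z (dx i).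
Definition Dt (u : E -> R) (z : E) : R := derive u z dt.
Definition Lap (u : E -> R) (z : E) : R := \sum_i derive ('D_(dx i) u) z (dx i).

Definition reg_solution (H : 'rV[R]_d -> 'rV[R]_d -> R) (g : R -> R)
  (eta : 'rV[R]_d -> R) (eps T : R) (uT m0 : 'rV[R]_d -> R) (u m : E -> R) : Prop :=
  [/\ smooth u /\ smooth m,
      (forall t, periodicT (fun x => u (x, t)) /\ periodicT (fun x => m (x, t))),
      (forall x t, 0 <= t <= T ->
         - Dt u (x, t) + H x (Dx u (x, t))
         = Lap u (x, t) + g_eps g eta eps (fun y => m (y, t)) x),
      (forall x t, 0 <= t <= T ->
         Dt m (x, t)
         - \sum_i derive (fun z => DpH H z.1 (Dx u z) 0 i * m z) (x, t) (dx i)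
         = Lap m (x, t))
      & (forall x, u (x, T) = uT x /\ m (x, 0) = m0 x)].
End Sol.

End Defs.

(* Main.v *)
Require Import Defs.
From HB Require Import structures.
From mathcomp Require Import all_boot all_order all_algebra.
From mathcomp Require Import all_classical all_reals all_analysis.
From mathcomp Require Import ring lra.
Set Implicit Arguments. Unset Strict Implicit. Unset Printing Implicit Defensive.
Import Order.TTheory GRing.Theory Num.Theory.
Import numFieldNormedType.Exports.
Local Open Scope classical_set_scope.
Local Open Scope ring_scope.

(* Write [v] for the mollified density and [F] for the coupling, so that [F <= (max v)^alpha].
   Duality between the two equations (multiplying one by [m], [Lap m] or a supersolution, and the
   other by [u], [Lap u]) produces a nondecreasing function [P] of time with
   [P' >= int v^(alpha+1) + int v^(alpha-1) |Dv|^2] and a total increase bounded uniformly in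
   [eps]. A Hardy inequality turns this dissipation into a bound of [int k v^(alpha+1)] for
   kernels [k] concentrated at a point.
   Testing the equation of [v], respectively of [u], against the periodic Gaussian
   [k = a^(-d/2) exp(-sum_i cos(pi y_i)^2 / a)], an approximate heat kernel, bounds [max v] by a
   power of the size of the drift, respectively [u] by a constant.
   Let [K] be the maximum of all [|D_i u|]. Comparing [u (x + h e_i, t) - u (x, t)] with a concave
   function of [h] at an interior maximum gives
   [K^2 <= C (max F + K^(1+mu)) <= C (K^e + K^(1+mu))], where
   [e = (1+mu) (d+kappa) alpha / (alpha+1) < 2] by (A10) when [kappa] is small; hence [K <= C]. *)

(** * Smooth functions and directional derivatives *)

Section Lines.
Variable R : realType.

(** Mollifying twice by the same even kernel makes the coupling symmetric: testing [F] against [h]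
    is testing [v^alpha] against the mollified [h]. Hence [m] and [Lap m] yield exactly
    [v^(alpha+1)] and [v^(alpha-1) |Dv|^2], with no trace of [eps]. The exponent [e] comes from
    scaling. With a drift of size [B ~ K^(1+mu)], a maximum [M] of [v] stays visible to a kernel of
    radius [r ~ 1/(1+B)] for a time of order [r^2]. Hardy keeps the rate of dissipation above a
    multiple of [M^(alpha+1) r^(d-2+kappa)] meanwhile, so [M^(alpha+1) <= C r^-(d+kappa)]. The loss
    [kappa] is the price for including [d = 2], where the Hardy inequality degenerates. The square
    of [K] comes from a bound [S] on the oscillation of [u]: a slope [K] persists only over lengths
    of order [S/K], which allows a comparison function of concavity [K^2/S]; the same length turns
    [|D_x H| <= C K^(2+mu)] into [K^(1+mu)]. (A10) acts twice: it gives [(d-2+kappa) alpha < 2],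
    which bounds [u] before anything is known about [K], and it gives [e < 2]. *)

Lemma is_derive_fun (E : normedModType R) (f : E -> R) z v (df : R) (g : E -> R) dg :
  is_derive z v f df -> f =1 g -> df = dg -> is_derive z v g dg.
Proof. by move=> fd /funext <- <-. Qed.

Lemma is_derive_add (E : normedModType R) (f g : E -> R) z v (df dg : R) :
  is_derive z v f df -> is_derive z v g dg ->
  is_derive z v (fun y => f y + g y) (df + dg).
Proof. by move=> fd gd; exact: is_deriveD. Qed.

Lemma is_derive_sub (E : normedModType R) (f g : E -> R) z v (df dg : R) :
  is_derive z v f df -> is_derive z v g dg ->
  is_derive z v (fun y => f y - g y) (df - dg).
Proof. by move=> fd gd; exact: is_deriveB. Qed.

Lemma is_derive_opp (E : normedModType R) (f : E -> R) z v (df : R) :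
  is_derive z v f df -> is_derive z v (fun y => - f y) (- df).
Proof. by move=> fd; exact: is_deriveN. Qed.

Lemma is_derive_const (E : normedModType R) (c : R) (z v : E) :
  is_derive z v (fun=> c) 0.
Proof. exact: is_derive_cst. Qed.

Lemma is_derive_idR (x : R) : is_derive x 1 (fun y : R => y) 1.
Proof. exact: is_derive_id. Qed.

Lemma is_derive_mul (E : normedModType R) (f g : E -> R) z v (df dg : R) :
  is_derive z v f df -> is_derive z v g dg ->
  is_derive z v (fun y => f y * g y) (df * g z + f z * dg).
Proof.
move=> fd gd; apply: is_derive_fun (is_deriveM fd gd) _ _ => //.
by rewrite addrC /GRing.scale /= [g z * df]mulrC.
Qed.

Lemma is_derive_lmul (E : normedModType R) (c : R) (f : E -> R) z v (df : R) :
  is_derive z v f df -> is_derive z v (fun y => c * f y) (c * df).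
Proof.
move=> fd; apply: is_derive_fun (is_derive_mul (is_derive_const c z v) fd) _ _ => //.
by rewrite mul0r add0r.
Qed.

Lemma is_derive_bigsum (E : normedModType R) (I : Type) (r : seq I) (f : I -> E -> R) z v
  (df : I -> R) : (forall i, is_derive z v (f i) (df i)) ->
  is_derive z v (fun y => \sum_(i <- r) f i y) (\sum_(i <- r) df i).
Proof.
move=> fd; elim: r => [|i r IH].
  rewrite big_nil; apply: is_derive_fun (is_derive_const 0 z v) _ _ => // y.
  by rewrite big_nil.
rewrite big_cons; apply: is_derive_fun (is_derive_add (fd i) IH) _ _ => // y.
by rewrite big_cons.
Qed.

Lemma is_derive_compR (f g : R -> R) (x a b : R) :
  is_derive (g x) 1 f a -> is_derive x 1 g b ->
  is_derive x 1 (fun y => f (g y)) (a * b).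
Proof. by move=> fd gd; exact: is_derive1_comp. Qed.

Lemma is_derive_line (E : normedModType R) (f : E -> R) (z v : E) (s : R) :
  derivable f (z + s *: v) v ->
  is_derive s 1 (fun t : R => f (z + t *: v)) ('D_v f (z + s *: v)).
Proof.
move=> fd.
have E1 : (fun h : R => h^-1 *: (f (z + (h *: (1 : R) + s) *: v) - f (z + s *: v)))
    = (fun h : R => h^-1 *: (f (h *: v + (z + s *: v)) - f (z + s *: v))).
  apply/funext => h; congr (_ *: (f _ - _)).
  by rewrite [h *: (1:R)](mulr1 h) scalerDl addrCA.
apply: DeriveDef; first by rewrite /derivable /= E1.
by rewrite /derive /= E1.
Qed.

Lemma mean_value (f df : R -> R) (a b : R) : a <= b ->
  (forall x, a <= x <= b -> is_derive x 1 f (df x)) ->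
  exists2 c, a <= c <= b & f b - f a = df c * (b - a).
Proof.
move=> ab fd.
have [c cab ->] : exists2 c, c \in `[a, b]%R & f b - f a = df c * (b - a).
  apply: MVT_segment => //.
    by move=> x; rewrite in_itv /= => /andP[ax xb]; apply: fd; rewrite !ltW.
  apply: derivable_within_continuous => x; rewrite in_itv /= => xab.
  by have [] := fd x xab.
by exists c.
Qed.

Lemma mean_value_line (E : normedModType R) (f : E -> R) (z v : E) :
  (forall y, derivable f y v) ->
  forall c, exists2 t, 0 <= t <= 1 &
    f (z + c *: v) - f z = c * 'D_v f (z + (t * c) *: v).
Proof.
move=> fd c.
have dl (x : R) : is_derive x 1 (fun t : R => f (z + (t * c) *: v)) (c * 'D_v f (z + (x * c) *: v)).
  have h1 := @is_derive_line E f z v (x * c) (fd _).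
  have h2 : is_derive x (1 : R) (fun t : R => t * c) c.
    by apply: is_derive_fun (is_derive_lmul c (is_derive_idR x)) _ _ => [y|]; rewrite mulrC ?mul1r.
  have := @is_derive1_comp R (fun t => f (z + t *: v)) (fun t => t * c) x _ _ h1 h2.
  by rewrite mulrC.
have [t t01] := mean_value ler01 (fun x _ => dl x).
by rewrite mul1r mul0r scale0r addr0 subr0 mulr1 => fE; exists t.
Qed.

Lemma ndecr_deriv (f df : R -> R) (a b : R) : a <= b ->
  (forall x, a <= x <= b -> is_derive x 1 f (df x)) ->
  (forall x, a <= x <= b -> 0 <= df x) -> f a <= f b.
Proof.
move=> ab fd d0; have [c cab E] := mean_value ab fd.
by rewrite -subr_ge0 E mulr_ge0 ?subr_ge0 // d0.
Qed.

Lemma diff_eps (E : normedModType R) (f : E -> R) (L : {linear E -> R}) x :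
  continuous L ->
  (forall e, 0 < e -> \forall h \near (0 : E), `|f (h + x) - f x - L h| <= e * `|h|) ->
  differentiable f x.
Proof.
move=> cL H.
have H1 : f \o shift x = cst (f x) + L +o_ (0 : E) id.
  apply/eqaddoP => e e0; near=> h => /=.
  rewrite /= opprD addrA; near: h; exact: H.
apply/diff_locallyP; rewrite (diff_unique cL H1); split => //.
Unshelve. all: by end_near. Qed.

Lemma cont_epsP (X : normedModType R) (f : X -> R) z :
  {for z, continuous f} <-> forall e, 0 < e ->
    exists2 d, 0 < d & forall y, `|y - z| < d -> `|f y - f z| < e.
Proof.
split=> [/cvgrPdist_lt fc e e0|H].
  have /nbhs_ballP [d /= d0 dH] := fc e e0.
  by exists d => // y yd; rewrite distrC; apply: dH; rewrite -ball_normE /ball_ /= distrC.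
apply/cvgrPdist_lt => e e0; have [d d0 dH] := H e e0.
apply/nbhs_ballP; exists d => //= y; rewrite -ball_normE /ball_ /= => yd.
by rewrite distrC; apply: dH; rewrite distrC.
Qed.

Lemma continuous_add (X : topologicalType) (f g : X -> R) :
  continuous f -> continuous g -> continuous (fun z => f z + g z).
Proof. by move=> fc gc z; apply: cvgD; [exact: fc|exact: gc]. Qed.

Lemma continuous_mul (X : topologicalType) (f g : X -> R) :
  continuous f -> continuous g -> continuous (fun z => f z * g z).
Proof. by move=> fc gc z; apply: cvgM; [exact: fc|exact: gc]. Qed.

Lemma continuous_opp (X : topologicalType) (f : X -> R) :
  continuous f -> continuous (fun z => - f z).
Proof. by move=> fc z; apply: cvgN; exact: fc. Qed.

Lemma continuous_const (X : topologicalType) (c : R) : continuous (fun _ : X => c).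
Proof. by move=> z; exact: cvg_cst. Qed.

Lemma continuous_sum (X : topologicalType) I (r : seq I) (f : I -> X -> R) :
  (forall i, continuous (f i)) -> continuous (fun z => \sum_(i <- r) f i z).
Proof.
move=> fc; elim: r => [|i r IH].
  under eq_fun do rewrite big_nil; exact: continuous_const.
under eq_fun do rewrite big_cons; exact: continuous_add.
Qed.

Lemma continuous_compose (X Y Z : topologicalType) (f : Y -> Z) (g : X -> Y) :
  continuous f -> continuous g -> continuous (fun z => f (g z)).
Proof. by move=> fc gc z; apply: continuous_comp; [exact: gc|exact: fc]. Qed.

Lemma continuous_pairing (X Y Z : topologicalType) (f : X -> Y) (g : X -> Z) :
  continuous f -> continuous g -> continuous (fun z => (f z, g z)).
Proof. by move=> fc gc z; apply: cvg_pair; [exact: fc|exact: gc]. Qed.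

(** Finite dimension, given by coordinate functionals that the norm dominates. The domination makes
    the coordinates continuous and controls partial sums of the expansion of a vector. *)
Definition fdim (E : normedModType R) := exists n (w : 'I_n -> E)
  (c : 'I_n -> {linear E -> R}), (forall z, z = \sum_i c i z *: w i) /\
  (forall i z, `|c i z| <= `|z|).

(** The increment from [x] to [x + h] is split along the coordinates of [h]. On each piece the mean
    value theorem gives a directional derivative at a nearby point, and continuity replaces that
    point by [x]. *)
Lemma gateaux_diff (E : normedModType R) (f : E -> R) : fdim E ->
  (forall z v, derivable f z v) -> (forall v, continuous ('D_v f)) ->
  forall z, differentiable f z.
Proof.
move=> [n [w [c [cz cb]]]] fd fc x.
pose L0 h := \sum_i c i h * 'D_(w i) f x.
have L0lin : linear L0.
  move=> a u v; rewrite /L0 scaler_sumr -big_split /=; apply: eq_bigr => i _.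
  by rewrite linearP /GRing.scale /= mulrDl mulrA.
pose Lm := GRing.isLinear.Build R E R _ L0 L0lin.
pose L : {linear E -> R} := HB.pack L0 Lm.
have cc i : continuous (c i).
  move=> z; apply/cont_epsP => e e0; exists e => // y yz.
  by rewrite -linearB (le_lt_trans (cb _ _)).
have cL : continuous L.
  have : continuous (fun h => \sum_i c i h * 'D_(w i) f x).
    by apply: continuous_sum => i; apply: continuous_mul; [exact: cc|exact: continuous_const].
  exact.
apply: (@diff_eps _ _ L) => // e e0.
(* The family of directions is arbitrary, not a basis, so that the induction can remove the first
   one. *)
have key : forall m (w : 'I_m -> E) (c : 'I_m -> E -> R),
   (forall i z, `|c i z| <= `|z|) -> forall e, 0 < e ->
   \forall h \near (0 : E), `|f (\sum_i c i h *: w i + x) - f x -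
      \sum_i c i h * 'D_(w i) f x| <= e * `|h|.
  elim=> [|m IH] w' c' cb' {}e {}e0.
    by near=> h; rewrite !big_ord0 add0r subrr subr0 normr0 mulr_ge0 // ltW.
  have e20 : 0 < e / 2 by rewrite divr_gt0.
  have IHm := IH (w' \o lift ord0) (c' \o lift ord0) (fun i z => cb' _ z) _ e20.
  have /cvgr_dist_le /(_ _ e20) := fc (w' ord0) x.
  move=> /nbhs_ballP [d /= d0 dH].
  pose B := \sum_i `|w' i| + 1.
  have B0 : 0 < B by rewrite ltr_wpDl // sumr_ge0.
  near=> h.
  rewrite !big_ord_recl; set S := \sum_(i < m) c' (lift ord0 i) h *: _.
  rewrite (_ : _ + S + x = S + x + c' ord0 h *: w' ord0); last by rewrite -addrA addrC.
  have [t /andP[t0 t1] E2] :=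
    @mean_value_line _ f (S + x) (w' ord0) (fun y => fd y _) (c' ord0 h).
  rewrite -[f _](subrK (f (S + x))) E2.
  set D := 'D_(w' ord0) f _.
  set T := \sum_(i < m) _.
  have -> : c' ord0 h * D + f (S + x) - f x - (c' ord0 h * 'D_(w' ord0) f x + T) =
     c' ord0 h * (D - 'D_(w' ord0) f x) + (f (S + x) - f x - T) by ring.
  rewrite (le_trans (ler_normD _ _)) // [e]splitr mulrDl lerD //; last first.
    by rewrite /T /S; near: h; exact: IHm.
  rewrite normrM mulrC ler_pM //.
  rewrite distrC; apply: dH; rewrite -ball_normE /ball_ /=.
  have -> : x - (S + x + (t * c' ord0 h) *: w' ord0) =
     - (S + (t * c' ord0 h) *: w' ord0) by rewrite [S + x]addrC -addrA opprD addrA subrr add0r.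
  rewrite normrN.
  have hB : B * `|h| < d.
    rewrite -ltr_pdivlMl //; near: h.
    have hd : 0 < B^-1 * d by rewrite mulr_gt0 ?invr_gt0.
    apply/nbhs_ballP; exists (B^-1 * d) => //= y.
    by rewrite -ball_normE /ball_ /= sub0r normrN.
  apply: le_lt_trans hB; rewrite /B big_ord_recl mulrDl mul1r.
  apply: (@le_trans _ _ ((`|w' ord0| + \sum_(i < m) `|w' (lift ord0 i)|) * `|h|)); last first.
    by rewrite lerDl.
  rewrite mulrDl [S + _]addrC (le_trans (ler_normD _ _)) // lerD //.
    rewrite normrZ mulrC ler_wpM2l // normrM (ger0_norm t0).
    by rewrite (le_trans _ (cb' ord0 h)) // ler_piMl.
  rewrite mulr_suml (le_trans (ler_norm_sum _ _ _)) // ler_sum // => i _.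
  by rewrite normrZ mulrC ler_wpM2l.
have := key n w (fun i => c i) cb e e0.
by apply: filterS => h; rewrite -cz.
Unshelve. all: by end_near. Qed.

Section Smooth.
Variable E : normedModType R.
Implicit Types f g : E -> R.

Lemma Ck_cont k f : Ck k f -> continuous f.
Proof. by case: k => [|k] []. Qed.

Lemma CkW k f : Ck k.+1 f -> Ck k f.
Proof.
elim: k f => [|k IH] f [fc [fd fD]]; first by split.
by split=> //; split=> // v; apply: IH; exact: fD.
Qed.

Lemma smooth_D f v : smooth f -> smooth ('D_v f).
Proof. by move=> fs k; have [_ [_]] := fs k.+1; exact. Qed.

Lemma smooth_diff f z : smooth f -> differentiable f z.
Proof. by move=> fs; have [_ [+ _]] := fs 1%N; exact. Qed.

Lemma smooth_cont f : smooth f -> continuous f.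
Proof. by move=> fs; have [] := fs 0%N. Qed.

Lemma smooth_derivable f z v : smooth f -> derivable f z v.
Proof. by move=> fs; apply: diff_derivable; exact: smooth_diff. Qed.

Lemma smooth_is_derive f z v : smooth f -> is_derive z v f ('D_v f z).
Proof. by move=> fs; apply: derivableP; exact: smooth_derivable. Qed.

Lemma derive_val_eq f z v (a : R) : is_derive z v f a -> 'D_v f z = a.
Proof. by move=> fd; rewrite derive_val. Qed.

Lemma derive_fun f v (df : E -> R) : (forall z, is_derive z v f (df z)) -> 'D_v f = df.
Proof. by move=> fd; apply/funext => z; exact: derive_val_eq. Qed.

Lemma Ck_const k (c : R) : Ck k (fun _ : E => c).
Proof.
elim: k c => [|k IH] c; first by split=> //; exact: continuous_const.
split; first exact: continuous_const.
split=> [z|v]; first exact: differentiable_cst.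
by rewrite (derive_fun (fun z => is_derive_const c z v)).
Qed.

Lemma Ck_diff k f z : Ck k.+1 f -> differentiable f z.
Proof. by case=> _ [+ _]; exact. Qed.

Lemma Ck_is_derive k f z v : Ck k.+1 f -> is_derive z v f ('D_v f z).
Proof. by move=> fk; apply: derivableP; apply: diff_derivable; exact: Ck_diff fk. Qed.

Lemma Ck_D k f v : Ck k.+1 f -> Ck k ('D_v f).
Proof. by case=> _ [_]; exact. Qed.

Lemma Ck_add k f g : Ck k f -> Ck k g -> Ck k (fun z => f z + g z).
Proof.
elim: k f g => [|k IH] f g fk gk; first by split=> //; apply: continuous_add; [case: fk|case: gk].
split; first exact: continuous_add (Ck_cont fk) (Ck_cont gk).
split=> [z|v]; first by apply: differentiableD; [exact: Ck_diff fk|exact: Ck_diff gk].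
rewrite (derive_fun (fun z => is_derive_add (Ck_is_derive z v fk) (Ck_is_derive z v gk))).
by apply: IH; exact: Ck_D.
Qed.

Lemma Ck_mul k f g : Ck k f -> Ck k g -> Ck k (fun z => f z * g z).
Proof.
elim: k f g => [|k IH] f g fk gk; first by split=> //; apply: continuous_mul; [case: fk|case: gk].
split; first exact: continuous_mul (Ck_cont fk) (Ck_cont gk).
split=> [z|v]; first by apply: differentiableM; [exact: Ck_diff fk|exact: Ck_diff gk].
rewrite (derive_fun (fun z => is_derive_mul (Ck_is_derive z v fk) (Ck_is_derive z v gk))).
by apply: Ck_add; apply: IH; try exact: CkW; exact: Ck_D.
Qed.

Lemma smooth_const (c : R) : smooth (fun _ : E => c).
Proof. by move=> k; exact: Ck_const. Qed.
Lemma smooth_add f g : smooth f -> smooth g -> smooth (fun z => f z + g z).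
Proof. by move=> fs gs k; exact: Ck_add. Qed.
Lemma smooth_mul f g : smooth f -> smooth g -> smooth (fun z => f z * g z).
Proof. by move=> fs gs k; exact: Ck_mul. Qed.
Lemma smooth_opp f : smooth f -> smooth (fun z => - f z).
Proof.
move=> fs; have := smooth_mul (smooth_const (-1)) fs.
by under eq_fun do rewrite mulN1r.
Qed.
Lemma smooth_sub f g : smooth f -> smooth g -> smooth (fun z => f z - g z).
Proof. by move=> fs gs; apply: smooth_add => //; exact: smooth_opp. Qed.
Lemma smooth_sum I (r : seq I) (f : I -> E -> R) :
  (forall i, smooth (f i)) -> smooth (fun z => \sum_(i <- r) f i z).
Proof.
move=> fc; elim: r => [|i r IH].
  under eq_fun do rewrite big_nil; exact: smooth_const.
under eq_fun do rewrite big_cons; exact: smooth_add.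
Qed.

(** Used with a class [S] stable under directional derivatives: exponentials, trigonometric sums,
    coordinates and parameter integrals are each placed in such a class, which avoids computing
    iterated derivatives. *)
Lemma smooth_gateaux (S : (E -> R) -> Prop) : fdim E ->
  (forall f, S f -> continuous f) ->
  (forall f, S f -> forall z v, derivable f z v) ->
  (forall f, S f -> forall v, S ('D_v f)) -> forall f, S f -> smooth f.
Proof.
move=> fE Sc Sd SD f Sf k; elim: k f Sf => [|k IH] f Sf; first by split=> //; exact: Sc.
split; first exact: Sc.
split=> [|v]; last by apply: IH; exact: SD.
apply: gateaux_diff => //; first exact: Sd.
by move=> v; apply: Sc; exact: SD.
Qed.
End Smooth.

Lemma derive_sumv (E : normedModType R) (f : E -> R) z n (c : 'I_n -> R) (w : 'I_n -> E) :
  differentiable f z ->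
  'D_(\sum_i c i *: w i) f z = \sum_i c i * 'D_(w i) f z.
Proof.
move=> fd; rewrite deriveE // linear_sum; apply: eq_bigr => i _.
by rewrite linearZ deriveE.
Qed.

Lemma derive_comp (E F : normedModType R) (G : F -> R) (phi : E -> F) z v :
  differentiable phi z -> differentiable G (phi z) ->
  is_derive z v (fun y => G (phi y)) ('D_('D_v phi z) G (phi z)).
Proof.
move=> pd Gd; have cd := differentiable_comp pd Gd.
apply: DeriveDef; first exact: (diff_derivable (f := G \o phi)).
rewrite (deriveE (f := G \o phi)) // diff_comp //= !deriveE //.
Qed.

(** [Ck] concerns scalar functions only, so the regularity of [phi] is expressed by expanding its
    derivatives in fixed vectors with smooth coefficients. The chain rule then writes a derivative
    of the composite through functions ['D_(w i) G], again composed with [phi], to which the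
    induction on [k] applies. *)
Lemma smooth_comp (E F : normedModType R) (phi : E -> F) :
  (forall z, differentiable phi z) ->
  (forall v, exists n (w : 'I_n -> F) (c : 'I_n -> E -> R),
     (forall i, smooth (c i)) /\ forall z, 'D_v phi z = \sum_i c i z *: w i) ->
  forall G, smooth G -> smooth (fun z => G (phi z)).
Proof.
move=> pd pD G Gs k; elim: k G Gs => [|k IH] G Gs.
  split=> // z; apply: continuous_comp; last exact: smooth_cont.
  exact: differentiable_continuous.
split=> [z|].
  apply: continuous_comp; last exact: smooth_cont.
  exact: differentiable_continuous.
split=> [z|v].
  by apply: (differentiable_comp (g := G)) => //; exact: smooth_diff.
rewrite (derive_fun (fun z => derive_comp v (pd z) (smooth_diff (phi z) Gs))).
have [n [w [c [cs cE]]]] := pD v.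
rewrite (_ : (fun _ => _) = fun z => \sum_i c i z * 'D_(w i) G (phi z)); last first.
  by apply/funext => z; rewrite cE derive_sumv //; exact: smooth_diff.
elim: (index_enum _) => [|i r IHr].
  by under eq_fun do rewrite big_nil; exact: Ck_const.
under eq_fun do rewrite big_cons; apply: Ck_add => //.
by apply: Ck_mul; [exact: cs|exact: (IH _ (smooth_D (w i) Gs))].
Qed.
End Lines.

(** * Iterated integrals over boxes *)

Section PosFunctional.
Variable R : realType.

Definition i1 (a b : R) (f : R -> R) : R := \int[lebesgue_measure]_(x in `[a, b]) f x.

(** A positive linear functional on continuous functions that only sees the compact set [K].
    Integrals over an interval, a cube and the box of the mollifier are all treated through this
    interface, so that limits under the integral sign need only compactness. *)
Definition posint (Y : topologicalType) (K : set Y) (L : (Y -> R) -> R) :=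
  [/\ compact K,
     (forall f g : Y -> R, continuous f -> continuous g -> L (fun y => f y + g y) = L f + L g),
     (forall (c : R) (f : Y -> R), continuous f -> L (fun y => c * f y) = c * L f) &
     (forall f g : Y -> R, continuous f -> continuous g ->
        (forall y, K y -> f y <= g y) -> L f <= L g)].

Lemma cont_slicer (X Y Z : topologicalType) (f : X * Y -> Z) x :
  continuous f -> continuous (fun y => f (x, y)).
Proof.
move=> fc y; apply: (@continuous_comp _ _ _ (fun y => (x, y)) f); last exact: fc.
by rewrite /continuous_at; apply: cvg_pair; [exact: cvg_cst|exact: cvg_id].
Qed.

Lemma cont_slicel (X Y Z : topologicalType) (f : X * Y -> Z) y :
  continuous f -> continuous (fun x => f (x, y)).
Proof.
move=> fc x; apply: (@continuous_comp _ _ _ (fun x => (x, y)) f); last exact: fc.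
by rewrite /continuous_at; apply: cvg_pair; [exact: cvg_id|exact: cvg_cst].
Qed.

Lemma cont_swap (X Y Z : topologicalType) (f : X * Y -> Z) :
  continuous f -> continuous (fun z : Y * X => f (z.2, z.1)).
Proof.
move=> fc z; apply: (@continuous_comp _ _ _ (fun z : Y * X => (z.2, z.1)) f); last exact: fc.
by rewrite /continuous_at; apply: cvg_pair; [exact: cvg_snd|exact: cvg_fst].
Qed.

Lemma derive_eps (f : R -> R) x0 a :
  (forall e, 0 < e -> exists2 d, 0 < d & forall h, h != 0 -> `|h| < d ->
     `|f (x0 + h) - f x0 - a * h| <= e * `|h|) -> is_derive x0 1 f a.
Proof.
move=> H.
suff C : h^-1 *: (f (h *: (1 : R) + x0) - f x0) @[h --> 0^'] --> a.
  apply: DeriveDef; first by apply/cvg_ex; exists a.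
  exact/cvg_lim.
apply/cvgrPdist_le => e e0; have [d d0 dH] := H e e0.
exists d => //= h; rewrite /ball_ /= sub0r normrN => hd h0.
have hn : 0 < `|h| by rewrite normr_gt0.
rewrite [h *: (1:R)](mulr1 h) [h + x0]addrC distrC -(ler_pM2r hn) -normrM.
rewrite (le_trans _ (dH h h0 hd)) // mulrBl [_ *: _]mulrC divfK //.
Qed.

Section Abstract.
Variables (Y : topologicalType) (K : set Y) (L : (Y -> R) -> R).
Hypothesis LP : posint K L.
Implicit Types (f g : Y -> R) (c e : R).

Lemma posint_add f g : continuous f -> continuous g ->
  L (fun y => f y + g y) = L f + L g.
Proof. by case: LP => _ + _ _; exact. Qed.

Lemma posint_scale c f : continuous f -> L (fun y => c * f y) = c * L f.
Proof. by case: LP => _ _ + _; exact. Qed.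

Lemma posint_le f g : continuous f -> continuous g ->
  (forall y, K y -> f y <= g y) -> L f <= L g.
Proof. by case: LP => _ _ _; exact. Qed.

Lemma posint_opp f : continuous f -> L (fun y => - f y) = - L f.
Proof.
move=> fc; rewrite -mulN1r -posint_scale //; congr L.
by apply/funext => y; rewrite mulN1r.
Qed.

Lemma posint_sub f g : continuous f -> continuous g ->
  L (fun y => f y - g y) = L f - L g.
Proof.
by move=> fc gc; rewrite posint_add // ?posint_opp //; exact: continuous_opp.
Qed.

Lemma posint_scaler c f : continuous f -> L (fun y => f y * c) = L f * c.
Proof.
move=> fc; rewrite mulrC -posint_scale //; congr L.
by apply/funext => y; rewrite mulrC.
Qed.

Lemma posint0 : L (fun=> 0) = 0.
Proof.
have := @posint_scale 0 (fun=> 0) (@continuous_const R Y 0); rewrite mul0r => ->.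
by rewrite mul0r.
Qed.

Lemma posint_const c : L (fun=> c) = c * L (fun=> 1).
Proof.
rewrite -posint_scale; last exact: continuous_const.
by congr L; apply/funext => y; rewrite mulr1.
Qed.

Lemma posint_ge0 f : continuous f -> (forall y, K y -> 0 <= f y) -> 0 <= L f.
Proof. by move=> fc f0; rewrite -posint0 posint_le //; exact: continuous_const. Qed.

Lemma posint_sum I (r : seq I) (f : I -> Y -> R) : (forall i, continuous (f i)) ->
  L (fun y => \sum_(i <- r) f i y) = \sum_(i <- r) L (f i).
Proof.
move=> fc; elim: r => [|i r IH].
  rewrite big_nil -[RHS]posint0; congr L; apply/funext => y.
  by rewrite big_nil.
rewrite big_cons -IH -posint_add //; last exact: continuous_sum.
by congr L; apply/funext => y; rewrite big_cons.
Qed.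

Lemma posint_abs f e : continuous f -> (forall y, K y -> `|f y| <= e) ->
  `|L f| <= e * L (fun=> 1).
Proof.
move=> fc fe; rewrite ler_norml -mulNr -!posint_const.
apply/andP; split; apply: posint_le => //; try exact: continuous_const.
  by move=> y /fe; rewrite ler_norml => /andP[].
by move=> y /fe; rewrite ler_norml => /andP[].
Qed.

(** The tube lemma: compactness of [K] makes the closeness uniform in [y]. It plays the part of
    dominated convergence. *)
Lemma tube (X : topologicalType) (f : X * Y -> R) (x0 : X) e : 0 < e ->
  (forall y, K y -> {for (x0, y), continuous f}) ->
  \forall x \near x0, forall y, K y -> `|f (x, y) - f (x0, y)| < e.
Proof.
move=> e0 fc; case: LP => cK _ _ _.
have := (compact_near_coveringP K).1 cK X (nbhs x0)
  (fun x y => `|f (x, y) - f (x0, y)| < e) _.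
apply => y Ky.
have e2 : 0 < e / 2 by rewrite divr_gt0.
have /cvgrPdist_lt /(_ _ e2) := fc y Ky.
case=> [[U V] [/= Ux Vy] UV].
exists (V, U); first by [].
move=> [y' x] /= [Vy' Ux'].
have h1 := UV (x, y') (conj Ux' Vy').
have h2 := UV (x0, y') (conj (nbhs_singleton Ux) Vy').
rewrite /= in h1 h2.
have -> : f (x, y') - f (x0, y') = (f (x0, y) - f (x0, y')) - (f (x0, y) - f (x, y')) by ring.
by rewrite (le_lt_trans (ler_normB _ _)) // [e]splitr ltrD.
Qed.

Lemma posint_cont (X : topologicalType) (f : X * Y -> R) : continuous f ->
  continuous (fun x => L (fun y => f (x, y))).
Proof.
move=> fc x0.
have sc x : continuous (fun y => f (x, y)) by exact: cont_slicer.
have L1 : 0 <= L (fun=> 1) by apply: posint_ge0; first exact: continuous_const.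
apply/cvgrPdist_le => e e0.
have e1 : 0 < e / (L (fun=> 1) + 1) by rewrite divr_gt0 // ltr_wpDl.
apply: filterS (tube e1 (fun y _ => fc (x0, y))) => x H.
rewrite distrC -posint_sub //.
rewrite (le_trans (posint_abs (e := e / (L (fun=> 1) + 1)) _ _)) //.
- by apply: continuous_add => //; exact: continuous_opp.
- by move=> y Ky; rewrite ltW // H.
- by rewrite mulrAC ler_pdivrMr ?ltr_wpDl // ler_pM2l // lerDl.
Qed.

(** By the mean value theorem the difference quotient at [y] is [q c y] with [c] near [x0], and the
    tube lemma compares it with [q x0 y] uniformly in [y]. The hypotheses on [p] are confined to
    []l, r[] because a primitive with a fixed lower bound is only known to be differentiable above
    it. *)
Lemma posint_deriv (p q : R -> Y -> R) (l r x0 : R) : l < x0 < r ->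
  (forall x, l < x < r -> continuous (p x)) ->
  (forall x y, l < x < r -> K y -> is_derive x 1 (p^~ y) (q x y)) ->
  (forall x, continuous (q x)) ->
  (forall y, K y -> {for (x0, y), continuous (fun z : R * Y => q z.1 z.2)}) ->
  is_derive x0 1 (fun x => L (p x)) (L (q x0)).
Proof.
move=> /andP[lx xr] pc pd qc qcc.
have L1 : 0 <= L (fun=> 1) by apply: posint_ge0; first exact: continuous_const.
apply: derive_eps => e e0.
have e1 : 0 < e / (L (fun=> 1) + 1) by rewrite divr_gt0 // ltr_wpDl.
have /nbhs_ballP [d /= d0 dH] := tube e1 qcc.
exists (Num.min d (Num.min (x0 - l) (r - x0))).
  by rewrite !lt_min d0 !subr_gt0 lx xr.
move=> h h0; rewrite !lt_min => /andP[hd /andP[hl hr]].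
move: hl hr; rewrite !ltr_norml => /andP[hl _] /andP[_ hr].
have xh : l < x0 + h < r by apply/andP; split; lra.
have x0i : l < x0 < r by rewrite lx xr.
rewrite -posint_sub; [|exact: pc..].
rewrite mulrC -posint_scale // -posint_sub; last 2 first.
  by apply: continuous_add; [exact: pc|apply: continuous_opp; exact: pc].
  by apply: continuous_mul => //; exact: continuous_const.
rewrite (le_trans (posint_abs (e := e / (L (fun=> 1) + 1) * `|h|) _ _)) //.
- apply: continuous_add; last first.
    by apply: continuous_opp; apply: continuous_mul => //; exact: continuous_const.
  by apply: continuous_add; [exact: pc|apply: continuous_opp; exact: pc].
- move=> y Ky.
  have [c [chd E]] : exists c, `|c - x0| < d /\ p (x0 + h) y - p x0 y = q c y * h.
    have [h_gt|h_le] := ltP 0 h.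
      have [||c /andP[c1 c2] E] := @mean_value R (p^~ y) (q^~ y) x0 (x0 + h).
        by rewrite lerDl ltW.
        by move=> x /andP[x1 x2]; apply: pd => //; apply/andP; split; lra.
        exists c; split; last by rewrite E addrAC subrr add0r.
        by rewrite ger0_norm ?subr_ge0 //; move: hd; rewrite gtr0_norm //; lra.
    have [||c /andP[c1 c2] E] := @mean_value R (p^~ y) (q^~ y) (x0 + h) x0.
      by rewrite gerDl.
      by move=> x /andP[x1 x2]; apply: pd => //; apply/andP; split; lra.
    exists c; split; last by rewrite -opprB E; ring.
    by rewrite ler0_norm ?subr_le0 //; move: hd; rewrite ler0_norm //; lra.
  rewrite E mulrC -mulrBr normrM mulrC ler_wpM2r // ltW //.
  have := dH c _ y Ky; apply.
  by rewrite -ball_normE /ball_ /= distrC.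
- rewrite mulrAC ler_wpM2r // mulrAC ler_pdivrMr ?ltr_wpDl //.
  by rewrite ler_pM2l // lerDl.
Qed.
End Abstract.

Lemma cont_integrable (f : R -> R) (a b : R) : continuous f ->
  (@lebesgue_measure R).-integrable `[a, b] (EFin \o f).
Proof.
move=> fc; apply: continuous_compact_integrable; first exact: segment_compact.
exact: continuous_subspaceT.
Qed.

(** The base point [a - 1] and the margin on the right make the primitive differentiable in the
    two-sided sense at [a] and at [b]. *)
Lemma primitive (f : R -> R) (a b : R) : continuous f ->
  exists F : R -> R, forall x : R, a - 1 < x < b + 1 -> is_derive x 1 F (f x).
Proof.
move=> fc; exists (fun x => i1 (a - 1) x f) => x /andP[ax xb].
have [d1 d2] := continuous_FTC1_closed xb (cont_integrable (a - 1) (b + 1) fc) ax (fc x).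
exact: DeriveDef d1 (etrans (esym (derive1E _ _)) d2).
Qed.

Lemma is_derive_continuous (F : R -> R) (x f : R) : is_derive x 1 F f -> {for x, continuous F}.
Proof. by move=> [Fd _]; apply: differentiable_continuous; exact/derivable1_diffP. Qed.

Lemma i1_FTC (f F : R -> R) (a b : R) : a <= b -> continuous f ->
  (forall x, a <= x <= b -> is_derive x 1 F (f x)) -> i1 a b f = F b - F a.
Proof.
rewrite le_eqVlt => /predU1P[<- _ _|ab fc Fd].
  by rewrite /i1 set_itv1 Rintegral_set1 subrr.
have ac : a <= a <= b by rewrite lexx ltW.
have bc : a <= b <= b by rewrite lexx ltW.
rewrite /i1 /Rintegral (@continuous_FTC2 _ f F) //=.
- exact: continuous_subspaceT.
- split=> [x||].
  + by rewrite in_itv /= => /andP[ax xb]; have [|//] := Fd x; rewrite !ltW.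
  + by apply: cvg_at_right_filter; apply: is_derive_continuous (Fd a ac).
  + by apply: cvg_at_left_filter; apply: is_derive_continuous (Fd b bc).
- move=> x; rewrite in_itv /= => /andP[ax xb]; rewrite derive1E.
  by have [|_ //] := Fd x; rewrite !ltW.
Qed.

Lemma i1_prim (f : R -> R) (a b : R) : a <= b -> continuous f -> exists F : R -> R,
  (forall x : R, a - 1 < x < b + 1 -> is_derive x 1 F (f x)) /\ i1 a b f = F b - F a.
Proof.
move=> ab fc; have [F Fd] := primitive a b fc; exists F; split => //.
apply: i1_FTC => // x /andP[ax xb]; apply: Fd; apply/andP; split; lra.
Qed.

Lemma i1_posint (a b : R) : a <= b -> @posint R `[a, b]%classic (i1 a b).
Proof.
move=> ab; split.
- exact: segment_compact.
- move=> f g fc gc.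
  have [F [Fd ->]] := i1_prim ab fc; have [G [Gd ->]] := i1_prim ab gc.
  rewrite (_ : F b - F a + (G b - G a) = (F b + G b) - (F a + G a)); last by ring.
  apply: (@i1_FTC (fun x => f x + g x) (fun x => F x + G x)) => //; first exact: continuous_add.
  move=> x /andP[ax xb].
  by apply: is_derive_add; [apply: Fd|apply: Gd]; apply/andP; split; lra.
- move=> c f fc; have [F [Fd ->]] := i1_prim ab fc; rewrite mulrBr.
  apply: (@i1_FTC (fun x => c * f x) (fun x => c * F x)) => //.
    by apply: continuous_mul => //; exact: continuous_const.
  by move=> x /andP[ax xb]; apply: is_derive_lmul; apply: Fd; apply/andP; split; lra.
- move=> f g fc gc fg.
  have [F [Fd ->]] := i1_prim ab fc; have [G [Gd ->]] := i1_prim ab gc.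
  suff : G a - F a <= G b - F b by lra.
  apply: (@ndecr_deriv _ (fun x => G x - F x) (fun x => g x - f x)) => // x xab; last first.
    by rewrite subr_ge0 fg //= in_itv.
  by move: xab => /andP[ax xb]; apply: is_derive_sub; [apply: Gd|apply: Fd]; apply/andP; split; lra.
Qed.

(* Both sides are primitives in the upper bound of the one-dimensional integral. *)
Lemma i1_comm (Y : topologicalType) (K : set Y) (L : (Y -> R) -> R) (f : R * Y -> R) a b :
  a <= b -> posint K L -> continuous f ->
  i1 a b (fun x => L (fun y => f (x, y))) = L (fun y => i1 a b (fun x => f (x, y))).
Proof.
move=> ab LP fc.
have s1 (x : R) : continuous (fun y => f (x, y)) by exact: cont_slicer.
have s2 y : continuous (fun x : R => f (x, y)) by exact: cont_slicel.
have sw := cont_swap fc.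
pose P x y := i1 (a - 1) x (fun t => f (t, y)).
have Pd x y : a - 1 < x -> is_derive x 1 (P^~ y) (f (x, y)).
  move=> ax; have xb : x < x + 1 by rewrite ltrDl.
  have [d1 d2] := continuous_FTC1_closed xb (cont_integrable (a - 1) (x + 1) (s2 y)) ax (s2 y x).
  exact: DeriveDef d1 (etrans (esym (derive1E _ _)) d2).
have Pc x : a - 1 < x -> continuous (P x).
  by move=> ax; apply: (posint_cont (i1_posint (ltW ax)) sw).
have iP y : i1 a b (fun x => f (x, y)) = P b y - P a y.
  apply: (@i1_FTC (fun x => f (x, y)) (P^~ y)) => // x /andP[ax xb].
  by apply: Pd; lra.
under [in RHS]eq_fun do rewrite iP.
have a1 : a - 1 < a by lra.
rewrite (posint_sub LP); [|by apply: Pc; lra..].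
apply: (@i1_FTC _ (fun x => L (P x))) => //.
  exact: (posint_cont LP fc).
move=> x /andP[ax xb].
apply: (posint_deriv LP (p := P) (q := fun x y => f (x, y)) (l := a - 1) (r := b + 1)) => //.
- by apply/andP; split; lra.
- by move=> z /andP[z1 _]; exact: Pc.
- by move=> z y /andP[z1 _] _; exact: Pd.
- move=> y _; rewrite (_ : (fun _ => _) = f); first exact: fc.
  by apply/funext => -[].
Qed.
End PosFunctional.

(** * Affine changes of variables, finite-dimensional spaces and iterated integrals over cubes *)

Section Cubes.
Variable R : realType.

Lemma cont_fst (X Y : topologicalType) : continuous (@fst X Y).
Proof. by move=> p; exact: cvg_fst. Qed.

Lemma cont_snd (X Y : topologicalType) : continuous (@snd X Y).
Proof. by move=> p; exact: cvg_snd. Qed.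

Section Affine.
Variables (E F : normedModType R) (A : E -> F) (b : F) (C : R).
Hypotheses (Alin : linear A) (Abd : forall z, `|A z| <= C * `|z|).

Let Lm := GRing.isLinear.Build R E F _ A Alin.
Let L : {linear E -> F} := HB.pack A Lm.

Lemma linear_cont : continuous A.
Proof.
move=> z; apply/cvgrPdist_le => e e0.
have C0 : 0 < `|C| + 1 by rewrite ltr_wpDl.
apply/nbhs_ballP; exists (e / (`|C| + 1)); first by rewrite /= divr_gt0.
move=> y; rewrite -ball_normE /ball_ /= => yz.
rewrite -[A z - A y](linearB L) (le_trans (Abd _)) //.
have : `|z - y| * (`|C| + 1) < e by rewrite -ltr_pdivlMr.
move/ltW; apply: le_trans; rewrite mulrC ler_wpM2l // (le_trans (ler_norm C)) // lerDl //.
Qed.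

Lemma affine_cont : continuous (fun z => A z + b).
Proof. by move=> z; apply: cvgD; [exact: linear_cont|exact: cvg_cst]. Qed.

Lemma affine_diff z : differentiable (fun z => A z + b) z.
Proof.
apply: (@differentiableD _ _ _ L (cst b)) => //; apply: linear_differentiable.
exact: linear_cont.
Qed.

Lemma affine_derive z v : 'D_v (fun z => A z + b) z = A v.
Proof.
have H : (fun h : R => h^-1 *: (A (h *: v + z) + b - (A z + b))) = (fun h => h^-1 *: (h *: A v)).
  apply/funext => h; congr (_ *: _).
  by rewrite -[A]/(L : E -> F) linearD linearZ /= opprD addrACA subrr addr0 addrK.
rewrite /derive H; apply: cvg_lim => //.
apply: (@cvg_trans _ (nbhs (A v))); last exact: cvg_id.
apply: (@cvg_trans _ (cst (A v) @ (0 : R)^')); last exact: cvg_cst.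
apply: near_eq_cvg; near=> h => /=; rewrite scalerA mulVf ?scale1r //.
by near: h; exact: nbhs_dnbhs_neq.
Unshelve. all: by end_near. Qed.

Lemma smooth_affine G : smooth G -> smooth (fun z => G (A z + b)).
Proof.
apply: smooth_comp => [z|v]; first exact: affine_diff.
exists 1%N, (fun=> A v), (fun _ _ => 1); split=> [i|z]; first exact: smooth_const.
by rewrite affine_derive big_ord1 scale1r.
Qed.

Lemma derive_affine G z v : smooth G ->
  'D_v (fun z => G (A z + b)) z = 'D_(A v) G (A z + b).
Proof.
move=> Gs; apply: derive_val_eq.
have := derive_comp v (affine_diff z) (smooth_diff (A z + b) Gs).
by rewrite affine_derive.
Qed.
End Affine.

Lemma mx_entry_norm m n (x : 'M[R]_(m, n)) i j : `|x i j| <= `|x|.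
Proof.
rewrite -[`|x|]/(mx_norm x) mx_normrE.
exact: (@le_bigmax _ _ _ 0 (fun ij => `|x ij.1 ij.2|) (i, j)).
Qed.

Lemma mx_norm_le m n (x : 'M[R]_(m, n)) c : 0 <= c -> (forall i j, `|x i j| <= c) -> `|x| <= c.
Proof.
move=> c0 H; rewrite -[`|x|]/(mx_norm x) mx_normrE.
by apply/bigmax_leP; split => // ij _; exact: H.
Qed.

Lemma pair_normE (E F : normedModType R) (z : E * F) : `|z| = Num.max `|z.1| `|z.2|.
Proof. by rewrite prod_normE. Qed.

Lemma norm_fst (E F : normedModType R) (z : E * F) : `|z.1| <= `|z|.
Proof. by rewrite pair_normE le_max lexx. Qed.

Lemma norm_snd (E F : normedModType R) (z : E * F) : `|z.2| <= `|z|.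
Proof. by rewrite pair_normE le_max lexx orbT. Qed.

Lemma fdimR : fdim R.
Proof.
exists 1%N, (fun=> 1), (fun=> idfun); split=> [z|i z] //=.
by rewrite big_ord1 [RHS]mulr1.
Qed.

Lemma rV_sum_basis n (z : 'rV[R]_n) : z = \sum_i z 0 i *: e_ R i.
Proof.
apply/rowP => j; rewrite summxE (bigD1 j) //= big1 => [|i ij].
  by rewrite !mxE !eqxx mulr1 addr0.
by rewrite !mxE eqxx /= eq_sym (negbTE ij) mulr0.
Qed.

Lemma coord_linear n (i : 'I_n) : linear (fun z : 'rV[R]_n => z 0 i).
Proof. by move=> a u v; rewrite !mxE. Qed.

Lemma fdim_rV n : fdim 'rV[R]_n.
Proof.
pose c i := GRing.isLinear.Build R 'rV[R]_n R _ _ (@coord_linear n i).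
pose C i : {linear 'rV[R]_n -> R} := HB.pack (fun z : 'rV[R]_n => z 0 i) (c i).
exists n, (fun i => e_ R i), C.
by split=> [z|i z] /=; [exact: rV_sum_basis|exact: mx_entry_norm].
Qed.

Lemma fdim_prod (E F : normedModType R) : fdim E -> fdim F -> fdim (E * F)%type.
Proof.
move=> [n [w [c [cz cb]]]] [n' [w' [c' [cz' cb']]]].
pose W (i : 'I_(n + n')) : E * F := match fintype.split i with inl j => (w j, 0) | inr j => (0, w' j) end.
pose D0 (i : 'I_(n + n')) : E * F -> R :=
  match fintype.split i with inl j => fun z => c j z.1 | inr j => fun z => c' j z.2 end.
have Dl i : linear (D0 i).
  by rewrite /D0; case: fintype.split => j a u v; rewrite linearP.
pose Dm i := GRing.isLinear.Build R (E * F)%type R _ _ (Dl i).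
pose D i : {linear (E * F)%type -> R} := HB.pack (D0 i) (Dm i).
exists (n + n')%N, W, D; split=> [z|i z] /=; last first.
  rewrite /D0; case: fintype.split => j.
    by rewrite (le_trans (cb _ _)) // norm_fst.
  by rewrite (le_trans (cb' _ _)) // norm_snd.
rewrite big_split_ord /= /W /D0.
under eq_bigr => i _ do rewrite (unsplitK (inl i)).
under [X in _ + X]eq_bigr => i _ do rewrite (unsplitK (inr i)).
have pf I (r : seq I) (f : I -> E) (g : I -> F) :
    \sum_(i <- r) (f i, g i) = (\sum_(i <- r) f i, \sum_(i <- r) g i).
  by elim: r => [|i r IH]; rewrite ?big_nil // !big_cons IH.
have E1 : \sum_i c i z.1 *: (w i, 0 : F) = (z.1, 0).
  under eq_bigr => i _ do rewrite -[_ *: (_, _)]/(c i z.1 *: w i, c i z.1 *: (0 : F)) scaler0.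
  by rewrite pf -cz big1.
have E2 : \sum_i c' i z.2 *: (0 : E, w' i) = (0, z.2).
  under eq_bigr => i _ do rewrite -[_ *: (_, _)]/(c' i z.2 *: (0 : E), c' i z.2 *: w' i) scaler0.
  by rewrite pf -cz' big1.
rewrite E1 E2 -[RHS]/(z.1 + 0, 0 + z.2) addr0 add0r.
by case: z {E1 E2}.
Qed.

Lemma is_derive_along (E : normedModType R) (g : E -> R) z v a :
  is_derive (0 : R) 1 (fun t : R => g (z + t *: v)) a -> is_derive z v g a.
Proof.
have H : (fun h : R => h^-1 *: (g (z + (h *: (1 : R) + 0) *: v) - g (z + (0 : R) *: v)))
    = (fun h : R => h^-1 *: (g (h *: v + z) - g z)).
  apply/funext => h; rewrite scale0r !addr0; congr (_ *: (g _ - _)).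
  by rewrite [h *: (1:R)](mulr1 h) addrC.
move=> [d1 d2]; apply: DeriveDef; first by move: d1; rewrite /derivable H.
by rewrite -d2 /derive H.
Qed.

Section Parametric.
Variables (E Y : normedModType R) (K : set Y) (L : (Y -> R) -> R).
Hypothesis LP : posint K L.

Lemma posint_is_derive (f : E * Y -> R) z v : smooth f ->
  is_derive z v (fun z => L (fun y => f (z, y))) (L (fun y => 'D_(v, 0) f (z, y))).
Proof.
move=> fs; apply: is_derive_along.
have lin t y : (z + t *: v, y) = (z, y) + t *: (v, 0) :> E * Y.
  by rewrite -[RHS]/(z + t *: v, y + t *: 0) scaler0 addr0.
have Dc := smooth_cont (smooth_D (v, 0) fs).
have := @posint_deriv _ _ _ _ LP (fun t y => f (z + t *: v, y))
  (fun t y => 'D_(v, 0) f (z + t *: v, y)) (-1) 1 0.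
rewrite scale0r addr0; apply.
- by rewrite ltrN10 ltr01.
- by move=> t _; apply: cont_slicer; exact: smooth_cont.
- move=> t y _ _; rewrite lin.
  have D1 := @is_derive_line R _ f (z, y) (v, 0) t (@smooth_derivable R _ f _ _ fs).
  by apply: (is_derive_fun D1) => // s; rewrite lin.
- by move=> t; exact: (@cont_slicer _ _ _ ('D_(v, 0) f)).
- move=> y _.
  have : continuous (fun x : R * Y => 'D_(v, 0) f ((z, 0) + (x.1 *: v, x.2))).
    apply: (continuous_compose Dc) => x.
    apply: cvgD; first exact: cvg_cst.
    rewrite /continuous_at; apply: cvg_pair; last exact: cvg_snd.
    by apply: cvgZr_tmp; exact: cvg_fst.
  move/(_ (0, y)).
  rewrite (_ : (fun x : R * Y => _) = (fun x : R * Y => 'D_(v, 0) f (z + x.1 *: v, x.2))) //.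
  by apply/funext => x; rewrite -[(z, 0) + _]/(z + x.1 *: v, 0 + x.2) add0r.
Qed.

Lemma posint_derive (f : E * Y -> R) v : smooth f ->
  'D_v (fun z => L (fun y => f (z, y))) = fun z => L (fun y => 'D_(v, 0) f (z, y)).
Proof. by move=> fs; apply: derive_fun => z; exact: posint_is_derive. Qed.

Lemma posint_smooth (f : E * Y -> R) : fdim E -> smooth f ->
  smooth (fun z => L (fun y => f (z, y))).
Proof.
move=> fE fs.
apply: (@smooth_gateaux _ _ (fun g => exists2 f : E * Y -> R, smooth f &
  g = fun z => L (fun y => f (z, y)))) => //; last by exists f.
- by move=> g [h hs ->]; apply: (posint_cont LP); exact: smooth_cont.
- by move=> g [h hs ->] z v; have [] := posint_is_derive z v hs.
- move=> g [h hs ->] v; exists ('D_(v, 0) h); first exact: smooth_D.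
  exact: posint_derive.
Qed.
End Parametric.

Definition box (a b : R) n : set 'rV[R]_n := [set v | forall i, a <= v 0 i <= b].

Arguments box : clear implicits.

Lemma box_compact a b n : compact (box a b n).
Proof.
have := @rV_compact R n (fun=> `[a, b]%classic) (fun=> @segment_compact R a b).
by congr compact; apply/seteqP; split=> v /= H i; have := H i; rewrite in_itv.
Qed.

Lemma cons_row0 n (a : R) (y : 'rV[R]_n) : cons_row a y 0 ord0 = a.
Proof. by rewrite mxE unlift_none. Qed.

Lemma cons_rowS n (a : R) (y : 'rV[R]_n) j : cons_row a y 0 (lift ord0 j) = y 0 j.
Proof. by rewrite mxE liftK. Qed.

Lemma cons_rowP n (P : 'I_n.+1 -> Prop) : P ord0 -> (forall j, P (lift ord0 j)) -> forall i, P i.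
Proof. by move=> P0 Pl i; have [j ->|->] := unliftP ord0 i. Qed.

Lemma cons_row_linear n : linear (fun p : R * 'rV[R]_n => cons_row p.1 p.2).
Proof.
move=> c u v; apply/rowP; apply: cons_rowP => [|j]; rewrite [RHS]mxE [in RHS]mxE.
  by rewrite !cons_row0.
by rewrite !cons_rowS !mxE.
Qed.

Lemma cons_row_norm n (p : R * 'rV[R]_n) : `|cons_row p.1 p.2| <= 1 * `|p|.
Proof.
rewrite mul1r; apply: mx_norm_le => // i; rewrite (ord1 i).
apply: cons_rowP => [|j]; first by rewrite cons_row0 norm_fst.
by rewrite cons_rowS (le_trans (mx_entry_norm _ _ _)) // norm_snd.
Qed.

Lemma cons_row_cont n : continuous (fun p : R * 'rV[R]_n => cons_row p.1 p.2).
Proof.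
have := @affine_cont _ _ _ 0 1 (@cons_row_linear n) (@cons_row_norm n).
by under eq_fun do rewrite addr0.
Qed.

Lemma iintS A n (f : 'rV[R]_n.+1 -> R) :
  iint A f = \int[lebesgue_measure]_(z in A) iint A (fun y => f (cons_row z y)).
Proof. by []. Qed.

Lemma box_cons a b n z (y : 'rV[R]_n) : a <= z <= b -> box a b n y -> box a b n.+1 (cons_row z y).
Proof.
by move=> zab yb; apply: cons_rowP => [|j]; rewrite ?cons_row0 // cons_rowS; exact: yb.
Qed.

Lemma cont_cons n (f : 'rV[R]_n.+1 -> R) : continuous f ->
  continuous (fun p : R * 'rV[R]_n => f (cons_row p.1 p.2)).
Proof. by move=> fc; apply: (continuous_compose fc); exact: cons_row_cont. Qed.

Lemma cont_cons2 n (f : 'rV[R]_n.+1 -> R) z : continuous f ->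
  continuous (fun y : 'rV[R]_n => f (cons_row z y)).
Proof. move=> fc; have := @cont_slicer _ _ _ (fun p : R * 'rV[R]_n => f (cons_row p.1 p.2)) z.
by apply; exact: cont_cons. Qed.

Lemma iint_posint a b n : a <= b -> @posint R 'rV[R]_n (box a b n) (@iint R `[a, b] n).
Proof.
move=> ab; elim: n => [|n IH].
  split=> //=; first exact: box_compact.
  by move=> f g _ _; apply; case.
have ic f : continuous f -> continuous (fun z : R => iint `[a, b] (fun y : 'rV[R]_n => f (cons_row z y))).
  by move=> fc; exact: (posint_cont IH (cont_cons fc)).
split; first exact: box_compact.
- move=> f g fc gc; rewrite !iintS -(posint_add (i1_posint ab)); [|exact: ic..].
  congr i1; apply/funext => z; rewrite -(posint_add IH) //; exact: cont_cons2.
- move=> c f fc; rewrite !iintS -(posint_scale (i1_posint ab)); last exact: ic.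
  congr i1; apply/funext => z; rewrite -(posint_scale IH) //; exact: cont_cons2.
- move=> f g fc gc fg; rewrite !iintS.
  apply: (posint_le (i1_posint ab)); [exact: ic..|].
  move=> z /=; rewrite in_itv /= => zab.
  apply: (posint_le IH); [exact: cont_cons2..|].
  by move=> y yb; apply: fg; exact: box_cons.
Qed.

(** The induction on the dimension moves one coordinate integral at a time past [L]. With the box of
    the mollifier as [L], this is the Fubini theorem behind the symmetry of mollification. *)
Lemma iint_comm (Y : topologicalType) (K : set Y) (L : (Y -> R) -> R) a b n
  (f : 'rV[R]_n * Y -> R) : a <= b -> posint K L -> continuous f ->
  iint `[a, b] (fun x => L (fun y => f (x, y))) = L (fun y => iint `[a, b] (fun x => f (x, y))).
Proof.
move=> ab LP; elim: n f => [|n IH] f fc //.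
have fc' : continuous (fun p : (R * Y) * 'rV[R]_n => f (cons_row p.1.1 p.2, p.1.2)).
  apply: (continuous_compose fc); apply: continuous_pairing; last first.
    by apply: (continuous_compose (@cont_snd R Y)); exact: cont_fst.
  apply: (@continuous_compose _ _ _ (fun p : R * 'rV[R]_n => cons_row p.1 p.2)
    (fun p : (R * Y) * 'rV[R]_n => (p.1.1, p.2)) (@cons_row_cont n)).
  apply: continuous_pairing; last exact: cont_snd.
  by apply: (continuous_compose (@cont_fst R Y)); exact: cont_fst.
have fz z : continuous (fun p : 'rV[R]_n * Y => f (cons_row z p.1, p.2)).
  apply: (continuous_compose fc); apply: continuous_pairing; last exact: cont_snd.
  apply: (@continuous_compose _ _ _ (fun y : 'rV[R]_n => cons_row z y) fst); last exact: cont_fst.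
  exact: (@cont_slicer _ _ _ (fun p : R * 'rV[R]_n => cons_row p.1 p.2) z (@cons_row_cont n)).
rewrite iintS; under eq_Rintegral => z _ do rewrite (IH _ (fz z)).
exact: (i1_comm ab LP (posint_cont (iint_posint n ab) fc')).
Qed.
End Cubes.

(** * Periodic functions *)

Section Torus.
Variable R : realType.
Notation J := (iint `[0, 1]%classic).

Lemma derive_quot (E F : normedModType R) (f : E -> R) (g : F -> R) x y v w :
  (forall h : R, f (h *: v + x) = g (h *: w + y)) -> 'D_v f x = 'D_w g y.
Proof.
move=> fg; have f0 : f x = g y by have := fg 0; rewrite !scale0r !add0r.
rewrite /derive (_ : (fun h : R => h^-1 *: ((f \o shift x) (h *: v) - f x)) =
  (fun h : R => h^-1 *: ((g \o shift y) (h *: w) - g y))) //.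
by apply/funext => h /=; rewrite fg f0.
Qed.

Lemma derive_periodic (E : normedModType R) (f : E -> R) (w : E) :
  (forall z, f (z + w) = f z) -> forall v z, 'D_v f (z + w) = 'D_v f z.
Proof.
by move=> fw v z; apply: derive_quot => h; rewrite addrA fw.
Qed.

Lemma smooth_cons n (f : 'rV[R]_n.+1 -> R) : smooth f ->
  smooth (fun p : R * 'rV[R]_n => f (cons_row p.1 p.2)).
Proof.
move=> fs; have := smooth_affine 0 (@cons_row_linear R n) (@cons_row_norm R n) fs.
by under eq_fun do rewrite addr0.
Qed.

Lemma derive_cons n (f : 'rV[R]_n.+1 -> R) (p v : R * 'rV[R]_n) : smooth f ->
  'D_v (fun p : R * 'rV[R]_n => f (cons_row p.1 p.2)) p = 'D_(cons_row v.1 v.2) f (cons_row p.1 p.2).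
Proof.
move=> fs; have := derive_affine 0 (@cons_row_linear R n) (@cons_row_norm R n) p v fs.
by rewrite addr0; under eq_fun do rewrite addr0.
Qed.

Lemma smooth_slicer (E F : normedModType R) (f : E * F -> R) x : smooth f ->
  smooth (fun y => f (x, y)).
Proof.
move=> fs.
have Alin : linear (fun y : F => (0 : E, y)).
  by move=> a u v; rewrite -[RHS]/(a *: 0 + 0, a *: u + v) scaler0 addr0.
have Abd (y : F) : `|(0 : E, y)| <= 1 * `|y|.
  by rewrite pair_normE /= normr0 mul1r max_r.
have := smooth_affine (x, 0) Alin Abd fs.
rewrite (_ : (fun z => _) = fun y => f (x, y)) //; apply/funext => y.
by rewrite -[_ + _]/(0 + x, y + 0) add0r addr0.
Qed.

Lemma derive_slicer (E F : normedModType R) (f : E * F -> R) x y v :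
  'D_v (fun y => f (x, y)) y = 'D_(0, v) f (x, y).
Proof.
apply: derive_quot => h; congr f.
by rewrite -[RHS]/(h *: 0 + x, h *: v + y) scaler0 add0r.
Qed.

Lemma derive_slicel (E F : normedModType R) (f : E * F -> R) x y v :
  'D_v (fun x => f (x, y)) x = 'D_(v, 0) f (x, y).
Proof.
apply: derive_quot => h; congr f.
by rewrite -[RHS]/(h *: v + x, h *: 0 + y) scaler0 add0r.
Qed.

Lemma smooth_slicel (E F : normedModType R) (f : E * F -> R) y : smooth f ->
  smooth (fun x => f (x, y)).
Proof.
move=> fs.
have Alin : linear (fun x : E => (x, 0 : F)).
  by move=> a u v; rewrite -[RHS]/(a *: u + v, a *: 0 + 0) scaler0 addr0.
have Abd (x : E) : `|(x, 0 : F)| <= 1 * `|x|.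
  by rewrite pair_normE /= normr0 mul1r max_l.
have := smooth_affine (0, y) Alin Abd fs.
rewrite (_ : (fun z => _) = fun x => f (x, y)) //; apply/funext => x.
by rewrite -[_ + _]/(x + 0, 0 + y) add0r addr0.
Qed.

Lemma cons_row_delta0 n : cons_row 1 0 = e_ R (@ord0 n).
Proof.
apply/rowP; apply: cons_rowP => [|j]; rewrite ?cons_row0 ?cons_rowS !mxE ?eqxx //=.
Qed.

Lemma cons_row_deltaS n (j : 'I_n) : cons_row 0 (e_ R j) = e_ R (lift ord0 j).
Proof.
apply/rowP; apply: cons_rowP => [|k]; rewrite ?cons_row0 ?cons_rowS !mxE ?eqxx //=.
Qed.

Lemma cons_rowD n a b (y z : 'rV[R]_n) : cons_row (a + b) (y + z) = cons_row a y + cons_row b z.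
Proof. by apply/rowP; apply: cons_rowP => [|k]; rewrite [RHS]mxE ?cons_row0 ?cons_rowS ?mxE. Qed.

Lemma iint_i1 (a b : R) n (f : 'rV[R]_n.+1 -> R) :
  iint `[a, b]%classic f = i1 a b (fun z => iint `[a, b]%classic (fun y => f (cons_row z y))).
Proof. by []. Qed.

Lemma eq_iint A n (f g : 'rV[R]_n -> R) : f =1 g -> iint A f = iint A g.
Proof. by move=> /funext ->. Qed.

Lemma eq_i1 (a b : R) (f g : R -> R) : f =1 g -> i1 a b f = i1 a b g.
Proof. by move=> /funext ->. Qed.

Let P01 n := @iint_posint R 0 1 n ler01.

(** In the first coordinate this is the fundamental theorem of calculus with equal end values; a
    later coordinate is differentiated inside the outer integral, where the induction hypothesis
    applies to each slice. *)
Lemma J_derive0 n (f : 'rV[R]_n -> R) i : smooth f -> periodicT f -> J ('D_(e_ R i) f) = 0.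
Proof.
elim: n f i => [|n IH] f i fs fp; first by case: i.
have fcs := smooth_cons fs.
move: i; apply: cons_rowP => [|j]; rewrite iint_i1.
  have D (z : R) : is_derive z 1 (fun z : R => J (fun y : 'rV[R]_n => f (cons_row z y)))
     (J (fun y => 'D_(e_ R ord0) f (cons_row z y))).
    apply: is_derive_fun (posint_is_derive (P01 n) z 1 fcs) _ _ => //.
    by congr iint; apply/funext => y; rewrite derive_cons //= cons_row_delta0.
  apply: (etrans (@i1_FTC R _ _ 0 1 ler01 _ (fun x _ => D x))).
    exact: (posint_cont (P01 n) (cont_cons (smooth_cont (smooth_D (e_ R ord0) fs)))).
  apply/eqP; rewrite subr_eq0; apply/eqP; congr iint; apply/funext => y.
  by rewrite -[y in LHS]addr0 -[1 in LHS]add0r cons_rowD cons_row_delta0 fp.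
have E0 z : J (fun y : 'rV[R]_n => 'D_(e_ R (lift ord0 j)) f (cons_row z y)) = 0.
  transitivity (J ('D_(e_ R j) (fun y => f (cons_row z y)))); last apply: IH.
  - apply: eq_iint => y.
    have -> := derive_slicer (fun p : R * 'rV[R]_n => f (cons_row p.1 p.2)) z y (e_ R j).
    by rewrite derive_cons //= cons_row_deltaS.
  - exact: (smooth_slicer z fcs).
  - by move=> y k; rewrite -[z]addr0 cons_rowD cons_row_deltaS fp addr0.
by rewrite (eq_i1 _ _ E0) (posint0 (i1_posint ler01)).
Qed.

Lemma i1_const (a b c : R) : a <= b -> i1 a b (fun=> c) = c * (b - a).
Proof.
move=> ab; rewrite mulrBr; apply: (@i1_FTC R _ (fun x => c * x)) => //.
  exact: continuous_const.
by move=> x _; apply: is_derive_fun (is_derive_lmul c (is_derive_idR x)) _ _; rewrite ?mulr1.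
Qed.

Lemma iint_const (a b c : R) n : a <= b -> @iint R `[a, b]%classic n (fun=> c) = c * (b - a) ^+ n.
Proof.
move=> ab; elim: n => [|n IH]; first by rewrite expr0 mulr1.
by rewrite iint_i1 IH exprSr mulrA; exact: i1_const.
Qed.

Lemma J_const c n : @iint R `[0, 1]%classic n (fun=> c) = c.
Proof. by rewrite iint_const // subr0 expr1n mulr1. Qed.

Lemma smooth_shift (E : normedModType R) (f : E -> R) c : smooth f -> smooth (fun x => f (x + c)).
Proof.
have Alin : linear (@id E) by move=> a u v.
have Abd (z : E) : `|z| <= 1 * `|z| by rewrite mul1r.
exact: (smooth_affine c Alin Abd).
Qed.

Lemma derive_shiftE (E : normedModType R) (f : E -> R) c v x :
  'D_v (fun x => f (x + c)) x = 'D_v f (x + c).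
Proof.
by apply: derive_quot => h; rewrite addrA.
Qed.

Lemma derive_basis n (f : 'rV[R]_n -> R) c x : smooth f ->
  'D_c f x = \sum_i c 0 i * 'D_(e_ R i) f x.
Proof.
move=> fs.
have := @derive_sumv R _ f x n (fun i => c 0 i) (fun i => e_ R i) (smooth_diff x fs).
by rewrite -rV_sum_basis.
Qed.

(** Along [t c] the derivative of the integral is a sum of integrals of partial derivatives, hence
    [0]. Invariance under translation follows without cutting the cube into pieces. *)
Lemma J_shift n (f : 'rV[R]_n -> R) c : smooth f -> periodicT f ->
  J (fun x => f (x + c)) = J f.
Proof.
move=> fs fp.
have Alin : linear (fun p : R * 'rV[R]_n => p.2 + p.1 *: c).
  by move=> a u v /=; rewrite scalerDr scalerDl scalerA addrACA.
have Abd (p : R * 'rV[R]_n) : `|p.2 + p.1 *: c| <= (1 + `|c|) * `|p|.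
  rewrite (le_trans (ler_normD _ _)) // mulrDl mul1r lerD //; first exact: norm_snd.
  by rewrite normrZ mulrC ler_wpM2l // norm_fst.
have gs := smooth_affine 0 Alin Abd fs.
have D (t : R) : is_derive t 1 (fun t : R => J (fun x : 'rV[R]_n => f (x + t *: c + 0))) 0.
  apply: is_derive_fun (posint_is_derive (P01 n) t 1 gs) _ _ => //.
  have E y : 'D_(1, 0) (fun p : R * 'rV[R]_n => f (p.2 + p.1 *: c + 0)) (t, y) = 'D_c f (y + t *: c).
    by rewrite (derive_affine 0 Alin Abd _ _ fs) /= add0r scale1r addr0.
  rewrite (_ : (fun y : 'rV[R]_n => _) = (fun y => 'D_c f (y + t *: c))); last exact/funext/E.
  rewrite (_ : (fun y => _) = (fun y => \sum_i c 0 i * 'D_(e_ R i) f (y + t *: c))); last first.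
    by apply/funext => y; exact: derive_basis.
  rewrite (posint_sum (P01 n)) => [|i]; last first.
    apply: continuous_mul; first exact: continuous_const.
    exact: (smooth_cont (smooth_shift (t *: c) (smooth_D (e_ R i) fs))).
  rewrite big1 // => i _; rewrite (posint_scale (P01 n)); last first.
    exact: (smooth_cont (smooth_shift (t *: c) (smooth_D (e_ R i) fs))).
  rewrite (_ : (fun y => _) = 'D_(e_ R i) (fun y => f (y + t *: c))); last first.
    by apply/funext => y; rewrite derive_shiftE.
  rewrite J_derive0 ?mulr0 //; first exact: smooth_shift.
  by move=> x j; rewrite addrAC fp.
have [s _] := mean_value ler01 (fun x _ => D x).
rewrite mul0r; move/eqP; rewrite subr_eq0 => /eqP.
rewrite (_ : (fun x => f (x + 1 *: c + 0)) = (fun x => f (x + c))); last first.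
  by apply/funext => x; rewrite scale1r addr0.
by move=> ->; apply: eq_iint => x; rewrite scale0r !addr0.
Qed.

Lemma i1_scale (G : R -> R) (e : R) : 0 < e -> continuous G ->
  i1 (- e) e (fun z => G (e^-1 * z)) = e * i1 (-1) 1 G.
Proof.
move=> e0 Gc; have h1 : (-1 : R) <= 1 by lra.
have [P [Pd ->]] := i1_prim h1 Gc.
have ee : - e <= e by lra.
apply: (etrans (@i1_FTC R (fun z => G (e^-1 * z)) (fun z => e * P (e^-1 * z)) _ _ ee _ _)); last first.
- by rewrite mulrN mulVf ?gt_eqF // mulrBr.
- move=> x /andP[x1 x2].
  have Dl := is_derive_lmul e^-1 (is_derive_idR x).
  have e10 : 0 < e^-1 by rewrite invr_gt0.
  have h2 : e^-1 * x <= 1 by rewrite mulrC ler_pdivrMr // mul1r.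
  have h3 : -1 <= e^-1 * x by rewrite mulrC ler_pdivlMr // mulN1r.
  have := is_derive_lmul e (is_derive_compR (Pd (e^-1 * x) _) Dl).
  rewrite mulr1 mulrCA mulfV ?gt_eqF // mulr1; apply; apply/andP; split; lra.
- apply: (continuous_compose Gc) => z; apply: cvgMl_tmp; exact: cvg_id.
Qed.

Lemma iint_scale n (G : 'rV[R]_n -> R) (e : R) : 0 < e -> continuous G ->
  iint `[- e, e]%classic (fun y => G (e^-1 *: y)) = e ^+ n * iint `[-1, 1]%classic G.
Proof.
move=> e0; elim: n G => [|n IH] G Gc; first by rewrite expr0 mul1r /= scaler0.
have h1 : (-1 : R) <= 1 by lra.
have cc := posint_cont (iint_posint n h1) (cont_cons Gc).
pose F z := iint `[-1, 1]%classic (fun y => G (cons_row z y)).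
have E z : iint `[- e, e]%classic (fun y => G (e^-1 *: cons_row z y)) = e ^+ n * F (e^-1 * z).
  rewrite -(IH (fun y => G (cons_row (e^-1 * z) y))); last exact: cont_cons2.
  congr iint; apply/funext => y; congr G; apply/rowP.
  by apply: cons_rowP => [|j]; rewrite [LHS]mxE ?cons_row0 ?cons_rowS ?mxE.
have ee : - e <= e by lra.
have cc2 : continuous (fun z => F (e^-1 * z)).
  by apply: (continuous_compose cc) => z; apply: cvgMl_tmp; exact: cvg_id.
by rewrite !iint_i1 (eq_i1 _ _ E) (posint_scale (i1_posint ee)) // i1_scale // exprSr mulrA.
Qed.

Lemma i1_refl (G : R -> R) (e : R) : 0 <= e -> continuous G ->
  i1 (- e) e (fun z => G (- z)) = i1 (- e) e G.
Proof.
move=> e0 Gc; have ee : - e <= e by lra.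
have [P [Pd ->]] := i1_prim ee Gc.
apply: (etrans (@i1_FTC R (fun z => G (- z)) (fun z => - P (- z)) _ _ ee _ _)); last first.
- by rewrite opprK opprK addrC.
- move=> x /andP[x1 x2].
  have := is_derive_opp (is_derive_compR (Pd (- x) _) (is_derive_opp (is_derive_idR x))).
  by rewrite mulrN1 opprK; apply; apply/andP; split; lra.
- by apply: (continuous_compose Gc) => z; apply: cvgN; exact: cvg_id.
Qed.

Lemma iint_refl n (G : 'rV[R]_n -> R) (e : R) : 0 <= e -> continuous G ->
  iint `[- e, e]%classic (fun y => G (- y)) = iint `[- e, e]%classic G.
Proof.
move=> e0; elim: n G => [|n IH] G Gc; first by rewrite /= oppr0.
have ee : - e <= e by lra.
have cc := posint_cont (iint_posint n ee) (cont_cons Gc).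
rewrite !iint_i1 -(i1_refl e0 cc).
apply: eq_i1 => z; rewrite -(IH (fun y => G (cons_row (- z) y))); last exact: cont_cons2.
congr iint; apply/funext => y; congr G; apply/rowP.
by apply: cons_rowP => [|j]; rewrite [LHS]mxE ?cons_row0 ?cons_rowS ?mxE.
Qed.

Lemma iint0 A n : @iint R A n (fun=> 0) = 0.
Proof. by elim: n => // n IH; rewrite iintS IH /Rintegral integral0. Qed.

(** Brings an integral over the whole space back to a compact box, where [posint] applies. *)
Lemma int_Rd_box n (f : 'rV[R]_n -> R) (e : R) :
  (forall y, ~ @box R (- e) e n y -> f y = 0) -> int_Rd f = iint `[- e, e]%classic f.
Proof.
rewrite /int_Rd; elim: n f => [|n IH] f f0 //.
rewrite [LHS]iintS [RHS]iintS [RHS]Rintegral_mkcond; apply: eq_Rintegral => z _; rewrite patchE.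
case: ifPn => [zi|zi].
  apply: IH => y yb; apply: f0 => H; apply: yb => i.
  by have := H (lift ord0 i); rewrite cons_rowS.
rewrite (_ : (fun y => _) = fun=> 0) ?iint0 //; apply/funext => y; apply: f0 => H.
by move/negP: zi; apply; rewrite inE /= in_itv /=; have := H ord0; rewrite cons_row0.
Qed.

Lemma periodic_int n (f : 'rV[R]_n -> R) (k : int) i x : periodicT f ->
  f (x + k%:~R *: e_ R i) = f x.
Proof.
move=> fp.
have nat m x' : f (x' + m%:R *: e_ R i) = f x'.
  elim: m x' => [|m IH] x'; first by rewrite scale0r addr0.
  by rewrite mulrS scalerDl scale1r addrA IH fp.
case: k => m; first exact: nat.
by rewrite NegzE mulrNz scaleNr -[in RHS](subrK (m.+1%:R *: e_ R i) x) nat.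
Qed.

Lemma periodic_reduce n (x : 'rV[R]_n) : exists2 x', @box R 0 1 n x' &
  forall f : 'rV[R]_n -> R, periodicT f -> f x' = f x.
Proof.
exists (\row_i (x 0 i - (Num.floor (x 0 i))%:~R)).
  move=> i; rewrite mxE; have /andP[h1 h2] := floor_itv (x 0 i).
  rewrite subr_ge0 h1 /= lerBlDl addrC; apply: ltW.
  by move: h2; rewrite intrD addrC.
move=> f fp.
have H (r : seq 'I_n) (y : 'rV[R]_n) : f (y + \sum_(i <- r) (- Num.floor (x 0 i))%:~R *: e_ R i) = f y.
  elim: r y => [|i r IH] y; first by rewrite big_nil addr0.
  by rewrite big_cons addrA IH periodic_int.
rewrite -(H (index_enum _) x); congr f.
rewrite [X in X + _](rV_sum_basis x) -big_split /= [LHS]rV_sum_basis.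
by apply: eq_bigr => i _; rewrite mxE -scalerDl mulrNz.
Qed.
End Torus.

(** * Exponential, cosine and powers; symmetry of second derivatives; conditions at a maximum *)

Section MoreSmooth.
Variable R : realType.

Lemma derive_R (f : R -> R) (x v a : R) : is_derive x 1 f a -> is_derive x v f (v * a).
Proof.
move=> [d e]; have fd : differentiable f x by exact/derivable1_diffP.
apply: DeriveDef; first exact: diff_derivable.
by rewrite deriveE // -[v in LHS]mulr1 -[v * 1]/(v *: (1 : R)) linearZ -deriveE // e.
Qed.

Lemma smooth_expR : smooth (@expR R).
Proof.
apply: (@smooth_gateaux R R (fun f => exists c, f = fun x => c * expR x)); first exact: fdimR.
- by move=> f [c ->]; apply: continuous_mul; [exact: continuous_const|exact: continuous_expR].
- move=> f [c ->] z v.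
  by have [] := derive_R v (is_derive_lmul c (is_derive_expR z)).
- move=> f [c ->] v; exists (v * c).
  rewrite (derive_fun (fun z => derive_R v (is_derive_lmul c (is_derive_expR z)))).
  by apply/funext => x; rewrite mulrA.
- by exists 1; apply/funext => x; rewrite mul1r.
Qed.

Lemma is_derive_trig (a b x : R) : is_derive x 1 (fun x => a * cos x + b * sin x)
  (b * cos x + (- a) * sin x).
Proof.
apply: is_derive_fun (is_derive_add (is_derive_lmul a (is_derive_cos x))
  (is_derive_lmul b (is_derive_sin x))) _ _ => //; ring.
Qed.

Lemma smooth_trig (a b : R) : smooth (fun x : R => a * cos x + b * sin x).
Proof.
apply: (@smooth_gateaux R R (fun f => exists a b, f = fun x => a * cos x + b * sin x)).
- exact: fdimR.
- move=> f [c [d ->]] z; exact: is_derive_continuous (is_derive_trig c d z).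
- by move=> f [c [d ->]] z v; have [] := derive_R v (is_derive_trig c d z).
- move=> f [c [d ->]] v; exists (v * d), (v * (- c)).
  rewrite (derive_fun (fun z => derive_R v (is_derive_trig c d z))).
  by apply/funext => x; rewrite mulrDr !mulrA.
- by exists a, b.
Qed.

Lemma smooth_cos : smooth (@cos R).
Proof. by have := smooth_trig 1 0; under eq_fun do rewrite mul1r mul0r addr0. Qed.

Section Comp1.
Variable E : normedModType R.
Implicit Types f : E -> R.

Lemma smooth_comp1 (G : R -> R) f : smooth G -> smooth f -> smooth (fun z => G (f z)).
Proof.
move=> Gs fs; apply: (@smooth_comp R E R f) => // [z|v]; first exact: smooth_diff.
exists 1%N, (fun=> 1), (fun=> 'D_v f); split=> [_|z]; first exact: smooth_D.
by rewrite big_ord1 [RHS]mulr1.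
Qed.

Lemma is_derive_comp1 (G : R -> R) f z v (g : R) : is_derive (f z) 1 G g -> differentiable f z ->
  is_derive z v (fun y => G (f y)) (g * 'D_v f z).
Proof.
move=> Gd fd; have GD : differentiable G (f z) by apply/derivable1_diffP; case: Gd.
have := derive_comp v fd GD; move=> H.
have E1 : 'D_('D_v f z) G (f z) = g * 'D_v f z.
  by rewrite (derive_val_eq (derive_R ('D_v f z) Gd)) mulrC.
by rewrite E1 in H.
Qed.

Lemma Ck_powR k f b : smooth f -> (forall z, 0 < f z) -> Ck k (fun z => f z `^ b).
Proof.
move=> fs f0; elim: k b => [|k IH] b.
  split=> // z; apply: (@differentiable_continuous _ _ _ z (fun z => f z `^ b)).
  apply: (differentiable_comp (g := fun y => y `^ b)); first exact: smooth_diff.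
  by apply/derivable1_diffP; have [] := is_derive1_powR b (f0 z).
split; first exact: Ck_cont (IH b).
split=> [z|v].
  apply: (differentiable_comp (g := fun y => y `^ b)); first exact: smooth_diff.
  by apply/derivable1_diffP; have [] := is_derive1_powR b (f0 z).
rewrite (derive_fun (fun z => is_derive_comp1 v (is_derive1_powR b (f0 z)) (smooth_diff z fs))).
apply: Ck_mul; last exact: smooth_D.
by apply: Ck_mul; [exact: Ck_const|exact: IH].
Qed.

Lemma smooth_powR f b : smooth f -> (forall z, 0 < f z) -> smooth (fun z => f z `^ b).
Proof. by move=> fs f0 k; exact: Ck_powR. Qed.

Lemma is_derive_powRf f b z v : smooth f -> 0 < f z ->
  is_derive z v (fun z => f z `^ b) (b * f z `^ (b - 1) * 'D_v f z).
Proof.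
move=> fs f0.
exact: (is_derive_comp1 v (is_derive1_powR b f0) (smooth_diff z fs)).
Qed.
End Comp1.

(** Integrated in the direction [w], the function ['D_v ('D_w f)] gives increments of ['D_v f], by
    differentiation under the integral sign; differentiating in the upper bound then gives
    ['D_w ('D_v f)]. *)
Lemma derive_schwarz (E : normedModType R) (f : E -> R) v w z : smooth f ->
  'D_v ('D_w f) z = 'D_w ('D_v f) z.
Proof.
move=> fs.
have Alin : linear (fun p : R * R => p.1 *: v + p.2 *: w).
  by move=> a p q /=; rewrite !scalerDl scalerDr !scalerA addrACA.
have Abd (p : R * R) : `|p.1 *: v + p.2 *: w| <= (`|v| + `|w|) * `|p|.
  rewrite (le_trans (ler_normD _ _)) // mulrDl lerD // normrZ mulrC ler_wpM2l //.
    exact: norm_fst.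
  exact: norm_snd.
have Dws := smooth_D w fs.
have gs := smooth_affine z Alin Abd Dws.
set g := fun p : R * R => _ in gs.
have gE (s r : R) : 'D_(1, 0) g (s, r) = 'D_v ('D_w f) (s *: v + r *: w + z).
  by rewrite (derive_affine z Alin Abd _ _ Dws) /= scale1r scale0r addr0.
have line (y : E) u (t : R) : is_derive t 1 (fun t : R => f (y + t *: u)) ('D_u f (y + t *: u)).
  by apply: is_derive_line; exact: smooth_derivable.
(* The lower bound [-1] keeps [0] inside the interval of integration, so that the derivative at [0]
   is two-sided. *)
have K (t : R) : -1 <= t -> 'D_v f (z + t *: w) - 'D_v f (z + (-1) *: w) =
    i1 (-1) t (fun r => 'D_v ('D_w f) (r *: w + z)).
  move=> t1.
  have D1 := @posint_is_derive R R R _ _ (i1_posint t1) g 0 1 gs.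
  have FE (s : R) : i1 (-1) t (fun r => g (s, r)) =
      f (z + t *: w + s *: v) - f (z + (-1) *: w + s *: v).
    have gc : continuous (fun r => g (s, r)) by apply: cont_slicer; exact: smooth_cont.
    rewrite ![z + _ + s *: v]addrAC.
    apply: (@i1_FTC R _ (fun r => f (z + s *: v + r *: w)) _ _ t1 gc) => x _.
    have -> : g (s, x) = 'D_w f (z + s *: v + x *: w) by rewrite /g /= addrC addrA.
    exact: line.
  have D2 := is_derive_sub (line (z + t *: w) v 0) (line (z + (-1) *: w) v 0).
  have {D2} D2 := derive_val_eq D2.
  have {D1} D1 := derive_val_eq D1.
  move: D1 D2; rewrite !scale0r !addr0.
  have FE' := funext FE; rewrite FE'.
  move=> -> <-; apply: eq_i1 => r; rewrite gE scale0r add0r //.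
have hc : continuous (fun r : R => 'D_v ('D_w f) (r *: w + z)).
  apply: (continuous_compose (smooth_cont (smooth_D v Dws))) => r.
  by apply: cvgD; [apply: cvgZr_tmp; exact: cvg_id|exact: cvg_cst].
have [d1 d2] := continuous_FTC1_closed (ltr01 : 0 < (1 : R)) (cont_integrable (-1) 1 hc) (ltrN10 R) (hc 0).
have D3 : is_derive (0 : R) 1 (fun t => i1 (-1) t (fun r => 'D_v ('D_w f) (r *: w + z)))
     ('D_v ('D_w f) z).
  have E0 : (0 : R) *: w + z = z by rewrite scale0r add0r.
  by move: d1 d2; rewrite E0 => d1 d2; exact: DeriveDef d1 (etrans (esym (derive1E _ _)) d2).
have D4 : is_derive (0 : R) 1 (fun t : R => 'D_v f (z + t *: w)) ('D_w ('D_v f) z).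
  have := @is_derive_line R E ('D_v f) z w 0 (@smooth_derivable R E ('D_v f) _ _ (smooth_D v fs)).
  by rewrite scale0r addr0.
have D5 := is_derive_sub D4 (is_derive_const ('D_v f (z + (-1) *: w)) (0 : R) 1).
rewrite -(derive_val_eq D3) -[RHS]subr0 -(derive_val_eq D5).
apply: near_eq_derive; near=> t; rewrite K //; near: t.
exists 1 => //= t; rewrite /ball_ /= sub0r normrN => /ltW; rewrite ler_norml => /andP[] //.
Unshelve. all: by end_near. Qed.

Lemma deriv_eps (f : R -> R) (x a : R) : is_derive x 1 f a -> forall e, 0 < e ->
  exists2 d, 0 < d & forall h, `|h| < d -> `|f (x + h) - f x - a * h| <= e * `|h|.
Proof.
move=> [fd fE] e e0.
have : h^-1 *: (f (h *: (1 : R) + x) - f x) @[h --> 0^'] --> a by rewrite -fE; exact: fd.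
move/cvgrPdist_le => /(_ e e0) [d /= d0 dH]; exists d => // h hd.
have [->|h0] := eqVneq h 0; first by rewrite addr0 subrr mulr0 subrr normr0 mulr0.
have := dH h; rewrite /ball_ /= sub0r normrN => /(_ hd h0).
rewrite [h *: (1:R)](mulr1 h) [h + x]addrC distrC => H.
have hn : 0 < `|h| by rewrite normr_gt0.
move: H; rewrite -(ler_pM2r hn) -normrM; apply: le_trans.
by rewrite mulrBl [_ *: _]mulrC divfK.
Qed.

Lemma local_max_right (f : R -> R) (x a d : R) : is_derive x 1 f a -> 0 < d ->
  (forall h, 0 < h < d -> f (x + h) <= f x) -> a <= 0.
Proof.
move=> fd d0 H; rewrite leNgt; apply/negP => a0.
have a2 : 0 < a / 2 by rewrite divr_gt0.
have [e e0 eH] := deriv_eps fd a2.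
pose h := Num.min e d / 2.
have m0 : 0 < Num.min e d by rewrite lt_min e0.
have h0 : 0 < h by rewrite divr_gt0.
have hm : h < Num.min e d by rewrite /h ltr_pdivrMr // ltr_pMr // ltr1n.
move: hm; rewrite lt_min => /andP[he hd].
have h1 := H h; rewrite h0 hd in h1; have {}h1 := h1 isT.
have := eH h; rewrite gtr0_norm // => /(_ he).
rewrite ler_norml => /andP[h2 _].
have : a * h <= a / 2 * h by lra.
by rewrite ler_pM2r //; lra.
Qed.

Lemma local_max_left (f : R -> R) (x a d : R) : is_derive x 1 f a -> 0 < d ->
  (forall h, 0 < h < d -> f (x - h) <= f x) -> 0 <= a.
Proof.
move=> fd d0 H.
have D := is_derive_opp (is_derive_idR (- x)).
have fd' : is_derive (- - x) 1 f a by rewrite opprK.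
have := @local_max_right (fun y => f (- y)) (- x) _ d (is_derive_compR fd' D) d0.
rewrite mulrN1 oppr_le0 opprK; apply => h h0.
by rewrite opprD opprK; exact: H.
Qed.

Lemma local_max2 (f df : R -> R) (ddf d : R) : (forall s : R, is_derive s 1 f (df s)) ->
  is_derive (0 : R) 1 df ddf -> 0 < d -> (forall h, `|h| < d -> f h <= f 0) ->
  df 0 = 0 /\ ddf <= 0.
Proof.
move=> fd dfd d0 H.
have df0 : df 0 = 0.
  apply/eqP; rewrite eq_le; apply/andP; split.
    apply: local_max_right (fd 0) d0 _ => h /andP[h0 hd].
    by rewrite add0r H // gtr0_norm.
  apply: local_max_left (fd 0) d0 _ => h /andP[h0 hd].
  by rewrite add0r H // normrN gtr0_norm.
split=> //; rewrite leNgt; apply/negP => a0.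
have a2 : 0 < ddf / 2 by rewrite divr_gt0.
have [e e0 eH] := deriv_eps dfd a2.
have pos h : 0 < h < e -> 0 < df h.
  move=> /andP[h0 he]; have := eH h; rewrite gtr0_norm // => /(_ he).
  rewrite add0r df0 subr0 ler_norml => /andP[h2 _].
  have : 0 < ddf / 2 * h by rewrite mulr_gt0.
  by lra.
(* The segment is cut at [h / 2]: as [df] vanishes at [0], the first half gives only a weak increase
   and the second half the strict one. *)
pose h := Num.min e d / 2.
have m0 : 0 < Num.min e d by rewrite lt_min e0.
have h0 : 0 < h by rewrite divr_gt0.
have hm : h < Num.min e d by rewrite /h ltr_pdivrMr // ltr_pMr // ltr1n.
move: hm; rewrite lt_min => /andP[he hd].
have h20 : 0 < h / 2 by rewrite divr_gt0.
have h2h : h / 2 <= h by rewrite ler_pdivrMr // ler_peMr ?ler1n // ltW.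
have [c /andP[c1 c2] E1] := mean_value h2h (fun x _ => fd x).
have [c' /andP[c1' c2'] E2] := mean_value (ltW h20) (fun x _ => fd x).
have p1 : 0 < df c by apply: pos; apply/andP; split; lra.
have p2 : 0 <= df c'.
  have [->|c0] := eqVneq c' 0; first by rewrite df0.
  by apply/ltW/pos; rewrite lt_neqAle eq_sym c0 c1' /=; lra.
have : 0 < f h - f (h / 2) by rewrite E1 mulr_gt0 //; lra.
have : 0 <= f (h / 2) - f 0 by rewrite E2 mulr_ge0 //; lra.
have := H h; rewrite gtr0_norm // => /(_ hd).
lra.
Qed.
End MoreSmooth.

(** * Functions of space and time *)

Section SpaceTime.
Variables (R : realType) (d : nat).
Local Notation E := ('rV[R]_d * R)%type.
Local Notation J := (@int_Td R d).
Implicit Types u f g : E -> R.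

Definition periodicE f := forall z i, f (z + dx R i) = f z.

Lemma periodicE_slice f t : periodicE f -> periodicT (fun x => f (x, t)).
Proof.
move=> fp x i; rewrite -(fp (x, t) i); congr f.
by rewrite -[RHS]/(x + e_ R i, t + 0) addr0.
Qed.

Lemma periodicE_of f : (forall t, periodicT (fun x => f (x, t))) -> periodicE f.
Proof.
move=> fp [x t] i; rewrite -(fp t x i); congr f.
by rewrite -[LHS]/(x + e_ R i, t + 0) addr0.
Qed.

Lemma periodicE_D f v : periodicE f -> periodicE ('D_v f).
Proof. by move=> fp z i; apply: derive_periodic => y; exact: fp. Qed.

Lemma periodicE_mul f g : periodicE f -> periodicE g -> periodicE (fun z => f z * g z).
Proof. by move=> fp gp z i; rewrite fp gp. Qed.

Lemma int_Td_posint : posint (@box R 0 1 d) J.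
Proof. exact: iint_posint ler01. Qed.
Let P01 := int_Td_posint.

Lemma eq_int_Td (f g : 'rV[R]_d -> R) : f =1 g -> J f = J g.
Proof. by move=> /funext ->. Qed.

Lemma slice_s f t : smooth f -> continuous (fun x => f (x, t)).
Proof. by move=> fs; apply: cont_slicel; exact: smooth_cont. Qed.

Lemma slice_D f t v : smooth f -> continuous (fun x => 'D_v f (x, t)).
Proof. by move=> fs; exact: (@slice_s ('D_v f) t (smooth_D v fs)). Qed.

Lemma J_dx0 f t i : smooth f -> periodicE f -> J (fun x => 'D_(dx R i) f (x, t)) = 0.
Proof.
move=> fs fp; apply: (etrans _ (J_derive0 i (smooth_slicel t fs) (periodicE_slice t fp))).
by apply: eq_int_Td => x; rewrite derive_slicel.
Qed.

Lemma J_ibp f g t i : smooth f -> smooth g -> periodicE f -> periodicE g ->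
  J (fun x => 'D_(dx R i) f (x, t) * g (x, t)) = - J (fun x => f (x, t) * 'D_(dx R i) g (x, t)).
Proof.
move=> fs gs fp gp; apply/eqP; rewrite -addr_eq0; apply/eqP.
rewrite -(J_dx0 t i (smooth_mul fs gs) (periodicE_mul fp gp)).
rewrite -(posint_add P01); last 2 first.
- by apply: continuous_mul; [exact: slice_D|exact: slice_s].
- by apply: continuous_mul; [exact: slice_s|exact: slice_D].
apply: eq_int_Td => x; apply/esym/derive_val_eq.
by apply: is_derive_mul; exact: smooth_is_derive.
Qed.

Lemma J_dt f (t : R) : smooth f ->
  is_derive t 1 (fun t => J (fun x => f (x, t))) (J (fun x => 'D_(dt R d) f (x, t))).
Proof.
move=> fs.
have Alin : linear (fun p : R * 'rV[R]_d => (p.2, p.1)) by [].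
have Abd (p : R * 'rV[R]_d) : `|(p.2, p.1)| <= 1 * `|p|.
  by rewrite mul1r !pair_normE /= maxC.
have gs := smooth_affine (0, 0) Alin Abd fs.
have z0 (p : E) : p + (0, 0) = p by case: p => a b; rewrite -[LHS]/(a + 0, b + 0) !addr0.
apply: is_derive_fun (posint_is_derive P01 t 1 gs) _ _ => [s|].
  by apply: eq_int_Td => x; rewrite z0.
by apply: eq_int_Td => x; rewrite (derive_affine (0, 0) Alin Abd _ _ fs) z0.
Qed.

Lemma smooth_fstE i : smooth (fun z : E => z.1 0 i).
Proof.
apply: (@smooth_gateaux R E (fun f => exists a b, f = fun z : E => a * z.1 0 i + b)).
- exact: fdim_prod (fdim_rV R d) (fdimR R).
- move=> f [a [b ->]]; apply: continuous_add; last exact: continuous_const.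
  apply: continuous_mul; first exact: continuous_const.
  move=> z; apply/cont_epsP => e e0; exists e => // y yz.
  rewrite (_ : y.1 0 i - z.1 0 i = (y - z).1 0 i); last by rewrite !mxE.
  by rewrite (le_lt_trans (mx_entry_norm _ _ _)) // (le_lt_trans (norm_fst _)).
- move=> f [a [b ->]] z v; suff [] : is_derive z v (fun z : E => a * z.1 0 i + b) (a * v.1 0 i) by [].
  apply: is_derive_fun (is_derive_along (a := a * v.1 0 i) _) _ _ => //.
  apply: is_derive_fun (is_derive_add (is_derive_lmul (a * v.1 0 i) (is_derive_idR 0))
     (is_derive_const (a * z.1 0 i + b) _ _)) _ _ => [s|]; last by rewrite mulr1 addr0.
  by rewrite -[(z + s *: v).1]/(z.1 + s *: v.1) !mxE; ring.
- move=> f [a [b ->]] v; exists 0, (a * v.1 0 i); apply: derive_fun => z; rewrite mul0r add0r.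
  apply: is_derive_fun (is_derive_along (a := a * v.1 0 i) _) _ _ => //.
  apply: is_derive_fun (is_derive_add (is_derive_lmul (a * v.1 0 i) (is_derive_idR 0))
     (is_derive_const (a * z.1 0 i + b) _ _)) _ _ => [s|]; last by rewrite mulr1 addr0.
  by rewrite -[(z + s *: v).1]/(z.1 + s *: v.1) !mxE; ring.
- by exists 1, 0; apply/funext => z; rewrite mul1r addr0.
Qed.

Lemma is_derive_snd (z v : E) : is_derive z v (fun z : E => z.2) v.2.
Proof.
apply: is_derive_along.
apply: is_derive_fun (is_derive_add (is_derive_lmul v.2 (is_derive_idR 0))
   (is_derive_const z.2 _ _)) _ _ => [s|]; last by rewrite mulr1 addr0.
by rewrite -[(z + s *: v).2]/(z.2 + s * v.2); ring.
Qed.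

Lemma smooth_snd : smooth (fun z : E => z.2).
Proof.
apply: (@smooth_gateaux R E (fun f => f = (fun z : E => z.2) \/ exists b, f = fun=> b)).
- exact: fdim_prod (fdim_rV R d) (fdimR R).
- by move=> f [->|[b ->]]; [exact: cont_snd|exact: continuous_const].
- by move=> f [->|[b ->]] z v; [have [] := is_derive_snd z v|have [] := is_derive_const b z v].
- move=> f [->|[b ->]] v; right.
    by exists v.2; apply: derive_fun => z; exact: is_derive_snd.
  by exists 0; apply: derive_fun => z; exact: is_derive_const.
- by left.
Qed.

Lemma torus_max f T : 0 <= T -> continuous f -> periodicE f ->
  exists x0 t0, 0 <= t0 <= T /\ forall x t, 0 <= t <= T -> f (x, t) <= f (x0, t0).
Proof.
move=> T0 fc fp.
have cK : compact (@box R 0 1 d `*` `[0, T]%classic).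
  by apply: compact_setX; [exact: box_compact|exact: segment_compact].
have [|[x0 t0]] := @compact_EVT_max _ R f _ _ cK (continuous_subspaceT fc).
  exists (0, 0); split => /=; first by move=> i; rewrite mxE lexx ler01.
  by rewrite in_itv /= lexx.
rewrite inE /= => -[_]; rewrite in_itv /= => t0T H.
exists x0, t0; split => // x t tT.
have [x' x'b /(_ _ (periodicE_slice t fp)) <-] := periodic_reduce x.
by apply: H; rewrite inE; split => //=; rewrite in_itv.
Qed.

Lemma max_point f T x0 t0 : smooth f -> 0 <= t0 <= T ->
  (forall x t, 0 <= t <= T -> f (x, t) <= f (x0, t0)) ->
  [/\ forall i, 'D_(dx R i) f (x0, t0) = 0,
      forall i, 'D_(dx R i) ('D_(dx R i) f) (x0, t0) <= 0,
      0 < t0 -> 0 <= 'D_(dt R d) f (x0, t0) &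
      t0 < T -> 'D_(dt R d) f (x0, t0) <= 0].
Proof.
move=> fs /andP[t00 t0T] H.
have line (g : E -> R) v (t : R) : smooth g ->
    is_derive t 1 (fun t : R => g ((x0, t0) + t *: v)) ('D_v g ((x0, t0) + t *: v)).
  by move=> gs; apply: is_derive_line; exact: smooth_derivable.
have X i : 'D_(dx R i) f (x0, t0) = 0 /\ 'D_(dx R i) ('D_(dx R i) f) (x0, t0) <= 0.
  have := @local_max2 R _ _ _ 1 (fun s => line f (dx R i) s fs)
     (line _ (dx R i) 0 (smooth_D (dx R i) fs)) ltr01.
  rewrite scale0r addr0; apply=> h _.
  rewrite -[(x0, t0) + h *: dx R i]/(x0 + h *: e_ R i, t0 + h *: 0) scaler0 addr0.
  by apply: H; rewrite t00.
have tl : is_derive t0 1 (fun t => f (x0, t)) ('D_(dt R d) f (x0, t0)).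
  have := line f (dt R d) 0 fs; rewrite scale0r addr0 => L0.
  have L1 : is_derive (t0 - t0) 1 (fun t : R => f ((x0, t0) + t *: dt R d)) ('D_(dt R d) f (x0, t0)).
    by rewrite subrr.
  have L2 := @is_derive_compR R _ (fun t => t - t0) t0 _ _ L1
    (is_derive_sub (is_derive_idR t0) (is_derive_const t0 _ _)).
  apply: is_derive_fun L2 _ _ => [t|]; last by rewrite subr0 mulr1.
  rewrite -[_ + _]/(x0 + (t - t0) *: 0, t0 + (t - t0) * 1) scaler0 addr0 mulr1.
  by rewrite addrCA subrr addr0.
split=> [i|i|h0|hT]; [exact: (X i).1|exact: (X i).2|..].
  apply: local_max_left tl h0 _ => h /andP[h1 h2]; apply: H; apply/andP; split; lra.
have hT' : 0 < T - t0 by rewrite subr_gt0.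
apply: local_max_right tl hT' _ => h /andP[h1 h2]; apply: H; apply/andP; split; lra.
Qed.

Lemma is_derive_expt L (z v : E) :
  is_derive z v (fun z : E => expR (L * z.2)) (expR (L * z.2) * (L * v.2)).
Proof.
have sm : smooth (fun z : E => L * z.2) by apply: smooth_mul; [exact: smooth_const|exact: smooth_snd].
have := is_derive_comp1 v (is_derive_expR (L * z.2)) (smooth_diff z sm).
by rewrite (derive_val_eq (is_derive_lmul L (is_derive_snd z v))).
Qed.

Lemma smooth_expt L : smooth (fun z : E => expR (L * z.2)).
Proof.
apply: smooth_comp1; first exact: smooth_expR.
by apply: smooth_mul; [exact: smooth_const|exact: smooth_snd].
Qed.

Lemma periodicE_expt L : periodicE (fun z : E => expR (L * z.2)).
Proof. by move=> z i; rewrite -[(z + _).2]/(z.2 + 0) addr0. Qed.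

(** Multiplied by [exp(-(L+1) t)], the function satisfies an inequality whose zero order coefficient
    is at most [-1], which forbids a negative minimum at a positive time. *)
Lemma min_principle f (b : 'I_d -> E -> R) (c : E -> R) L T : 0 <= T ->
  smooth f -> periodicE f -> (forall x t, 0 <= t <= T -> c (x, t) <= L) ->
  (forall x t, 0 <= t <= T -> Lap f (x, t) + \sum_i b i (x, t) * 'D_(dx R i) f (x, t)
      + c (x, t) * f (x, t) <= Dt f (x, t)) ->
  (forall x, 0 <= f (x, 0)) ->
  forall x t, 0 <= t <= T -> 0 <= f (x, t).
Proof.
move=> T0 fs fp cL fE f0 x t tT.
pose M := - (L + 1).
pose w (z : E) := expR (M * z.2) * - f z.
have ws : smooth w by apply: smooth_mul; [exact: smooth_expt|exact: smooth_opp].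
have wp : periodicE w by move=> z i; rewrite /w fp; congr (_ * _); exact: periodicE_expt.
have [x0 [t0 [t0T H]]] := torus_max T0 (smooth_cont ws) wp.
have [D1 D2 D3 _] := max_point ws t0T H.
have wD v : 'D_v w = fun z : E => expR (M * z.2) * (M * v.2) * - f z + expR (M * z.2) * - 'D_v f z.
  apply: derive_fun => z; apply: is_derive_mul; first exact: is_derive_expt.
  by apply: is_derive_opp; exact: smooth_is_derive.
have wDx i : 'D_(dx R i) w = fun z : E => expR (M * z.2) * - 'D_(dx R i) f z.
  by rewrite wD; apply/funext => z /=; rewrite !mulr0 mul0r add0r.
have wDp v z : 'D_v w z = expR (M * z.2) * (M * v.2) * - f z + expR (M * z.2) * - 'D_v f z.
  by rewrite -[LHS]/(('D_v w : E -> R) z) wD.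
have wDxx i : 'D_(dx R i) ('D_(dx R i) w) (x0, t0) =
    expR (M * t0) * - 'D_(dx R i) ('D_(dx R i) f) (x0, t0).
  rewrite wDx; apply: derive_val_eq.
  have h1 := smooth_is_derive (x0, t0) (dx R i) (smooth_D (dx R i) fs).
  have := is_derive_mul (is_derive_expt M (x0, t0) (dx R i)) (is_derive_opp h1).
  by rewrite /= !mulr0 mul0r add0r.
have e0 := expR_gt0 (M * t0).
have w0 : 0 <= f (x0, t0).
  rewrite leNgt; apply/negP => fn.
  have t0p : 0 < t0.
    rewrite lt_neqAle; case/andP: t0T => -> _; rewrite andbT.
    by apply/eqP => t00; move: fn; rewrite -t00 ltNge f0.
  have F1 i : 'D_(dx R i) f (x0, t0) = 0.
    by have := D1 i; rewrite wDp /= !mulr0 mul0r add0r => /eqP; rewrite mulf_eq0 gt_eqF //= oppr_eq0 => /eqP.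
  have F2 i : 0 <= 'D_(dx R i) ('D_(dx R i) f) (x0, t0).
    by have := D2 i; rewrite wDxx pmulr_rle0 // oppr_le0.
  have := D3 t0p; rewrite wDp /= mulr1 -mulrA -mulrDr pmulr_rge0 // => F3.
  have := fE x0 t0 t0T; rewrite /Lap /Dt [X in _ + X + _]big1 => [|i _]; last first.
    by rewrite F1 mulr0.
  rewrite addr0 => F4.
  have F5 : 0 <= \sum_i 'D_(dx R i) ('D_(dx R i) f) (x0, t0) by apply: sumr_ge0.
  have F6 := cL x0 t0 t0T.
  have F7 : (L + 1 - c (x0, t0)) * f (x0, t0) < 0 by rewrite pmulr_rlt0 //; lra.
  move: F3 F4 F5 F7; rewrite /M; lra.
have := H x t tT; rewrite /w /= => h.
have h1 : expR (M * t0) * - f (x0, t0) <= 0 by rewrite pmulr_rle0 // oppr_le0.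
have := le_trans h h1; rewrite pmulr_rle0 ?expR_gt0 // oppr_le0 //.
Qed.
End SpaceTime.

(** * Comparison of the values of a solution at two points *)

Section Doubling.
Variables (R : realType) (d : nat).
Local Notation E := ('rV[R]_d * R)%type.

(* The maximum of [u (x + h e, t) - u (x, t) - psi h] is tested by moving both points in the same
   direction, except along [e], where they move apart: this yields
   [Lap u X - Lap u Y <= 4 psi''] without any rotation. *)
Lemma increment_bound (u F : E -> R) (H : 'rV[R]_d -> 'rV[R]_d -> R) (i0 : 'I_d) (sg : R)
  (T a b r0 S : R) : 0 < T -> sg ^+ 2 = 1 ->
  smooth u -> periodicE u ->
  (forall x t, 0 <= t <= T -> - Dt u (x, t) + H x (Dx u (x, t)) = Lap u (x, t) + F (x, t)) ->
  let e := sg *: e_ R i0 in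
  0 < r0 -> 0 <= b -> b * r0 <= a -> S <= a / 2 * r0 ->
  (forall x h t, 0 <= t <= T -> u (x + h *: e, t) - u (x, t) <= S) ->
  (forall x h, 0 <= h -> u (x + h *: e, T) - u (x, T) <= a / 2 * h) ->
  (forall x h t, 0 <= h <= r0 -> 0 <= t <= T ->
     H x (Dx u (x, t)) - H (x + h *: e) (Dx u (x, t)) + F (x + h *: e, t) - F (x, t) < 4 * b) ->
  forall x h t, 0 <= h <= r0 -> 0 <= t <= T -> u (x + h *: e, t) - u (x, t) <= a * h.
Proof.
move=> T0 sg2 us up HJ e r0p b0 bra Sa osc term HF.
(* A concave profile with [psi'' = -b]. Since [b r0 <= a], it lies between [a h / 2] and [a h] on
   [[0, r0]]: the lower bound excludes a positive maximum at [h = r0] or at [t = T], the upper bound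
   gives the conclusion. *)
pose psi h := a * h - b / 2 * h ^+ 2.
have psile h : psi h <= a * h.
  by rewrite /psi lerBlDr lerDl mulr_ge0 ?sqr_ge0 // divr_ge0.
have psige h : 0 <= h <= r0 -> a / 2 * h <= psi h.
  move=> /andP[h0 hr]; have : b * h * h <= a * h.
    by rewrite ler_wpM2r // (le_trans _ bra) // ler_wpM2l.
  rewrite /psi expr2; lra.
suff main : forall x h t, 0 <= h <= r0 -> 0 <= t <= T -> u (x + h *: e, t) - u (x, t) <= psi h.
  by move=> x h t hr tT; exact: le_trans (main x h t hr tT) (psile h).
pose Phi (p : ('rV[R]_d * R) * R) := u (p.1.1 + p.1.2 *: e, p.2) - u (p.1.1, p.2) - psi p.1.2.
have c11 : continuous (fun p : ('rV[R]_d * R) * R => p.1.1).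
  by apply: (continuous_compose (@cont_fst _ _)); exact: cont_fst.
have c12 : continuous (fun p : ('rV[R]_d * R) * R => p.1.2).
  by apply: (continuous_compose (@cont_snd _ _)); exact: cont_fst.
have c2 : continuous (fun p : ('rV[R]_d * R) * R => p.2) by exact: cont_snd.
have Phic : continuous Phi.
  apply: continuous_add; last first.
    apply: continuous_opp; apply: continuous_add.
      by apply: continuous_mul => //; exact: continuous_const.
    apply: continuous_opp; apply: continuous_mul; first exact: continuous_const.
    by under eq_fun do rewrite expr2; exact: continuous_mul.
  apply: continuous_add; last first.
    by apply: continuous_opp; apply: (continuous_compose (smooth_cont us)); exact: continuous_pairing.
  apply: (continuous_compose (smooth_cont us)); apply: continuous_pairing => //.
  by move=> p; apply: cvgD; [exact: c11|apply: cvgZr_tmp; exact: c12].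
have cK : compact ((@box R 0 1 d `*` `[0, r0]) `*` `[0, T])%classic.
  apply: compact_setX; last exact: segment_compact.
  by apply: compact_setX; [exact: box_compact|exact: segment_compact].
have [|[[x0 h0] t0]] := @compact_EVT_max _ R Phi _ _ cK (continuous_subspaceT Phic).
  exists ((0, 0), 0); split => /=; last by rewrite in_itv /= lexx ltW.
  by split=> /= [i|]; rewrite ?mxE ?in_itv /= lexx ?ler01 ?ltW.
rewrite inE /= => -[[_]]; rewrite !in_itv /= => h0r t0T Mx.
have Max x h t : 0 <= h <= r0 -> 0 <= t <= T ->
    u (x + h *: e, t) - u (x, t) - psi h <= u (x0 + h0 *: e, t0) - u (x0, t0) - psi h0.
  move=> hr tT; pose q := fun x => u (x + h *: e, t) - u (x, t).
  have qp : periodicT q.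
    move=> y i; rewrite /q addrAC.
    have := periodicE_slice t up; move=> upt.
    by rewrite (upt (y + h *: e)) (upt y).
  have [x' x'b /(_ _ qp) qE] := periodic_reduce x.
  have := Mx ((x', h), t); rewrite /Phi /= -/(q x') qE; apply.
  by rewrite inE; split => /=; [split=> //=|]; rewrite in_itv.
case: (leP (u (x0 + h0 *: e, t0) - u (x0, t0) - psi h0) 0) => [neg|pos].
  by move=> x h t hr tT; rewrite -subr_le0; exact: le_trans (Max x h t hr tT) neg.
exfalso.
have /andP[h00 h0r0] := h0r; have /andP[t00 t0T0] := t0T.
have h0p : 0 < h0.
  rewrite lt_neqAle h00 andbT; apply/eqP => h0E.
  by move: pos; rewrite -h0E scale0r addr0 subrr /psi mulr0 expr2 !mulr0 subrr subr0 ltxx.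
have h0lt : h0 < r0.
  rewrite lt_neqAle h0r0 andbT; apply/eqP => h0E.
  move: pos; apply/negP; rewrite -leNgt subr_le0 (le_trans (osc x0 h0 t0 t0T)) //.
  by rewrite (le_trans Sa) // -h0E psige.
have t0lt : t0 < T.
  rewrite lt_neqAle t0T0 andbT; apply/eqP => t0E.
  move: pos; apply/negP; rewrite -leNgt subr_le0 t0E.
  by rewrite (le_trans (term x0 h0 h00)) // psige.
pose X : E := (x0 + h0 *: e, t0); pose Y : E := (x0, t0).
have line (g : E -> R) (z v : E) (t : R) : smooth g ->
    is_derive t 1 (fun t : R => g (z + t *: v)) ('D_v g (z + t *: v)).
  by move=> gs; apply: is_derive_line; exact: smooth_derivable.
have same i : 'D_(dx R i) u X = 'D_(dx R i) u Y /\
    'D_(dx R i) ('D_(dx R i) u) X - 'D_(dx R i) ('D_(dx R i) u) Y <= 0.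
  have f1 s := is_derive_sub (is_derive_sub (line u X (dx R i) s us) (line u Y (dx R i) s us))
     (is_derive_const (psi h0) s 1).
  have us1 := smooth_D (dx R i) us.
  have f2 := is_derive_sub (is_derive_sub (line _ X (dx R i) 0 us1) (line _ Y (dx R i) 0 us1))
     (is_derive_const (0 : R) (0 : R) 1).
  have := @local_max2 R _ _ _ 1 f1 f2 ltr01.
  rewrite !scale0r !addr0 !subr0 => -[h _|D1 D2]; last first.
    by split=> //; apply/eqP; rewrite -subr_eq0 D1.
  rewrite -[X + _]/(x0 + h0 *: e + h *: e_ R i, t0 + h *: 0) scaler0 addr0 (addrAC x0 (h0 *: e)).
  rewrite -[Y + _]/(x0 + h *: e_ R i, t0 + h *: 0) scaler0 addr0.
  exact: Max.
(* Moving the two points apart by [s] each changes their distance by [2 s], so that [psi'' = -b] is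
   seen with the factor [4]. *)
have apart : 'D_(dx R i0) ('D_(dx R i0) u) X - 'D_(dx R i0) ('D_(dx R i0) u) Y <= - (4 * b).
  pose v : E := (e, 0).
  have psiD (s : R) : is_derive s 1 (fun s => psi (h0 + 2 * s)) (2 * a - 2 * b * (h0 + 2 * s)).
    have l1 := is_derive_add (is_derive_const h0 s 1) (is_derive_lmul 2 (is_derive_idR s)).
    have l2 := is_derive_mul l1 l1.
    apply: is_derive_fun (is_derive_sub (is_derive_lmul a l1) (is_derive_lmul (b / 2) l2)) _ _.
      by move=> t; rewrite /psi expr2.
    by field.
  have lN (g : E -> R) (s : R) : smooth g ->
      is_derive s 1 (fun s : R => g (Y + (- s) *: v)) (- 'D_v g (Y + (- s) *: v)).
    move=> gs; have := @is_derive_compR R _ (fun s => - s) s _ _ (line g Y v (- s) gs)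
       (is_derive_opp (is_derive_idR s)).
    by rewrite mulrN1.
  have f1 s := is_derive_sub (is_derive_sub (line u X v s us) (lN u s us)) (psiD s).
  have us1 := smooth_D v us.
  have psi2 : is_derive (0 : R) 1 (fun s => 2 * a - 2 * b * (h0 + 2 * s)) (- (4 * b)).
    have l1 := is_derive_add (is_derive_const h0 (0 : R) 1) (is_derive_lmul 2 (is_derive_idR 0)).
    apply: is_derive_fun (is_derive_sub (is_derive_const (2 * a) _ _) (is_derive_lmul (2 * b) l1)) _ _ => //.
    by ring.
  have f2 := is_derive_sub (is_derive_sub (line _ X v 0 us1) (is_derive_opp (lN _ 0 us1))) psi2.
  pose dd := Num.min (h0 / 2) ((r0 - h0) / 2).
  have ddp : 0 < dd by rewrite lt_min !divr_gt0 // subr_gt0.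
  have := @local_max2 R _ _ _ dd f1 f2 ddp.
  rewrite !scale0r oppr0 !scale0r !addr0 !mulr0 !addr0 opprK => -[h|_ H2].
    rewrite lt_min => /andP[]; rewrite !ltr_norml => /andP[h1 h2] /andP[h3 h4].
    rewrite -[X + _]/(x0 + h0 *: e + h *: e, t0 + h *: 0) scaler0 addr0.
    rewrite -[Y + _]/(x0 + - h *: e, t0 + - h *: 0) scaler0 addr0.
    have -> : x0 + h0 *: e + h *: e = x0 + - h *: e + (h0 + 2 * h) *: e.
      by rewrite -!addrA -!scalerDl; congr (_ + _ *: _); ring.
    by apply: Max => //; clear -h1 h2 h3 h4; apply/andP; split; lra.
  have vE : v = sg *: dx R i0.
    by rewrite -[RHS]/(sg *: e_ R i0, sg *: 0) scaler0.
  have DvE (g : E -> R) z : smooth g -> 'D_v g z = sg * 'D_(dx R i0) g z.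
    move=> gs; have gd := smooth_diff z gs.
    by rewrite vE !deriveE // linearZ.
  have DvvE z : 'D_v ('D_v u) z = 'D_(dx R i0) ('D_(dx R i0) u) z.
    have -> : 'D_v u = fun z => sg * 'D_(dx R i0) u z by apply/funext => y; exact: DvE.
    rewrite DvE; last by apply: smooth_mul; [exact: smooth_const|exact: smooth_D].
    rewrite (derive_val_eq (is_derive_lmul sg (smooth_is_derive _ _ (smooth_D _ us)))).
    by rewrite mulrA -expr2 sg2 mul1r.
  have EX := DvvE X; have EY := DvvE Y; clear f1 f2 lN psiD us1 psi2.
  clearbody X Y v; move: H2; rewrite -EX -EY.
  by move: ('D_v ('D_v u) X) ('D_v ('D_v u) Y) => p q H2; clear -H2; lra.
have lap : Lap u X - Lap u Y <= - (4 * b).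
  rewrite /Lap -sumrB (bigD1 i0) //= -[leRHS]addr0 lerD //.
  by apply: sumr_le0 => i _; exact: (same i).2.
have DxE : Dx u X = Dx u Y by apply/rowP => i; rewrite !mxE (same i).1.
(* The maximum may sit at [t0 = 0]; increments towards later times are enough for this sign. *)
have time : Dt u X - Dt u Y <= 0.
  have f1 := is_derive_sub (line u X (dt R d) 0 us) (line u Y (dt R d) 0 us).
  rewrite !scale0r !addr0 in f1.
  have tp : 0 < T - t0 by rewrite subr_gt0.
  apply: local_max_right f1 tp _ => h /andP[hp ht].
  rewrite !add0r !scale0r !addr0.
  rewrite -[X + _]/(x0 + h0 *: e + h *: 0, t0 + h * 1) scaler0 addr0 mulr1.
  rewrite -[Y + _]/(x0 + h *: 0, t0 + h * 1) scaler0 addr0 mulr1.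
  have := Max x0 h0 (t0 + h) h0r; rewrite -/X -/Y lerBlDr subrK; apply.
  by rewrite addr_ge0 ?(ltW hp) //= -lerBrDl ltW.
have e1 := HJ (x0 + h0 *: e) t0 t0T; have e2 := HJ x0 t0 t0T.
have e3 := HF x0 h0 t0 h0r t0T.
move: e1 e2 e3; rewrite -/X -/Y DxE; clear -lap time; move: lap time.
move: (Dt u X) (Dt u Y) (Lap u X) (Lap u Y) (H _ _) (H _ _) (F X) (F Y) => *; lra.
Qed.
End Doubling.

(** * Mollification *)

Section NormedCont.
Variables (R : realType) (X : normedModType R).

Lemma cont_shiftc (c : X) : continuous (fun y : X => y + c).
Proof. by move=> y; apply: cvgD; [exact: cvg_id|exact: cvg_cst]. Qed.

Lemma cont_reflc (c : X) : continuous (fun y : X => c - y).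
Proof. by move=> y; apply: cvgB; [exact: cvg_cst|exact: cvg_id]. Qed.

Lemma cont_scalec (c : R) : continuous (fun y : X => c *: y).
Proof. by move=> y; apply: cvgZl_tmp; exact: cvg_id. Qed.
End NormedCont.

Section Mollification.
Variables (R : realType) (d : nat) (eta : 'rV[R]_d -> R) (eps : R).
Hypotheses (etaP : mollifier eta) (eps0 : 0 < eps).
Local Notation E := ('rV[R]_d * R)%type.
Local Notation J := (@int_Td R d).
Local Notation S := (mconv eta eps).
Local Notation et := (eta_eps eta eps).
Implicit Types f g h : 'rV[R]_d -> R.

Lemma int_Td_shift f c : smooth f -> periodicT f -> J (fun x => f (x + c)) = J f.
Proof. exact: J_shift. Qed.

(** The cube contains the support of the rescaled kernel, so mollifications are computed by this
    integral. *)
Definition window f : R := iint `[- eps, eps]%classic f.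

Lemma window_posint : posint (@box R (- eps) eps d) window.
Proof. by apply: iint_posint; rewrite ge0_cp // ltW. Qed.
Let PW := window_posint.
Let PJ := @int_Td_posint R d.

Lemma enorm_coord n (v : 'rV[R]_n) i : `|v 0 i| <= enorm v.
Proof.
rewrite -sqrtr_sqr ler_sqrt; last by apply: sumr_ge0 => j _; exact: sqr_ge0.
by rewrite (bigD1 i) //= lerDl sumr_ge0 // => j _; exact: sqr_ge0.
Qed.

Lemma et_smooth : smooth et.
Proof.
case: etaP => es _ _ _ _; apply: smooth_mul; first exact: smooth_const.
have Alin : linear (fun y : 'rV[R]_d => eps^-1 *: y).
  by move=> a u v; rewrite scalerDr !scalerA mulrC.
have Abd (y : 'rV[R]_d) : `|eps^-1 *: y| <= `|eps^-1| * `|y| by rewrite normrZ.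
by have := smooth_affine 0 Alin Abd es; under eq_fun do rewrite addr0.
Qed.
Let etc := smooth_cont et_smooth.

Lemma et_ge0 y : 0 <= et y.
Proof. by case: etaP => _ e0 _ _ _; rewrite mulr_ge0 // invr_ge0 exprn_ge0 // ltW. Qed.

Lemma et_even y : et (- y) = et y.
Proof. by case: etaP => _ _ _ es _; rewrite /eta_eps scalerN es. Qed.

Lemma eta_out e (y : 'rV[R]_d) : 0 < e -> ~ @box R (- e) e d y -> eta (e^-1 *: y) = 0.
Proof.
move=> e0 yb; case: etaP => _ _ e1 _ _; apply: e1.
have [i yi] : exists i, e < `|y 0 i|.
  apply: contrapT => /forallNP H; apply: yb => i; rewrite -ler_norml leNgt.
  exact/negP/H.
apply: lt_le_trans (enorm_coord _ i); rewrite mxE normrM gtr0_norm ?invr_gt0 //.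
by rewrite mulrC ltr_pdivlMr // mul1r.
Qed.

Lemma mconvE f x : S f x = window (fun y => et y * f (x - y)).
Proof.
by apply: int_Rd_box => y yb; rewrite /eta_eps eta_out // mulr0 mul0r.
Qed.

Lemma window_et : window et = 1.
Proof.
have [es _ _ _ e1] := etaP; rewrite -e1 /window (int_Rd_box (e := 1)); last first.
  by move=> y yb; have := eta_out (ltr01 : 0 < 1 :> R) yb; rewrite invr1 scale1r.
have ec : continuous (fun y : 'rV[R]_d => eta (eps^-1 *: y)).
  exact: (continuous_compose (smooth_cont es) (@cont_scalec R 'rV[R]_d eps^-1)).
have := posint_scale PW (eps ^- d) ec; rewrite /window => ->.
rewrite iint_scale //; last exact: smooth_cont.
by rewrite mulrA mulVf ?mul1r // expf_neq0 // gt_eqF.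
Qed.

Lemma conv_cont2 f : continuous f -> continuous (fun p : 'rV[R]_d * 'rV[R]_d => et p.2 * f (p.1 - p.2)).
Proof.
move=> fc; apply: continuous_mul; first by apply: (continuous_compose etc); exact: cont_snd.
by apply: (continuous_compose fc) => p; apply: cvgB; [exact: cvg_fst|exact: cvg_snd].
Qed.

Lemma conv_cont f x : continuous f -> continuous (fun y => et y * f (x - y)).
Proof. move=> fc; apply: continuous_mul; first exact: etc.
exact: (continuous_compose fc (@cont_reflc R 'rV[R]_d x)). Qed.

Lemma mconv_cont f : continuous f -> continuous (S f).
Proof.
move=> fc; have := posint_cont PW (conv_cont2 fc).
by under eq_fun do rewrite -mconvE.
Qed.

Lemma mconv_const c x : S (fun=> c) x = c.
Proof. by rewrite mconvE (posint_scaler PW) // window_et mul1r. Qed.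

Lemma mconv_le f g x : continuous f -> continuous g -> (forall y, f y <= g y) -> S f x <= S g x.
Proof.
move=> fc gc fg; rewrite !mconvE; apply: (posint_le PW); [exact: conv_cont..|].
by move=> y _; rewrite ler_wpM2l // et_ge0.
Qed.

Lemma mconv_ge f c x : continuous f -> (forall y, c <= f y) -> c <= S f x.
Proof. by move=> fc H; rewrite -{1}(mconv_const c x) mconv_le //; exact: continuous_const. Qed.

Lemma mconv_leC f c x : continuous f -> (forall y, f y <= c) -> S f x <= c.
Proof. by move=> fc H; rewrite -(mconv_const c x) mconv_le //; exact: continuous_const. Qed.

Lemma mconv_abs f c g x : continuous f -> continuous g ->
  (forall y, `|f y| <= c * g y) -> `|S f x| <= c * S g x.
Proof.
move=> fc gc H.
have E0 c' : c' * S g x = S (fun y => c' * g y) x.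
  rewrite !mconvE -(posint_scale PW); last exact: conv_cont.
  by congr window; apply/funext => y; rewrite mulrCA.
have cc c' : continuous (fun y => c' * g y) by apply: continuous_mul => //; exact: continuous_const.
rewrite ler_norml -mulNr !E0; apply/andP; split; apply: mconv_le => // y;
  have := H y; rewrite ler_norml -mulNr => /andP[] //.
Qed.

Lemma int_mconv f h : continuous f -> continuous h ->
  J (fun x => h x * S f x) = window (fun y => et y * J (fun x => h x * f (x - y))).
Proof.
move=> fc hc.
have hfc : continuous (fun p : 'rV[R]_d * 'rV[R]_d => h p.1 * f (p.1 - p.2)).
  apply: continuous_mul; first by apply: (continuous_compose hc); exact: cont_fst.
  by apply: (continuous_compose fc) => p; apply: cvgB; [exact: cvg_fst|exact: cvg_snd].
have Fc : continuous (fun p : 'rV[R]_d * 'rV[R]_d => et p.2 * (h p.1 * f (p.1 - p.2))).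
  apply: continuous_mul => //; by apply: (continuous_compose etc); exact: cont_snd.
have := iint_comm (ler01 : (0 : R) <= 1) PW Fc; rewrite /= => FB.
transitivity (J (fun x => window (fun y => et y * (h x * f (x - y))))).
  apply: eq_int_Td => x; rewrite mconvE -(posint_scale PW); last exact: conv_cont.
  by congr window; apply/funext => y; rewrite mulrCA.
rewrite /int_Td FB; congr window; apply/funext => y.
apply: (posint_scale PJ (et y)); apply: continuous_mul => //.
exact: (continuous_compose fc (@cont_shiftc R 'rV[R]_d (- y))).
Qed.

(** Fubini, a translation on the torus and the evenness of the kernel exchange the two factors. *)
Lemma mconv_adjoint f h : smooth f -> smooth h -> periodicT f -> periodicT h ->
  J (fun x => h x * S f x) = J (fun x => S h x * f x).
Proof.
move=> fs hs fp hp.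
have fc := smooth_cont fs; have hc := smooth_cont hs.
rewrite int_mconv //.
have sh y : J (fun x => h x * f (x - y)) = J (fun x => f x * h (x + y)).
  rewrite -(@int_Td_shift (fun x => h x * f (x - y)) y).
  - by apply: eq_int_Td => x; rewrite addrK mulrC.
  - apply: smooth_mul => //; exact: smooth_shift.
  - by move=> x i; rewrite hp addrAC fp.
have hfc : continuous (fun p : 'rV[R]_d * 'rV[R]_d => f p.2 * h (p.2 + p.1)).
  apply: continuous_mul; first by apply: (continuous_compose fc); exact: cont_snd.
  by apply: (continuous_compose hc) => p; apply: cvgD; [exact: cvg_snd|exact: cvg_fst].
have kc : continuous (fun y => et y * J (fun x => f x * h (x + y))).
  by apply: continuous_mul => //; exact: (posint_cont PJ hfc).
transitivity (window (fun y => et y * J (fun x => f x * h (x + y)))).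
  by congr window; apply/funext => y; rewrite sh.
rewrite -[LHS](iint_refl (ltW eps0) kc).
transitivity (J (fun x => f x * S h x)); last by apply: eq_int_Td => x; rewrite mulrC.
rewrite int_mconv //; congr window; apply/funext => y; rewrite et_even.
by congr (_ * _).
Qed.

Lemma int_mconv1 f : smooth f -> periodicT f -> J (S f) = J f.
Proof.
move=> fs fp.
have := mconv_adjoint fs (@smooth_const R _ 1) fp (fun _ _ => erefl).
rewrite (_ : (fun x => 1 * S f x) = S f); last by apply/funext => x; rewrite mul1r.
by move=> ->; apply: eq_int_Td => x; rewrite mconv_const mul1r.
Qed.

(** Mollification in space only: time is a parameter, and derivatives in both variables commute with
    it. *)
Definition mconvE2 (f : E -> R) (z : E) : R := S (fun y => f (y, z.2)) z.1.

Section SpaceTimeConv.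
Variable f : E -> R.
Hypothesis fs : smooth f.

Let A (p : E * 'rV[R]_d) : E := (p.1.1 - p.2, p.1.2).
Let Alin : linear A.
Proof.
move=> a u v; rewrite /A -[RHS]/(a *: (u.1.1 - u.2) + (v.1.1 - v.2), a *: u.1.2 + v.1.2).
by congr pair => /=; rewrite scalerBr opprD addrACA.
Qed.
Let Abd p : `|A p| <= 2 * `|p|.
Proof.
have h1 : `|p.1.1| <= `|p| := le_trans (norm_fst _) (norm_fst _).
have h2 : `|p.1.2| <= `|p| := le_trans (norm_snd _) (norm_fst _).
have h3 : `|p.2| <= `|p| := norm_snd _.
rewrite pair_normE ge_max /=; apply/andP; split.
  by rewrite (le_trans (ler_normB _ _)) // mulr_natl mulr2n lerD.
by rewrite (le_trans h2) // ler_peMl // ler1n.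
Qed.

Let G (p : E * 'rV[R]_d) := et p.2 * f (A p).

Let Gs : smooth G.
Proof.
have As := smooth_affine 0 Alin Abd fs.
have Bs : smooth (fun p : E * 'rV[R]_d => et p.2).
  have Blin : linear (fun p : E * 'rV[R]_d => p.2) by [].
  have Bbd (p : E * 'rV[R]_d) : `|p.2| <= 1 * `|p| by rewrite mul1r norm_snd.
  by have := smooth_affine 0 Blin Bbd et_smooth; under eq_fun do rewrite addr0.
by apply: smooth_mul => //; move: As; under eq_fun do rewrite addr0.
Qed.

Let mconvE2_G : mconvE2 f = fun z => window (fun y => G (z, y)).
Proof. by apply/funext => z; rewrite /mconvE2 mconvE. Qed.

Lemma smooth_mconvE2 : smooth (mconvE2 f).
Proof.
rewrite mconvE2_G; apply: (posint_smooth PW) => //.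
exact: fdim_prod (fdim_rV R d) (fdimR R).
Qed.

Lemma derive_mconvE2 v : 'D_v (mconvE2 f) = mconvE2 ('D_v f).
Proof.
rewrite mconvE2_G (posint_derive PW) //; apply/funext => z; rewrite /mconvE2 mconvE.
congr window; apply/funext => y.
have -> : 'D_(v, 0) G (z, y) = 'D_v (fun z : E => et y * f (z - (y, 0))) z.
  rewrite -(derive_slicel G z y v); apply: derive_quot => h; rewrite /G /A.
  by rewrite -[_ - (y, 0)]/((h *: v + z).1 - y, (h *: v + z).2 - 0) subr0.
rewrite (derive_val_eq (is_derive_lmul (et y) (smooth_is_derive z v (smooth_shift (- (y, 0)) fs)))).
rewrite derive_shiftE; congr (_ * 'D_v f _).
by case: z => a b; rewrite -[(a, b) - (y, 0)]/(a - y, b - 0) subr0.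
Qed.

Lemma periodicE_mconvE2 : periodicE f -> periodicE (mconvE2 f).
Proof.
move=> fp z i; rewrite /mconvE2 !mconvE; congr window; apply/funext => y; congr (_ * _).
rewrite -(fp (z.1 - y, z.2) i); congr f.
by rewrite -[RHS]/(z.1 - y + e_ R i, z.2 + 0) -[(z + dx R i).1]/(z.1 + e_ R i)
   -[(z + dx R i).2]/(z.2 + 0) addrAC.
Qed.
End SpaceTimeConv.
End Mollification.

(** * The Hamiltonian along a solution *)

Section Curves.
Variables (R : realType) (E F : normedModType R) (n : nat) (c : 'I_n -> E -> R) (w : 'I_n -> F).
Hypothesis cs : forall i, smooth (c i).

Let phi (z : E) : F := \sum_i c i z *: w i.

Let phiE : phi = \sum_i (fun z : E => c i z *: w i).
Proof. by apply/funext => z; rewrite fct_sumE. Qed.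

Lemma curve_diff z : differentiable phi z.
Proof.
by rewrite phiE; apply: differentiable_sum => i; apply: differentiableZl; exact: smooth_diff.
Qed.

Lemma curve_derive z v : 'D_v phi z = \sum_i 'D_v (c i) z *: w i.
Proof.
have dz i : differentiable (fun z : E => c i z *: w i) z.
  by apply: differentiableZl; exact: smooth_diff.
rewrite phiE derive_sum => [|i]; last exact: diff_derivable.
apply: eq_bigr => i _; rewrite !deriveE //; last exact: smooth_diff.
by rewrite diffZl //; exact: smooth_diff.
Qed.

(** Vector-valued maps enter in coordinates, as sums of smooth scalar functions times fixed vectors;
    this is the form that [smooth_comp] requires. *)
Lemma curve_smooth G : smooth G -> smooth (fun z => G (\sum_i c i z *: w i)).
Proof.
apply: (@smooth_comp R E F phi) => [z|v]; first exact: curve_diff.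
exists n, w, (fun i => 'D_v (c i)); split=> [i|z]; first exact: smooth_D.
exact: curve_derive.
Qed.

Lemma curve_is_derive G z v : smooth G ->
  is_derive z v (fun z => G (\sum_i c i z *: w i))
    (\sum_i 'D_v (c i) z * 'D_(w i) G (\sum_i c i z *: w i)).
Proof.
move=> Gs; have := derive_comp v (curve_diff z) (smooth_diff (phi z) Gs).
by rewrite curve_derive derive_sumv //; exact: smooth_diff.
Qed.
End Curves.

Lemma sum_pair (R : realType) (E F : normedModType R) I (r : seq I) (f : I -> E) (g : I -> F) :
  \sum_(i <- r) ((f i, g i) : (E * F)%type) = (\sum_(i <- r) f i, \sum_(i <- r) g i).
Proof. by elim: r => [|i r IH]; rewrite ?big_nil // !big_cons IH. Qed.

Lemma tr_mul2 (R : comNzRingType) d (A M : 'M[R]_d) :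
  \tr (A *m M) = \sum_i \sum_j M i j * A j i.
Proof.
rewrite /mxtrace exchange_big; apply: eq_bigr => j _; rewrite mxE.
by apply: eq_bigr => i _; rewrite mulrC.
Qed.

Lemma tr_mul3 (R : comNzRingType) d (A M : 'M[R]_d) : M^T = M ->
  \tr (A *m (M *m M)) = \sum_i \sum_j \sum_k M i j * (M i k * A k j).
Proof.
move=> Ms; transitivity (\sum_k \sum_j \sum_i M i j * (M i k * A k j)).
  apply: eq_bigr => k _; rewrite mxE; apply: eq_bigr => j _.
  rewrite mxE mulr_sumr; apply: eq_bigr => i _; rewrite -{1}Ms mxE; ring.
rewrite exchange_big /= (eq_bigr _ (fun j _ => exchange_big _ _ _ _ _ _)) /=.
by rewrite exchange_big.
Qed.

Lemma sum_expand (R : comNzRingType) d (a w b e : 'I_d -> 'I_d -> R) t :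
  (forall i j, b i j = e i j + \sum_(k < d) t i j k) ->
  \sum_i \sum_j (a i j + w i j * b i j) = \sum_i \sum_j a i j +
    (\sum_i \sum_j w i j * e i j + \sum_i \sum_j \sum_k w i j * t i j k).
Proof.
move=> be; rewrite -!big_split; apply: eq_bigr => i _ /=; rewrite -!big_split.
by apply: eq_bigr => j _ /=; rewrite be mulrDr mulr_sumr.
Qed.

Section AlongGradient.
Variables (R : realType) (d : nat).
Local Notation V := 'rV[R]_d.
Local Notation E := (V * R)%type.
Variable u : E -> R.
Hypothesis us : smooth u.
Implicit Types G : (V * V)%type -> R.

Let ex (i : 'I_d) : (V * V)%type := (e_ R i, 0).
Let ep (i : 'I_d) : (V * V)%type := (0, e_ R i).

(** The coordinates of the map sending [z] to [(z.1, Dx u z)]: the first [d] carry the point, the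
    last [d] the gradient. *)
Let c (i : 'I_(d + d)) : E -> R :=
  match fintype.split i with inl j => fun z : E => z.1 0 j | inr j => 'D_(dx R j) u end.
Let w (i : 'I_(d + d)) : (V * V)%type :=
  match fintype.split i with inl j => ex j | inr j => ep j end.

Let cs i : smooth (c i).
Proof. by rewrite /c; case: fintype.split => j; [exact: smooth_fstE|exact: smooth_D]. Qed.

Let split_sum (W : nmodType) (f : 'I_(d + d) -> W) :
  \sum_i f i = \sum_j f (lshift d j) + \sum_j f (rshift d j).
Proof. exact: big_split_ord. Qed.

Let cl j : c (lshift d j) = fun z : E => z.1 0 j.
Proof. by rewrite /c (unsplitK (inl j)). Qed.
Let cr j : c (rshift d j) = 'D_(dx R j) u.
Proof. by rewrite /c (unsplitK (inr j)). Qed.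
Let wl j : w (lshift d j) = ex j.
Proof. by rewrite /w (unsplitK (inl j)). Qed.
Let wr j : w (rshift d j) = ep j.
Proof. by rewrite /w (unsplitK (inr j)). Qed.

Let phiE z : \sum_i c i z *: w i = (z.1, Dx u z).
Proof.
have E1 : \sum_j z.1 0 j *: ex j = (z.1, 0).
  under eq_bigr => j _ do rewrite -[_ *: ex j]/(z.1 0 j *: e_ R j, z.1 0 j *: (0 : V)) scaler0.
  by rewrite sum_pair -rV_sum_basis big1.
have E2 : \sum_j 'D_(dx R j) u z *: ep j = (0, Dx u z).
  under eq_bigr => j _ do
    rewrite -[_ *: ep j]/('D_(dx R j) u z *: (0 : V), 'D_(dx R j) u z *: e_ R j) scaler0.
  rewrite sum_pair big1 //; congr pair.
  by rewrite [RHS]rV_sum_basis; apply: eq_bigr => j _; rewrite mxE.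
rewrite split_sum (eq_bigr (fun j => z.1 0 j *: ex j)) => [|j _]; last by rewrite cl wl.
rewrite E1 (eq_bigr (fun j => 'D_(dx R j) u z *: ep j)) => [|j _]; last by rewrite cr wr.
by rewrite E2 -[LHS]/(z.1 + 0, 0 + Dx u z) addr0 add0r.
Qed.

Lemma shift_coord (z : E) s i j : (z + s *: dx R i).1 0 j = z.1 0 j + s * (j == i)%:R.
Proof. by rewrite !mxE. Qed.

Lemma smooth_along G : smooth G -> smooth (fun z : E => G (z.1, Dx u z)).
Proof. by move=> Gs; have := curve_smooth w cs Gs; under eq_fun do rewrite phiE. Qed.

Lemma derive_along G i z : smooth G ->
  'D_(dx R i) (fun z : E => G (z.1, Dx u z)) z =
  'D_(ex i) G (z.1, Dx u z) +
  \sum_j 'D_(dx R i) ('D_(dx R j) u) z * 'D_(ep j) G (z.1, Dx u z).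
Proof.
move=> Gs; apply: derive_val_eq.
apply: is_derive_fun (curve_is_derive w cs z (dx R i) Gs) _ _ => [y|]; first by rewrite phiE.
rewrite phiE split_sum; congr (_ + _); last first.
  by apply: eq_bigr => j _; rewrite cr wr; reflexivity.
rewrite (bigD1 i) //= cl wl big1 => [|j ji].
  have c1 : 'D_(dx R i) (fun z : E => z.1 0 i) z = 1.
    apply: derive_val_eq; apply: is_derive_along.
    apply: is_derive_fun (is_derive_add (is_derive_const (z.1 0 i) _ _) (is_derive_idR 0)) _ _.
      by move=> s; rewrite shift_coord eqxx mulr1.
    by rewrite add0r.
  by rewrite c1 mul1r addr0.
rewrite cl wl; suff -> : 'D_(dx R i) (fun z : E => z.1 0 j) z = 0 by rewrite mul0r.
apply: derive_val_eq; apply: is_derive_along.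
apply: is_derive_fun (is_derive_const (z.1 0 j) _ _) _ _ => // s.
by rewrite shift_coord (negbTE ji) mulr0 addr0.
Qed.

Definition hess (z : E) : 'M[R]_d := \matrix_(i, j) 'D_(dx R i) ('D_(dx R j) u) z.

Lemma hess_sym z : (hess z)^T = hess z.
Proof. by apply/matrixP => i j; rewrite !mxE; exact: derive_schwarz. Qed.

Lemma smooth_Lap : smooth (Lap u).
Proof. by apply: smooth_sum => i; do 2 apply: smooth_D. Qed.

Lemma derive_Lap v z : 'D_v (Lap u) z = \sum_i 'D_(dx R i) ('D_(dx R i) ('D_v u)) z.
Proof.
have := is_derive_bigsum (index_enum 'I_d) (fun i =>
  smooth_is_derive z v (smooth_D (dx R i) (smooth_D (dx R i) us))).
move=> /derive_val_eq ->; apply: eq_bigr => i _.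
apply: (etrans (@derive_schwarz R E ('D_(dx R i) u) v (dx R i) z (smooth_D (dx R i) us))).
have Ei : 'D_v ('D_(dx R i) u) = 'D_(dx R i) ('D_v u).
  by apply/funext => y; exact: (@derive_schwarz R E u v (dx R i) y us).
exact: (congr1 (fun f => derive f z (dx R i)) Ei).
Qed.

Variable H : V -> V -> R.
Let Hc (z : (V * V)%type) : R := H z.1 z.2.
Hypothesis Hs : smooth Hc.

Definition drift i (z : E) : R := DpH H z.1 (Dx u z) 0 i.
Definition Halong (z : E) : R := H z.1 (Dx u z).

Let driftE i : drift i = fun z : E => ('D_(ep i) Hc) (z.1, Dx u z).
Proof. by apply/funext => z; rewrite /drift mxE. Qed.

Let hessE y i j : hess y i j = 'D_(dx R i) ('D_(dx R j) u) y.
Proof. by rewrite /hess mxE. Qed.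
Let DpxE x p i j : DpxH H x p i j = 'D_(ep i) ('D_(ex j) Hc) (x, p).
Proof. by rewrite /DpxH mxE. Qed.
Let DppE x p i j : DppH H x p i j = 'D_(ep i) ('D_(ep j) Hc) (x, p).
Proof. by rewrite /DppH mxE. Qed.

Lemma smooth_drift i : smooth (drift i).
Proof. by rewrite driftE; exact: (smooth_along (smooth_D (ep i) Hs)). Qed.

Lemma smooth_Halong : smooth Halong.
Proof. exact: (smooth_along Hs). Qed.

(** The third derivatives of [u] in the Laplacian of [H(x, Du)] are exactly those of the transport
    of [Lap u] by the drift. The difference contains second derivatives of [u] only, in the
    combination of traces that (A5) controls. *)
Lemma Lap_Halong z : Lap Halong z - \sum_i drift i z * 'D_(dx R i) (Lap u) z =
  \tr (DxxH H z.1 (Dx u z)) + 2 * \tr (DpxH H z.1 (Dx u z) *m hess z) +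
  \tr (DppH H z.1 (Dx u z) *m (hess z *m hess z)).
Proof.
have D1 i : 'D_(dx R i) Halong = fun z => ('D_(ex i) Hc) (z.1, Dx u z) +
    \sum_j 'D_(dx R i) ('D_(dx R j) u) z * drift j z.
  apply/funext => y; rewrite -[LHS]/('D_(dx R i) Halong y) (derive_along i y Hs).
  by congr (_ + _); apply: eq_bigr => j _; rewrite driftE.
have D2 i : 'D_(dx R i) ('D_(dx R i) Halong) z =
    'D_(dx R i) (fun z : E => ('D_(ex i) Hc) (z.1, Dx u z)) z +
    \sum_j ('D_(dx R i) ('D_(dx R i) ('D_(dx R j) u)) z * drift j z +
       'D_(dx R i) ('D_(dx R j) u) z * 'D_(dx R i) (drift j) z).
  rewrite D1; apply: derive_val_eq; apply: is_derive_add.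
    exact: smooth_is_derive (smooth_along (smooth_D (ex i) Hs)).
  apply: is_derive_bigsum => j; apply: is_derive_mul; apply: smooth_is_derive.
    by do 2 apply: smooth_D.
  exact: smooth_drift.
have D3 i j : 'D_(dx R i) (drift j) z = 'D_(ep j) ('D_(ex i) Hc) (z.1, Dx u z) +
    \sum_k 'D_(dx R i) ('D_(dx R k) u) z * 'D_(ep k) ('D_(ep j) Hc) (z.1, Dx u z).
  rewrite driftE; apply: (etrans (derive_along i z (smooth_D (ep j) Hs))).
  apply: (congr1 (fun r : R => r + _)).
  exact: (@derive_schwarz R _ Hc (ex i) (ep j) _ Hs).
have S3 : \sum_i drift i z * 'D_(dx R i) (Lap u) z =
    \sum_i \sum_j 'D_(dx R i) ('D_(dx R i) ('D_(dx R j) u)) z * drift j z.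
  rewrite exchange_big /=; apply: eq_bigr => j _.
  by rewrite derive_Lap mulr_sumr; apply: eq_bigr => i _; rewrite mulrC.
have T1 : \tr (DxxH H z.1 (Dx u z)) = \sum_i 'D_(ex i) ('D_(ex i) Hc) (z.1, Dx u z).
  by apply: eq_bigr => i _; rewrite mxE.
have T2 : \tr (DpxH H z.1 (Dx u z) *m hess z) = \sum_i \sum_j
    'D_(dx R i) ('D_(dx R j) u) z * 'D_(ep j) ('D_(ex i) Hc) (z.1, Dx u z).
  rewrite tr_mul2; apply: eq_bigr => i _; apply: eq_bigr => j _.
  exact: (congr2 (fun a b : R => a * b) (hessE z i j) (DpxE _ _ j i)).
have T3 : \tr (DppH H z.1 (Dx u z) *m (hess z *m hess z)) = \sum_i \sum_j \sum_k
    'D_(dx R i) ('D_(dx R j) u) z * ('D_(dx R i) ('D_(dx R k) u) z *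
      'D_(ep k) ('D_(ep j) Hc) (z.1, Dx u z)).
  rewrite (tr_mul3 _ (hess_sym z)).
  apply: eq_bigr => i _; apply: eq_bigr => j _; apply: eq_bigr => k _.
  exact: (congr2 (fun a b : R => a * b) (hessE z i j)
    (congr2 (fun a b : R => a * b) (hessE z i k) (DppE _ _ k j))).
have D4 : \sum_i 'D_(dx R i) (fun z : E => ('D_(ex i) Hc) (z.1, Dx u z)) z =
   \sum_i 'D_(ex i) ('D_(ex i) Hc) (z.1, Dx u z) + \sum_i \sum_j
    'D_(dx R i) ('D_(dx R j) u) z * 'D_(ep j) ('D_(ex i) Hc) (z.1, Dx u z).
  apply: (etrans _ (big_split _ _ _ _ _)).
  by apply: eq_bigr => i _; exact: (derive_along i z (smooth_D (ex i) Hs)).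
have D5 : \sum_i \sum_j ('D_(dx R i) ('D_(dx R i) ('D_(dx R j) u)) z * drift j z +
       'D_(dx R i) ('D_(dx R j) u) z * 'D_(dx R i) (drift j) z) =
   \sum_i \sum_j 'D_(dx R i) ('D_(dx R i) ('D_(dx R j) u)) z * drift j z +
   (\sum_i \sum_j 'D_(dx R i) ('D_(dx R j) u) z * 'D_(ep j) ('D_(ex i) Hc) (z.1, Dx u z) +
    \sum_i \sum_j \sum_k
    'D_(dx R i) ('D_(dx R j) u) z * ('D_(dx R i) ('D_(dx R k) u) z *
      'D_(ep k) ('D_(ep j) Hc) (z.1, Dx u z))).
  exact: (sum_expand _ _ D3).
have L1 := etrans (etrans (eq_bigr _ (fun i _ => D2 i)) (big_split _ _ _ _ _))
  (congr2 (fun a b : R => a + b) D4 D5).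
have fin (l s t1 t2 t3 s1 s2 s3 ss : R) : l = s1 + s2 + (ss + (s2 + s3)) -> s = ss ->
    t1 = s1 -> t2 = s2 -> t3 = s3 -> l - s = t1 + 2 * t2 + t3.
  by move=> -> -> -> -> ->; ring.
exact: (fin _ _ _ _ _ _ _ _ _ L1 S3 T1 T2 T3).
Qed.
End AlongGradient.

(** * Positivity of the density and lower bound of the value function *)

Section Solutions.
Variables (R : realType) (d : nat).
Local Notation E := ('rV[R]_d * R)%type.
Local Notation J := (@int_Td R d).
Let PJ := @int_Td_posint R d.

Lemma torus_bound (f : E -> R) T : 0 <= T -> continuous f -> periodicE f ->
  exists2 B, 0 <= B & forall x t, 0 <= t <= T -> `|f (x, t)| <= B.
Proof.
move=> T0 fc fp.
have [x0 [t0 [t0T H]]] := torus_max T0 fc fp.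
have [|x1 [t1 [t1T H']]] := torus_max T0 (continuous_opp fc); first by move=> z i; rewrite fp.
exists (Num.max `|f (x0, t0)| `|f (x1, t1)|); first by rewrite le_max normr_ge0.
move=> x t tT; rewrite ler_norml; apply/andP; split.
  rewrite lerNl (le_trans (H' x t tT)) // le_max; apply/orP; right.
  by rewrite -normrN ler_norm.
by rewrite (le_trans (H x t tT)) // le_max ler_norm.
Qed.

Lemma periodicE_sum I (r : seq I) (f : I -> E -> R) : (forall i, periodicE (f i)) ->
  periodicE (fun z => \sum_(i <- r) f i z).
Proof. by move=> fp z j; apply: eq_bigr => i _; exact: fp. Qed.

Lemma periodicE_Lap (f : E -> R) : periodicE f -> periodicE (Lap f).
Proof. by move=> fp; apply: periodicE_sum => i; do 2 apply: periodicE_D. Qed.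

Section Convolution.
Variables (eta : 'rV[R]_d -> R) (eps : R).
Hypotheses (etaP : mollifier eta) (eps0 : 0 < eps).
Local Notation S := (mconv eta eps).
Let PW := @window_posint R d eps eps0.

Lemma mconv_sum I (r : seq I) (f : I -> 'rV[R]_d -> R) x : (forall i, continuous (f i)) ->
  S (fun y => \sum_(i <- r) f i y) x = \sum_(i <- r) S (f i) x.
Proof.
move=> fc; rewrite (mconvE etaP eps0) -[RHS](_ : window eps (fun y =>
  \sum_(i <- r) eta_eps eta eps y * f i (x - y)) = _); last first.
  rewrite (posint_sum PW) => [|i]; last exact: conv_cont.
  by apply: eq_bigr => i _; rewrite (mconvE etaP eps0).
by congr window; apply/funext => y; rewrite mulr_sumr.
Qed.

Lemma mconv_add (f g : 'rV[R]_d -> R) x : continuous f -> continuous g ->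
  S (fun y => f y + g y) x = S f x + S g x.
Proof.
move=> fc gc; rewrite !(mconvE etaP eps0) -(posint_add PW); [|exact: conv_cont..].
by congr window; apply/funext => y; rewrite mulrDr.
Qed.

Lemma Lap_mconvE2 (f : E -> R) z : smooth f ->
  Lap (mconvE2 eta eps f) z = mconvE2 eta eps (Lap f) z.
Proof.
move=> fs; rewrite [RHS]/mconvE2 mconv_sum => [|i]; last first.
  exact: (@slice_D R d ('D_(dx R i) f) z.2 (dx R i) (smooth_D (dx R i) fs)).
apply: eq_bigr => i _; rewrite (derive_mconvE2 etaP eps0 fs).
exact: (congr1 (fun g : E -> R => g z) (derive_mconvE2 etaP eps0 (smooth_D (dx R i) fs) (dx R i))).
Qed.

End Convolution.

Section Along.
Variables (H : 'rV[R]_d -> 'rV[R]_d -> R) (u : E -> R).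
Hypotheses (us : smooth u) (up : periodicE u).
Hypotheses (Hs : smooth (fun z : ('rV[R]_d * 'rV[R]_d)%type => H z.1 z.2)).
Hypothesis Hp : forall p, periodicT (fun x => H x p).

Lemma periodic_Dx z i : Dx u (z + dx R i) = Dx u z.
Proof. by apply/rowP => j; rewrite !mxE; exact: periodicE_D. Qed.

Lemma periodicE_Halong : periodicE (Halong u H).
Proof. by move=> z i; rewrite /Halong periodic_Dx; exact: Hp. Qed.

Lemma periodicE_drift i : periodicE (drift u H i).
Proof.
move=> z j; rewrite /drift periodic_Dx !mxE.
have Hp' (y : ('rV[R]_d * 'rV[R]_d)%type) :
    H (y + (e_ R j, 0)).1 (y + (e_ R j, 0)).2 = H y.1 y.2.
  by rewrite -[(y + _).1]/(y.1 + e_ R j) -[(y + _).2]/(y.2 + 0) addr0; exact: Hp.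
have := derive_periodic Hp' (0, e_ R i) (z.1, Dx u z).
by rewrite -[X in derive _ X]/(z.1 + e_ R j, Dx u z + 0) addr0.
Qed.
End Along.

(** The divergence is expanded and its zero order coefficient is bounded by some [L], so that
    [kap exp(-L t)] is a subsolution. This [L] depends on the solution: the bound serves to know
    that the density is positive, never as a constant. *)
Lemma transport_positive (f : E -> R) (b : 'I_d -> E -> R) T kap : 0 <= T -> 0 < kap ->
  smooth f -> periodicE f -> (forall i, smooth (b i)) -> (forall i, periodicE (b i)) ->
  (forall x t, 0 <= t <= T ->
    Dt f (x, t) = Lap f (x, t) + \sum_i 'D_(dx R i) (fun z => b i z * f z) (x, t)) ->
  (forall x, kap <= f (x, 0)) ->
  exists2 dl, 0 < dl & forall x t, 0 <= t <= T -> dl <= f (x, t).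
Proof.
move=> T0 k0 fs fp bs bp feq f0.
pose c (z : E) := \sum_i 'D_(dx R i) (b i) z.
have cs : smooth c by apply: smooth_sum => i; exact: smooth_D.
have cp : periodicE c by apply: periodicE_sum => i; exact: periodicE_D.
have [L L0 cL] := torus_bound T0 (smooth_cont cs) cp.
pose N (z : E) := f z - kap * expR (- L * z.2).
have es : smooth (fun z : E => kap * expR (- L * z.2)).
  by apply: smooth_mul; [exact: smooth_const|exact: smooth_expt].
have ND v z : 'D_v N z = 'D_v f z - kap * (expR (- L * z.2) * (- L * v.2)).
  apply: derive_val_eq; apply: is_derive_sub; first exact: smooth_is_derive.
  by apply: is_derive_lmul; exact: is_derive_expt.
have NDx i : 'D_(dx R i) N = 'D_(dx R i) f.
  by apply/funext => z; rewrite -[LHS]/('D_(dx R i) N z) ND /= !mulr0 subr0.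
have N0 : forall x t, 0 <= t <= T -> 0 <= N (x, t).
  apply: (@min_principle R d N b c L T) => //.
  - exact: smooth_sub.
  - by move=> z i; rewrite /N fp -[(z + _).2]/(z.2 + 0) addr0.
  - by move=> x t tT; apply: le_trans (cL x t tT); exact: ler_norm.
  - move=> x t tT; rewrite /Dt ND -[derive f _ _]/(Dt f (x, t)) feq //=.
    have -> : Lap N (x, t) = Lap f (x, t) by apply: eq_bigr => i _; rewrite NDx.
    have -> : \sum_i 'D_(dx R i) (fun z => b i z * f z) (x, t) =
        \sum_i b i (x, t) * 'D_(dx R i) f (x, t) + c (x, t) * f (x, t).
      rewrite /c mulr_suml -big_split; apply: eq_bigr => i _ /=.
      rewrite (derive_val_eq (is_derive_mul (smooth_is_derive (x, t) (dx R i) (bs i))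
        (smooth_is_derive (x, t) (dx R i) fs))).
      by rewrite addrC.
    have -> : \sum_i b i (x, t) * 'D_(dx R i) N (x, t) = \sum_i b i (x, t) * 'D_(dx R i) f (x, t).
      by apply: eq_bigr => i _; rewrite -[X in _ * X = _]/(('D_(dx R i) N : E -> R) (x, t)) NDx.
    rewrite /N mulr1 -addrA -[leRHS]addrA lerD2l -addrA lerD2l mulrBr lerD2l.
    rewrite mulrN !mulrN lerN2 -subr_ge0.
    rewrite (_ : _ - - _ = (L + c (x, t)) * (kap * expR (- L * t))); last by rewrite /=; ring.
    apply: mulr_ge0; last by rewrite mulr_ge0 ?expR_ge0 // ltW.
    by have := cL x t tT; rewrite ler_norml => /andP[h _]; rewrite -lerBlDl sub0r.
  - by move=> x; rewrite /N /= mulr0 expR0 mulr1 subr_ge0.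
exists (kap * expR (- L * T)); first by rewrite mulr_gt0 ?expR_gt0.
move=> x t tT; have := N0 x t tT; rewrite subr_ge0; apply: le_trans.
rewrite ler_pM2l // ler_expR !mulNr lerN2 ler_wpM2l //.
by case/andP: tT.
Qed.

(** A maximum of [(C + 1) t - u] before time [T] would have [Du = 0], [Lap u >= 0] and
    [Dt u >= C + 1], against [Dt u <= H(x, 0) <= C] from the equation. The extra [1] makes the
    contradiction strict. *)
Lemma hj_lower (u F : E -> R) (H : 'rV[R]_d -> 'rV[R]_d -> R) T C U : 0 <= T ->
  smooth u -> periodicE u ->
  (forall x t, 0 <= t <= T -> - Dt u (x, t) + H x (Dx u (x, t)) = Lap u (x, t) + F (x, t)) ->
  (forall x t, 0 <= t <= T -> 0 <= F (x, t)) -> 0 <= C -> (forall x, H x 0 <= C) ->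
  (forall x, - U <= u (x, T)) ->
  forall x t, 0 <= t <= T -> - (U + (C + 1) * T) <= u (x, t).
Proof.
move=> T0 us up ueq F0 C0 HC uU x t tT.
pose f (z : E) := (C + 1) * z.2 - u z.
have fs : smooth f.
  apply: smooth_sub => //; apply: smooth_mul; [exact: smooth_const|exact: smooth_snd].
have fp : periodicE f by move=> z i; rewrite /f up -[(z + _).2]/(z.2 + 0) addr0.
have fD v z : 'D_v f z = (C + 1) * v.2 - 'D_v u z.
  apply: derive_val_eq; apply: is_derive_sub; last exact: smooth_is_derive.
  by apply: is_derive_lmul; exact: is_derive_snd.
have fDx i : 'D_(dx R i) f = fun z => - 'D_(dx R i) u z.
  by apply/funext => z; rewrite -[LHS]/('D_(dx R i) f z) fD /= mulr0 sub0r.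
have [x0 [t0 [t0T fM]]] := torus_max T0 (smooth_cont fs) fp.
have [D1 D2 _ D4] := max_point fs t0T fM.
suff t0E : t0 = T.
  have := fM x t tT; rewrite t0E /f /=; have := uU x0.
  case/andP: tT => t1 t2; have : 0 <= (C + 1) * t by rewrite mulr_ge0 // addr_ge0.
  rewrite opprD; lra.
apply: contrapT => t0E; have t0lt : t0 < T by case/andP: t0T => _; rewrite le_eqVlt => /orP[/eqP|].
have E1 : Dx u (x0, t0) = 0.
  apply/rowP => i; rewrite !mxE; have := D1 i.
  by rewrite -[LHS]/('D_(dx R i) f (x0, t0)) fD /= mulr0 sub0r => /eqP; rewrite oppr_eq0 => /eqP.
have E2 : 0 <= Lap u (x0, t0).
  apply: sumr_ge0 => i _; have := D2 i; rewrite fDx.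
  rewrite (derive_val_eq (is_derive_opp (smooth_is_derive (x0, t0) (dx R i) (smooth_D (dx R i) us)))).
  by rewrite oppr_le0.
have := D4 t0lt; rewrite fD /= mulr1 => E3.
have := ueq x0 t0 t0T; rewrite E1 /Dt; have := F0 x0 t0 t0T; have := HC x0; lra.
Qed.
End Solutions.

(** * Space integrals at a fixed time and integration by parts *)

Section SliceIntegrals.
Variables (R : realType) (d : nat).
Local Notation E := ('rV[R]_d * R)%type.
Local Notation J := (@int_Td R d).
Let PJ := @int_Td_posint R d.
Implicit Types (f g : E -> R) (t : R).

Definition slice_int t f := J (fun x => f (x, t)).
Local Notation I := slice_int.

Lemma slice_int_eq t f g : (forall x, f (x, t) = g (x, t)) -> I t f = I t g.
Proof. by move=> fg; apply: eq_int_Td. Qed.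

Lemma slice_intD t f g : smooth f -> smooth g -> I t (fun z => f z + g z) = I t f + I t g.
Proof. by move=> fs gs; apply: (posint_add PJ); exact: slice_s. Qed.

Lemma slice_intN t f : smooth f -> I t (fun z => - f z) = - I t f.
Proof. by move=> fs; apply: (posint_opp PJ); exact: slice_s. Qed.

Lemma slice_intB t f g : smooth f -> smooth g -> I t (fun z => f z - g z) = I t f - I t g.
Proof. by move=> fs gs; apply: (posint_sub PJ); exact: slice_s. Qed.

Lemma slice_intZ t c f : smooth f -> I t (fun z => c * f z) = c * I t f.
Proof. by move=> fs; apply: (posint_scale PJ); exact: slice_s. Qed.

Lemma slice_int_sum J' (r : seq J') t (F : J' -> E -> R) : (forall i, smooth (F i)) ->
  I t (fun z => \sum_(i <- r) F i z) = \sum_(i <- r) I t (F i).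
Proof. by move=> fs; apply: (posint_sum PJ) => i; exact: slice_s. Qed.

Lemma slice_int_le t f g : smooth f -> smooth g -> (forall x, f (x, t) <= g (x, t)) ->
  I t f <= I t g.
Proof. by move=> fs gs H; apply: (posint_le PJ) => [||x _]; [exact: slice_s..|]. Qed.

Lemma slice_int_ge0 t f : smooth f -> (forall x, 0 <= f (x, t)) -> 0 <= I t f.
Proof. by move=> fs H; apply: (posint_ge0 PJ) => [|x _]; first exact: slice_s. Qed.

Lemma slice_int_const t c : I t (fun=> c) = c.
Proof. exact: J_const. Qed.

Lemma slice_int_dt t f : smooth f -> is_derive t 1 (fun t => I t f) (I t (Dt f)).
Proof. exact: J_dt. Qed.

Lemma slice_int_Lap t f g : smooth f -> smooth g -> periodicE f -> periodicE g ->
  I t (fun z => Lap f z * g z) = I t (fun z => f z * Lap g z).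
Proof.
move=> fs gs fp gp.
have fss i := smooth_D (dx R i) (smooth_D (dx R i) fs).
have gss i := smooth_D (dx R i) (smooth_D (dx R i) gs).
transitivity (\sum_i I t (fun z => 'D_(dx R i) ('D_(dx R i) f) z * g z)).
  rewrite -slice_int_sum => [|i]; last exact: smooth_mul.
  by apply: slice_int_eq => x; rewrite mulr_suml.
transitivity (\sum_i I t (fun z => f z * 'D_(dx R i) ('D_(dx R i) g) z)); last first.
  rewrite -slice_int_sum => [|i]; last exact: smooth_mul.
  by apply: slice_int_eq => x; rewrite mulr_sumr.
apply: eq_bigr => i _.
apply: (etrans (J_ibp t i (smooth_D (dx R i) fs) gs (periodicE_D (dx R i) fp) gp)).
have := J_ibp t i fs (smooth_D (dx R i) gs) fp (periodicE_D (dx R i) gp).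
by move=> ->; rewrite opprK.
Qed.

Lemma slice_int_div t f (b : 'I_d -> E -> R) : smooth f -> periodicE f ->
  (forall i, smooth (b i)) -> (forall i, periodicE (b i)) ->
  I t (fun z => f z * \sum_i 'D_(dx R i) (b i) z) = - I t (fun z => \sum_i b i z * 'D_(dx R i) f z).
Proof.
move=> fs fp bs bp.
transitivity (\sum_i I t (fun z => 'D_(dx R i) (b i) z * f z)).
  rewrite -slice_int_sum => [|i]; last by apply: smooth_mul => //; exact: smooth_D.
  by apply: slice_int_eq => x; rewrite mulr_sumr; apply: eq_bigr => i _; rewrite mulrC.
rewrite slice_int_sum => [|i]; last by apply: smooth_mul => //; exact: smooth_D.
rewrite -sumrN; apply: eq_bigr => i _; exact: J_ibp.
Qed.

Lemma derive_slice_eq f g v x t : v.2 = 0 -> (forall x, f (x, t) = g (x, t)) ->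
  'D_v f (x, t) = 'D_v g (x, t).
Proof.
move=> v0 fg; apply: derive_quot => h.
rewrite -[h *: v + (x, t)]/(h *: v.1 + x, h * v.2 + t) v0 mulr0 add0r; exact: fg.
Qed.

Lemma Lap_slice_eq f g x t : (forall x, f (x, t) = g (x, t)) -> Lap f (x, t) = Lap g (x, t).
Proof.
by move=> fg; apply: eq_bigr => i _; do 2 (apply: derive_slice_eq => // ?).
Qed.

Lemma smooth_lift (f : 'rV[R]_d -> R) : smooth f -> smooth (fun z : E => f z.1).
Proof.
move=> fs.
have Alin : linear (fun z : E => z.1) by [].
have Abd (z : E) : `|z.1| <= 1 * `|z| by rewrite mul1r; exact: norm_fst.
by have := smooth_affine 0 Alin Abd fs; under eq_fun do rewrite addr0.
Qed.

Lemma periodicE_lift (f : 'rV[R]_d -> R) : periodicT f -> periodicE (fun z : E => f z.1).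
Proof. by move=> fp z i; exact: fp. Qed.

Lemma int_Td_ibp (f g : 'rV[R]_d -> R) i : smooth f -> smooth g -> periodicT f -> periodicT g ->
  J (fun x => 'D_(e_ R i) f x * g x) = - J (fun x => f x * 'D_(e_ R i) g x).
Proof.
move=> fs gs fp gp; apply/eqP; rewrite -addr_eq0; apply/eqP.
have fgp : periodicT (fun x => f x * g x) by move=> x j; rewrite fp gp.
apply: (etrans _ (J_derive0 i (smooth_mul fs gs) fgp)).
have h1 := smooth_cont (smooth_mul (smooth_D (e_ R i) fs) gs).
have h2 := smooth_cont (smooth_mul fs (smooth_D (e_ R i) gs)).
apply: (etrans (esym (posint_add PJ h1 h2))).
apply: eq_int_Td => x; apply/esym/derive_val_eq.
by apply: is_derive_mul; exact: smooth_is_derive.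
Qed.

Lemma powR_add (v r s : R) : 0 < v -> v `^ (r + s) = v `^ r * v `^ s.
Proof. by move=> v0; rewrite powRD // lt0r_neq0 // implybT. Qed.

(** Either [v >= 1 / dl] and the first term suffices, or [v < 1 / dl] and the second does. The
    dependence on [dl] is explicit so that it can be balanced against the width of a kernel. *)
Lemma powR_young (v dl al : R) : 0 < v -> 0 < dl -> 0 <= al ->
  v `^ al <= dl * v `^ (al + 1) + dl `^ (- al).
Proof.
move=> v0 d0 a0.
have e1 : v `^ (al + 1) = v `^ al * v.
  by rewrite powR_add // powRr1 // ltW.
have [h|h] := lerP dl^-1 v.
  rewrite e1 mulrCA ler_wpDr ?powR_ge0 // ler_peMr ?powR_ge0 //.
  by rewrite -ler_pdivrMl // mulr1.
rewrite ler_wpDl ?mulr_ge0 ?powR_ge0 //; first exact: ltW.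
rewrite -[- al]mulN1r powRrM powR_inv1 ?(ltW d0) //.
by apply: ge0_ler_powR; rewrite ?nnegrE ?invr_ge0 // ltW.
Qed.
End SliceIntegrals.

(** * Energy estimates *)

Section Laplacians.
Variables (R : realType) (d : nat).
Local Notation E := ('rV[R]_d * R)%type.

Lemma Lap_add (f g : E -> R) z : smooth f -> smooth g ->
  Lap (fun z => f z + g z) z = Lap f z + Lap g z.
Proof.
move=> fs gs; rewrite /Lap -big_split; apply: eq_bigr => i _ /=.
have -> : 'D_(dx R i) (fun z => f z + g z) = fun z => 'D_(dx R i) f z + 'D_(dx R i) g z.
  by apply: derive_fun => y; apply: is_derive_add; exact: smooth_is_derive.
by apply: derive_val_eq; apply: is_derive_add; apply: smooth_is_derive; exact: smooth_D.
Qed.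

Lemma Lap_opp (f : E -> R) z : smooth f -> Lap (fun z => - f z) z = - Lap f z.
Proof.
move=> fs; rewrite /Lap -sumrN; apply: eq_bigr => i _ /=.
have -> : 'D_(dx R i) (fun z => - f z) = fun z => - 'D_(dx R i) f z.
  by apply: derive_fun => y; apply: is_derive_opp; exact: smooth_is_derive.
by apply: derive_val_eq; apply: is_derive_opp; apply: smooth_is_derive; exact: smooth_D.
Qed.

Lemma Lap_sub (f g : E -> R) z : smooth f -> smooth g ->
  Lap (fun z => f z - g z) z = Lap f z - Lap g z.
Proof. by move=> fs gs; rewrite (Lap_add z fs (smooth_opp gs)) Lap_opp. Qed.

Lemma Lap_const (c : R) z : Lap (fun _ : E => c) z = 0.
Proof.
rewrite /Lap big1 // => i _.
have -> : 'D_(dx R i) (fun _ : E => c) = fun=> 0 by apply: derive_fun => y; exact: is_derive_const.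
by apply: derive_val_eq; exact: is_derive_const.
Qed.
End Laplacians.

Section Energies.
Variables (R : realType) (d : nat).
Local Notation V := 'rV[R]_d.
Local Notation E := (V * R)%type.
Local Notation J := (@int_Td R d).
Local Notation I := (@slice_int R d).
Let PJ := @int_Td_posint R d.

Variables (H : V -> V -> R) (T al : R) (m0 uT : V -> R).
Hypotheses (T0 : 0 < T) (al0 : 0 < al).
Hypothesis Hs : smooth (fun z : (V * V)%type => H z.1 z.2).
Hypothesis Hp : forall p, periodicT (fun x => H x p).
(** [cL] and [CL] come from (A3), [Kx] from (A5). [C0] bounds [u] from below, [kap] and [Mm] enclose
    [m0], and [lam] makes [exp(lam t) m0] a supersolution of the heat equation. [Dm] and [Du] bound
    the Laplacians of the data, [U] the final value. *)
Variables (cL CL Kx C0 kap Mm lam Dm U Du : R).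
Hypotheses (cL0 : 0 < cL) (CL0 : 0 <= CL) (Kx0 : 0 <= Kx) (Mm0 : 0 <= Mm).
Hypothesis HL : forall x p, cL * H x p - CL <= Lhat H x p.
Hypothesis H1 : forall x p, 1 <= H x p.
Hypothesis Htr : forall x p (M : 'M[R]_d), M^T = M ->
  - Kx * H x p <= \tr (DxxH H x p) + 2 * \tr (DpxH H x p *m M) + \tr (DppH H x p *m (M *m M)).
Let m0E (z : E) := m0 z.1.
Let uTE (z : E) := uT z.1.
Hypotheses (m0s : smooth m0) (m0p : periodicT m0) (m0J : J m0 = 1).
Hypotheses (kap0 : 0 < kap) (m0k : forall x, kap <= m0 x) (m0M : forall x, m0 x <= Mm).
Hypotheses (lam0 : 0 <= lam) (m0lam : forall z, Lap m0E z <= lam * m0E z).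
Hypothesis m0D : forall z, `|Lap m0E z| <= Dm.
Hypotheses (uTU : forall x, `|uT x| <= U) (uTD : forall z, `|Lap uTE z| <= Du).
Hypothesis UC0 : U <= C0.

Variables (eta : V -> R) (eps : R) (u m : E -> R).
Hypotheses (etaP : mollifier eta) (eps0 : 0 < eps).
Local Notation S := (mconv eta eps).
Hypotheses (us : smooth u) (ms : smooth m) (up : periodicE u) (mp : periodicE m).
Let v := mconvE2 eta eps m.
(** The coupling is read off the equation of [u] instead of being defined by mollification: in this
    form it is smooth for all times, whereas the positivity of [v], hence the smoothness of its
    powers, is known on [[0, T]] only. *)
Definition coupling (z : E) := - Dt u z + Halong u H z - Lap u z.
Local Notation F := coupling.
Let b i (z : E) := drift u H i z * m z.
Hypothesis Feq : forall x t, 0 <= t <= T -> F (x, t) = S (fun y => v (y, t) `^ al) x.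
Hypothesis meq : forall x t, 0 <= t <= T ->
  Dt m (x, t) = Lap m (x, t) + \sum_i 'D_(dx R i) (b i) (x, t).
Hypothesis mpos : forall x t, 0 <= t <= T -> 0 < m (x, t).
Hypothesis vpos : forall x t, 0 <= t <= T -> 0 < v (x, t).
Hypothesis ulow : forall x t, 0 <= t <= T -> - C0 <= u (x, t).
Hypothesis m0E0 : forall x, m (x, 0) = m0 x.
Hypothesis uTET : forall x, u (x, T) = uT x.

Let vs : smooth v := smooth_mconvE2 etaP eps0 ms.
Let vp : periodicE v := periodicE_mconvE2 etaP eps0 mp.
Let Dts f : smooth f -> smooth (Dt f : E -> R). Proof. exact: smooth_D. Qed.
Let Dtp f : periodicE f -> periodicE (Dt f : E -> R). Proof. exact: periodicE_D. Qed.
Let Hzs : smooth (Halong u H) := smooth_Halong us Hs.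
Let Hzp : periodicE (Halong u H) := periodicE_Halong up Hp.
Let Fs : smooth F.
Proof. by apply: smooth_sub (smooth_Lap us); apply: smooth_add (smooth_opp (Dts us)) Hzs. Qed.
Let Fp : periodicE F.
Proof. by move=> z i; rewrite /F Hzp (Dtp up) (periodicE_Lap up). Qed.
Let ds i : smooth (drift u H i) := smooth_drift us Hs i.
Let bs i : smooth (b i). Proof. by apply: smooth_mul ms; exact: ds. Qed.
Let bp i : periodicE (b i). Proof. by apply: periodicE_mul mp; exact: periodicE_drift. Qed.
Let divb (z : E) := \sum_i 'D_(dx R i) (b i) z.
Let divbs : smooth divb. Proof. by apply: smooth_sum => i; exact: smooth_D. Qed.
Let ws t : smooth (fun x => v (x, t)). Proof. exact: smooth_slicel. Qed.
Let wp t : periodicT (fun x => v (x, t)). Proof. exact: periodicE_slice. Qed.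
Let was t c : 0 <= t <= T -> smooth (fun x => v (x, t) `^ c).
Proof. by move=> tT; apply: smooth_powR => // x; exact: vpos. Qed.
Let wap t c : periodicT (fun x => v (x, t) `^ c).
Proof. by move=> x i; rewrite (wp t x i). Qed.

Definition vpow c t := J (fun x => v (x, t) `^ c).
Definition vgrad t :=
  J (fun x => v (x, t) `^ (al - 1) * \sum_i 'D_(dx R i) v (x, t) ^+ 2).

Lemma coupling_adjoint t h : 0 <= t <= T -> smooth h -> periodicE h ->
  I t (fun z => F z * h z) = J (fun x => mconvE2 eta eps h (x, t) * v (x, t) `^ al).
Proof.
move=> tT hs hp.
transitivity (J (fun x => h (x, t) * S (fun y => v (y, t) `^ al) x)).
  by apply: eq_int_Td => x; rewrite Feq // mulrC.
rewrite (mconv_adjoint etaP eps0 (was al tT) (smooth_slicel t hs) (@wap t al)) //.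
exact: periodicE_slice.
Qed.

Lemma coupling_mass t : 0 <= t <= T -> I t (fun z => F z * m z) = vpow (al + 1) t.
Proof.
move=> tT; rewrite coupling_adjoint //; apply: eq_int_Td => x.
rewrite powR_add ?vpos // powRr1; first by rewrite mulrC.
by rewrite ltW // vpos.
Qed.

Lemma coupling_int t : 0 <= t <= T -> I t F = vpow al t.
Proof.
move=> tT; apply: (etrans _ (int_mconv1 etaP eps0 (was al tT) (@wap t al))).
by apply: eq_int_Td => x; rewrite Feq.
Qed.

Lemma coupling_ge0 x t : 0 <= t <= T -> 0 <= F (x, t).
Proof.
move=> tT; rewrite Feq //; apply: (mconv_ge etaP eps0); first exact: smooth_cont (was al tT).
by move=> y; exact: powR_ge0.
Qed.

(** Mollifying [Lap m] gives [Lap v], and one integration by parts against [v^al] leaves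
    [- al v^(al-1) |Dv|^2]. This is the source of the gradient part of the dissipation. *)
Lemma coupling_Lap t : 0 <= t <= T -> I t (fun z => F z * Lap m z) = - al * vgrad t.
Proof.
move=> tT; rewrite (coupling_adjoint tT (smooth_Lap ms) (periodicE_Lap mp)).
transitivity (\sum_i J (fun x => 'D_(e_ R i) (fun y => 'D_(dx R i) v (y, t)) x * v (x, t) `^ al)).
  rewrite -(posint_sum PJ) => [|i]; last first.
    apply: continuous_mul; last exact: smooth_cont (was al tT).
    exact: smooth_cont (smooth_D (e_ R i) (smooth_slicel t (smooth_D (dx R i) vs))).
  apply: eq_int_Td => x; rewrite -Lap_mconvE2 // -/v mulr_suml; apply: eq_bigr => i _.
  by rewrite -derive_slicel.
rewrite /vgrad -(posint_scale PJ); last first.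
  apply: continuous_mul; first exact: smooth_cont (was (al - 1) tT).
  apply: continuous_sum => i; under eq_fun do rewrite expr2.
  by apply: continuous_mul; exact: slice_D.
transitivity (J (fun x => \sum_i - ('D_(dx R i) v (x, t) * (al * v (x, t) `^ (al - 1) * 'D_(dx R i) v (x, t))))).
  rewrite (posint_sum PJ) => [|i]; last first.
    apply/continuous_opp/continuous_mul; first exact: slice_D.
    apply: continuous_mul; last exact: slice_D.
    by apply: continuous_mul; [exact: continuous_const|exact: smooth_cont (was (al - 1) tT)].
  apply: eq_bigr => i _.
  have D1p : periodicT (fun y => 'D_(dx R i) v (y, t)).
    exact: (periodicE_slice t (periodicE_D (dx R i) vp)).
  have D1s : smooth (fun y => 'D_(dx R i) v (y, t)).
    exact: (smooth_slicel t (smooth_D (dx R i) vs)).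
  rewrite (int_Td_ibp i D1s (was al tT) D1p (@wap t al)) (posint_opp PJ); last first.
    apply: continuous_mul; first exact: slice_D.
    apply: continuous_mul; last exact: slice_D.
    by apply: continuous_mul; [exact: continuous_const|exact: smooth_cont (was (al - 1) tT)].
  congr (- _); apply: eq_int_Td => x; congr (_ * _).
  rewrite (derive_val_eq (is_derive_powRf al (e_ R i) (ws t) (vpos x tT))).
  by rewrite derive_slicel.
apply: eq_int_Td => x; rewrite sumrN mulNr; congr (- _).
by rewrite !mulr_sumr; apply: eq_bigr => i _; rewrite expr2; ring.
Qed.

Lemma mass_one t : 0 <= t <= T -> I t m = 1.
Proof.
move=> /andP[t0 tT].
have E0 : I 0 m = 1 by rewrite -m0J; apply: eq_int_Td => x; exact: m0E0.
have D (s : R) : 0 <= s <= t -> is_derive s 1 (fun s => I s m) 0.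
  move=> /andP[s0 st]; apply: is_derive_fun (slice_int_dt s ms) _ _ => //.
  have sT : 0 <= s <= T by rewrite s0 (le_trans st).
  have -> : I s (Dt m) = I s (fun z => Lap m z * 1 + 1 * divb z).
    by apply: slice_int_eq => x; rewrite meq // mulr1 mul1r.
  have c1 : smooth (fun _ : E => 1 : R) := @smooth_const R E 1.
  have p1 : periodicE (fun _ : E => 1 : R) by [].
  have D1 i z : 'D_(dx R i) (fun _ : E => 1 : R) z = 0.
    by apply: derive_val_eq; exact: is_derive_const.
  rewrite slice_intD; last 2 first.
  - by apply: smooth_mul => //; exact: smooth_Lap.
  - exact: smooth_mul.
  rewrite slice_int_Lap // (@slice_int_div R d s (fun=> 1) b c1 p1 bs bp).
  rewrite (slice_int_eq (g := fun=> 0)) => [|x]; last first.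
    rewrite /Lap big1 ?mulr0 // => i _.
    have -> : 'D_(dx R i) (fun _ : E => 1 : R) = fun=> 0 by apply/funext => y; exact: D1.
    by apply: derive_val_eq; exact: is_derive_const.
  rewrite slice_int_const (slice_int_eq (g := fun=> 0)) => [|x]; last first.
    by rewrite big1 // => i _; rewrite D1 mulr0.
  by rewrite slice_int_const oppr0 addr0.
have [c _ h] := mean_value t0 D.
by apply/eqP; rewrite -subr_eq0 -E0; apply/eqP; rewrite h mul0r.
Qed.

(** Integration by parts moves the operator of the density equation onto [f], where it becomes the
    adjoint, that is the linearised equation of [u]. *)
Lemma pairing_derive f t : 0 <= t <= T -> smooth f -> periodicE f ->
  is_derive t 1 (fun t => I t (fun z => f z * m z))
    (I t (fun z => (Dt f z + Lap f z - \sum_i drift u H i z * 'D_(dx R i) f z) * m z)).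
Proof.
move=> tT fs fp.
apply: is_derive_fun (slice_int_dt t (smooth_mul fs ms)) _ _ => //.
pose G0 (z : E) := \sum_i b i z * 'D_(dx R i) f z.
have G0s : smooth G0 by apply: smooth_sum => i; apply: smooth_mul => //; exact: smooth_D.
have Lfs := smooth_Lap fs; have Lms := smooth_Lap ms; have Dfs := Dts fs.
have M1 : smooth (fun z => Dt f z * m z) by exact: smooth_mul.
have M2 : smooth (fun z => f z * Lap m z) by exact: smooth_mul.
have M3 : smooth (fun z => f z * divb z) by exact: smooth_mul.
have M4 : smooth (fun z => Lap f z * m z) by exact: smooth_mul.
transitivity (I t (fun z => Dt f z * m z + (f z * Lap m z + f z * divb z))).
  apply: slice_int_eq => x; rewrite -mulrDr.
  have -> : Lap m (x, t) + divb (x, t) = Dt m (x, t) by rewrite meq.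
  by apply: derive_val_eq; apply: is_derive_mul; exact: smooth_is_derive.
transitivity (I t (fun z => Dt f z * m z + (Lap f z * m z - G0 z))); last first.
  apply: slice_int_eq => x; rewrite addrA mulrBl -mulrDl; congr (_ - _).
  by rewrite mulr_suml; apply: eq_bigr => i _; rewrite /b mulrAC.
rewrite (slice_intD t M1 (smooth_add M2 M3)) (slice_intD t M2 M3).
rewrite (slice_intD t M1 (smooth_sub M4 G0s)) (slice_intB t M4 G0s).
congr (_ + (_ + _)); first by rewrite slice_int_Lap.
exact: (@slice_int_div R d t f b fs fp bs bp).
Qed.

Let DtuE z : Dt u z = Halong u H z - Lap u z - F z.
Proof. by rewrite /F; ring. Qed.

Let Lh (z : E) := \sum_i drift u H i z * 'D_(dx R i) u z - Halong u H z.
Let Lhs : smooth Lh.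
Proof.
apply: smooth_sub => //; apply: smooth_sum => i; apply: smooth_mul; [exact: ds|exact: smooth_D].
Qed.

(** For [f = u] the adjoint operator gives [- Lhat - F], so that the pairing decreases at the rate
    of the coupling energy plus the Lagrangian cost. *)
Lemma energy1 t : 0 <= t <= T ->
  is_derive t 1 (fun t => - I t (fun z => u z * m z)) (vpow (al + 1) t + I t (fun z => Lh z * m z)).
Proof.
move=> tT; apply: is_derive_fun (is_derive_opp (pairing_derive tT us up)) _ _ => //.
have M1 : smooth (fun z => F z * m z) by exact: smooth_mul.
have M2 : smooth (fun z => Lh z * m z) by exact: smooth_mul.
rewrite -coupling_mass // -(slice_intD t M1 M2) -slice_intN.
  by apply: slice_int_eq => x; rewrite DtuE /Lh; ring.
apply: smooth_mul => //; apply: smooth_sub.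
  by apply: smooth_add (smooth_Lap us); exact: Dts.
by apply: smooth_sum => i; apply: smooth_mul; [exact: ds|exact: smooth_D].
Qed.

Let Hm t := I t (fun z => Halong u H z * m z).

Lemma energy1_ge t : 0 <= t <= T -> cL * Hm t - CL <= I t (fun z => Lh z * m z).
Proof.
move=> tT; rewrite -{1}[CL]mulr1 -(mass_one tT) -!slice_intZ //; last exact: smooth_mul.
rewrite -slice_intB; last 2 first.
- by apply: smooth_mul; [exact: smooth_const|exact: smooth_mul].
- by apply: smooth_mul => //; exact: smooth_const.
apply: slice_int_le => [||x].
- apply: smooth_sub; last by apply: smooth_mul => //; exact: smooth_const.
  by apply: smooth_mul; [exact: smooth_const|exact: smooth_mul].
- exact: smooth_mul.
rewrite mulrA -mulrBl ler_pM2r ?mpos //.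
apply: le_trans (HL x (Dx u (x, t))) _; rewrite /Lhat lerD2r.
by apply: ler_sum => i _; rewrite [Dx u _ _ _]mxE.
Qed.

(** Applied to [Lap u], the adjoint operator returns the combination of traces minus [Lap F]. Moving
    the Laplacian from [F] to [m] produces [al] times the gradient dissipation, and the traces cost
    at most [Kx] times the mean of the Hamiltonian. *)
Lemma energy4 t : 0 <= t <= T -> exists2 D,
  is_derive t 1 (fun t => I t (fun z => Lap u z * m z)) D & - Kx * Hm t + al * vgrad t <= D.
Proof.
move=> tT; have Lus := smooth_Lap us; have Lup := periodicE_Lap up.
eexists; first exact: (pairing_derive tT Lus Lup).
pose X (z : E) := Lap (Halong u H) z - \sum_i drift u H i z * 'D_(dx R i) (Lap u) z.
have Xs : smooth X.
  apply: smooth_sub; first exact: smooth_Lap.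
  by apply: smooth_sum => i; apply: smooth_mul; [exact: ds|exact: smooth_D].
have DL z : Dt (Lap u) z + Lap (Lap u) z = Lap (Halong u H) z - Lap F z.
  have -> : Dt (Lap u) z = Lap (Dt u) z by exact: (derive_Lap us).
  have fin (a a' c l1 l2 l3 : R) : l1 = l2 - a' -> l2 = l3 + c -> l3 = - a -> a + a' = c - l1.
    by move=> -> -> ->; ring.
  exact: (fin _ _ _ _ _ _ (Lap_sub z (smooth_add (smooth_opp (Dts us)) Hzs) Lus)
    (Lap_add z (smooth_opp (Dts us)) Hzs) (Lap_opp z (Dts us))).
have M1 : smooth (fun z => X z * m z) by exact: smooth_mul.
have M2 : smooth (fun z => Lap F z * m z) := smooth_mul (smooth_Lap Fs) ms.
have M3 : smooth (fun z => Halong u H z * m z) by exact: smooth_mul.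
rewrite (slice_int_eq (g := fun z => X z * m z - Lap F z * m z)) => [|x]; last first.
  have fin (a a' c l s k : R) : a + a' = c - l -> (a + a' - s) * k = (c - s) * k - l * k.
    by move=> ->; ring.
  exact: (fin _ _ _ _ _ _ (DL (x, t))).
rewrite (slice_intB t M1 M2) (slice_int_Lap t Fs ms Fp mp) (coupling_Lap tT).
rewrite [- al * _]mulNr opprK lerD2r.
rewrite -slice_intZ //; apply: slice_int_le => [||x] //.
  by apply: smooth_mul => //; exact: smooth_const.
rewrite mulrA ler_pM2r ?mpos // /X Lap_Halong //.
exact: Htr (hess_sym us _).
Qed.

Let m0Es : smooth m0E := smooth_lift m0s.
Let m0Ep : periodicE m0E := periodicE_lift m0p.
Let uC (z : E) := u z + C0.
Let uCs : smooth uC. Proof. by apply: smooth_add => //; exact: smooth_const. Qed.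
Let uCp : periodicE uC. Proof. by move=> z i; rewrite /uC up. Qed.
Let m0E_ge0 z : 0 <= m0E z. Proof. by rewrite (le_trans (ltW kap0)) // m0k. Qed.
Let K2 := expR (lam * T) * Mm.

Lemma vpow_ge0 c t : 0 <= t <= T -> 0 <= vpow c t.
Proof.
by move=> tT; apply: (posint_ge0 PJ) => [|x _]; [exact: smooth_cont (was c tT)|exact: powR_ge0].
Qed.

Lemma vpow_young dl t : 0 <= t <= T -> 0 < dl ->
  vpow al t <= dl * vpow (al + 1) t + dl `^ (- al).
Proof.
move=> tT dl0; rewrite -[X in _ + X](J_const _ d).
have c1 := smooth_cont (was (al + 1) tT).
have c2 : continuous (fun x : V => dl * v (x, t) `^ (al + 1)).
  by apply: continuous_mul => //; exact: continuous_const.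
rewrite /vpow -(posint_scale PJ dl c1) -(posint_add PJ c2); last exact: continuous_const.
apply: (posint_le PJ) => [||x _]; first exact: smooth_cont (was al tT).
  by apply: continuous_add => //; exact: continuous_const.
by apply: powR_young => //; [exact: vpos|exact: ltW].
Qed.

Let is_derive_expl (t : R) : is_derive t 1 (fun t : R => expR (lam * t)) (expR (lam * t) * lam).
Proof.
apply: is_derive_fun (is_derive_compR (is_derive_expR _)
  (is_derive_lmul lam (is_derive_idR t))) _ _ => //; by rewrite mulr1.
Qed.

(** The factor [exp(lam t)] absorbs the term with [Lap m0], because [u + C0 >= 0] and
    [Lap m0 <= lam m0]. Only the coupling remains as a loss, with a lower power of [v] than in the
    dissipation. *)
Lemma energy2 t : 0 <= t <= T -> exists2 D,
  is_derive t 1 (fun t => expR (lam * t) * I t (fun z => uC z * m0E z)) D & - K2 * vpow al t <= D.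
Proof.
move=> tT; have Lus := smooth_Lap us.
have S1 : smooth (fun z => uC z * m0E z) by exact: smooth_mul.
have := is_derive_mul (is_derive_expl t) (slice_int_dt t S1).
set D := (X in is_derive _ _ _ X) => DD; exists D => //.
have S2 : smooth (fun z => uC z * Lap m0E z) := smooth_mul uCs (smooth_Lap m0Es).
have S3 : smooth (fun z => Halong u H z * m0E z) by exact: smooth_mul.
have S4 : smooth (fun z => F z * m0E z) by exact: smooth_mul.
have S5 : smooth (fun z => Lap u z * m0E z) by exact: smooth_mul.
have E1 : I t (Dt (fun z => uC z * m0E z)) =
    I t (fun z => Halong u H z * m0E z) - I t (fun z => uC z * Lap m0E z) - I t (fun z => F z * m0E z).
  rewrite -(slice_int_Lap t uCs m0Es uCp m0Ep).
  rewrite (slice_int_eq (f := fun z => Lap uC z * m0E z) (g := fun z => Lap u z * m0E z)) => [|x]; last first.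
    by rewrite (Lap_add _ us (@smooth_const R E C0)) Lap_const addr0.
  rewrite -(slice_intB t S3 S5) -(slice_intB t (smooth_sub S3 S5) S4).
  apply: slice_int_eq => x; rewrite -2!mulrBl -DtuE.
  have D0 : is_derive (x, t) (dt R d) m0E 0.
    apply: is_derive_along; apply: is_derive_fun (is_derive_const (m0 x) _ _) _ _ => // s.
    by rewrite /m0E -[(_ + _).1]/(x + s *: 0) scaler0 addr0.
  have D1 := is_derive_add (smooth_is_derive (x, t) (dt R d) us) (is_derive_const C0 (x, t) (dt R d)).
  rewrite -[LHS]/('D_(dt R d) (fun z => uC z * m0E z) (x, t)).
  by rewrite (derive_val_eq (is_derive_mul D1 D0)) mulr0 !addr0.
have B1 : I t (fun z => uC z * Lap m0E z) <= lam * I t (fun z => uC z * m0E z).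
  rewrite -slice_intZ //; apply: slice_int_le => // [|x].
    by apply: smooth_mul => //; exact: smooth_const.
  rewrite mulrCA ler_wpM2l ?m0lam //.
  by have := ulow x tT; rewrite /uC -subr_ge0 opprK.
have B2 : 0 <= I t (fun z => Halong u H z * m0E z).
  by apply: slice_int_ge0 => // x; rewrite mulr_ge0 // (le_trans ler01) // H1.
have B3 : I t (fun z => F z * m0E z) <= Mm * vpow al t.
  rewrite -coupling_int // -slice_intZ //; apply: slice_int_le => // [|x].
    by apply: smooth_mul => //; exact: smooth_const.
  by rewrite mulrC ler_wpM2r ?coupling_ge0 // m0M.
have e1 : expR (lam * t) <= expR (lam * T).
  by case/andP: tT => _ tT; rewrite ler_expR ler_wpM2l.
rewrite /D E1 -mulrA -mulrDr /K2.
apply: (@le_trans _ _ (expR (lam * t) * (- (Mm * vpow al t)))).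
  rewrite mulrN mulNr lerN2 -mulrA ler_wpM2r // mulr_ge0 // vpow_ge0 //.
rewrite ler_wpM2l ?expR_ge0 //; lra.
Qed.

(** Chosen with [K2 dl <= 1/2], so that by Young's inequality half of the term in [v^(al+1)] absorbs
    the loss of [energy2]. *)
Let dl := (2 * (K2 + 1))^-1.
Let C3 := CL + K2 * dl `^ (- al).
Let AT := U + expR (lam * T) * (U + C0).
Definition energy_Ku := (2 * AT + 3 * (C3 * T)) / kap.
(** Large enough to pay for the factor [1/2] left on [v^(al+1)] and for the mean Hamiltonian lost in
    [energy4], whose coefficient becomes [Kx / al]. *)
Let K1 := 2 + Kx / (al * cL).
Definition energy_KP := K1 * (AT + C3 * T) + (Du + Dm * energy_Ku) / al.

Let K2_ge0 : 0 <= K2. Proof. by rewrite mulr_ge0 ?expR_ge0. Qed.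
Let dl_gt0 : 0 < dl. Proof. by rewrite invr_gt0 mulr_gt0 // ltr_wpDl. Qed.
Let K2dl : K2 * dl <= 2^-1.
Proof.
rewrite /dl invfM mulrCA ler_piMr ?invr_ge0 //.
by rewrite ler_pdivrMr ?mul1r ?lerDl // ltr_wpDl.
Qed.
Let C3_ge0 : 0 <= C3. Proof. by rewrite addr_ge0 // mulr_ge0 // powR_ge0. Qed.
Let U_ge0 : 0 <= U. Proof. exact: le_trans (normr_ge0 _) (uTU 0). Qed.

(** At time [0] the unknown values of [u] cancel, since [m = m0], and [A 0 = C0]; at time [T] the
    values of [u] are the final data. Hence the total increase of [A] is bounded by the data. *)
Let A t := - I t (fun z => u z * m z) + expR (lam * t) * I t (fun z => uC z * m0E z).

Let K2vpow t : 0 <= t <= T -> K2 * vpow al t <= vpow (al + 1) t / 2 + K2 * dl `^ (- al).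
Proof.
move=> tT; apply: le_trans (ler_wpM2l K2_ge0 (vpow_young tT dl_gt0)) _.
rewrite mulrDr lerD2r mulrA mulrC ler_wpM2l //; exact: vpow_ge0.
Qed.

Let energyA t : 0 <= t <= T -> exists2 D, is_derive t 1 A D &
  vpow (al + 1) t / 2 + cL * Hm t - C3 <= D.
Proof.
move=> tT; have [D2 DD2 B2] := energy2 tT.
exists (vpow (al + 1) t + I t (fun z => Lh z * m z) + D2).
  exact: (is_derive_add (energy1 tT) DD2).
have B1 := energy1_ge tT.
have B3 := K2vpow tT.
move: B1 B2 B3; rewrite /C3 mulNr; move: (K2 * _) (K2 * _) (cL * _) (I t _) => a1 a2 a3 a4.
move: (vpow _ t) => a5; lra.
Qed.

Let Hm_ge0 t : 0 <= t <= T -> 0 <= Hm t.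
Proof.
move=> tT; apply: slice_int_ge0 => [|x]; first exact: smooth_mul.
by apply: mulr_ge0; [rewrite (le_trans ler01) // H1|rewrite ltW ?mpos].
Qed.

Let T0T : 0 <= T <= T. Proof. by rewrite lexx ltW. Qed.
Let T00 : 0 <= (0 : R) <= T. Proof. by rewrite lexx ltW. Qed.

Let A2T : expR (lam * T) * I T (fun z => uC z * m0E z) <= expR (lam * T) * (U + C0).
Proof.
rewrite ler_wpM2l ?expR_ge0 //.
have <- : I T (fun z => (U + C0) * m0E z) = U + C0.
  by rewrite slice_intZ // -[RHS]mulr1 -m0J.
apply: slice_int_le => [||x]; first exact: smooth_mul.
  by apply: smooth_mul => //; exact: smooth_const.
rewrite ler_wpM2r // /uC uTET lerD2r.
by have := uTU x; rewrite ler_norml => /andP[].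
Qed.

Let AT_ge : A T <= AT.
Proof.
rewrite /A lerD ?A2T // lerNl -[- U]mulr1 -(mass_one T0T) -slice_intZ //.
apply: slice_int_le => [||x]; last 1 first.
- rewrite ler_pM2r ?mpos // uTET.
  by have := uTU x; rewrite ler_norml => /andP[].
- by apply: smooth_mul => //; exact: smooth_const.
- exact: smooth_mul.
Qed.

Let A0 : A 0 = C0.
Proof.
rewrite /A mulr0 expR0 mul1r -[RHS]mulr1 -m0J.
have -> : C0 * J m0 = I 0 (fun z => C0 * m0E z) by rewrite slice_intZ.
have S1 : smooth (fun z => u z * m z) by exact: smooth_mul.
have S2 : smooth (fun z => uC z * m0E z) by exact: smooth_mul.
rewrite -(slice_intN 0 S1) -(slice_intD 0 (smooth_opp S1) S2).
by apply: slice_int_eq => x; rewrite m0E0 /uC /m0E /=; ring.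
Qed.

Let energyA_ge t : 0 <= t <= T -> C0 - C3 * T <= A t.
Proof.
move=> /andP[t0 tT].
have D (s : R) : 0 <= s <= t -> is_derive s 1 (fun s => A s + C3 * s) ('D_1 A s + C3).
  move=> /andP[s0 st]; have sT : 0 <= s <= T by rewrite s0 (le_trans st).
  have [D DD _] := energyA sT.
  apply: is_derive_fun (is_derive_add DD (is_derive_lmul C3 (is_derive_idR s))) _ _ => //.
  by rewrite mulr1 (derive_val_eq DD).
have := ndecr_deriv t0 D; rewrite A0 mulr0 addr0 => h.
have h1 : C3 * t <= C3 * T by rewrite ler_wpM2l.
suff : C0 <= A t + C3 * t by move: h1; lra.
apply: h => s /andP[s0 st]; have sT : 0 <= s <= T by rewrite s0 (le_trans st).
have [D' DD BD] := energyA sT; rewrite (derive_val_eq DD).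
have h2 := Hm_ge0 sT.
have h3 := vpow_ge0 (al + 1) sT.
have h4 : 0 <= cL * Hm s by rewrite mulr_ge0 // ltW.
move: h3 h4 BD; move: (vpow _ s) (cL * _) => a1 a2; lra.
Qed.

(** The second part of [A] is added to [A] once more; the sum is nondecreasing up to a linear term
    and known at [T]. As [A t] is bounded below, this bounds the integral of [u + C0] against [m0],
    and [m0 >= kap]. *)
Lemma int_u_bound t : 0 <= t <= T -> I t uC <= energy_Ku.
Proof.
move=> tTT; case/andP: (tTT) => t0 tT.
pose A2 t := expR (lam * t) * I t (fun z => uC z * m0E z).
have D (s : R) : t <= s <= T ->
    is_derive s 1 (fun s => (A s + A2 s) + (2 * C3) * s) ('D_1 A s + 'D_1 A2 s + 2 * C3).
  move=> /andP[s0 st]; have sT : 0 <= s <= T by rewrite st (le_trans t0).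
  have [D DD _] := energyA sT; have [D' DD' _] := energy2 sT.
  have := is_derive_add (is_derive_add DD DD') (is_derive_lmul (2 * C3) (is_derive_idR s)).
  by move=> h; apply: is_derive_fun h _ _ => //; rewrite mulr1 (derive_val_eq DD) (derive_val_eq DD').
have h1 : (A t + A2 t) + 2 * C3 * t <= (A T + A2 T) + 2 * C3 * T.
  apply: (ndecr_deriv tT D) => s /andP[s0 st]; have sT : 0 <= s <= T by rewrite st (le_trans t0).
  have [D1 DD BD] := energyA sT; have [D2 DD' BD'] := energy2 sT.
  rewrite (derive_val_eq DD) (derive_val_eq DD').
  have B3 := K2vpow sT.
  have h4 : 0 <= cL * Hm s.
    rewrite mulr_ge0 //; first exact: ltW.
    exact: Hm_ge0.
  have h5 : K2 * dl `^ (- al) <= C3 by rewrite /C3 lerDr.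
  move: BD BD' B3 h4 h5; rewrite mulNr.
  by move: (vpow _ s) (cL * _) (K2 * _) (K2 * _) C3_ge0 => a1 a2 a3 a4; lra.
have h2 := energyA_ge tTT.
have h3 : kap * I t uC <= A2 t.
  have g1 : kap * I t uC <= I t (fun z => uC z * m0E z).
    rewrite -slice_intZ //; apply: slice_int_le => [||x]; last 1 first.
    - rewrite mulrC ler_wpM2l // ?m0k //.
      by have := ulow x tTT; rewrite /uC -subr_ge0 opprK.
    - by apply: smooth_mul => //; exact: smooth_const.
    - exact: smooth_mul.
  have g2 : 0 <= I t (fun z => uC z * m0E z).
    apply: slice_int_ge0 => [|x]; first exact: smooth_mul.
    rewrite mulr_ge0 //; have := ulow x tTT; by rewrite /uC -subr_ge0 opprK.
  apply: le_trans g1 _; rewrite /A2 ler_peMl // -expR0 ler_expR mulr_ge0 //.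
have h4 : A2 T <= AT by rewrite (le_trans A2T) // lerDr.
have h5 : 0 <= 2 * C3 * t by rewrite !mulr_ge0.
have h6 := AT_ge; have h7 := le_trans U_ge0 UC0.
rewrite /energy_Ku ler_pdivlMr // mulrC.
move: h1 h2 h3 h4 h5 h6 h7; rewrite -(mulrA 2 C3 T).
move: (A t) (A T) (A2 t) (A2 T) (C3 * T) (kap * _) (2 * _ * t) => a1 a2 a3 a4 a5 a6 a7; lra.
Qed.

(** The integral of [Lap u] against [m] is controlled at [T] by the final data. At [0], where
    [m = m0], the Laplacian is moved to [m0] and the bound on the mean of [u] applies. *)
Lemma energy_bound : exists P Pd : R -> R,
  [/\ forall t : R, 0 <= t <= T -> is_derive t 1 P (Pd t),
      forall t, 0 <= t <= T -> vpow (al + 1) t + vgrad t <= Pd t &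
      P T - P 0 <= energy_KP].
Proof.
pose A4 t := I t (fun z => Lap u z * m z).
pose P t := K1 * A t + al^-1 * A4 t + (K1 * C3) * t.
have K1_ge : 2 <= K1.
  by rewrite lerDl divr_ge0 // mulr_ge0 // ltW.
exists P, (fun t => K1 * 'D_1 A t + al^-1 * 'D_1 A4 t + K1 * C3); split.
- move=> t tT; have [D1 DD1 _] := energyA tT; have [D4 DD4 _] := energy4 tT.
  have h := is_derive_add (is_derive_add (is_derive_lmul K1 DD1) (is_derive_lmul al^-1 DD4))
    (is_derive_lmul (K1 * C3) (is_derive_idR t)).
  by apply: is_derive_fun h _ _ => //; rewrite mulr1 (derive_val_eq DD1) (derive_val_eq DD4).
- move=> t tT; have [D1 DD1 B1] := energyA tT; have [D4 DD4 B4] := energy4 tT.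
  rewrite (derive_val_eq DD1) (derive_val_eq DD4).
  have h2 := Hm_ge0 tT.
  have h3 := vpow_ge0 (al + 1) tT.
  have b1 : K1 * (vpow (al + 1) t / 2 + cL * Hm t - C3) <= K1 * D1.
    by rewrite ler_wpM2l // (le_trans _ K1_ge).
  have b4 : al^-1 * (- Kx * Hm t + al * vgrad t) <= al^-1 * D4.
    by rewrite ler_wpM2l // invr_ge0 ltW.
  have e4 : al^-1 * (- Kx * Hm t + al * vgrad t) = vgrad t - (Kx / al) * Hm t.
    by field; rewrite gt_eqF.
  have b5 : Kx / al <= K1 * cL.
    rewrite /K1 mulrDl; apply: ler_wpDl; first by rewrite mulr_ge0 // ltW.
    by rewrite invfM !mulrA divfK // gt_eqF.
  have b6 : (Kx / al) * Hm t <= K1 * cL * Hm t by rewrite ler_wpM2r.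
  have b7 : 2 * vpow (al + 1) t <= K1 * vpow (al + 1) t by rewrite ler_wpM2r.
  move: b1 b4; rewrite e4 => b1 b4.
  have e1 : K1 * (vpow (al + 1) t / 2 + cL * Hm t - C3) =
    (K1 * vpow (al + 1) t) / 2 + K1 * cL * Hm t - K1 * C3 by field.
  move: b1 b4 b6 b7; rewrite e1.
  lra.
- have K1p : 0 <= K1 by rewrite (le_trans _ K1_ge).
  have b1 : K1 * A T <= K1 * AT by rewrite ler_wpM2l // AT_ge.
  have b2 : 0 <= K1 * A 0 by rewrite A0 mulr_ge0 // (le_trans U_ge0).
  have b3 : A4 T <= Du.
    rewrite -[Du]mulr1 -(mass_one T0T) -slice_intZ //; apply: slice_int_le => [||x]; last 1 first.
    - rewrite ler_pM2r ?mpos // (Lap_slice_eq (g := uTE)) => [|y]; last exact: uTET.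
      exact: le_trans (ler_norm _) (uTD _).
    - exact: smooth_mul (smooth_Lap us) ms.
    - by apply: smooth_mul => //; exact: smooth_const.
  have b4 : - A4 0 <= Dm * energy_Ku.
    have Dm0 : 0 <= Dm := le_trans (normr_ge0 _) (m0D 0).
    apply: le_trans (ler_wpM2l Dm0 (int_u_bound T00)).
    have -> : A4 0 = I 0 (fun z => uC z * Lap m0E z).
      rewrite -(slice_int_Lap 0 uCs m0Es uCp m0Ep); apply: slice_int_eq => x.
      by rewrite m0E0 (Lap_add _ us (@smooth_const R E C0)) Lap_const addr0.
    have S1 : smooth (fun z => uC z * Lap m0E z) := smooth_mul uCs (smooth_Lap m0Es).
    rewrite -slice_intZ // -(slice_intN 0 S1); apply: slice_int_le => [||x].
    - exact: smooth_opp.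
    - by apply: smooth_mul => //; exact: smooth_const.
    - rewrite -mulrN mulrC ler_wpM2r //.
        by have := ulow x T00; rewrite /uC -subr_ge0 opprK.
      by rewrite (le_trans (ler_norm _)) // normrN m0D.
  have b5 : al^-1 * (A4 T - A4 0) <= (Du + Dm * energy_Ku) / al.
    rewrite mulrC ler_wpM2r ?invr_ge0 ?lerD //; exact: ltW.
  rewrite /P /energy_KP mulr0 addr0 (mulrDr K1 AT) mulrA.
  move: b1 b2 b5; rewrite (mulrBr al^-1).
  move: (K1 * A T) (K1 * AT) (K1 * A 0) (al^-1 * _) (al^-1 * _) (_ / al) (K1 * C3 * T).
  by move=> a1 a2 a3 a4 a5 a6 a7; lra.
Qed.
End Energies.

(** * A Gaussian kernel on the torus *)

Section OneDimensional.
Variable R : realType.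
Variable b : R.
Hypothesis b1 : 1 <= b.
Let b0 : 0 < b := lt_le_trans ltr01 b1.
Let w (z : R) := b * cos (pi * z).

Let wD (z : R) : is_derive z 1 w (- (b * (pi * sin (pi * z)))).
Proof.
apply: is_derive_fun (is_derive_lmul b (is_derive_compR (is_derive_cos _)
  (is_derive_lmul pi (is_derive_idR z)))) _ _ => //; ring.
Qed.

Let wc : continuous w.
Proof. by move=> z; apply: is_derive_continuous (wD z). Qed.

Let w1 : w 1 = - b. Proof. by rewrite /w mulr1 cospi mulrN1. Qed.
Let w0 : w 0 = b. Proof. by rewrite /w mulr0 cos0 mulr1. Qed.

Let sin_ge0 z : 0 <= z <= 1 -> 0 <= sin (pi * z) :> R.
Proof.
move=> /andP[z0 z1]; apply: sin_ge0_pi; rewrite mulr_ge0 ?pi_ge0 //=.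
by rewrite ler_piMr // pi_ge0.
Qed.

Let onew (x : R) : 0 < 1 + x ^+ 2. Proof. by rewrite ltr_pwDl // sqr_ge0. Qed.

Let sqD (g : R -> R) (z dg : R) : is_derive z 1 g dg ->
  is_derive z 1 (fun z => 1 + g z ^+ 2) (2 * g z * dg).
Proof.
move=> gD; apply: is_derive_fun (is_derive_add (is_derive_const 1 z 1) (is_derive_mul gD gD)) _ _.
  by move=> y; rewrite expr2.
by ring.
Qed.

Let hc : continuous (fun z => b / (1 + w z ^+ 2)).
Proof.
apply: continuous_mul; first exact: continuous_const.
move=> z; apply: cvgV; first by rewrite gt_eqF.
exact: is_derive_continuous (sqD (wD z)).
Qed.

Let sc : continuous (fun z : R => sin (pi * z)).
Proof.
apply: continuous_compose; first exact: continuous_sin.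
by move=> z; apply: cvgM; [exact: cvg_cst|exact: cvg_id].
Qed.

(** The derivative of [- atan (w z) / pi] is [b sin(pi z) / (1 + w^2)]. Inserting the sine costs at
    most [1 / b], since [b^2 (1 - sin) <= b^2 (1 - sin^2) = w^2]. *)
Lemma cauchy_kernel_int : i1 0 1 (fun z => b / (1 + w z ^+ 2)) <= 2.
Proof.
have b_inv : b^-1 <= 1 by rewrite invf_le1.
pose f (z : R) := - (pi^-1) * atan (w z) + b^-1 * z.
pose df (z : R) := b * sin (pi * z) / (1 + w z ^+ 2) + b^-1.
have fD (z : R) : is_derive z 1 f (df z).
  apply: is_derive_fun (is_derive_add (is_derive_lmul (- pi^-1)
     (is_derive_compR (is_derive1_atan _) (wD z))) (is_derive_lmul b^-1 (is_derive_idR z))) _ _ => //.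
  have pn : pi != 0 :> R by rewrite gt_eqF ?pi_gt0.
  have wn : 1 + w z ^+ 2 != 0 by rewrite gt_eqF.
  have bn : b != 0 by rewrite gt_eqF.
  rewrite /df; move: pn wn bn; move: pi (w z) (sin _) => p x s pn wn bn.
  by field; rewrite ?pn ?wn ?bn.
have dfc : continuous df.
  apply: continuous_add; last exact: continuous_const.
  by have := continuous_mul hc sc; under eq_fun do rewrite mulrAC.
have P := @i1_posint R 0 1 ler01.
apply: (@le_trans _ _ (i1 0 1 df)).
  apply: (posint_le P) => // z /=; rewrite in_itv /= => z01.
  have s0 := sin_ge0 z01; have s1 := sin_le1 (pi * z).
  have cs := sin2cos2 (pi * z).
  rewrite /df -lerBlDl -mulrBl ler_pdivrMr // ler_pdivlMl //.
  have -> : w z ^+ 2 = b ^+ 2 * (1 - sin (pi * z) ^+ 2).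
    by rewrite cs /w; ring.
  suff : (b ^+ 2) * (1 - sin (pi * z)) <= b ^+ 2 * (1 - sin (pi * z) ^+ 2) by nra.
  rewrite ler_pM2l ?exprn_gt0 //; nra.
rewrite (i1_FTC ler01 dfc (fun z _ => fD z)) /f w1 w0 atanN mulr0 mulr1.
have a1 := ltW (atan_ltpi2 b); have p0 := @pi_gt0 R.
have : pi^-1 * atan b <= 2^-1.
  by rewrite ler_pdivrMl // (le_trans a1) // mulrC.
lra.
Qed.

(** A closed primitive of [(1 - x^2) / (1 + x^2)^3], a rational minorant of the Gaussian. *)
Let G (x : R) := 4^-1 * atan x + 4^-1 * (x / (1 + x ^+ 2)) + 2^-1 * (x / (1 + x ^+ 2) ^+ 2).

Let GD (x : R) : is_derive x 1 G ((1 - x ^+ 2) / (1 + x ^+ 2) ^+ 3).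
Proof.
have n0 : 1 + x ^+ 2 != 0 by rewrite gt_eqF.
have h1 : is_derive x 1 (fun x : R => (1 + x ^+ 2)^-1) (- (2 * x) / (1 + x ^+ 2) ^+ 2).
  have := @is_deriveV R (fun x : R => 1 + x ^+ 2) x _ 1 n0 (sqD (is_derive_idR x)).
  move=> h; apply: is_derive_fun h _ _ => //.
  by rewrite mulr1 -[LHS]/(- (1 + x ^+ 2) ^- 2 * (2 * x)) mulrC mulrN mulNr.
have h2 := is_derive_mul h1 h1.
have h3 := is_derive_mul (is_derive_idR x) h1.
have h4 := is_derive_mul (is_derive_idR x) h2.
apply: is_derive_fun (is_derive_add (is_derive_add (is_derive_lmul 4^-1 (is_derive1_atan x))
  (is_derive_lmul 4^-1 h3)) (is_derive_lmul 2^-1 h4)) _ _ => [y|].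
  by rewrite /G; congr (_ + _ * (_ * _)); rewrite -expr2 -exprVn.
by field.
Qed.

(* [G' w = (1 - w^2) / (1 + w^2)^3 <= exp (- w^2)] while [G] keeps a positive total variation. *)
Lemma gauss_kernel_int : 8^-1 <= i1 0 1 (fun z => b * expR (- w z ^+ 2)).
Proof.
pose f (z : R) := - (pi^-1) * G (w z).
pose df (z : R) := b * sin (pi * z) * ((1 - w z ^+ 2) / (1 + w z ^+ 2) ^+ 3).
have fD (z : R) : is_derive z 1 f (df z).
  apply: is_derive_fun (is_derive_lmul (- pi^-1) (is_derive_compR (GD _) (wD z))) _ _ => //.
  have pn : pi != 0 :> R by rewrite gt_eqF ?pi_gt0.
  have wn : 1 + w z ^+ 2 != 0 by rewrite gt_eqF.
  have bn : b != 0 by rewrite gt_eqF.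
  rewrite /df; move: pn wn bn; move: pi (w z) (sin _) => p x s pn wn bn.
  by field; rewrite ?pn ?wn ?bn.
have wc2 : continuous (fun z => w z ^+ 2).
  by under eq_fun do rewrite expr2; exact: continuous_mul.
have dfc : continuous df.
  apply: continuous_mul.
    by apply: continuous_mul => //; exact: continuous_const.
  apply: continuous_mul.
    by apply: continuous_add; [exact: continuous_const|exact: continuous_opp].
  move=> z; apply: cvgV; first by rewrite expf_neq0 // gt_eqF.
  have c1 : continuous (fun z => 1 + w z ^+ 2).
    by apply: continuous_add => //; exact: continuous_const.
  have c2 := continuous_mul c1 (continuous_mul c1 c1).
  by move: z; under eq_fun do rewrite exprS expr2.
have ec : continuous (fun z => b * expR (- w z ^+ 2)).
  apply: continuous_mul; first exact: continuous_const.
  by apply: continuous_compose; [exact: continuous_expR|exact: continuous_opp].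
have P := @i1_posint R 0 1 ler01.
apply: (@le_trans _ _ (i1 0 1 df)).
  rewrite (i1_FTC ler01 dfc (fun z _ => fD z)) /f w1 w0 /G atanN sqrrN.
  have p0 := @pi_gt0 R.
  (* Since [b >= 1], [atan b] is at least [pi / 4]. With the coefficient [1/4] in [G] and the two
     ends [b] and [-b] this gives [1/8], the other terms being nonnegative. *)
  have a1 : pi / 4 <= atan b by rewrite -atan1; exact: le_atan.
  have q1 : 0 <= b / (1 + b ^+ 2) by rewrite divr_ge0 // ltW.
  have q2 : 0 <= b / (1 + b ^+ 2) ^+ 2 by rewrite divr_ge0 ?exprn_ge0 // ltW.
  have : 4^-1 <= pi^-1 * atan b by rewrite ler_pdivlMl.
  rewrite !mulNr !mulrN.
  have q3 : 0 <= pi^-1 * (b / (1 + b ^+ 2)) by rewrite mulr_ge0 // invr_ge0 ltW.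
  have q4 : 0 <= pi^-1 * (b / (1 + b ^+ 2) ^+ 2) by rewrite mulr_ge0 // invr_ge0 ltW.
  move: q3 q4; move: (b / _) (b / _) (atan b) (pi^-1) => x y z t.
  by rewrite !mulrDr; nra.
apply: (posint_le P) => // z /=; rewrite in_itv /= => z01.
have s0 := sin_ge0 z01; have s1 := sin_le1 (pi * z).
rewrite /df -mulrA ler_pM2l //.
have e1 := expR_ge1Dx (- w z ^+ 2); have e2 := expR_gt0 (- w z ^+ 2).
have d1 : 1 <= (1 + w z ^+ 2) ^+ 3 by rewrite exprn_ege1 // lerDl sqr_ge0.
have d0 := lt_le_trans ltr01 d1.
rewrite mulrA ler_pdivrMr //; move: (w z ^+ 2) (sin _) (expR _) d1 e1 e2 s0 s1 => x s e d1 e1 e2 s0 s1.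
(* Where [w^2 >= 1] the minorant is nonpositive; elsewhere the sine is bounded by [1] and
   [1 - x <= exp(-x)]. *)
have [x1|x1] := lerP 1 x.
  apply: (@le_trans _ _ 0); last by rewrite mulr_ge0 // ltW // (lt_le_trans ltr01).
  by rewrite mulr_ge0_le0 // subr_le0.
apply: (@le_trans _ _ (1 - x)); first by rewrite ler_piMl // subr_ge0 ltW.
by rewrite (le_trans e1) // ler_peMr // ltW.
Qed.
End OneDimensional.

Section Kernel.
Variables (R : realType) (d : nat).
Local Notation V := 'rV[R]_d.
Local Notation E := (V * R)%type.
Local Notation J := (@int_Td R d).
Let PJ := @int_Td_posint R d.

Lemma continuous_prod (X : topologicalType) K (r : seq K) (f : K -> X -> R) :
  (forall i, continuous (f i)) -> continuous (fun z => \prod_(i <- r) f i z).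
Proof.
move=> fc; elim: r => [|i r IH].
  by under eq_fun do rewrite big_nil; exact: continuous_const.
by under eq_fun do rewrite big_cons; exact: continuous_mul.
Qed.

Lemma int_Td_prod n (g : R -> R) : continuous g ->
  int_Td (fun y : 'rV[R]_n => \prod_i g (y 0 i)) = i1 0 1 g ^+ n.
Proof.
move=> gc.
have pc k : continuous (fun y : 'rV[R]_k => \prod_i g (y 0 i)).
  apply: continuous_prod => i; apply: (continuous_compose gc) => y; exact: coord_continuous.
elim: n => [|n IH]; first by rewrite expr0 /int_Td /= big_ord0.
rewrite /int_Td iint_i1 exprS -IH.
have -> : (fun z => iint `[0, 1] (fun y : 'rV[R]_n => \prod_i g ((cons_row z y) 0 i))) =
   fun z => g z * int_Td (fun y : 'rV[R]_n => \prod_i g (y 0 i)).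
  apply/funext => z; rewrite -(posint_scale (@int_Td_posint R n) (g z) (pc n)).
  apply: eq_iint => y; rewrite big_ord_recl cons_row0; congr (_ * _).
  by apply: eq_bigr => i _; rewrite cons_rowS.
exact: (posint_scaler (@i1_posint R 0 1 ler01)).
Qed.

(** Of period [1] and, near the centre of the cube, equivalent to [pi^2] times the squared distance
    to it. Hence a Gaussian with exponent [- rho2 / a] imitates the heat kernel at time
    [a / (4 pi^2)]. *)
Definition rho2 (z : E) : R := \sum_i cos (pi * z.1 0 i) ^+ 2.
(* The second variable is the logarithm of the width: [kern (y, ln a) = a^(-d/2) exp (- rho2 y / a)],
   which concentrates at [(1/2, ..., 1/2)] as [a] tends to 0. *)
Definition kern (z : E) : R := expR (- (d%:R / 2) * z.2 - rho2 z * expR (- z.2)).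
Definition kernX (z : E) : R := rho2 z * expR (- z.2).

Let C i (z : E) : R := cos (pi * z.1 0 i).
Let Sn i (z : E) : R := sin (pi * z.1 0 i).

Let argD i (z v : E) : is_derive z v (fun z : E => pi * z.1 0 i) (pi * v.1 0 i).
Proof.
apply: is_derive_along.
apply: is_derive_fun (is_derive_add (is_derive_const (pi * z.1 0 i) _ _)
  (is_derive_lmul (pi * v.1 0 i) (is_derive_idR 0))) _ _ => [s|]; last by rewrite add0r mulr1.
by rewrite -[(z + s *: v).1]/(z.1 + s *: v.1) !mxE; ring.
Qed.
Let args i : smooth (fun z : E => pi * z.1 0 i).
Proof. by apply: smooth_mul; [exact: smooth_const|exact: smooth_fstE]. Qed.

Let CD i (z v : E) : is_derive z v (C i) (- Sn i z * (pi * v.1 0 i)).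
Proof.
have := is_derive_comp1 v (is_derive_cos (pi * z.1 0 i)) (smooth_diff z (args i)).
by rewrite (derive_val_eq (argD i z v)).
Qed.
Let SnD i (z v : E) : is_derive z v (Sn i) (C i z * (pi * v.1 0 i)).
Proof.
have := is_derive_comp1 v (is_derive_sin (pi * z.1 0 i)) (smooth_diff z (args i)).
by rewrite (derive_val_eq (argD i z v)).
Qed.
Let Cs i : smooth (C i). Proof. exact: smooth_comp1 (@smooth_cos R) (args i). Qed.
Let CS i z : C i z ^+ 2 + Sn i z ^+ 2 = 1. Proof. exact: cos2Dsin2. Qed.

Lemma rho2D (z v : E) : is_derive z v rho2 (\sum_i - (2 * pi) * C i z * Sn i z * v.1 0 i).
Proof.
apply: is_derive_bigsum => i.
apply: is_derive_fun (is_derive_mul (CD i z v) (CD i z v)) _ _ => [y|]; last ring.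
by rewrite expr2.
Qed.

Lemma smooth_rho2 : smooth rho2.
Proof.
apply: smooth_sum => i; under eq_fun do rewrite expr2; exact: (smooth_mul (Cs i) (Cs i)).
Qed.

Lemma rho2_ge0 z : 0 <= rho2 z. Proof. by apply: sumr_ge0 => i _; exact: sqr_ge0. Qed.
Lemma rho2_le z : rho2 z <= d%:R.
Proof.
rewrite -[d%:R](_ : \sum_(i < d) 1 = _); last by rewrite sumr_const card_ord.
by apply: ler_sum => i _; rewrite -[leRHS](CS i z) lerDl sqr_ge0.
Qed.

Lemma periodicE_rho2 : periodicE rho2.
Proof.
move=> z j; apply: eq_bigr => i _.
rewrite -[(z + _).1]/(z.1 + e_ R j) !mxE eqxx /=; case: (i == j); last by rewrite addr0.
by rewrite mulrDr mulr1 cosDpi sqrrN.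
Qed.

Let dxi i j : (dx R j : E).1 0 i = (i == j)%:R.
Proof. by rewrite /dx /e_ /= !mxE. Qed.

Lemma rho2_dx j : 'D_(dx R j) rho2 = fun z => - (2 * pi) * (C j z * Sn j z).
Proof.
apply: derive_fun => z; apply: is_derive_fun (rho2D z (dx R j)) _ _ => //.
rewrite (bigD1 j) //= big1 => [|i ij]; last by rewrite dxi (negbTE ij) mulr0.
by rewrite dxi eqxx mulr1 addr0; ring.
Qed.

Lemma rho2_dxx j z : is_derive z (dx R j) ('D_(dx R j) rho2)
  (2 * pi ^+ 2 * (1 - 2 * C j z ^+ 2)).
Proof.
rewrite rho2_dx.
apply: is_derive_fun (is_derive_lmul (- (2 * pi)) (is_derive_mul (CD j z (dx R j)) (SnD j z (dx R j)))) _ _ => //.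
have := CS j z; rewrite dxi eqxx mulr1; move: pi (C j z) (Sn j z) => p c s h.
have e : s * s = 1 - c ^+ 2 by rewrite -h; ring.
transitivity (2 * p ^+ 2 * (s * s - c ^+ 2)); first ring.
by rewrite e; ring.
Qed.

Let ea (z : E) : R := expR (- z.2).
Let eaE : ea = fun z => expR (-1 * z.2).
Proof. by apply/funext => z; rewrite mulN1r. Qed.
Let eas : smooth ea. Proof. rewrite eaE; exact: smooth_expt. Qed.
Let eaD (z v : E) : is_derive z v ea (- ea z * v.2).
Proof. by rewrite eaE; apply: is_derive_fun (is_derive_expt (-1) z v) _ _ => //; ring. Qed.
Let ea0 z : 0 < ea z. Proof. exact: expR_gt0. Qed.

Lemma smooth_kernX : smooth kernX.
Proof. exact: smooth_mul smooth_rho2 eas. Qed.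
Lemma kernX_ge0 z : 0 <= kernX z. Proof. by rewrite mulr_ge0 ?rho2_ge0 // ltW. Qed.

Let kernE : kern = fun z => expR (- (d%:R / 2) * z.2 - kernX z). Proof. by []. Qed.
Let ks0 : smooth (fun z : E => - (d%:R / 2) * z.2 - kernX z).
Proof.
apply: smooth_sub smooth_kernX; apply: smooth_mul; [exact: smooth_const|exact: smooth_snd].
Qed.

Lemma smooth_kern : smooth kern.
Proof. rewrite kernE; exact: smooth_comp1 (@smooth_expR R) ks0. Qed.
Lemma kern_gt0 z : 0 < kern z. Proof. exact: expR_gt0. Qed.

Lemma periodicE_kern : periodicE kern.
Proof.
by move=> z i; rewrite /kern periodicE_rho2 -[(z + _).2]/(z.2 + 0) addr0.
Qed.

Let kernD (z v : E) : is_derive z v kern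
  (kern z * (- (d%:R / 2) * v.2 - ('D_v rho2 z * ea z - kernX z * v.2))).
Proof.
have h1 := is_derive_mul (smooth_is_derive z v smooth_rho2) (eaD z v).
have h2 := is_derive_sub (is_derive_lmul (- (d%:R / 2)) (is_derive_snd z v)) h1.
have := is_derive_comp1 v (is_derive_expR (- (d%:R / 2) * z.2 - kernX z)) (smooth_diff z ks0).
rewrite (derive_val_eq h2) => h; apply: is_derive_fun h _ _ => //.
by congr (_ * (_ - _)); rewrite /kernX /ea; ring.
Qed.

Lemma kern_dx j : 'D_(dx R j) kern = fun z => kern z * (- 'D_(dx R j) rho2 z * ea z).
Proof.
by apply: derive_fun => z; apply: is_derive_fun (kernD z (dx R j)) _ _ => //=; ring.
Qed.

Lemma kern_dt z : Dt kern z = kern z * (kernX z - d%:R / 2).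
Proof. by apply: derive_val_eq; apply: is_derive_fun (kernD z (dt R d)) _ _ => //=;
  rewrite (derive_val_eq (rho2D z (dt R d))) big1 => [|i _]; [ring|rewrite mxE mulr0]. Qed.

(** One derivative costs [exp(-t/2)], up to the weight [1 + X]: with [b = exp(-t/2)] and [c] the
    cosine, [2 |c| b <= 1 + c^2 b^2]. *)
Lemma kern_dx_le j z : `|'D_(dx R j) kern z| <= pi * expR (- z.2 / 2) * ((1 + kernX z) * kern z).
Proof.
have -> : 'D_(dx R j) kern z = kern z * (- 'D_(dx R j) rho2 z * ea z).
  exact: (congr1 (fun f : E -> R => f z) (kern_dx j)).
have -> : 'D_(dx R j) rho2 z = - (2 * pi) * (C j z * Sn j z).
  exact: (congr1 (fun f : E -> R => f z) (rho2_dx j)).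
set b := expR (- z.2 / 2); have b0 : 0 < b := expR_gt0 _.
have eb : ea z = b ^+ 2 by rewrite /b -expRM_natl /ea; congr expR; field.
have CX : C j z ^+ 2 * ea z <= kernX z.
  rewrite /kernX ler_pM2r ?expR_gt0 // /rho2 (bigD1 j) //= lerDl.
  by apply: sumr_ge0 => i _; exact: sqr_ge0.
have p0 := @pi_gt0 R; have k0 := kern_gt0 z.
have -> : kern z * (- (- (2 * pi) * (C j z * Sn j z)) * ea z) =
  ((2 * pi) * (C j z * Sn j z) * ea z) * kern z by ring.
rewrite normrM (gtr0_norm k0) [leRHS]mulrA ler_pM2r //.
rewrite normrM (gtr0_norm (ea0 z)) normrM [X in X * _ * _]gtr0_norm ?mulr_gt0 // normrM.
have s1 : `|Sn j z| <= 1 := sin_max _.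
have h : 2 * `|C j z| * b <= 1 + kernX z.
  have := sqr_ge0 (`|C j z| * b - 1); have e1 : (`|C j z|) ^+ 2 = C j z ^+ 2 by rewrite real_normK ?num_real.
  by move: CX; rewrite eb -e1; lra.
have c0 := normr_ge0 (C j z); have s0 := normr_ge0 (Sn j z).
apply: (@le_trans _ _ (pi * b * (2 * `|C j z| * b))); last by rewrite ler_wpM2l // ltW // mulr_gt0.
rewrite eb.
have -> : 2 * pi * (`|C j z| * `|Sn j z|) * b ^+ 2 = (pi * b * (2 * `|C j z| * b)) * `|Sn j z| by ring.
by rewrite ler_piMr // !mulr_ge0 // ltW.
Qed.

(* The fourth powers of the cosines produced by the Laplacian have the good sign and are dropped. *)
Lemma kern_heat z : - (4 * pi ^+ 2) * kernX z * kern z <=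
  4 * pi ^+ 2 * expR (- z.2) * Dt kern z - Lap kern z.
Proof.
have D2 j : 'D_(dx R j) ('D_(dx R j) kern) z = kern z *
    (4 * pi ^+ 2 * (C j z * Sn j z) ^+ 2 * ea z ^+ 2 - 2 * pi ^+ 2 * (1 - 2 * C j z ^+ 2) * ea z).
  rewrite kern_dx; apply: derive_val_eq.
  have h := is_derive_mul (kernD z (dx R j)) (is_derive_mul (is_derive_opp (rho2_dxx j z)) (eaD z (dx R j))).
  apply: is_derive_fun h _ _ => //=.
  have -> : 'D_(dx R j) rho2 z = - (2 * pi) * (C j z * Sn j z).
    exact: (congr1 (fun f : E -> R => f z) (rho2_dx j)).
  by move: pi (C j z) (Sn j z) (ea z) (kern z) (kernX z) => p c s e k x; ring.
rewrite kern_dt /Lap (eq_bigr _ (fun j _ => D2 j)) -mulr_sumr.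
have p0 := @pi_gt0 R.
have -> : \sum_i (4 * pi ^+ 2 * (C i z * Sn i z) ^+ 2 * ea z ^+ 2 -
     2 * pi ^+ 2 * (1 - 2 * C i z ^+ 2) * ea z) =
   4 * pi ^+ 2 * ea z ^+ 2 * \sum_i (C i z * Sn i z) ^+ 2 - 2 * pi ^+ 2 * ea z * (d%:R - 2 * rho2 z).
  rewrite big_split /= sumrN -!mulr_suml; congr (_ - _).
    by rewrite -mulr_sumr mulrAC.
  rewrite -mulr_sumr mulrAC; congr (_ * _).
  by rewrite big_split /= sumrN sumr_const card_ord -mulr_sumr.
have Q : \sum_i (C i z * Sn i z) ^+ 2 <= rho2 z.
  apply: ler_sum => i _; rewrite exprMn ler_piMr ?sqr_ge0 //.
  by rewrite -[leRHS](CS i z) lerDr sqr_ge0.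
have k0 := kern_gt0 z; have e0 := ea0 z.
have := ler_wpM2l (mulr_ge0 (ltW k0) (mulr_ge0 (mulr_ge0 (ler0n R 4) (sqr_ge0 (pi : R))) (sqr_ge0 (ea z)))) Q.
rewrite /kernX -/(ea z); move: (\sum_i _) (rho2 z) (kern z) (ea z) (pi : R) (d%:R : R) => q r k e p n.
by lra.
Qed.

Local Notation I := (@slice_int R d).

Lemma kern_prod y t : kern (y, t) =
  \prod_i (expR (- t / 2) * expR (- (expR (- t / 2) * cos (pi * y 0 i)) ^+ 2)).
Proof.
rewrite big_split /= prodr_const card_ord -expRM_natl -expR_sum -expRD /kern /=; congr expR.
have e2 : expR (- t / 2) ^+ 2 = expR (- t) by rewrite -expRM_natl; congr expR; field.
congr (_ + _); first by field.
by rewrite /rho2 mulr_suml -sumrN; apply: eq_bigr => i _ /=; rewrite exprMn e2 mulrC.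
Qed.

Lemma kern_int_ge t : t <= 0 -> 8^-1 ^+ d <= I t kern.
Proof.
move=> t0; have b1 : 1 <= expR (- t / 2).
  by rewrite -[leLHS]expR0 ler_expR divr_ge0 // oppr_ge0.
have gc : continuous (fun z : R => expR (- t / 2) * expR (- (expR (- t / 2) * cos (pi * z)) ^+ 2)).
  apply: continuous_mul; first exact: continuous_const.
  apply: (continuous_compose (@continuous_expR R)); apply: continuous_opp.
  have c1 : continuous (fun z : R => expR (- t / 2) * cos (pi * z)).
    apply: continuous_mul; first exact: continuous_const.
    apply: (continuous_compose (@continuous_cos R)).
    by apply: continuous_mul; [exact: continuous_const|move=> z; exact: cvg_id].
  by under eq_fun do rewrite expr2; exact: continuous_mul.
rewrite (slice_int_eq (g := fun z : E => \prod_i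
  (expR (- t / 2) * expR (- (expR (- t / 2) * cos (pi * z.1 0 i)) ^+ 2)))) => [|y]; last first.
  exact: kern_prod.
rewrite /slice_int /= (int_Td_prod d gc); apply: lerXn2r; rewrite ?nnegrE ?invr_ge0 //.
  apply: le_trans (gauss_kernel_int b1); by rewrite invr_ge0.
exact: gauss_kernel_int.
Qed.

(** The weight is paid with half of the exponent, [1 + X <= 2 exp(X/2)], and each remaining factor
    [exp(-x/2)] is at most [2 / (1 + x)]. The resulting product of Cauchy kernels integrates to at
    most [4^d]. *)
Lemma kernX_int_le t : t <= 0 -> I t (fun z => (1 + kernX z) * kern z) <= 2 * 4 ^+ d.
Proof.
move=> t0; have b1 : 1 <= expR (- t / 2).
  by rewrite -[leLHS]expR0 ler_expR divr_ge0 // oppr_ge0.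
set b := expR (- t / 2) in b1.
have e2 : b ^+ 2 = expR (- t) by rewrite -expRM_natl; congr expR; field.
have on (x : R) : 0 < 1 + x ^+ 2 by rewrite ltr_pwDl // sqr_ge0.
pose g (z : R) := b / (1 + (b * cos (pi * z)) ^+ 2).
have gc : continuous g.
  apply: continuous_mul; first exact: continuous_const.
  have c1 : continuous (fun z : R => b * cos (pi * z)).
    apply: continuous_mul; first exact: continuous_const.
    apply: (continuous_compose (@continuous_cos R)).
    by apply: continuous_mul; [exact: continuous_const|move=> z; exact: cvg_id].
  have c2 : continuous (fun z : R => 1 + (b * cos (pi * z)) ^+ 2).
    apply: continuous_add; first exact: continuous_const.
    by under eq_fun do rewrite expr2; exact: continuous_mul.
  by move=> z; apply: cvgV; [rewrite gt_eqF|exact: c2].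
pose g2 (z : R) := 2 * g z.
have g2c : continuous g2 by apply: continuous_mul; [exact: continuous_const|].
apply: (@le_trans _ _ (2 * int_Td (fun y : V => \prod_i g2 (y 0 i)))); last first.
  rewrite ler_pM2l // (int_Td_prod d g2c); apply: lerXn2r; rewrite ?nnegrE //.
    apply: (posint_ge0 (@i1_posint R 0 1 ler01)) => // z _.
    by rewrite /g2 mulr_ge0 // divr_ge0 ?(le_trans ler01 b1) // ltW.
  rewrite /g2 (posint_scale (@i1_posint R 0 1 ler01)) //.
  have := cauchy_kernel_int b1; rewrite -/g; lra.
have pc : continuous (fun y : V => \prod_i g2 (y 0 i)).
  apply: continuous_prod => i; apply: (continuous_compose g2c) => y; exact: coord_continuous.
rewrite -(posint_scale PJ) //; apply: (posint_le PJ) => [||y _].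
- exact: (@slice_s R d _ t (smooth_mul (smooth_add (@smooth_const R E 1) smooth_kernX) smooth_kern)).
- by apply: continuous_mul => //; exact: continuous_const.
rewrite kern_prod.
have -> : kernX (y, t) = \sum_i (b * cos (pi * y 0 i)) ^+ 2.
  by rewrite /kernX /rho2 mulr_suml; apply: eq_bigr => i _; rewrite exprMn e2 mulrC.
set x := fun i => (b * cos (pi * y 0 i)) ^+ 2; rewrite -/(\sum_i x i).
have x0 i : 0 <= x i by exact: sqr_ge0.
have h1 : 1 + \sum_i x i <= 2 * expR (\sum_i (x i / 2)).
  rewrite -mulr_suml; have := expR_ge1Dx ((\sum_i x i) / 2); lra.
apply: (@le_trans _ _ (2 * expR (\sum_i (x i / 2)) * \prod_i (b * expR (- x i)))).
  by rewrite ler_wpM2r // prodr_ge0 // => i _; rewrite mulr_ge0 ?expR_ge0 // (le_trans ler01).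
rewrite -mulrA ler_pM2l // expR_sum -big_split /=; apply: ler_prod => i _.
rewrite !mulr_ge0 ?expR_ge0 ?(le_trans ler01 b1) //= /g2 /g mulrCA [leRHS]mulrCA ler_wpM2l //.
  exact: (le_trans ler01 b1).
rewrite -/(x i) -expRD ler_pdivlMr; last exact: on.
have -> : x i / 2 + - x i = - (x i / 2) by lra.
rewrite expRN mulrC ler_pdivrMr ?expR_gt0 //.
have := expR_ge1Dx (x i / 2); have := x0 i; lra.
Qed.
End Kernel.

(** * Backward heat equations tested against the kernel *)

Section Retime.
Variables (R : realType) (d : nat).
Local Notation V := 'rV[R]_d.
Local Notation E := (V * R)%type.

(* The time after which a heat flow has spread to width [exp t]. *)
Definition htime (t : R) : R := expR t / (4 * pi ^+ 2).
(** The function is recentred by [p] and read in the time scale of the kernel, so that both depend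
    on the same variable, the logarithm of the width. *)
Definition retime (p : V) (f : E -> R) (z : E) : R := f (z.1 + p, htime z.2).

Let c (p : V) (i : 'I_d.+1) (z : E) : R :=
  if unlift ord0 i is Some j then z.1 0 j + p 0 j else htime z.2.
Let w (i : 'I_d.+1) : E := if unlift ord0 i is Some j then dx R j else dt R d.

Let hts : smooth (fun z : E => htime z.2).
Proof.
apply: smooth_mul; last exact: smooth_const.
exact: smooth_comp1 (@smooth_expR R) (@smooth_snd R d).
Qed.

Let htD (z v : E) : is_derive z v (fun z : E => htime z.2) (htime z.2 * v.2).
Proof.
have := is_derive_comp1 v (is_derive_expR z.2) (smooth_diff z (@smooth_snd R d)).
rewrite (derive_val_eq (is_derive_snd z v)) => h.
apply: is_derive_fun (is_derive_mul h (is_derive_const (4 * pi ^+ 2)^-1 z v)) _ _ => //.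
by rewrite /htime; ring.
Qed.

Let cs p i : smooth (c p i).
Proof.
rewrite /c; case: unlift => [j|]; last exact: hts.
by apply: smooth_add; [exact: smooth_fstE|exact: smooth_const].
Qed.

Let c0 p : c p ord0 = fun z => htime z.2. Proof. by rewrite /c unlift_none. Qed.
Let cS p j : c p (lift ord0 j) = fun z => z.1 0 j + p 0 j. Proof. by rewrite /c liftK. Qed.
Let w0 : w ord0 = dt R d. Proof. by rewrite /w unlift_none. Qed.
Let wS j : w (lift ord0 j) = dx R j. Proof. by rewrite /w liftK. Qed.

Let phiE p z : \sum_i c p i z *: w i = (z.1 + p, htime z.2).
Proof.
rewrite big_ord_recl c0 w0.
rewrite (eq_bigr (fun j => ((z.1 + p) 0 j *: e_ R j, 0))) => [|j _]; last first.
  by rewrite cS wS -[LHS]/(_ *: e_ R j, _ *: 0) scaler0 !mxE.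
rewrite sum_pair -rV_sum_basis big1 //.
by rewrite -[LHS]/(htime z.2 *: 0 + (z.1 + p), htime z.2 * 1 + 0) scaler0 add0r mulr1 addr0.
Qed.

Lemma smooth_retime p f : smooth f -> smooth (retime p f).
Proof. by move=> fs; have := curve_smooth w (cs p) fs; under eq_fun do rewrite phiE. Qed.

Lemma retime_is_derive p f z v : smooth f ->
  is_derive z v (retime p f) (\sum_j v.1 0 j * retime p ('D_(dx R j) f) z +
    htime z.2 * v.2 * retime p (Dt f) z).
Proof.
move=> fs; apply: is_derive_fun (curve_is_derive w (cs p) z v fs) _ _ => [y|]; first by rewrite phiE.
rewrite big_ord_recl phiE c0 w0 (derive_val_eq (htD z v)) addrC; congr (_ + _).
apply: eq_bigr => j _; rewrite wS cS; congr (_ * _); apply: derive_val_eq.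
apply: is_derive_along; apply: is_derive_fun (is_derive_add (is_derive_const (z.1 0 j + p 0 j) _ _)
  (is_derive_lmul (v.1 0 j) (is_derive_idR 0))) _ _ => [s|]; last by rewrite add0r mulr1.
by rewrite -[(z + s *: v).1]/(z.1 + s *: v.1) !mxE; ring.
Qed.

Lemma retime_dx p f i : smooth f -> 'D_(dx R i) (retime p f) = retime p ('D_(dx R i) f).
Proof.
move=> fs; apply: derive_fun => z; apply: is_derive_fun (retime_is_derive p z (dx R i) fs) _ _ => //=.
rewrite mulr0 mul0r addr0 (bigD1 i) //= big1 => [|j ji]; rewrite !mxE eqxx /=.
  by rewrite eqxx mul1r addr0.
by rewrite (negbTE ji) mul0r.
Qed.

Lemma retime_dt p f z : smooth f -> Dt (retime p f) z = htime z.2 * retime p (Dt f) z.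
Proof.
move=> fs; apply: derive_val_eq.
apply: is_derive_fun (retime_is_derive p z (dt R d) fs) _ _ => //=.
by rewrite mulr1 big1 ?add0r // => j _; rewrite mxE mul0r.
Qed.

Lemma retime_Lap p f z : smooth f -> Lap (retime p f) z = retime p (Lap f) z.
Proof.
move=> fs; apply: eq_bigr => i _; rewrite (retime_dx p i fs).
exact: (congr1 (fun g : E -> R => g z) (retime_dx p i (smooth_D (dx R i) fs))).
Qed.

Lemma periodicE_retime p f : periodicE f -> periodicE (retime p f).
Proof.
move=> fp z i; rewrite /retime -(fp (z.1 + p, htime z.2) i); congr f.
by rewrite -[RHS]/(z.1 + p + e_ R i, htime z.2 + 0) -[(z + _).1]/(z.1 + e_ R i)
  -[(z + _).2]/(z.2 + 0) !addr0 addrAC.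
Qed.

Lemma htime_gt0 t : 0 < htime t.
Proof. by rewrite divr_gt0 ?expR_gt0 // mulr_gt0 // exprn_gt0 // pi_gt0. Qed.

Lemma htime_derive (t : R) : is_derive t 1 htime (htime t).
Proof.
apply: is_derive_fun (is_derive_mul (is_derive_expR t) (is_derive_const (4 * pi ^+ 2)^-1 t 1)) _ _ => //.
by rewrite mulr0 addr0.
Qed.

Lemma htime_mono s t : s <= t -> htime s <= htime t.
Proof.
by move=> st; rewrite ler_pM2r ?ler_expR // invr_gt0 mulr_gt0 // exprn_gt0 // pi_gt0.
Qed.

Lemma htimeM t : 4 * pi ^+ 2 * htime t = expR t.
Proof. by rewrite /htime mulrC divfK // gt_eqF // mulr_gt0 // exprn_gt0 // pi_gt0. Qed.

End Retime.

Section KernelTest.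
Variables (R : realType) (d : nat).
Local Notation V := 'rV[R]_d.
Local Notation E := (V * R)%type.
Local Notation J := (@int_Td R d).
Local Notation I := (@slice_int R d).
Local Notation k := (@kern R d).
Local Notation X := (@kernX R d).
Let PJ := @int_Td_posint R d.
Let Ck : R := 2 * 4 ^+ d.
Let ck : R := 8^-1 ^+ d.
Let ctr : V := const_mx 2^-1.

Let Ck0 : 0 <= Ck. Proof. by rewrite mulr_ge0 // exprn_ge0. Qed.
Let ck0 : 0 < ck. Proof. by rewrite exprn_gt0 // invr_gt0. Qed.
Let X0 z : 0 <= X z := @kernX_ge0 R d z.
Let kpos z : 0 < k z := @kern_gt0 R d z.
Let ks : smooth k := @smooth_kern R d.
Let Xs : smooth X := @smooth_kernX R d.
Let kp : periodicE k := @periodicE_kern R d.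
Let Xks : smooth (fun z => X z * k z). Proof. exact: smooth_mul Xs ks. Qed.
Let Xk1s : smooth (fun z => (1 + X z) * k z).
Proof. exact: smooth_mul (smooth_add (@smooth_const R E 1) Xs) ks. Qed.

Lemma kern_int_le t : t <= 0 -> I t k <= Ck.
Proof.
move=> t0; apply: le_trans (kernX_int_le d t0); apply: slice_int_le => // x.
by rewrite ler_peMl ?lerDl // ltW.
Qed.

Lemma Xkern_int_le t : t <= 0 -> I t (fun z => X z * k z) <= Ck.
Proof.
move=> t0; apply: le_trans (kernX_int_le d t0); apply: slice_int_le => // x.
by rewrite ler_pM2r ?lerDr.
Qed.

(** On [[0, 1]] the function [cos(pi y)^2] grows with the distance to [1/2]: the cosine is monotone
    on the left half, and [y] may be replaced by [1 - y] on the right half. *)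
Lemma cos_far (y dl : R) : 0 <= y <= 1 -> 0 <= dl <= 2^-1 -> dl <= `|y - 2^-1| ->
  cos (pi * (2^-1 - dl)) ^+ 2 <= cos (pi * y) ^+ 2.
Proof.
move=> /andP[y0 y1] /andP[d0 d1] dy; have p0 := @pi_gt0 R.
have c0 : 0 <= cos (pi * (2^-1 - dl)).
  apply: cos_ge0_pihalf; apply/andP; split.
    by rewrite (@le_trans _ _ 0) ?oppr_le0 ?divr_ge0 ?mulr_ge0 ?subr_ge0 // ltW.
  by rewrite ler_pM2l // lerBlDr lerDl.
have mono x : 0 <= x -> x <= 2^-1 - dl -> cos (pi * (2^-1 - dl)) ^+ 2 <= cos (pi * x) ^+ 2.
  move=> x0 x1.
  have le1 : cos (pi * (2^-1 - dl)) <= cos (pi * x).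
    rewrite leNgt ltr_cos ?in_itv /= ?mulr_ge0 ?(ltW p0) //=; last 3 first.
    - by rewrite ler_piMr ?(ltW p0) //; lra.
    - lra.
    - by rewrite ler_piMr ?(ltW p0) //; lra.
    by rewrite -leNgt ler_pM2l.
  by rewrite lerXn2r // nnegrE // (le_trans c0).
have [h|h] := lerP y 2^-1.
  by apply: mono => //; move: dy; rewrite ler0_norm ?subr_le0 // => dy; lra.
have -> : cos (pi * y) ^+ 2 = cos (pi * (1 - y)) ^+ 2.
  by rewrite mulrBr mulr1 cosB cospi sinpi mul0r addr0 mulN1r sqrrN.
by apply: mono; move: dy; rewrite ?gtr0_norm ?subr_gt0 //; lra.
Qed.

(** [W] stands for the density read backward in time, with [h = 0] and the mollified drift as flux
    [be], or for the value function read forward, with [be = 0] and [h] the Hamiltonian minus the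
    coupling. In both cases the largest value [M] is attained at time [0], at [x0]. *)
Variables (W h : E -> R) (be : 'I_d -> E -> R) (x0 : V) (M B S0 : R).
Hypotheses (Ws : smooth W) (hs : smooth h) (bes : forall i, smooth (be i)).
Hypotheses (Wp : periodicE W) (bep : forall i, periodicE (be i)).
Hypotheses (B0 : 0 <= B) (S00 : 0 < S0).
Hypothesis W0 : forall x s, 0 <= s <= S0 -> 0 <= W (x, s) <= M.
Hypothesis WE : forall x s, 0 <= s <= S0 ->
  Dt W (x, s) + Lap W (x, s) = h (x, s) - \sum_i 'D_(dx R i) (be i) (x, s).
Hypothesis beB : forall i x s, 0 <= s <= S0 -> `|be i (x, s)| <= B * M.
Hypothesis WM : W (x0, 0) = M.
(** The translation that puts [x0] at the point of concentration of the kernel. *)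
Let p := x0 - ctr.
Local Notation "f ^~r" := (retime p f) (at level 2, format "f ^~r").

Let M0 : 0 <= M.
Proof.
have s0 : 0 <= (0 : R) <= S0 by rewrite lexx ltW.
by rewrite -WM; case/andP: (W0 x0 s0).
Qed.

Let W's : smooth W^~r := smooth_retime p Ws.
Let h's : smooth h^~r := smooth_retime p hs.
Let be's i : smooth (be i)^~r := smooth_retime p (bes i).

Definition test_mass t := I t (fun z => k z * W^~r z).

Let sOK t : htime t <= S0 -> 0 <= htime t <= S0.
Proof. by rewrite (ltW (htime_gt0 t)). Qed.

(** The Laplacian of [W] is moved to the kernel, which solves the heat equation up to a loss of
    [exp t] times [X k]. The flux meets the gradient of the kernel, of order [exp(-t/2)], against
    the time factor [exp t], hence [exp(t/2)]. Both losses are integrable towards [-oo]. *)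
Lemma test_derive (t : R) : t <= 0 -> htime t <= S0 -> exists2 D, is_derive t 1 test_mass D &
  htime t * I t (fun z => k z * h^~r z) - Ck * M * expR t - d%:R * Ck * B * M * expR (t / 2) <= D.
Proof.
move=> t0 tS; have sS := sOK tS.
have kWs : smooth (fun z => k z * W^~r z) := smooth_mul ks W's.
pose W1 := (Dt W)^~r.
eexists; first exact: slice_int_dt.
pose L1 (z : E) := (Dt k z - htime t * Lap k z) * W^~r z.
have Lks := smooth_Lap ks.
have Dks : smooth (Dt k : E -> R) := smooth_D (dt R d) ks.
have L1s : smooth L1.
  exact: smooth_mul (smooth_sub Dks (smooth_mul (@smooth_const R E (htime t)) Lks)) W's.
have khs : smooth (fun z => k z * h^~r z) := smooth_mul ks h's.
pose N (z : E) := \sum_i (be i)^~r z * 'D_(dx R i) k z.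
have Ns : smooth N.
  by apply: smooth_sum => i; exact: smooth_mul (be's i) (smooth_D (dx R i) ks).
have LWs : smooth (fun z => k z * Lap W^~r z) := smooth_mul ks (smooth_Lap W's).
have divs : smooth (fun z => k z * \sum_i 'D_(dx R i) (be i)^~r z).
  by apply: smooth_mul ks _; apply: smooth_sum => i; exact: smooth_D (dx R i) (be's i).
have DW : smooth (fun z => Dt k z * W^~r z) := smooth_mul Dks W's.
have kLW : smooth (fun z => Lap k z * W^~r z) := smooth_mul Lks W's.
have -> : I t (Dt (fun z => k z * W^~r z)) = I t L1 + htime t * I t (fun z => k z * h^~r z)
   + htime t * I t N.
  have -> : I t (Dt (fun z => k z * W^~r z)) = I t (fun z => Dt k z * W^~r z +
      htime t * (k z * h^~r z - k z * (\sum_i 'D_(dx R i) (be i)^~r z) - k z * Lap W^~r z)).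
    apply: slice_int_eq => x.
    have D1 := smooth_is_derive (x, t) (dt R d) ks.
    have D2 : is_derive (x, t) (dt R d) W^~r (htime t * W1 (x, t)).
      by have := smooth_is_derive (x, t) (dt R d) W's; rewrite -[derive _ _ _]/(Dt W^~r (x, t)) retime_dt.
    rewrite -[LHS]/('D_(dt R d) (fun z => k z * W^~r z) (x, t)) (derive_val_eq (is_derive_mul D1 D2)).
    rewrite (retime_Lap p (x, t) Ws) (eq_bigr (fun i => ('D_(dx R i) (be i))^~r (x, t))) => [|i _]; last first.
      exact: (congr1 (fun g : E -> R => g (x, t)) (retime_dx p i (bes i))).
    have := WE (x + p) sS; rewrite /W1 /retime /=.
    move: (Dt W _) (Lap W _) (h _) (\sum_i _) (k _) (W _) => a1 a2 a3 a4 a5 a6 e.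
    have -> : a1 = a3 - a4 - a2 by rewrite -e; ring.
    by rewrite -[derive _ _ _]/(Dt k (x, t)); ring.
  rewrite (slice_intD t DW); last first.
    exact: smooth_mul (@smooth_const R E (htime t)) (smooth_sub (smooth_sub khs divs) LWs).
  rewrite (slice_intZ t _ (smooth_sub (smooth_sub khs divs) LWs)).
  rewrite (slice_intB t (smooth_sub khs divs) LWs) (slice_intB t khs divs).
  rewrite -(slice_int_Lap t ks W's kp (periodicE_retime p Wp)).
  rewrite (@slice_int_div R d t k (fun i => (be i)^~r) ks kp be's (fun i => periodicE_retime p (bep i))).
  rewrite -/N (slice_int_eq (f := L1) (g := fun z => Dt k z * W^~r z - htime t * (Lap k z * W^~r z))) => [|x]; last first.
    by rewrite /L1; ring.
  rewrite (slice_intB t DW (smooth_mul (@smooth_const R E (htime t)) kLW)) (slice_intZ t _ kLW).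
  by ring.
have B1 : - (Ck * M * expR t) <= I t L1.
  apply: (@le_trans _ _ (- (expR t * M) * I t (fun z => X z * k z))).
    rewrite mulNr lerN2; have -> : Ck * M * expR t = expR t * M * Ck by ring.
    by rewrite ler_wpM2l ?mulr_ge0 ?expR_ge0 //; exact: Xkern_int_le.
  rewrite -(slice_intZ t _ Xks); apply: slice_int_le => [||x] //.
    exact: smooth_mul (@smooth_const R E _) Xks.
  have /andP[w0 w1] : 0 <= W^~r (x, t) <= M by exact: W0.
  have := kern_heat (x, t); rewrite /= => kh.
  have kh2 : - (expR t) * X (x, t) * k (x, t) <= Dt k (x, t) - htime t * Lap k (x, t).
    have := ler_wpM2l (ltW (htime_gt0 t)) kh.
    have e1 : htime t * (4 * pi ^+ 2 * expR (- t)) = 1.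
      by rewrite mulrA (mulrC (htime t)) htimeM -expRD subrr expR0.
    have e2 := htimeM t.
    move: (htime t) (X _) (k _) (Dt k _) (Lap k _) (expR t) (expR (- t)) pi e1 e2.
    move=> s x1 k1 k2 k3 e e' q e1 e2.
    have -> : s * (4 * q ^+ 2 * e' * k2 - k3) = (s * (4 * q ^+ 2 * e')) * k2 - s * k3 by ring.
    have -> : s * (- (4 * q ^+ 2) * x1 * k1) = - (4 * q ^+ 2 * s) * x1 * k1 by ring.
    by rewrite e1 e2 mul1r.
  have h2 := ler_wpM2r w0 kh2.
  apply: le_trans _ h2; rewrite !mulNr lerN2.
  have xk : 0 <= expR t * (X (x, t) * k (x, t)).
    by apply: mulr_ge0; [exact: expR_ge0|apply: mulr_ge0 => //; exact: ltW].
  have := ler_wpM2l xk w1; lra.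
have B2 : - (d%:R * Ck * B * M * expR (t / 2)) <= htime t * I t N.
  apply: (@le_trans _ _ (htime t * (- (d%:R * B * M * (pi * expR (- t / 2))) * I t (fun z => (1 + X z) * k z)))).
    have e1 : htime t * expR (- t / 2) = expR (t / 2) / (4 * pi ^+ 2).
      by rewrite /htime mulrAC -expRD; congr (expR _ / _); field.
    have -> : htime t * (- (d%:R * B * M * (pi * expR (- t / 2))) * I t (fun z => (1 + X z) * k z)) =
      - (d%:R * B * M * pi * (htime t * expR (- t / 2)) * I t (fun z => (1 + X z) * k z)) by ring.
    rewrite lerN2 e1; have p0 := @pi_gt0 R; have p2 := @pi_ge2 R.
    have -> : d%:R * B * M * pi * (expR (t / 2) / (4 * pi ^+ 2)) * I t (fun z => (1 + X z) * k z) =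
       (d%:R * B * M * expR (t / 2)) * ((4 * pi)^-1 * I t (fun z => (1 + X z) * k z)).
      move: p0 p2; move: pi (expR (t / 2)) (I t _) => q e j q0 _.
      by field; rewrite gt_eqF.
    have -> : d%:R * Ck * B * M * expR (t / 2) = (d%:R * B * M * expR (t / 2)) * Ck by ring.
    rewrite ler_wpM2l ?mulr_ge0 ?expR_ge0 //.
    apply: le_trans (_ : I t (fun z => (1 + X z) * k z) <= _); last exact: kernX_int_le.
    rewrite ler_piMl //; last by rewrite invf_le1 ?mulr_gt0 //; lra.
    by apply: slice_int_ge0 => // x; rewrite mulr_ge0 ?addr_ge0 // ltW.
  rewrite ler_wpM2l ?(ltW (htime_gt0 t)) // -slice_intZ //.
  apply: slice_int_le => // [|x]; first exact: smooth_mul (@smooth_const R E _) Xk1s.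
  have Bd i : - (B * M * (pi * expR (- t / 2) * ((1 + X (x, t)) * k (x, t)))) <=
      (be i)^~r (x, t) * 'D_(dx R i) k (x, t).
    have h1 : `|(be i)^~r (x, t) * 'D_(dx R i) k (x, t)| <=
      B * M * (pi * expR (- t / 2) * ((1 + X (x, t)) * k (x, t))).
      rewrite normrM; apply: ler_pM => //; first exact: beB.
      exact: kern_dx_le.
    by move: h1; rewrite ler_norml => /andP[].
  rewrite [leLHS](_ : _ = \sum_(i < d)
    - (B * M * (pi * expR (- t / 2) * ((1 + X (x, t)) * k (x, t))))); first by apply: ler_sum => i _; exact: Bd.
  by rewrite sumr_const card_ord -mulr_natl; ring.
move: B1 B2; lra.
Qed.

(** As the width shrinks the kernel sees only a neighbourhood of [x0], where [W] is close to [M].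
    Its integral being at least [ck], a quarter of [ck M] is reached at some small width. *)
Lemma test_mass_small (t1 : R) : exists2 t, t <= t1 & ck * M / 4 <= test_mass t.
Proof.
have [->|M_n0] := eqVneq M 0.
  exists (Num.min t1 (Num.min 0 (ln (4 * pi ^+ 2 * S0)))); first by rewrite ge_min lexx.
  set t := Num.min _ _; rewrite mulr0 mul0r; apply: slice_int_ge0 => [|x]; first exact: smooth_mul ks W's.
  have tS : htime t <= S0.
    have q0 : 0 < 4 * pi ^+ 2 :> R by rewrite mulr_gt0 // exprn_gt0 // pi_gt0.
    have pS : 0 < 4 * pi ^+ 2 * S0 by rewrite mulr_gt0.
    rewrite -(ler_pM2l q0) htimeM -[leRHS]lnK ?posrE // ler_expR.
    by rewrite /t !ge_min lexx !orbT.
  by rewrite mulr_ge0 ?(ltW (kpos _)) //; case/andP: (W0 (x + p) (sOK tS)).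
have Mp : 0 < M by rewrite lt_neqAle eq_sym M_n0.
have Wc := smooth_cont Ws.
have [dl d0 Hd] := (cont_epsP _ _).1 (Wc (x0, 0)) (M / 2) (divr_gt0 Mp (ltr0n R 2)).
pose d' := Num.min (dl / 2) 4^-1.
have d'0 : 0 < d' by rewrite lt_min; apply/andP; split; [rewrite divr_gt0|rewrite invr_gt0].
have d'1 : 0 <= d' <= 2^-1.
  by rewrite ltW //= ge_min; apply/orP; right; lra.
pose sg := cos (pi * (2^-1 - d')); have p0 := @pi_gt0 R.
have sg0 : 0 < sg.
  apply: cos_gt0_pihalf; apply/andP; split.
    rewrite (@lt_trans _ _ 0) ?oppr_lt0 ?divr_gt0 ?mulr_gt0 ?subr_gt0 //.
    by rewrite gt_min; apply/orP; right; lra.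
  by rewrite ltr_pM2l // ltrBlDr ltrDl.
have sg2 : 0 < sg ^+ 2 by rewrite exprn_gt0.
have CkS : 0 < 2 * (Ck + 1) by rewrite mulr_gt0 // ltr_wpDl.
pose ep := Num.min (Num.min 1 (4 * pi ^+ 2 * (d' * 2^-1))) (Num.min (4 * pi ^+ 2 * S0) (ck * sg ^+ 2 / (2 * (Ck + 1)))).
have q0 : 0 < 4 * pi ^+ 2 :> R by rewrite mulr_gt0 // exprn_gt0.
have ep0 : 0 < ep.
  by rewrite !lt_min ltr01 !mulr_gt0 ?invr_gt0 //= divr_gt0 ?mulr_gt0.
exists (Num.min t1 (ln ep)); first by rewrite ge_min lexx.
set t := Num.min _ _.
have et : expR t <= ep.
  by rewrite -[leRHS]lnK ?posrE // ler_expR /t ge_min lexx orbT.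
have e1 : expR t <= 1 by rewrite (le_trans et) // !ge_min lexx.
have e2 : htime t <= d' / 2.
  by rewrite -(ler_pM2l q0) htimeM (le_trans et) // !ge_min lexx ?orbT.
have e3 : htime t <= S0 by rewrite -(ler_pM2l q0) htimeM (le_trans et) // !ge_min lexx ?orbT.
have e4 : expR t <= ck * sg ^+ 2 / (2 * (Ck + 1)) by rewrite (le_trans et) // !ge_min lexx ?orbT.
have t0 : t <= 0 by rewrite -ler_expR expR0.
have sS := sOK e3.
(* This is the kernel times [M/2 (1 - rho2 / sg^2)], which is at most [M/2] near the centre, where
   [W > M/2], and nonpositive at distance [d'] or more, where only [W >= 0] is known. Its integral
   needs no integration over a ball. *)
pose lo (z : E) := M / 2 * (k z - expR t / sg ^+ 2 * (X z * k z)).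
have los : smooth lo.
  exact: smooth_mul (@smooth_const R E _) (smooth_sub ks (smooth_mul (@smooth_const R E _) Xks)).
have lower : I t lo <= test_mass t.
  apply: (posint_le PJ) => [||y yb].
  - exact: (@slice_s R d lo t los).
  - exact: (@slice_s R d _ t (smooth_mul ks W's)).
  have -> : lo (y, t) = k (y, t) * (M / 2 * (1 - rho2 (y, t) / sg ^+ 2)).
    rewrite /lo /kernX /=; have := expRN t; have := expR_gt0 t.
    move: (expR t) (expR (- t)) (rho2 _) (k _) => a a' r q a0 ->.
    by field; rewrite ?(gt_eqF sg0) ?(gt_eqF a0).
  rewrite ler_pM2l ?kpos //.
  have /andP[w0 w1] : 0 <= W^~r (y, t) <= M by exact: W0.
  have [far|near] := pselect (exists i, d' <= `|y 0 i - 2^-1|).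
    have [i yi] := far.
    have : sg ^+ 2 <= rho2 (y, t).
      apply: le_trans (cos_far (yb i) d'1 yi) _.
      by rewrite /rho2 (bigD1 i) //= lerDl sumr_ge0 // => j _; exact: sqr_ge0.
    rewrite -[X in X <= _]mul1r -ler_pdivlMr // => h1.
    by apply: le_trans w0; rewrite mulr_ge0_le0 ?divr_ge0 // subr_le0.
  have h1 : `|W^~r (y, t) - M| < M / 2.
    suff : `|W (y + p, htime t) - W (x0, 0)| < M / 2 by rewrite WM.
    apply: Hd; rewrite pair_normE gt_max /=.
    have d'dl : d' < dl.
      by rewrite (@le_lt_trans _ _ (dl / 2)) ?ge_min ?lexx // ltr_pdivrMr // ltr_pMr // ltr1n.
    apply/andP; split.
      rewrite (le_lt_trans _ d'dl) //; apply: mx_norm_le; first exact: ltW.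
      move=> i j; rewrite ord1 !mxE.
      have -> : y 0 j + (x0 0 j - 2^-1) - x0 0 j = y 0 j - 2^-1 by ring.
      by rewrite ltW // ltNge; apply/negP => yj; apply: near; exists j.
    rewrite subr0 gtr0_norm ?htime_gt0 // (le_lt_trans e2) //.
    by apply: lt_trans d'dl; rewrite ltr_pdivrMr // ltr_pMr // ltr1n.
  have : M / 2 * (1 - rho2 (y, t) / sg ^+ 2) <= M / 2.
    by rewrite ler_piMr ?divr_ge0 // gerBl divr_ge0 ?rho2_ge0 // ltW.
  move: h1; rewrite ltr_norml => /andP[]; lra.
apply: le_trans lower; rewrite /lo.
rewrite (slice_intZ t _ (smooth_sub ks (smooth_mul (@smooth_const R E _) Xks))).
rewrite (slice_intB t ks (smooth_mul (@smooth_const R E _) Xks)) (slice_intZ t _ Xks).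
have g1 := kern_int_ge d t0; have g2 := Xkern_int_le t0.
have g3 : expR t / sg ^+ 2 * I t (fun z => X z * k z) <= ck / 2.
  have a0 : 0 <= expR t / sg ^+ 2 by rewrite divr_ge0 ?expR_ge0 // ltW.
  apply: le_trans (ler_wpM2l a0 g2) _.
  rewrite mulrAC ler_pdivrMr //; apply: le_trans (ler_wpM2r Ck0 e4) _.
  rewrite mulrAC ler_pdivrMr //.
  have -> : ck / 2 * sg ^+ 2 * (2 * (Ck + 1)) = ck * sg ^+ 2 * (Ck + 1) by field.
  by rewrite ler_wpM2l ?lerDl // mulr_ge0 // ltW.
have -> : ck * M / 4 = M / 2 * (ck / 2) by field.
by rewrite ler_wpM2l ?divr_ge0 //; move: g1 g3; rewrite -/ck; lra.
Qed.

(* [P] compensates the source term [h]. *)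
Lemma kernel_test (P Pd : R -> R) (P0 t1 : R) : t1 <= 0 -> htime t1 <= S0 ->
  (forall t : R, t <= t1 -> is_derive t 1 P (Pd t)) ->
  (forall t, t <= t1 -> - (htime t * I t (fun z => k z * h^~r z)) <= Pd t) ->
  (forall t, t <= t1 -> P0 <= P t) ->
  ck * M / 4 <= test_mass t1 + (P t1 - P0) + Ck * M * expR t1 + 2 * (d%:R * Ck * B * M) * expR (t1 / 2).
Proof.
move=> t10 t1S PD Pge P0le.
have [t0 t01 low] := test_mass_small t1.
(* The two exponential terms are primitives of the losses in [test_derive], the factor [2] being due
   to [exp(t/2)]; hence [Q] is nondecreasing. *)
pose Q (t : R) := test_mass t + P t + Ck * M * expR t + 2 * (d%:R * Ck * B * M) * expR (t / 2).
have e2D (t : R) : is_derive t 1 (fun t : R => expR (t / 2)) (expR (t / 2) / 2).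
  apply: is_derive_fun (is_derive_compR (is_derive_expR _)
    (is_derive_lmul 2^-1 (is_derive_idR t))) _ _ => [s|].
    by rewrite mulrC.
  by rewrite mulr1 mulrC [2^-1 * t]mulrC mulrC.
have QD (t : R) : t0 <= t <= t1 -> is_derive t 1 Q ('D_1 test_mass t + Pd t + Ck * M * expR t +
    2 * (d%:R * Ck * B * M) * (expR (t / 2) / 2)).
  move=> /andP[_ tt1].
  have [D DD _] := test_derive (le_trans tt1 t10) (le_trans (htime_mono tt1) t1S).
  rewrite (derive_val_eq DD).
  exact: (is_derive_add (is_derive_add (is_derive_add DD (PD t tt1)) (is_derive_lmul (Ck * M) (is_derive_expR t)))
    (is_derive_lmul (2 * (d%:R * Ck * B * M)) (e2D t))).
have := ndecr_deriv t01 QD; rewrite /Q => mono.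
have : Q t0 <= Q t1.
  apply: mono => t /andP[_ tt1].
  have [D DD BD] := test_derive (le_trans tt1 t10) (le_trans (htime_mono tt1) t1S).
  rewrite (derive_val_eq DD); have := Pge t tt1; move: BD.
  by move: (htime t * _) (Pd t) (Ck * M * _) (d%:R * _ * _ * _) (expR (t / 2)) => a1 a2 a3 a4 a5; nra.
have p1 : 0 <= Ck * M * expR t0 by rewrite !mulr_ge0 ?expR_ge0.
have p2 : 0 <= 2 * (d%:R * Ck * B * M) * expR (t0 / 2) by rewrite !mulr_ge0 ?expR_ge0.
have := P0le t0 t01; rewrite /Q; move: low; lra.
Qed.
End KernelTest.

(** * Hardy inequality *)

Section Hardy.
Variables (R : realType) (d : nat).
Local Notation V := 'rV[R]_d.
Local Notation E := (V * R)%type.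
Local Notation J := (@int_Td R d).
Local Notation I := (@slice_int R d).
Local Notation k := (@kern R d).
Let PJ := @int_Td_posint R d.
Variables (al kap t : R).
Hypotheses (al0 : 0 < al) (kap0 : 0 < kap) (kap1 : kap <= 1) (d2 : 2 <= d%:R :> R) (t0 : t <= 0).
Let q : R := 1 - kap / 2.
Let q0 : 0 <= q.
Proof. by rewrite /q subr_ge0 ler_pdivrMr // mul1r (le_trans kap1) // ler1n. Qed.
Let a := expR t.
Let rs : smooth (@rho2 R d) := @smooth_rho2 R d.
Let rp : periodicE (@rho2 R d) := @periodicE_rho2 R d.
Let N (z : E) := rho2 z + a.

Let N0 z : 0 < N z.
Proof. by rewrite ltr_wpDl ?expR_gt0 // rho2_ge0. Qed.
Let Ns : smooth N. Proof. exact: smooth_add rs (@smooth_const R E a). Qed.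
Let Nle z : N z <= d%:R + 1.
Proof. by rewrite lerD ?rho2_le // /a -expR0 ler_expR. Qed.
Let ND i z : is_derive z (dx R i) N ('D_(dx R i) (@rho2 R d) z).
Proof.
apply: is_derive_fun (is_derive_add (smooth_is_derive z (dx R i) rs) (is_derive_const a z _)) _ _ => //.
by rewrite addr0.
Qed.
Let Dr i : smooth ('D_(dx R i) (@rho2 R d)) := smooth_D (dx R i) rs.
Let Nq (z : E) := N z `^ (- q).
Let Nqs : smooth Nq. Proof. exact: smooth_powR. Qed.
Let Nq0 z : 0 < Nq z. Proof. exact: powR_gt0. Qed.
(** Up to a constant, a periodic form of [x |x|^(kap - 2)], regularised by [a] at the scale of the
    kernel. On the whole space the divergence of that field is [(d - 2 + kap) |x|^(kap - 2)], the
    identity behind the Hardy inequality. *)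
Let Y i (z : E) := 'D_(dx R i) (@rho2 R d) z * Nq z.
Let Ys i : smooth (Y i). Proof. exact: smooth_mul. Qed.
Let Yp i : periodicE (Y i).
Proof. by move=> z j; rewrite /Y /Nq /N rp (periodicE_D (dx R i) rp). Qed.

Let r2 i z : 'D_(dx R i) (@rho2 R d) z = - (2 * pi) * (cos (pi * z.1 0 i) * sin (pi * z.1 0 i)).
Proof. exact: (congr1 (fun f : E -> R => f z) (rho2_dx R i)). Qed.

Let r2_sum z : \sum_i 'D_(dx R i) (@rho2 R d) z ^+ 2 <= 4 * pi ^+ 2 * N z.
Proof.
apply: (@le_trans _ _ (4 * pi ^+ 2 * rho2 z)); last first.
  by rewrite ler_wpM2l ?lerDl ?expR_ge0 // mulr_ge0 // sqr_ge0.
rewrite /rho2 mulr_sumr; apply: ler_sum => i _; rewrite r2.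
have e : (- (2 * pi) * (cos (pi * z.1 0 i) * sin (pi * z.1 0 i))) ^+ 2 =
   4 * pi ^+ 2 * cos (pi * z.1 0 i) ^+ 2 * sin (pi * z.1 0 i) ^+ 2 by ring.
rewrite e ler_piMr //; last exact: mulr_ge0 (mulr_ge0 (ler0n R 4) (sqr_ge0 pi)) (sqr_ge0 _).
Qed.

Let r2_le i z : 'D_(dx R i) (@rho2 R d) z ^+ 2 <= 4 * pi ^+ 2 * N z.
Proof.
apply: le_trans (r2_sum z); rewrite (bigD1 i) //= lerDl.
by apply: sumr_ge0 => j _; exact: sqr_ge0.
Qed.

Let Nq1 z : Nq z = N z * N z `^ (- q - 1).
Proof. by rewrite -[X in X * _]powRr1 ?(ltW (N0 z)) // -powR_add //; congr (_ `^ _); ring. Qed.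

Let Nq_le z : N z * Nq z <= d%:R + 1.
Proof.
have [h|h] := lerP 1 (N z).
  apply: le_trans (Nle z); rewrite ler_piMr ?(ltW (N0 z)) //.
  rewrite -[leRHS](powRr0 (N z)) ler_powR // oppr_le0; exact: q0.
apply: (@le_trans _ _ 1); last by rewrite lerDr.
rewrite -[X in X * _]powRr1 ?(ltW (N0 z)) // -powR_add //.
have -> : 1 + - q = kap / 2 by rewrite /q; ring.
rewrite [leRHS](_ : 1 = 1 `^ (kap / 2)); last by rewrite powR1.
rewrite ge0_ler_powR ?nnegrE ?(ltW (N0 z)) ?(ltW h) //.
by rewrite divr_ge0 // ltW.
Qed.

(** The leading coefficient is [d - 2 q = d - 2 + kap >= kap], by [|D rho2|^2 <= 4 pi^2 N]. The
    correction due to periodicity carries the factor [rho2 Nq], which is bounded. *)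
Let divY z : 2 * pi ^+ 2 * kap * Nq z <=
  \sum_i 'D_(dx R i) (Y i) z + 4 * pi ^+ 2 * (d%:R + 1).
Proof.
have DY i : 'D_(dx R i) (Y i) z = 2 * pi ^+ 2 * (1 - 2 * cos (pi * z.1 0 i) ^+ 2) * Nq z -
    q * N z `^ (- q - 1) * 'D_(dx R i) (@rho2 R d) z ^+ 2.
  apply: derive_val_eq.
  have h := is_derive_powRf (- q) (dx R i) Ns (N0 z).
  apply: is_derive_fun (is_derive_mul (rho2_dxx i z) h) _ _ => //.
  by rewrite (derive_val_eq (ND i z)) /Nq; ring.
rewrite (eq_bigr _ (fun i _ => DY i)) big_split /= sumrN -mulr_suml -!mulr_sumr.
rewrite big_split /= sumrN sumr_const card_ord -mulr_sumr -/(rho2 z).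
have n1 : 0 <= N z `^ (- q - 1) by exact: powR_ge0.
have h1 := ler_wpM2l (mulr_ge0 q0 n1) (r2_sum z).
have h2 := Nq1 z.
have h3 : rho2 z * Nq z <= d%:R + 1.
  apply: le_trans (Nq_le z); rewrite ler_wpM2r ?(ltW (Nq0 z)) //.
  by rewrite /N lerDl expR_ge0.
have p2 : 0 <= (pi : R) ^+ 2 by exact: sqr_ge0.
have h4 := ler_wpM2l p2 h3.
have h5 : kap * Nq z <= (d%:R - 2 * q) * Nq z.
  rewrite ler_wpM2r ?(ltW (Nq0 z)) //.
  have -> : d%:R - 2 * q = kap + (d%:R - 2) by rewrite /q; field.
  by rewrite lerDl subr_ge0.
have h6 := ler_wpM2l p2 h5.
have e1 : q * N z `^ (- q - 1) * (4 * pi ^+ 2 * N z) = 4 * pi ^+ 2 * q * Nq z by rewrite h2; ring.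
move: h1; rewrite e1; move: h4 h6.
move: (q * _ * _) (rho2 z) (Nq z) (pi ^+ 2) (d%:R : R) => x r n p D; nra.
Qed.

Variable f : V -> R.
Hypotheses (fs : smooth f) (fp : periodicT f) (f0 : forall y, 0 < f y).
Let fE (z : E) := f z.1.
Let fEs : smooth fE := smooth_lift fs.
Let g (z : E) := fE z `^ (al + 1).
Let gs : smooth g. Proof. by apply: smooth_powR => // z; exact: f0. Qed.
Let gp : periodicE g. Proof. by move=> z i; rewrite /g /fE; congr (_ `^ _); exact: fp. Qed.
Let g1 (z : E) := fE z `^ (al - 1).
Let g1s : smooth g1. Proof. by apply: smooth_powR => // z; exact: f0. Qed.
Let Gd (z : E) := g1 z * \sum_i 'D_(dx R i) fE z ^+ 2.
Let Gds : smooth Gd.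
Proof.
apply: smooth_mul g1s _; apply: smooth_sum => i; under eq_fun do rewrite expr2.
exact: smooth_mul (smooth_D (dx R i) fEs) (smooth_D (dx R i) fEs).
Qed.
Definition hardy_const := (al + 1) ^+ 2 * d%:R * (d%:R + 1) / kap ^+ 2 + 4 * (d%:R + 1) / kap.

(** The field [Y] is tested against [f^(al+1)]; after integration by parts Young's inequality
    returns part of the left side and leaves [|Df|^2] with the weight [N Nq], which is bounded. *)
Let hardy_N : I t (fun z => Nq z * g z) <= hardy_const * (I t g + I t Gd).
Proof.
have p0 : 0 < (pi : R) ^+ 2 by rewrite exprn_gt0 // pi_gt0.
have p1 : 1 <= (pi : R) ^+ 2.
  by rewrite exprn_ege1 // (le_trans _ (@pi_ge2 R)) // ler1n.
have d0 : 0 < d%:R :> R by rewrite (lt_le_trans _ d2).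
have S1 : smooth (fun z => Nq z * g z) := smooth_mul Nqs gs.
have S2 : smooth (fun z => \sum_i 'D_(dx R i) (Y i) z).
  by apply: smooth_sum => i; exact: smooth_D (dx R i) (Ys i).
have S3 : smooth (fun z => g z * \sum_i 'D_(dx R i) (Y i) z) := smooth_mul gs S2.
have S4 : smooth (fun z => \sum_i Y i z * 'D_(dx R i) g z).
  by apply: smooth_sum => i; exact: smooth_mul (Ys i) (smooth_D (dx R i) gs).
have L1 : 2 * pi ^+ 2 * kap * I t (fun z => Nq z * g z) <=
    I t (fun z => g z * \sum_i 'D_(dx R i) (Y i) z) + 4 * pi ^+ 2 * (d%:R + 1) * I t g.
  rewrite -!slice_intZ // -slice_intD //; last exact: smooth_mul (@smooth_const R E _) gs.
  apply: slice_int_le => [||x].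
  - exact: smooth_mul (@smooth_const R E _) S1.
  - exact: smooth_add S3 (smooth_mul (@smooth_const R E _) gs).
  have := ler_wpM2l (powR_ge0 (f x) (al + 1)) (divY (x, t)); rewrite -[f x `^ _]/(g (x, t)).
  by move: (Nq _) (g _) (\sum_i _) => n y s; lra.
have L2 : - I t (fun z => \sum_i Y i z * 'D_(dx R i) g z) <=
    pi ^+ 2 * kap * I t (fun z => Nq z * g z) + (al + 1) ^+ 2 * d%:R / kap * (d%:R + 1) * I t Gd.
  rewrite -slice_intN // -!slice_intZ // -slice_intD; last 2 first.
  - exact: smooth_mul (@smooth_const R E _) S1.
  - exact: smooth_mul (@smooth_const R E _) Gds.
  apply: slice_int_le => [||x].
  - exact: smooth_opp.
  - exact: smooth_add (smooth_mul (@smooth_const R E _) S1) (smooth_mul (@smooth_const R E _) Gds).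
  set z : E := (x, t).
  have Dg i : 'D_(dx R i) g z = (al + 1) * (g1 z * fE z) * 'D_(dx R i) fE z.
    rewrite (derive_val_eq (@is_derive_powRf R E fE (al + 1) z (dx R i) fEs (f0 x))).
    congr (_ * _ * _); rewrite /g1 -[X in _ * X]powRr1 ?(ltW (f0 x)) // -powR_add ?f0 //.
    by congr (_ `^ _); ring.
  have gE : g z = g1 z * fE z ^+ 2.
    rewrite /g1 -powR_mulrn ?(ltW (f0 x)) // -powR_add ?f0 //.
    by congr (_ `^ _); ring.
  (* With this weight the [d] terms of Young's inequality add up to [pi^2 kap], half of the
     coefficient on the left of [L1], and are absorbed. *)
  pose dl : R := pi ^+ 2 * kap / d%:R.
  have dl0 : 0 < dl by rewrite divr_gt0 // mulr_gt0.
  have term i : - (Y i z * 'D_(dx R i) g z) <= Nq z * g1 z *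
      (dl * fE z ^+ 2 + (al + 1) ^+ 2 * pi ^+ 2 / dl * N z * 'D_(dx R i) fE z ^+ 2).
    rewrite Dg /Y; have := r2_le i z.
    have ng : 0 <= Nq z * g1 z by rewrite mulr_ge0 // powR_ge0.
    move: ng; move: ('D_(dx R i) (@rho2 R d) z) ('D_(dx R i) fE z) (fE z) (N z) => s y w n ng hs.
    have -> : - (s * Nq z * ((al + 1) * (g1 z * w) * y)) = Nq z * g1 z * (- (al + 1) * s * w * y) by ring.
    apply: ler_wpM2l => //.
    have h1 : (al + 1) ^+ 2 / (4 * dl) * s ^+ 2 * y ^+ 2 <= (al + 1) ^+ 2 * pi ^+ 2 / dl * n * y ^+ 2.
      rewrite ler_wpM2r ?sqr_ge0 //.
      have c0 : 0 <= (al + 1) ^+ 2 / (4 * dl) by rewrite divr_ge0 ?sqr_ge0 // mulr_ge0 // ltW.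
      apply: le_trans (ler_wpM2l c0 hs) _; rewrite le_eqVlt; apply/orP; left; apply/eqP.
      have dn : dl != 0 by rewrite gt_eqF.
      by move: dn; move: (pi : R) => p dn; field.
    apply: le_trans (lerD (lexx _) h1).
    rewrite -subr_ge0.
    have -> : dl * w ^+ 2 + (al + 1) ^+ 2 / (4 * dl) * s ^+ 2 * y ^+ 2 - - (al + 1) * s * w * y =
       dl * (w + (al + 1) * s * y / (2 * dl)) ^+ 2.
      have dn : dl != 0 by rewrite gt_eqF.
      by field.
    by rewrite mulr_ge0 ?sqr_ge0 // ltW.
  rewrite -sumrN; apply: (@le_trans _ _ (\sum_i Nq z * g1 z *
      (dl * fE z ^+ 2 + (al + 1) ^+ 2 * pi ^+ 2 / dl * N z * 'D_(dx R i) fE z ^+ 2))).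
    by apply: ler_sum => i _; exact: term.
  rewrite -mulr_sumr big_split /= sumr_const card_ord -mulr_sumr.
  have -> : dl * fE z ^+ 2 *+ d = pi ^+ 2 * kap * fE z ^+ 2.
    rewrite -[LHS]mulr_natl /dl; by move: (pi ^+ 2) d0 => p D0; field; rewrite gt_eqF.
  have e1 : (al + 1) ^+ 2 * pi ^+ 2 / dl = (al + 1) ^+ 2 * d%:R / kap.
    by rewrite /dl; move: (pi ^+ 2) p0 => p pp; field; rewrite ?(gt_eqF pp) ?(gt_eqF d0) ?(gt_eqF kap0).
  rewrite e1 mulrDr gE.
  have -> : Nq z * g1 z * (pi ^+ 2 * kap * fE z ^+ 2) = pi ^+ 2 * kap * (Nq z * (g1 z * fE z ^+ 2)) by ring.
  rewrite lerD2l.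
  have -> : Nq z * g1 z * ((al + 1) ^+ 2 * d%:R / kap * N z * \sum_i 'D_(dx R i) fE z ^+ 2) =
     ((al + 1) ^+ 2 * d%:R / kap * Gd z) * (N z * Nq z) by rewrite /Gd; ring.
  have -> : (al + 1) ^+ 2 * d%:R / kap * (d%:R + 1) * Gd z =
     ((al + 1) ^+ 2 * d%:R / kap * Gd z) * (d%:R + 1) by ring.
  apply: ler_wpM2l => //; apply: mulr_ge0.
    by rewrite divr_ge0 ?(ltW kap0) // mulr_ge0 ?sqr_ge0 // ltW.
  by rewrite /Gd mulr_ge0 ?powR_ge0 // sumr_ge0 // => i _; exact: sqr_ge0.
rewrite (@slice_int_div R d t g Y gs gp Ys Yp) in L1.
have Ig : 0 <= I t g by apply: slice_int_ge0 => // x; exact: powR_ge0.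
have IG : 0 <= I t Gd.
  apply: slice_int_ge0 => // x.
  by rewrite mulr_ge0 ?powR_ge0 // sumr_ge0 // => i _; exact: sqr_ge0.
have L3 : pi ^+ 2 * kap * I t (fun z => Nq z * g z) <=
   (al + 1) ^+ 2 * d%:R / kap * (d%:R + 1) * I t Gd + 4 * pi ^+ 2 * (d%:R + 1) * I t g.
  by move: L1 L2; move: (I t _) (I t _) (I t g) (I t Gd) (pi ^+ 2) => x1 x2 x3 x4 p; lra.
have pk : 0 < pi ^+ 2 * kap by rewrite mulr_gt0.
rewrite -(ler_pM2l pk); apply: le_trans L3 _.
pose c1 := (al + 1) ^+ 2 * d%:R * (d%:R + 1) / kap ^+ 2.
pose c2 := 4 * (d%:R + 1) / kap.
have c10 : 0 <= c1 by rewrite /c1 divr_ge0 ?sqr_ge0 // !mulr_ge0 ?sqr_ge0 ?addr_ge0 // ltW.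
have c20 : 0 <= c2 by rewrite /c2 divr_ge0 ?(ltW kap0) // mulr_ge0 // addr_ge0 // ltW.
have -> : (al + 1) ^+ 2 * d%:R / kap * (d%:R + 1) = kap * c1.
  by rewrite /c1; field; rewrite gt_eqF.
have -> : 4 * pi ^+ 2 * (d%:R + 1) = pi ^+ 2 * kap * c2.
  by rewrite /c2; move: (pi ^+ 2) => p; field; rewrite gt_eqF.
rewrite -[hardy_const]/(c1 + c2).
have h1 : kap * c1 * I t Gd <= pi ^+ 2 * kap * c1 * I t Gd.
  rewrite ler_wpM2r // ler_wpM2r // ler_peMl //; exact: ltW.
have h2 : 0 <= pi ^+ 2 * kap * c1 * I t g := mulr_ge0 (mulr_ge0 (ltW pk) c10) Ig.
have h3 : 0 <= pi ^+ 2 * kap * c2 * I t Gd := mulr_ge0 (mulr_ge0 (ltW pk) c20) IG.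
move: h1 h2 h3; move: (I t g) (I t Gd) (pi ^+ 2) => x y p; lra.
Qed.

(** As [q <= 1], [exp(-x) <= (1 + x)^(-q)] with [x = rho2 / a]: the Gaussian lies below a multiple
    of the Hardy weight, and the power of the width that is missing stands in front. *)
Let kern_le z : z.2 = t -> k z <= expR (- ((d%:R - 2 + kap) / 2) * t) * Nq z.
Proof.
move=> zt; rewrite /kern zt.
have X0 := kernX_ge0 z; rewrite /kernX zt in X0.
have NE : N z = expR t * (1 + rho2 z * expR (- t)).
  by rewrite mulrDr mulr1 mulrCA -expRD subrr expR0 mulr1 addrC.
have e1 : Nq z = expR (- q * t) * (1 + rho2 z * expR (- t)) `^ (- q).
  rewrite /Nq NE powRM ?expR_ge0 ?addr_ge0 //; congr (_ * _).
  by rewrite /powR gt_eqF ?expR_gt0 // expRK.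
rewrite e1 mulrA -expRD [X in X <= _]expRD.
have -> : - ((d%:R - 2 + kap) / 2) * t + - q * t = - (d%:R / 2) * t by rewrite /q; field.
rewrite ler_pM2l ?expR_gt0 // powRN expRN lef_pV2 ?posrE ?expR_gt0 //; last first.
  by rewrite powR_gt0 // ltr_pwDl.
apply: (@le_trans _ _ (1 + rho2 z * expR (- t))); last exact: expR_ge1Dx.
rewrite -[leRHS]powRr1 ?addr_ge0 // ler_powR ?lerDl // /q.
by rewrite gerBl divr_ge0 // ltW.
Qed.

Lemma hardy : J (fun y => k (y, t) * f y `^ (al + 1)) <=
  expR (- ((d%:R - 2 + kap) / 2) * t) * hardy_const *
  (J (fun y => f y `^ (al + 1)) + J (fun y => f y `^ (al - 1) * \sum_i 'D_(e_ R i) f y ^+ 2)).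
Proof.
have -> : J (fun y => f y `^ (al - 1) * \sum_i 'D_(e_ R i) f y ^+ 2) = I t Gd.
  apply: eq_int_Td => y; congr (_ * _); apply: eq_bigr => i _; congr (_ ^+ 2).
rewrite -mulrA; apply: le_trans (ler_wpM2l (expR_ge0 _) hardy_N).
rewrite -slice_intZ; last exact: smooth_mul.
apply: (@slice_int_le R d t (fun z => k z * g z)) => [||x].
- exact: smooth_mul (@smooth_kern R d) gs.
- exact: smooth_mul (@smooth_const R E _) (smooth_mul Nqs gs).
rewrite mulrA ler_wpM2r ?powR_ge0 //; exact: kern_le.
Qed.
End Hardy.

(** * Pointwise bounds of the density and of the value function *)

Section TimeShift.
Variables (R : realType) (d : nat).
Local Notation E := ('rV[R]_d * R)%type.
Variables (sg t0 : R).

(** Time is counted from [t0], backward for the density ([sg = -1]) and forward for the value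
    function ([sg = 1]), which gives both equations the same form. *)
Definition tshift (f : E -> R) (z : E) : R := f (z.1, t0 + sg * z.2).

Let A (z : E) : E := (z.1, sg * z.2).
Let Alin : linear A.
Proof. by move=> c x y; rewrite /A /=; congr pair; rewrite mulrDr mulrCA. Qed.
Let Abd z : `|A z| <= (1 + `|sg|) * `|z|.
Proof.
have h : 1 <= 1 + `|sg| by rewrite lerDl.
rewrite pair_normE ge_max /=; apply/andP; split.
  by rewrite (le_trans (norm_fst z)) // ler_peMl.
rewrite normrM mulrDl mul1r; apply: ler_wpDl => //.
by rewrite ler_wpM2l // norm_snd.
Qed.
Let AE f : tshift f = fun z => f (A z + (0, t0)).
Proof.
apply/funext => z; rewrite /tshift; congr f.
by rewrite -[RHS]/(z.1 + 0, sg * z.2 + t0) addr0 addrC.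
Qed.

Lemma smooth_tshift f : smooth f -> smooth (tshift f).
Proof. by rewrite AE; exact: smooth_affine. Qed.

Lemma tshift_dx f i z : smooth f -> 'D_(dx R i) (tshift f) z = tshift ('D_(dx R i) f) z.
Proof.
move=> fs; rewrite !AE (derive_affine _ Alin Abd _ _ fs); congr derive.
by rewrite /A /dx /= mulr0.
Qed.

Lemma tshift_Lap f z : smooth f -> Lap (tshift f) z = tshift (Lap f) z.
Proof.
move=> fs; apply: eq_bigr => i _.
have -> : 'D_(dx R i) (tshift f) = tshift ('D_(dx R i) f) by apply/funext => y; exact: tshift_dx.
exact: tshift_dx (smooth_D (dx R i) fs).
Qed.

Lemma tshift_dt f z : smooth f -> Dt (tshift f) z = sg * tshift (Dt f) z.
Proof.
move=> fs; rewrite /Dt !AE (derive_affine _ Alin Abd _ _ fs).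
have -> : A (dt R d) = \sum_(i < 1) sg *: dt R d.
  by rewrite big_ord1 /A /dt -[RHS]/(sg *: 0, sg * 1) scaler0.
by rewrite (derive_sumv (fun=> sg) (fun=> dt R d) (smooth_diff _ fs)) big_ord1.
Qed.

Lemma periodicE_tshift f : periodicE f -> periodicE (tshift f).
Proof.
move=> fp z i; rewrite /tshift -(fp (z.1, t0 + sg * z.2) i); congr f.
by rewrite -[RHS]/(z.1 + e_ R i, t0 + sg * z.2 + 0) -[(z + _).2]/(z.2 + 0) !addr0.
Qed.
End TimeShift.

Section Density.
Variables (R : realType) (d : nat).
Local Notation V := 'rV[R]_d.
Local Notation E := (V * R)%type.
Local Notation J := (@int_Td R d).
Local Notation I := (@slice_int R d).
Local Notation k := (@kern R d).
Let PJ := @int_Td_posint R d.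
Variables (al kap T KP : R).
Hypotheses (al0 : 0 < al) (kap0 : 0 < kap) (kap1 : kap <= 1) (d2 : 2 <= d%:R :> R) (T0 : 0 < T).
Let th : R := (d%:R - 2 + kap) / 2.
Let CH := hardy_const d al kap.
Let Ck : R := 2 * 4 ^+ d.
Let ck : R := 8^-1 ^+ d.
Let Ck0 : 0 < Ck. Proof. by rewrite mulr_gt0 // exprn_gt0. Qed.
Let ck0 : 0 < ck. Proof. by rewrite exprn_gt0 // invr_gt0. Qed.
Let th0 : 0 < th. Proof. by rewrite divr_gt0 // ltr_wpDl // subr_ge0. Qed.
Let CH0 : 0 < CH.
Proof.
have dd : 0 < d%:R :> R by rewrite (lt_le_trans _ d2).
rewrite /CH /hardy_const; apply: ltr_wpDl.
  by rewrite divr_ge0 ?sqr_ge0 // mulr_ge0 ?addr_ge0 ?(ltW dd) // mulr_ge0 ?sqr_ge0 // ltW.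
by rewrite divr_gt0 // mulr_gt0 // ltr_wpDl // ltW.
Qed.

Variable v : E -> R.
Hypotheses (vs : smooth v) (vp : periodicE v) (v0 : forall x t, 0 <= t <= T -> 0 < v (x, t)).
Definition dissipation t := J (fun x => v (x, t) `^ (al + 1)) +
  J (fun x => v (x, t) `^ (al - 1) * \sum_i 'D_(dx R i) v (x, t) ^+ 2).

Let w p t (y : V) := v (y + p, t).
Let ws p t : smooth (w p t).
Proof. exact: (smooth_shift p (smooth_slicel t vs)). Qed.
Let wp p t : periodicT (w p t).
Proof. by move=> x i; rewrite /w addrAC; exact: (periodicE_slice t vp). Qed.
Let w0 p t y : 0 <= t <= T -> 0 < w p t y. Proof. by move=> tT; exact: v0. Qed.

(** The dissipation is invariant under translation, so the same right side serves for a kernel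
    centred anywhere. *)
Lemma hardy_slice p s t : 0 <= s <= T -> t <= 0 ->
  J (fun y => k (y, t) * v (y + p, s) `^ (al + 1)) <= expR (- th * t) * CH * dissipation s.
Proof.
move=> sT t0; have h := hardy al0 kap0 kap1 d2 t0 (ws p s) (wp p s) (fun y => w0 p y sT).
apply: (le_trans h); rewrite -/th -/CH le_eqVlt; apply/orP; left; apply/eqP; congr (_ * _); congr (_ + _).
  have gs : smooth (fun x => v (x, s) `^ (al + 1)).
    by apply: smooth_powR (smooth_slicel s vs) _ => y; exact: v0.
  apply: (J_shift p gs) => x i; congr (_ `^ _); exact: (periodicE_slice s vp).
have g1 : smooth (fun x => v (x, s) `^ (al - 1)).
  by apply: smooth_powR (smooth_slicel s vs) _ => y; exact: v0.
have g2 : smooth (fun x => v (x, s) `^ (al - 1) * \sum_i 'D_(dx R i) v (x, s) ^+ 2).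
  apply: smooth_mul g1 _; apply: smooth_sum => i; under eq_fun do rewrite expr2.
  by apply: smooth_mul; exact: (smooth_slicel s (smooth_D (dx R i) vs)).
have g3 : periodicT (fun x => v (x, s) `^ (al - 1) * \sum_i 'D_(dx R i) v (x, s) ^+ 2).
  move=> x i; have -> : v (x + e_ R i, s) = v (x, s) := periodicE_slice s vp x i.
  congr (_ * _); apply: eq_bigr => j _; congr (_ ^+ 2).
  exact: (periodicE_slice s (periodicE_D (dx R j) vp)).
apply: (etrans _ (J_shift p g2 g3)).
apply: eq_int_Td => y; congr (_ * _); apply: eq_bigr => i _; congr (_ ^+ 2).
rewrite -(derive_slicel v (y + p) s (e_ R i)); exact: (derive_shiftE (fun x => v (x, s)) p).
Qed.

Variables (P Pd : R -> R).
Hypothesis PD : forall t : R, 0 <= t <= T -> is_derive t 1 P (Pd t).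
Hypothesis PdQ : forall t, 0 <= t <= T -> dissipation t <= Pd t.
Hypothesis PKP : P T - P 0 <= KP.

Lemma dissipation_ge0 t : 0 <= t <= T -> 0 <= dissipation t.
Proof.
move=> tT; have g c : smooth (fun x => v (x, t) `^ c).
  by apply: smooth_powR (smooth_slicel t vs) _ => y; exact: v0.
apply: addr_ge0.
  by apply: (posint_ge0 PJ) => [|x _]; [exact: smooth_cont|exact: powR_ge0].
apply: (posint_ge0 PJ) => [|x _].
  apply/smooth_cont/smooth_mul => //; apply: smooth_sum => i; under eq_fun do rewrite expr2.
  by apply: smooth_mul; exact: (smooth_slicel t (smooth_D (dx R i) vs)).
by rewrite mulr_ge0 ?powR_ge0 // sumr_ge0 // => i _; exact: sqr_ge0.
Qed.

Let Pmono s t : 0 <= s -> s <= t -> t <= T -> P s <= P t.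
Proof.
move=> s0 st tT; apply: (ndecr_deriv st (df := Pd)) => r /andP[r1 r2].
  by apply: PD; rewrite (le_trans s0) // (le_trans r2).
have rT : 0 <= r <= T by rewrite (le_trans s0) // (le_trans r2).
exact: le_trans (dissipation_ge0 rT) (PdQ rT).
Qed.

Let expR_htime s : 0 < s -> htime (ln (4 * pi ^+ 2 * s)) = s :> R.
Proof.
move=> s0; have q0 : 0 < 4 * pi ^+ 2 :> R by rewrite mulr_gt0 // exprn_gt0 // pi_gt0.
by apply: (mulfI (lt0r_neq0 q0)); rewrite htimeM lnK // posrE mulr_gt0.
Qed.

(** Below the level [lam] the first term suffices, above it the second. Only the mass above the
    level has to be paid for by dissipation. *)
Lemma le_level (x lam : R) : 0 < x -> 0 < lam -> x <= lam + lam `^ (- al) * x `^ (al + 1).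
Proof.
move=> w_gt0 l0; have [h|h] := lerP x lam.
  by rewrite ler_wpDr // mulr_ge0 // powR_ge0.
rewrite ler_wpDl ?(ltW l0) // powR_add // powRr1 ?(ltW w_gt0) // mulrA ler_peMl ?(ltW w_gt0) //.
rewrite powRN mulrC ler_pdivlMr ?powR_gt0 // mul1r.
by apply: ge0_ler_powR; rewrite ?nnegrE ?ltW.
Qed.

Section SupDensity.
Variables (be : 'I_d -> E -> R) (B M Mm : R) (x0 : V) (t0 : R).
Hypotheses (bes : forall i, smooth (be i)) (bep : forall i, periodicE (be i)) (B0 : 0 <= B).
Hypothesis veq : forall x t, 0 <= t <= T ->
  Dt v (x, t) = Lap v (x, t) + \sum_i 'D_(dx R i) (be i) (x, t).
Hypothesis beB : forall i x t, 0 <= t <= T -> `|be i (x, t)| <= B * v (x, t).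
Hypothesis t0T : 0 <= t0 <= T.
Hypothesis vM : forall x t, 0 <= t <= T -> v (x, t) <= M.
Hypothesis ME : v (x0, t0) = M.
Hypothesis vMm : forall x, v (x, 0) <= Mm.
(** Makes the radius [r = c5 / (1 + B)] so small that the two losses of [kernel_test] stay below
    [ck M / 32] and [ck M / 16]. *)
Let c5 := ck / (32 * (d%:R + 1) * Ck).
Let C6 := 2 * KP * (4 * pi ^+ 2) * (2 `^ th) * CH / Ck.
Definition sup_density_const := (16 * Ck / ck) `^ (al + 1) * (C6 * (c5^-1 `^ (d%:R + kap))) +
   (8 * Ck * Mm / ck) `^ (al + 1).

Let p : V := x0 - const_mx 2^-1.
Let W := tshift (-1) t0 v.
Let Ws : smooth W := smooth_tshift (-1) t0 vs.
Let M0 : 0 < M. Proof. by rewrite -ME; exact: v0. Qed.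
Let backT s : 0 <= s <= t0 -> 0 <= t0 + -1 * s <= T.
Proof.
move=> /andP[s0 st]; case/andP: t0T => _ tT; rewrite mulN1r subr_ge0 st /=.
by rewrite (le_trans _ tT) // gerBl.
Qed.

Let dR0 : 0 <= d%:R :> R. Proof. exact: ler0n. Qed.
Let ckCk : ck <= Ck.
Proof.
apply: (@le_trans _ _ 1).
  by rewrite exprn_ile1 ?invr_ge0 // invf_le1 // ler1n.
by rewrite /Ck mulr_ege1 ?ler1n // exprn_ege1 // ler1n.
Qed.
Let c50 : 0 < c5.
Proof. by rewrite divr_gt0 // !mulr_gt0 // ltr_wpDl. Qed.
Let r := c5 / (1 + B).
Let B1 : 0 < 1 + B. Proof. by rewrite ltr_pwDl. Qed.
Let r0 : 0 < r. Proof. by rewrite divr_gt0. Qed.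
Let c51 : c5 * (32 * (d%:R + 1) * Ck) = ck.
Proof. by rewrite /c5 divfK // gt_eqF // !mulr_gt0 // ltr_wpDl. Qed.
Let rB : r * (1 + B) = c5. Proof. by rewrite /r divfK // gt_eqF. Qed.
Let rCk : Ck * r <= ck / 32.
Proof.
have h1 : r <= c5 by rewrite -rB ler_peMr ?(ltW r0) // lerDl.
have h2 : c5 * Ck <= ck / 32.
  rewrite ler_pdivlMr // -c51.
  have -> : c5 * (32 * (d%:R + 1) * Ck) = c5 * Ck * 32 * (d%:R + 1) by ring.
  by rewrite ler_peMr ?lerDr //; exact: mulr_ge0 (ltW (mulr_gt0 c50 Ck0)) (ler0n R 32).
by rewrite (le_trans _ h2) // mulrC ler_wpM2r // ltW.
Qed.
Let rBCk : 2 * (d%:R * Ck * B) * r <= ck / 16.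
Proof.
have h1 : B * r <= c5 by rewrite -rB mulrC ler_wpM2l ?(ltW r0) // lerDr.
have -> : 2 * (d%:R * Ck * B) * r = 2 * d%:R * Ck * (B * r) by ring.
apply: (@le_trans _ _ (2 * d%:R * Ck * c5)).
  by rewrite ler_wpM2l // !mulr_ge0 // ltW.
rewrite ler_pdivlMr // -c51.
have -> : 2 * d%:R * Ck * c5 * 16 = (32 * Ck * c5) * d%:R by ring.
have -> : c5 * (32 * (d%:R + 1) * Ck) = (32 * Ck * c5) * (d%:R + 1) by ring.
rewrite ler_wpM2l ?lerDl //; exact: mulr_ge0 (mulr_ge0 (ler0n R 32) (ltW Ck0)) (ltW c50).
Qed.
Let r1 : r <= 1.
Proof.
rewrite -(ler_pM2l Ck0) mulr1 (le_trans rCk) // (le_trans _ ckCk) //.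
by rewrite ler_pdivrMr // ler_peMr ?(ltW ck0) // ler1n.
Qed.
Let tm := 2 * ln r.
Let tm0 : tm <= 0. Proof. by rewrite /tm pmulr_rle0 // ln_le0. Qed.
Let tm2 : expR (tm / 2) = r.
Proof. by rewrite /tm mulrAC divff ?mul1r ?lnK // posrE. Qed.

(** At every width up to [exp tm] the losses leave at least [1/4 - 1/32 - 1/16 >= 1/8] of [ck M]
    near the maximum point. *)
Let mass_lower t : t <= tm -> htime t <= t0 ->
  ck * M / 8 <= I t (fun z => k z * retime p W z).
Proof.
move=> ttm tt0; have t_0 : t <= 0 := le_trans ttm tm0.
have t00 : 0 < t0 := lt_le_trans (htime_gt0 t) tt0.
have zs : smooth (fun _ : E => 0 : R) := @smooth_const R E 0.
have be's i : smooth (tshift (-1) t0 (be i)) := smooth_tshift (-1) t0 (bes i).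
have be'p i : periodicE (tshift (-1) t0 (be i)) := @periodicE_tshift R d (-1) t0 _ (bep i).
have W0 x s : 0 <= s <= t0 -> 0 <= W (x, s) <= M.
  by move=> sT; have bT := backT sT; rewrite /W /tshift /= ltW ?v0 // vM.
have WE x s : 0 <= s <= t0 -> Dt W (x, s) + Lap W (x, s) =
    0 - \sum_i 'D_(dx R i) (tshift (-1) t0 (be i)) (x, s).
  move=> sT; rewrite (tshift_dt _ _ _ vs) (tshift_Lap _ _ _ vs) {1}/tshift /= veq ?backT //.
  have e : \sum_i 'D_(dx R i) (tshift (-1) t0 (be i)) (x, s) =
      \sum_i 'D_(dx R i) (be i) (x, t0 + -1 * s).
    by apply: eq_bigr => i _; exact: (tshift_dx (-1) t0 i (x, s) (bes i)).
  have fin (a b b' : R) : b' = b -> -1 * (a + b) + a = 0 - b' by move=> ->; ring.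
  exact: (fin _ _ _ e).
have beBM i x s : 0 <= s <= t0 -> `|tshift (-1) t0 (be i) (x, s)| <= B * M.
  move=> sT; apply: le_trans (beB i x (backT sT)) _.
  by rewrite ler_wpM2l // vM // backT.
have WM : W (x0, 0) = M by rewrite /W /tshift /= mulr0 addr0.
have := @kernel_test R d W (fun=> 0) (fun i => tshift (-1) t0 (be i)) x0 M B t0 Ws zs be's
  (@periodicE_tshift R d (-1) t0 _ vp) be'p B0 t00 W0 WE beBM WM (fun=> 0) (fun=> 0) 0 t t_0 tt0.
rewrite -/p -/ck -/Ck /test_mass => KT.
have et : expR (t / 2) <= r by rewrite -tm2 ler_expR ler_wpM2r // invr_ge0.
have et2 : expR t <= r.
  have -> : expR t = expR (t / 2) ^+ 2 by rewrite -expRM_natl; congr expR; field.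
  rewrite expr2 (le_trans _ et) // ler_piMr ?expR_ge0 //; exact: le_trans et r1.
have h1 : Ck * M * expR t <= ck * M / 32.
  rewrite mulrAC (mulrAC ck); apply: ler_wpM2r; first exact: ltW.
  by apply: le_trans rCk; rewrite ler_wpM2l // ltW.
have h2 : 2 * (d%:R * Ck * B * M) * expR (t / 2) <= ck * M / 16.
  have -> : 2 * (d%:R * Ck * B * M) * expR (t / 2) = 2 * (d%:R * Ck * B) * expR (t / 2) * M by ring.
  rewrite (mulrAC ck); apply: ler_wpM2r; first exact: ltW.
  by apply: le_trans rBCk; rewrite ler_wpM2l // !mulr_ge0 // ltW.
have cM : 0 <= ck * M by rewrite mulr_ge0 // ltW.
have : ck * M / 4 <= I t (fun z => k z * retime p W z) + (0 - 0) + Ck * M * expR t +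
    2 * (d%:R * Ck * B * M) * expR (t / 2).
  apply: KT => [s _|s _]; last exact: lexx.
  rewrite oppr_le0 mulr_ge0 ?(ltW (htime_gt0 _)) // (slice_int_eq (g := fun=> 0)) => [|x].
    by rewrite slice_int_const.
  by rewrite /retime mulr0.
by move: h1 h2 cM; move: (I t _) (Ck * M * _) (2 * _ * _) (ck * M) => x1 x2 x3 x4; lra.
Qed.

Let KP0 : 0 <= KP.
Proof.
have := Pmono (lexx 0) (ltW T0) (lexx T); rewrite -subr_ge0 => h; exact: le_trans h PKP.
Qed.

Let C60 : 0 <= C6.
Proof.
apply: divr_ge0 (ltW Ck0); apply: mulr_ge0 (ltW CH0); apply: mulr_ge0 (powR_ge0 _ _).
by apply: mulr_ge0; apply: mulr_ge0 => //; exact: sqr_ge0.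
Qed.
Let C70 : 0 <= C6 * (c5^-1 `^ (d%:R + kap)).
Proof. exact: mulr_ge0 C60 (powR_ge0 _ _). Qed.

Let retW y t : retime p W (y, t) = v (y + p, t0 + -1 * htime t).
Proof. by []. Qed.

Let kWs t : continuous (fun y => k (y, t) * retime p W (y, t)).
Proof. exact: (@slice_s R d _ t (smooth_mul (@smooth_kern R d) (smooth_retime p Ws))). Qed.

Let exp_ge1 : 1 <= (1 + B) `^ (d%:R + kap).
Proof.
rewrite -[leLHS](powRr0 (1 + B)) ler_powR ?lerDl //.
by rewrite addr_ge0 // ltW.
Qed.

Lemma sup_density : M `^ (al + 1) <= sup_density_const * (1 + B) `^ (d%:R + kap).
Proof.
have al1 : 0 <= al + 1 by rewrite addr_ge0 // ltW.
(* If [t0] lies in the initial layer, the kernel is followed back to time [0], where [v <= Mm]. *)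
have [tmt|tmt] := lerP t0 (htime tm).
  suff h : M <= 8 * Ck * Mm / ck.
    apply: (@le_trans _ _ ((8 * Ck * Mm / ck) `^ (al + 1))).
      by apply: ge0_ler_powR; rewrite ?nnegrE ?(ltW M0) // (le_trans (ltW M0)).
    rewrite -[leLHS]mulr1; apply: ler_pM => //; first exact: powR_ge0.
    by rewrite lerDr mulr_ge0 ?powR_ge0.
  have [t00|t00] := eqVneq t0 0.
    have MMm : M <= Mm by rewrite -ME t00.
    apply: (le_trans MMm); rewrite ler_pdivlMr //.
    have Mm0 : 0 <= Mm := le_trans (ltW M0) MMm.
    have := ler_wpM2l Mm0 ckCk; have : 0 <= Mm * Ck by rewrite mulr_ge0 // ltW.
    lra.
  have t0p : 0 < t0 by rewrite lt_neqAle eq_sym t00; case/andP: t0T.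
  pose t := ln (4 * pi ^+ 2 * t0).
  have ht : htime t = t0 := expR_htime t0p.
  have ttm : t <= tm.
    by rewrite -ler_expR -!htimeM ler_pM2l ?ht // mulr_gt0 // exprn_gt0 // pi_gt0.
  have := mass_lower ttm _; rewrite ht => /(_ (lexx _)) low.
  have up : I t (fun z => k z * retime p W z) <= Ck * Mm.
    apply: (@le_trans _ _ (I t (fun z => k z * Mm))).
      apply: slice_int_le => [||x].
      - exact: smooth_mul (@smooth_kern R d) (smooth_retime p Ws).
      - exact: smooth_mul (@smooth_kern R d) (@smooth_const R E Mm).
      by rewrite ler_wpM2l ?(ltW (kern_gt0 _)) // retW ht mulN1r subrr.
    have Mm0 : 0 <= Mm by rewrite (le_trans _ (vMm 0)) // ltW // v0 // lexx ltW.
    rewrite (slice_int_eq (g := fun z => Mm * k z)) => [|x]; last by rewrite mulrC.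
    rewrite slice_intZ; last exact: smooth_kern.
    by rewrite mulrC ler_wpM2r // kern_int_le // (le_trans ttm).
  rewrite ler_pdivlMr //; move: (le_trans low up); lra.
(* The mass below this level is at most [lam Ck = ck M / 16], half of what [mass_lower] provides;
   the other half lies above it. *)
pose lam := ck * M / (16 * Ck).
have lam0 : 0 < lam by rewrite divr_gt0 ?mulr_gt0.
have ML : M = 16 * Ck / ck * lam.
  by rewrite /lam; field; rewrite !gt_eqF.
(* Between the times [htime tm / 2] and [htime tm] the width is at least [exp tm / 2], whence
   [ln 2]. *)
pose Qm := Ck * lam `^ (al + 1) * expR (th * (tm - ln 2)) / CH.
have Qlow s : htime tm / 2 <= s <= htime tm -> Qm <= dissipation (t0 + -1 * s).
  move=> /andP[s1 s2]; have hm := htime_gt0 tm.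
  have s0 : 0 < s by rewrite (lt_le_trans _ s1) // divr_gt0.
  pose t := ln (4 * pi ^+ 2 * s).
  have ht : htime t = s := expR_htime s0.
  have q0 : 0 < 4 * pi ^+ 2 :> R by rewrite mulr_gt0 // exprn_gt0 // pi_gt0.
  have ttm : t <= tm by rewrite -ler_expR -!htimeM ler_pM2l // ht.
  have tlow : tm - ln 2 <= t.
    rewrite -ler_expR expRD expRN lnK ?posrE // -!htimeM ht.
    by rewrite -mulrA ler_pM2l.
  have st0 : s <= t0 by rewrite (le_trans s2) // ltW.
  have sT : 0 <= s <= t0 by rewrite ltW.
  have := mass_lower ttm _; rewrite ht => /(_ st0) low.
  have low2 : ck * M / 8 <= lam * Ck + lam `^ (- al) * J (fun y => k (y, t) * v (y + p, t0 + -1 * s) `^ (al + 1)).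
    apply: (le_trans low).
    have c1 : continuous (fun y => k (y, t) * v (y + p, t0 + -1 * s) `^ (al + 1)).
      apply: continuous_mul; first exact: (@slice_s R d _ t (@smooth_kern R d)).
      exact: (smooth_cont (@smooth_powR R V (w p _) (al + 1) (ws p _) (fun y => w0 p y (backT sT)))).
    have c2 : continuous (fun y => k (y, t)) := @slice_s R d _ t (@smooth_kern R d).
    apply: (@le_trans _ _ (J (fun y => lam * k (y, t) + lam `^ (- al) * (k (y, t) * v (y + p, t0 + -1 * s) `^ (al + 1))))).
      apply: (posint_le PJ) => [||y _]; first exact: kWs.
        by apply: continuous_add; apply: continuous_mul => //; exact: continuous_const.
      have -> : lam * k (y, t) + lam `^ (- al) * (k (y, t) * v (y + p, t0 + -1 * s) `^ (al + 1)) =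
         k (y, t) * (lam + lam `^ (- al) * v (y + p, t0 + -1 * s) `^ (al + 1)) by ring.
      rewrite ler_wpM2l ?(ltW (kern_gt0 _)) // retW ht le_level //.
      by apply: v0; exact: backT.
    rewrite (posint_add PJ); last 2 first.
    - by apply: continuous_mul => //; exact: continuous_const.
    - by apply: continuous_mul => //; exact: continuous_const.
    rewrite (posint_scale PJ) // (posint_scale PJ) // lerD2r ler_wpM2l ?(ltW lam0) //.
    by apply: kern_int_le; exact: le_trans ttm tm0.
  have hs := hardy_slice p (backT sT) (le_trans ttm tm0).
  have e1 : ck * M / 8 = 2 * (lam * Ck) by rewrite /lam; field; rewrite gt_eqF.
  have l1 : lam * Ck <= lam `^ (- al) * (expR (- th * t) * CH * dissipation (t0 + -1 * s)).
    have h2 := ler_wpM2l (powR_ge0 lam (- al)) hs.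
    by move: low2; rewrite e1; move: h2; move: (lam `^ (- al) * _) (lam `^ (- al) * _) => x y; lra.
  rewrite /Qm ler_pdivrMr // (powR_add al 1 lam0) powRr1 ?(ltW lam0) //.
  have la : 0 < lam `^ al := powR_gt0 al lam0.
  have l2 := ler_wpM2l (ltW la) l1.
  have e2 : lam `^ al * (lam `^ (- al) * (expR (- th * t) * CH * dissipation (t0 + -1 * s))) =
     expR (- th * t) * CH * dissipation (t0 + -1 * s).
    by rewrite mulrA powRN mulfV ?mul1r // gt_eqF.
  rewrite e2 in l2.
  have l3 := ler_wpM2l (expR_ge0 (th * t)) l2.
  have e3 : expR (th * t) * (expR (- th * t) * CH * dissipation (t0 + -1 * s)) =
     dissipation (t0 + -1 * s) * CH.
    by rewrite !mulrA -expRD (mulNr th t) subrr expR0 mul1r mulrC.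
  rewrite e3 in l3; apply: le_trans l3.
  have -> : expR (th * t) * (lam `^ al * (lam * Ck)) = Ck * (lam `^ al * lam) * expR (th * t) by ring.
  rewrite ler_wpM2l ?ler_expR ?ler_wpM2l ?(ltW th0) //.
  exact: mulr_ge0 (ltW Ck0) (mulr_ge0 (ltW la) (ltW lam0)).
have sm := htime_gt0 tm.
have Qm0 : 0 <= Qm.
  by apply: divr_ge0 (ltW CH0); apply: mulr_ge0 (expR_ge0 _); exact: mulr_ge0 (ltW Ck0) (powR_ge0 _ _).
(* The rate of [P] is at least [Qm] during a time [htime tm / 2], while its total increase is at
   most [KP]; this bounds [lam], hence [M]. *)
have inc : Qm * (htime tm / 2) <= KP.
  pose sa := t0 - htime tm; pose sb := t0 - htime tm / 2.
  have ab : sa <= sb by rewrite lerD2l lerN2 ler_pdivrMr // ler_peMr ?ler1n // ltW.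
  have sa0 : 0 <= sa by rewrite subr_ge0 ltW.
  have sbT : sb <= T.
    by case/andP: t0T => _ tT; apply: le_trans tT; rewrite gerBl divr_ge0 // ltW.
  have inT s : sa <= s <= sb -> 0 <= s <= T.
    by move=> /andP[h1 h2]; rewrite (le_trans sa0) // (le_trans h2).
  have PDs (s : R) : sa <= s <= sb -> is_derive s 1 P (Pd s) by move=> sab; apply: PD; exact: inT.
  have [s sab e] := mean_value ab PDs.
  have e2 : sb - sa = htime tm / 2 by rewrite /sa /sb; field.
  have sQ : Qm <= Pd s.
    apply: le_trans (PdQ (inT s sab)).
    have -> : s = t0 + -1 * (t0 - s) by ring.
    by apply: Qlow; case/andP: sab; rewrite /sa /sb => h1 h2; apply/andP; split; lra.
  have P1 : P 0 <= P sa by apply: Pmono => //; exact: le_trans ab sbT.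
  have P2 : P sb <= P T by apply: Pmono => //; exact: le_trans sa0 ab.
  have h : Qm * (htime tm / 2) <= Pd s * (htime tm / 2) by rewrite ler_wpM2r // divr_ge0 // ltW.
  by move: h e; rewrite e2; move: P1 P2 PKP; lra.
have lamC : lam `^ (al + 1) <= C6 * (c5^-1 `^ (d%:R + kap)) * (1 + B) `^ (d%:R + kap).
  have q0 : 0 < 4 * pi ^+ 2 :> R by rewrite mulr_gt0 // exprn_gt0 // pi_gt0.
  have rI : c5^-1 `^ (d%:R + kap) * (1 + B) `^ (d%:R + kap) = expR (- (th + 1) * tm).
    rewrite -powRM ?invr_ge0 ?(ltW c50) ?(ltW B1) //.
    have -> : c5^-1 * (1 + B) = r^-1.
      by rewrite -rB invfM -mulrA mulVf ?mulr1 // gt_eqF.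
    by rewrite /powR gt_eqF ?invr_gt0 // lnV ?posrE // /tm /th; congr expR; field.
  have two : expR (th * (tm - ln 2)) = (2 `^ th)^-1 * expR (th * tm).
    by rewrite mulrBr expRD expRN mulrC /powR gt_eqF.
  have t2 : 0 < 2 `^ th :> R by rewrite powR_gt0.
  rewrite -mulrA rI mulNr expRN ler_pdivlMr ?expR_gt0 //.
  have -> : expR ((th + 1) * tm) = expR (th * tm) * (4 * pi ^+ 2 * htime tm).
    by rewrite htimeM -expRD; congr expR; ring.
  move: inc; rewrite /Qm two /C6 => inc.
  rewrite [leRHS](_ : _ = KP * (2 * (4 * pi ^+ 2) * 2 `^ th * CH / Ck)); last by ring.
  have c0 : 0 <= 2 * (4 * pi ^+ 2) * 2 `^ th * CH / Ck.
    apply: divr_ge0 (ltW Ck0); apply: mulr_ge0 (ltW CH0); apply: mulr_ge0 (ltW t2).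
    by apply: mulr_ge0 => //; exact: ltW.
  apply: le_trans (ler_wpM2r c0 inc); rewrite le_eqVlt; apply/orP; left; apply/eqP.
  have n1 := lt0r_neq0 Ck0; have n2 := lt0r_neq0 CH0; have n3 := lt0r_neq0 t2.
  move: n1 n2 n3; move: (2 `^ th) (expR _) (lam `^ _) (htime tm) (pi ^+ 2) CH Ck => a1 a2 a3 a4 a5 a6 a7 n1 n2 n3.
  by field; rewrite ?n1 ?n2 ?n3.
rewrite {1}ML powRM ?(ltW lam0) //; last by rewrite divr_ge0 // ?mulr_ge0 // ltW.
have c0 := powR_ge0 (16 * Ck / ck) (al + 1).
have := ler_wpM2l c0 lamC => h; apply: (le_trans h).
rewrite /sup_density_const [leLHS](_ : _ = (16 * Ck / ck) `^ (al + 1) *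
  (C6 * c5^-1 `^ (d%:R + kap)) * (1 + B) `^ (d%:R + kap)); last by ring.
by rewrite ler_wpM2r ?powR_ge0 // lerDl powR_ge0.
Qed.
End SupDensity.

Section SupValue.
Variables (eta : V -> R) (eps : R) (u : E -> R) (C0 U Ku : R).
Hypotheses (etaP : mollifier eta) (eps0 : 0 < eps) (thal : th * al < 1).
Local Notation S := (mconv eta eps).
Hypotheses (us : smooth u) (up : periodicE u) (C00 : 0 <= C0).
Hypothesis ulow : forall x t, 0 <= t <= T -> - C0 <= u (x, t).
Hypothesis uT : forall x, u (x, T) <= U.
Hypothesis uKu : forall t, 0 <= t <= T -> I t (fun z => u z + C0) <= Ku.
Hypothesis ueq : forall x t, 0 <= t <= T ->
  - S (fun y => v (y, t) `^ al) x <= Dt u (x, t) + Lap u (x, t).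
(** The factor of the primitive of [htime t] times [Ck exp(- th al t)], the second term of
    [coupling_test]; the condition [th al < 1] makes this primitive bounded towards [-oo]. *)
Let C9 := Ck / (4 * pi ^+ 2 * (1 - th * al)).
(** The logarithm of the width at which the loss [Ck M exp t] equals half of [ck M / 4]. *)
Let ts := ln (ck / (8 * Ck)).
Definition sup_value_const :=
  8 / ck * (expR (- (d%:R / 2) * ts) * Ku + Ck * (U + C0) + CH * KP + C9) + (U + C0).

Let vas t c : 0 <= t <= T -> smooth (fun x => v (x, t) `^ c).
Proof. by move=> tT; apply: smooth_powR (smooth_slicel t vs) _ => y; exact: v0. Qed.

(** The mollification becomes an average over translates. Young's inequality with parameter
    [exp(th t)] cancels the Hardy factor, so that the dissipation enters with a constant
    coefficient; the rest is of order [exp(- th al t)]. *)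
Lemma coupling_test p s t : 0 <= s <= T -> t <= 0 ->
  J (fun y => k (y, t) * S (fun x => v (x, s) `^ al) (y + p)) <=
  CH * dissipation s + Ck * expR (- (th * al) * t).
Proof.
move=> sT t0.
have kc : continuous (fun y => k (y, t)) := @slice_s R d _ t (@smooth_kern R d).
have vc : continuous (fun x => v (x, s) `^ al) := smooth_cont (vas al sT).
have vpc (q : V) : continuous (fun x : V => v (x + q, s) `^ al) := continuous_compose vc (@cont_shiftc R V q).
have -> : J (fun y => k (y, t) * S (fun x => v (x, s) `^ al) (y + p)) =
    J (fun y => k (y, t) * S (fun x => v (x + p, s) `^ al) y).
  apply: eq_int_Td => y; congr (_ * _); rewrite !(mconvE etaP eps0).
  by congr window; apply/funext => x; rewrite addrAC.
rewrite (int_mconv etaP eps0 (vpc p) kc).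
set B := _ + _.
have bnd y : J (fun x => k (x, t) * v (x - y + p, s) `^ al) <= B.
  pose e := expR (th * t).
  have e0 : 0 < e := expR_gt0 _.
  have c1 : continuous (fun x => k (x, t) * v (x + (p - y), s) `^ (al + 1)).
    apply: continuous_mul => //.
    exact: continuous_compose (smooth_cont (vas (al + 1) sT)) (@cont_shiftc R V (p - y)).
  apply: (@le_trans _ _ (J (fun x => e * (k (x, t) * v (x + (p - y), s) `^ (al + 1)) + e `^ (- al) * k (x, t)))).
    apply: (posint_le PJ) => [||x _].
    - apply: continuous_mul => //.
      by have := vpc (p - y); under eq_fun do rewrite addrA addrAC.
    - by apply: continuous_add; apply: continuous_mul => //; exact: continuous_const.
    have -> : x - y + p = x + (p - y) by rewrite addrA addrAC.
    have -> : e * (k (x, t) * v (x + (p - y), s) `^ (al + 1)) + e `^ (- al) * k (x, t) =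
      k (x, t) * (e * v (x + (p - y), s) `^ (al + 1) + e `^ (- al)) by ring.
    by rewrite ler_wpM2l ?(ltW (kern_gt0 _)) // powR_young ?v0 // ltW.
  rewrite (posint_add PJ); last 2 first.
  - by apply: continuous_mul => //; exact: continuous_const.
  - by apply: continuous_mul => //; exact: continuous_const.
  rewrite (posint_scale PJ) // (posint_scale PJ) //; apply: lerD.
    apply: le_trans (ler_wpM2l (ltW e0) (hardy_slice (p - y) sT t0)) _.
    by rewrite !mulrA /e -expRD (mulNr th t) subrr expR0 mul1r.
  have -> : e `^ (- al) = expR (- (th * al) * t).
    by rewrite /e /powR gt_eqF ?expR_gt0 // expRK; congr expR; ring.
  by rewrite mulrC ler_wpM2r ?expR_ge0 // kern_int_le.
have PW := window_posint d eps0.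
have etc := smooth_cont (et_smooth eps etaP).
have Jc : continuous (fun y : V => J (fun x : V => k (x, t) * v (x - y + p, s) `^ al)).
  have c2 : continuous (fun q : V * V => k (q.2, t) * v (q.2 - q.1 + p, s) `^ al).
    apply: continuous_mul; first by apply: (continuous_compose kc); exact: cont_snd.
    apply: (continuous_compose (vpc p)) => q; apply: cvgB; [exact: cvg_snd|exact: cvg_fst].
  exact: (@posint_cont R V _ J PJ V _ c2).
apply: (@le_trans _ _ (window eps (fun y => eta_eps eta eps y * B))).
  apply: (posint_le PW) => [||y _]; first exact: continuous_mul.
    by apply: continuous_mul => //; exact: continuous_const.
  by rewrite ler_wpM2l // (et_ge0 etaP eps0).
by rewrite (posint_scaler PW) // (window_et etaP eps0) mul1r.
Qed.

Lemma sup_value x t : 0 <= t <= T -> u (x, t) + C0 <= sup_value_const.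
Proof.
move=> tT.
have [x0 [t0 [t0T uM]]] := torus_max (ltW T0) (smooth_cont us) up.
apply: (@le_trans _ _ (u (x0, t0) + C0)); first by rewrite lerD2r uM.
set M := _ + C0.
have M0 : 0 <= M by rewrite /M -lerBlDr sub0r ulow.
have TT : 0 <= T <= T by rewrite lexx ltW.
have UC : 0 <= U + C0.
  by apply: (@le_trans _ _ (u (0, T) + C0)); [rewrite -lerBlDr sub0r ulow|rewrite lerD2r].
have KP0 : 0 <= KP.
  by have := Pmono (lexx 0) (ltW T0) (lexx T); rewrite -subr_ge0 => h; exact: le_trans h PKP.
have Ku0 : 0 <= Ku.
  apply: le_trans (uKu TT); apply: slice_int_ge0 => [|y]; last by rewrite -lerBlDr sub0r ulow.
  exact: smooth_add us (@smooth_const R E C0).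
have q0 : 0 < 4 * pi ^+ 2 :> R by rewrite mulr_gt0 // exprn_gt0 // pi_gt0.
have C90 : 0 <= C9 by rewrite divr_ge0 ?(ltW Ck0) // mulr_ge0 ?(ltW q0) // subr_ge0 ltW.
have e0 : 0 <= expR (- (d%:R / 2) * ts) * Ku by rewrite mulr_ge0 ?expR_ge0.
have cUC : 0 <= Ck * (U + C0) by rewrite mulr_ge0 // ltW.
have cKP : 0 <= CH * KP by rewrite mulr_ge0 // ltW.
have c8 : 0 <= 8 / ck by rewrite divr_ge0 // ltW.
have [t0E|t0E] := eqVneq t0 T.
  rewrite /sup_value_const; apply: ler_wpDl; first by rewrite mulr_ge0 // !addr_ge0.
  by rewrite /M t0E lerD2r.
case/andP: (t0T) => t00 t0T'.
have S0 : 0 < T - t0 by rewrite subr_gt0 lt_neqAle t0E.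
have fT s : 0 <= s <= T - t0 -> 0 <= t0 + 1 * s <= T.
  by move=> /andP[s0 s1]; rewrite mul1r addr_ge0 //= -lerBrDl.
pose uC (z : E) := u z + C0.
have uCs : smooth uC := smooth_add us (@smooth_const R E C0).
have uCp : periodicE uC by move=> z i; rewrite /uC up.
pose h0 (z : E) := Dt u z + Lap u z.
have h0s : smooth h0 := smooth_add (smooth_D (dt R d) us) (smooth_Lap us).
pose W := tshift 1 t0 uC; pose h := tshift 1 t0 h0.
have Ws : smooth W := smooth_tshift 1 t0 uCs.
have hs : smooth h := smooth_tshift 1 t0 h0s.
have Wp : periodicE W := @periodicE_tshift R d 1 t0 _ uCp.
have W0 y s : 0 <= s <= T - t0 -> 0 <= W (y, s) <= M.
  move=> sT; rewrite /W /tshift /uC /= lerD2r uM ?fT // andbT.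
  by rewrite -lerBlDr sub0r ulow // fT.
have zs (i : 'I_d) : smooth (fun _ : E => 0 : R) := @smooth_const R E 0.
have zp (i : 'I_d) : periodicE (fun _ : E => 0 : R) by [].
have DuC z : Dt uC z = Dt u z.
  apply: derive_val_eq; apply: is_derive_fun (is_derive_add (smooth_is_derive z (dt R d) us)
    (is_derive_const C0 z (dt R d))) _ _ => //; by rewrite addr0.
have WE y s : 0 <= s <= T - t0 -> Dt W (y, s) + Lap W (y, s) =
    h (y, s) - \sum_(i < d) 'D_(dx R i) (fun _ : E => 0 : R) (y, s).
  move=> sT; rewrite big1 => [|i _]; last first.
    by apply: derive_val_eq; exact: is_derive_const.
  rewrite (tshift_dt _ _ _ uCs) (tshift_Lap _ _ _ uCs) mul1r subr0 /h /h0 /tshift /= DuC.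
  by rewrite (Lap_add _ us (@smooth_const R E C0)) Lap_const addr0.
have zB (i : 'I_d) y s : 0 <= s <= T - t0 -> `|(fun _ : E => 0 : R) (y, s)| <= 0 * M.
  by rewrite normr0 mul0r.
have WM : W (x0, 0) = M by rewrite /W /tshift /= mulr0 addr0.
pose p : V := x0 - const_mx 2^-1.
have kWsm : smooth (fun z : E => k z * retime p W z) := smooth_mul (@smooth_kern R d) (smooth_retime p Ws).
(* The first term pays for the dissipation in [coupling_test] by the increase of [P], the second
   compensates the remaining power of the width. *)
pose Ph (t1 : R) := CH * P (t0 + 1 * htime t1) + C9 * expR ((1 - th * al) * t1).
pose Phd (t1 : R) := CH * (Pd (t0 + 1 * htime t1) * htime t1) +
   C9 * (expR ((1 - th * al) * t1) * (1 - th * al)).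
have KT t1 : t1 <= 0 -> htime t1 <= T - t0 ->
   ck * M / 4 <= I t1 (fun z => k z * retime p W z) + (Ph t1 - CH * P t0) + Ck * M * expR t1.
  move=> t10 t1S.
  have := @kernel_test R d W h (fun _ _ => 0) x0 M 0 (T - t0) Ws hs zs Wp zp (lexx 0) S0 W0 WE zB WM
    Ph Phd (CH * P t0) t1 t10 t1S.
  rewrite -/p -/ck -/Ck /test_mass mulr0 mul0r mulr0 mul0r addr0; apply.
  - move=> s st1; have sS : 0 <= htime s <= T - t0.
      by rewrite (ltW (htime_gt0 s)) (le_trans (htime_mono st1)).
    have d1 : is_derive s 1 (fun s : R => t0 + 1 * htime s) (htime s).
      apply: is_derive_fun (is_derive_add (is_derive_const t0 s 1) (is_derive_lmul 1 (htime_derive s))) _ _ => //.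
      by rewrite add0r mul1r.
    have d2' : is_derive s 1 (fun s : R => expR ((1 - th * al) * s)) (expR ((1 - th * al) * s) * (1 - th * al)).
      apply: is_derive_fun (is_derive_compR (is_derive_expR _)
        (is_derive_lmul (1 - th * al) (is_derive_idR s))) _ _ => //; by rewrite mulr1.
    exact: is_derive_add (is_derive_lmul CH (@is_derive_compR R P (fun s => t0 + 1 * htime s) s _ _ (PD (fT _ sS)) d1)) (is_derive_lmul C9 d2').
  - move=> s st1; have sS : 0 <= htime s <= T - t0.
      by rewrite (ltW (htime_gt0 s)) (le_trans (htime_mono st1)).
    have ct := coupling_test p (fT _ sS) (le_trans st1 t10).
    have ge : - J (fun y => k (y, s) * S (fun x => v (x, t0 + 1 * htime s) `^ al) (y + p)) <=
        I s (fun z => k z * retime p h z).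
      have c1 : continuous (fun y => k (y, s) * S (fun x => v (x, t0 + 1 * htime s) `^ al) (y + p)).
        apply: continuous_mul; first exact: (@slice_s R d _ s (@smooth_kern R d)).
        apply: (continuous_compose (mconv_cont etaP eps0 (smooth_cont (vas al (fT _ sS))))).
        exact: (@cont_shiftc R V p).
      rewrite -(posint_opp PJ c1); apply: (posint_le PJ) => [||y _].
      - exact: continuous_opp.
      - exact: (@slice_s R d _ s (smooth_mul (@smooth_kern R d) (smooth_retime p hs))).
      by rewrite -mulrN ler_wpM2l ?(ltW (kern_gt0 _)) // ueq // fT.
    have c9 : C9 * (expR ((1 - th * al) * s) * (1 - th * al)) = htime s * (Ck * expR (- (th * al) * s)).
      have n1 : 1 - th * al != 0 by rewrite gt_eqF // subr_gt0.
      have -> : (1 - th * al) * s = s + (- (th * al) * s) by ring.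
      rewrite /C9 expRD /htime; have pn : pi != 0 :> R by rewrite gt_eqF ?pi_gt0.
      move: n1 pn; move: (1 - th * al) pi Ck (expR s) (expR (- (th * al) * s)) => a1 q c a2 a3 n1 pn.
      by field; rewrite ?n1 ?pn.
    rewrite /Phd c9; have hs0 := ltW (htime_gt0 s).
    have PdQ' := ler_wpM2l (ltW CH0) (PdQ (fT _ sS)).
    have l1 : - (CH * Pd (t0 + 1 * htime s) + Ck * expR (- (th * al) * s)) <= I s (fun z => k z * retime p h z).
      by apply: le_trans ge; rewrite lerN2 (le_trans ct) // lerD2r.
    have := ler_wpM2l hs0 l1.
    by move: (htime s) (I s _) (Pd _) (Ck * _) => a1 a2 a3 a4; lra.
  - move=> s st1; have sS : 0 <= htime s <= T - t0.
      by rewrite (ltW (htime_gt0 s)) (le_trans (htime_mono st1)).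
    apply: ler_wpDr; first by rewrite mulr_ge0 ?expR_ge0.
    rewrite ler_wpM2l ?(ltW CH0) //; apply: Pmono => //; first by rewrite lerDl mul1r (ltW (htime_gt0 s)).
    by case/andP: (fT _ sS).
have Phb t1 : t1 <= 0 -> htime t1 <= T - t0 -> Ph t1 - CH * P t0 <= CH * KP + C9.
  move=> t10 t1S; have sS : 0 <= htime t1 <= T - t0 by rewrite (ltW (htime_gt0 t1)).
  have h1 : P (t0 + 1 * htime t1) <= P T.
    by case/andP: (fT _ sS) => g1 g2; apply: Pmono.
  have h2 : P 0 <= P t0 by apply: Pmono.
  have h3 : expR ((1 - th * al) * t1) <= 1.
    by rewrite -[leRHS]expR0 ler_expR mulr_ge0_le0 // subr_ge0 ltW.
  have h4 := ler_wpM2l C90 h3.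
  have h5 : CH * (P (t0 + 1 * htime t1) - P t0) <= CH * KP.
    rewrite ler_wpM2l ?(ltW CH0) //; move: h1 h2 PKP; lra.
  by move: h4 h5; rewrite /Ph; move: (C9 * _) (P _) (P t0) => a1 a2 a3; lra.
have ets : expR ts = ck / (8 * Ck) by rewrite /ts lnK // posrE divr_gt0 // mulr_gt0.
have ts0 : ts <= 0.
  rewrite -ler_expR expR0 ets ler_pdivrMr ?mulr_gt0 // mul1r.
  have : ck <= 1 by rewrite exprn_ile1 ?invr_ge0 // invf_le1 // ler1n.
  have : 1 <= Ck by rewrite mulr_ege1 ?ler1n // exprn_ege1 // ler1n.
  lra.
have fin t1 : t1 <= ts -> htime t1 <= T - t0 ->
   I t1 (fun z => k z * retime p W z) <= expR (- (d%:R / 2) * ts) * Ku + Ck * (U + C0) ->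
   M <= sup_value_const.
  move=> t1s t1S h1; have t10 := le_trans t1s ts0.
  have h2 := KT t1 t10 t1S; have h3 := Phb t1 t10 t1S.
  have h4 : Ck * M * expR t1 <= ck * M / 8.
    have : Ck * M * expR t1 <= Ck * M * expR ts.
      by rewrite ler_wpM2l ?ler_expR // mulr_ge0 // ltW.
    rewrite ets; have -> : Ck * M * (ck / (8 * Ck)) = ck * M / 8 by field; rewrite gt_eqF.
    by [].
  have h5 : ck * M / 8 <= expR (- (d%:R / 2) * ts) * Ku + Ck * (U + C0) + CH * KP + C9.
    by move: h1 h2 h3 h4; move: (I t1 _) (Ph t1) (Ck * M * _) (expR _ * Ku) => a1 a2 a3 a4; lra.
  rewrite /sup_value_const; apply: ler_wpDr => //.
  have -> : M = 8 / ck * (ck * M / 8) by field; rewrite gt_eqF.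
  by rewrite ler_wpM2l.
(* If the final time is far enough, the kernel of width [exp ts] is bounded and the mean of [u]
   concludes; otherwise the kernel reaches time [T], where [u <= U]. *)
have [big|small] := lerP (htime ts) (T - t0).
  apply: (fin ts) => //; apply: ler_wpDr => //.
  have sS : 0 <= htime ts <= T - t0 by rewrite (ltW (htime_gt0 ts)).
  have kle y : k (y, ts) <= expR (- (d%:R / 2) * ts).
    by rewrite /kern ler_expR /= gerBl mulr_ge0 ?expR_ge0 // rho2_ge0.
  have retW y : retime p W (y, ts) = uC (y + p, t0 + 1 * htime ts) by [].
  have uw : smooth (fun y => uC (y, t0 + 1 * htime ts)) := smooth_slicel _ uCs.
  apply: (@le_trans _ _ (J (fun y => expR (- (d%:R / 2) * ts) * uC (y + p, t0 + 1 * htime ts)))).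
    apply: (posint_le PJ) => [||y _].
    - exact: (@slice_s R d _ ts kWsm).
    - apply: continuous_mul; first exact: continuous_const.
      exact: smooth_cont (smooth_shift p uw).
    by rewrite retW ler_wpM2r // -lerBlDr sub0r ulow // fT.
  rewrite (posint_scale PJ); last exact: smooth_cont (smooth_shift p uw).
  rewrite ler_wpM2l ?expR_ge0 //.
  apply: le_trans (uKu (fT _ sS)); rewrite le_eqVlt; apply/orP; left; apply/eqP.
  exact: (J_shift p uw (periodicE_slice _ uCp)).
pose t1 := ln (4 * pi ^+ 2 * (T - t0)).
have ht : htime t1 = T - t0 := expR_htime S0.
apply: (fin t1); [|by rewrite ht|].
  by rewrite -ler_expR -!htimeM ler_pM2l // ht ltW.
have t1s : t1 <= ts by rewrite -ler_expR -!htimeM ler_pM2l // ht ltW.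
apply: ler_wpDl => //.
apply: (@le_trans _ _ (I t1 (fun z => (U + C0) * k z))).
  apply: slice_int_le => [||y].
  - exact: kWsm.
  - exact: smooth_mul (@smooth_const R E _) (@smooth_kern R d).
  rewrite mulrC ler_wpM2r ?(ltW (kern_gt0 _)) // /retime /W /tshift /= ht.
  have -> : t0 + 1 * (T - t0) = T by ring.
  by rewrite /uC lerD2r.
rewrite slice_intZ; last exact: smooth_kern.
by rewrite mulrC ler_wpM2r // kern_int_le // (le_trans t1s).
Qed.
End SupValue.
End Density.

(** * Gradient bound *)

Section GradientStep.
Variables (R : realType) (d : nat).
Local Notation V := 'rV[R]_d.
Local Notation E := (V * R)%type.

Lemma enorm_le (p : V) (K : R) : 0 <= K -> (forall i, `|p 0 i| <= K) -> enorm p <= d%:R * K.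
Proof.
move=> K0 pK; have dK : 0 <= d%:R * K by rewrite mulr_ge0.
rewrite -[leRHS]ger0_norm // -sqrtr_sqr ler_sqrt ?sqr_ge0 //.
apply: (@le_trans _ _ (\sum_(i < d) K ^+ 2)).
  by apply: ler_sum => i _; rewrite -real_normK ?num_real // ler_sqr ?nnegrE.
rewrite sumr_const card_ord -[X in X <= _]mulr_natl exprMn.
apply: ler_wpM2r; first exact: sqr_ge0.
by rewrite -natrX ler_nat; case: (d) => // n; rewrite leq_pmull.
Qed.

(** If this failed, [increment_bound] would apply with slope [K / 2], and the derivative along [e]
    at [(x0, t0)] would be at most [K / 2] instead of [K]. *)
Lemma gradient_step (u F : E -> R) (H : V -> V -> R) (T K S Fm HM G : R) i0 x0 t0 :
  0 < T ->
  smooth u -> periodicE u -> smooth (fun z : (V * V)%type => H z.1 z.2) ->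
  (forall x t, 0 <= t <= T -> - Dt u (x, t) + H x (Dx u (x, t)) = Lap u (x, t) + F (x, t)) ->
  0 < K -> 0 < S -> 4 * G <= K -> 0 <= t0 <= T -> `|'D_(dx R i0) u (x0, t0)| = K ->
  (forall x y t, 0 <= t <= T -> u (y, t) - u (x, t) <= S) ->
  (forall x, `|'D_(dx R i0) u (x, T)| <= G) ->
  (forall x t, 0 <= t <= T -> 0 <= F (x, t) <= Fm) ->
  (forall y x t, 0 <= t <= T -> `|DxH H y (Dx u (x, t)) 0 i0| <= HM) ->
  K ^+ 2 / (4 * S) <= Fm + HM * (4 * S / K).
Proof.
move=> T0 us up Hs HJ K0 S0 GK t0T DK osc term FF HMP; rewrite leNgt; apply/negP => lt.
have [sg [sg2 sgn sgD]] : exists sg : R, [/\ sg ^+ 2 = 1, `|sg| = 1 &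
    sg * 'D_(dx R i0) u (x0, t0) = K].
  have [D0|D0] := lerP 0 ('D_(dx R i0) u (x0, t0)).
    by exists 1; rewrite expr1n normr1 mul1r -DK ger0_norm.
  by exists (-1); rewrite sqrrN expr1n normrN normr1 mulN1r -DK ltr0_norm.
(* At the distance [r0] a line of slope [K / 4] reaches the oscillation bound [S]. Then
   [b r0 = K / 4], and [4 b] is the left side of the conclusion. *)
pose e := sg *: e_ R i0; pose r0 := 4 * S / K; pose b := K ^+ 2 / (16 * S).
have Kn : K != 0 by rewrite gt_eqF.
have Sn : S != 0 by rewrite gt_eqF.
have r00 : 0 < r0 by rewrite divr_gt0 ?mulr_gt0.
have b0 : 0 <= b by rewrite divr_ge0 ?sqr_ge0 // mulr_ge0 // ltW.
have br : b * r0 <= K / 2.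
  have -> : b * r0 = K / 4 by rewrite /b /r0; field; rewrite Kn Sn.
  by lra.
have Sr : S <= K / 2 / 2 * r0.
  by rewrite le_eqVlt /r0; apply/orP; left; apply/eqP; field.
have HM0 : 0 <= HM by exact: le_trans (normr_ge0 _) (HMP x0 x0 t0 t0T).
have derE x t : 'D_(e, 0) u (x, t) = sg * 'D_(dx R i0) u (x, t).
  have -> : (e, 0) = sg *: dx R i0 :> E by rewrite /dx -[RHS]/(e, sg * 0) mulr0.
  by rewrite (deriveE _ (smooth_diff _ us)) (deriveE _ (smooth_diff _ us)) linearZ.
have lineE x t h : (x, t) + h *: (e, 0) = (x + h *: e, t) :> E.
  by rewrite -[LHS]/(x + h *: e, t + h * 0) mulr0 addr0.
have osc' x h t : 0 <= t <= T -> u (x + h *: e, t) - u (x, t) <= S by exact: osc.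
have term' x h : 0 <= h -> u (x + h *: e, T) - u (x, T) <= K / 2 / 2 * h.
  move=> h0; have [s _] := mean_value_line (x, T) (fun y => @smooth_derivable R E u y (e, 0) us) h.
  rewrite !lineE derE => ->; rewrite mulrC ler_wpM2r //.
  apply: (le_trans (ler_norm _)); rewrite normrM sgn mul1r (le_trans (term _)) //; lra.
have HF x h t : 0 <= h <= r0 -> 0 <= t <= T ->
    H x (Dx u (x, t)) - H (x + h *: e) (Dx u (x, t)) + F (x + h *: e, t) - F (x, t) < 4 * b.
  move=> /andP[h0 hr] tT; pose q := Dx u (x, t); pose Hc (z : V * V) := H z.1 z.2.
  have [s _] := mean_value_line (x, q) (fun y => @smooth_derivable R (V * V)%type Hc y (e_ R i0, 0) Hs) (h * sg).
  have -> : (x, q) + (h * sg) *: (e_ R i0, 0) = (x + h *: e, q) :> V * V.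
    by rewrite -[LHS]/(x + (h * sg) *: e_ R i0, q + (h * sg) *: 0) scaler0 addr0 /e scalerA.
  have -> : (x, q) + (s * (h * sg)) *: (e_ R i0, 0) = (x + (s * (h * sg)) *: e_ R i0, q) :> V * V.
    by rewrite -[LHS]/(x + (s * (h * sg)) *: e_ R i0, q + (s * (h * sg)) *: 0) scaler0 addr0.
  rewrite /Hc /= -/Hc => Heq; have := HMP (x + (s * (h * sg)) *: e_ R i0) x t tT.
  rewrite mxE -/Hc -/q => hD.
  have h1 : H x q - H (x + h *: e) q <= HM * r0.
    rewrite -opprB Heq; apply: (le_trans (ler_norm _)).
    rewrite normrN !normrM sgn mulr1 (ger0_norm h0) mulrC.
    exact: ler_pM.
  have /andP[_ h2] := FF (x + h *: e) t tT; have /andP[h3 _] := FF x t tT.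
  have h4 : 4 * b = K ^+ 2 / (4 * S) by rewrite /b; field.
  rewrite h4; apply: le_lt_trans lt; rewrite -/r0; move: h1 h2 h3; rewrite -/q.
  move: (H x q) (H _ q) (F _) (F _) (HM * r0) => a1 a2 a3 a4 a5; lra.
have main := increment_bound T0 sg2 us up HJ r00 b0 br Sr osc' term' HF.
have dl := @is_derive_line R E u (x0, t0) (e, 0) 0 (@smooth_derivable R E u _ _ us).
rewrite scale0r addr0 derE sgD in dl.
have dl2 : is_derive (0 : R) 1 (fun h : R => u ((x0, t0) + h *: (e, 0)) - K / 2 * h) (K - K / 2 * 1).
  by apply: is_derive_sub => //; apply: is_derive_lmul; exact: is_derive_idR.
have : K - K / 2 * 1 <= 0.
  apply: (local_max_right dl2 r00) => h /andP[h0 hr].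
  rewrite add0r scale0r addr0 mulr0 subr0 lineE lerBlDr -lerBlDl.
  by apply: main => //; rewrite (ltW h0) ltW.
lra.
Qed.
End GradientStep.

Lemma power_closing (R : realType) (K e C : R) : 1 <= K -> e < 2 ->
  K ^+ 2 <= C * K `^ e -> K <= C `^ (2 - e)^-1.
Proof.
move=> K1 e2 H; have K0 : 0 < K by rewrite (lt_le_trans _ K1).
have e0 : 0 < 2 - e by rewrite subr_gt0.
have KC : K `^ (2 - e) <= C.
  rewrite -(ler_pM2r (powR_gt0 e K0)); apply: le_trans H.
  by rewrite -powR_add // subrK (powR_mulrn 2%N) // ltW.
have -> : K = (K `^ (2 - e)) `^ (2 - e)^-1.
  by rewrite -powRrM mulfV ?gt_eqF // powRr1 // ltW.
apply: ge0_ler_powR; rewrite ?nnegrE ?powR_ge0 ?invr_ge0 ?(ltW e0) //.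
exact: le_trans (powR_ge0 _ _) KC.
Qed.

Section GradientBound.
Variables (R : realType) (d : nat).
Local Notation V := 'rV[R]_d.
Local Notation E := (V * R)%type.
Local Notation J := (@int_Td R d).
Local Notation I := (@slice_int R d).
Variables (H : V -> V -> R) (g : R -> R) (T al mu : R) (m0 uT eta : V -> R).
Hypotheses (T0 : 0 < T) (al0 : 0 < al) (mu0 : 0 < mu) (mu1 : mu < 1).
Hypothesis Hs : smooth (fun z : (V * V)%type => H z.1 z.2).
Hypothesis Hp : forall p, periodicT (fun x => H x p).
Hypothesis galE : forall z, 0 <= z -> g z = z `^ al.
Variables (cL CL Kx kap Mm lam Dm U Du G CH0 C5 c2 C2 C8 kp : R).
Hypotheses (cL0 : 0 < cL) (CL0 : 0 <= CL) (Kx0 : 0 <= Kx) (Mm0 : 0 <= Mm).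
Hypothesis HL : forall x p, cL * H x p - CL <= Lhat H x p.
Hypothesis H1 : forall x p, 1 <= H x p.
Hypothesis Htr : forall x p (M : 'M[R]_d), M^T = M ->
  - Kx * H x p <= \tr (DxxH H x p) + 2 * \tr (DpxH H x p *m M) + \tr (DppH H x p *m (M *m M)).
Hypotheses (m0s : smooth m0) (m0p : periodicT m0) (m0J : J m0 = 1).
Hypotheses (kap0 : 0 < kap) (m0k : forall x, kap <= m0 x) (m0M : forall x, m0 x <= Mm).
Hypotheses (lam0 : 0 <= lam) (m0lam : forall z : E, Lap (fun z : E => m0 z.1) z <= lam * m0 z.1).
Hypothesis m0D : forall z : E, `|Lap (fun z : E => m0 z.1) z| <= Dm.
Hypotheses (uTU : forall x, `|uT x| <= U) (uTD : forall z : E, `|Lap (fun z : E => uT z.1) z| <= Du).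
Hypothesis uTG : forall i x, `|'D_(e_ R i) uT x| <= G.
Hypotheses (CH00 : 0 <= CH0) (H0 : forall x, H x 0 <= CH0).
Hypotheses (C50 : 0 <= C5) (HC5 : forall i x p, `|DxH H x p 0 i| <= C5 * H x p).
Hypotheses (c20 : 0 <= c2) (C20 : 0 <= C2) (HU : forall x p, H x p <= c2 * enorm p `^ (2 + mu) + C2).
Hypotheses (C80 : 0 <= C8)
  (HC8 : forall i x p, DpH H x p 0 i ^+ 2 <= C8 * (enorm p `^ mu * H x p + 1)).
Hypotheses (kp0 : 0 < kp) (kp1 : kp <= 1) (d2 : 2 <= d%:R :> R).
Hypothesis thal : (d%:R - 2 + kp) / 2 * al < 1.
Let e1 : R := (1 + mu) * (d%:R + kp) * (al / (al + 1)).
Hypothesis e12 : e1 < 2.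
Hypothesis etaP : mollifier eta.
Let C0 : R := U + (CH0 + 1) * T.
Let U0 : 0 <= U. Proof. exact: le_trans (normr_ge0 _) (uTU 0). Qed.
Let UC0 : U <= C0. Proof. by rewrite lerDl mulr_ge0 ?(ltW T0) // addr_ge0. Qed.
Let Ku := energy_Ku T al CL C0 kap Mm lam U.
Let KP := energy_KP T al cL CL Kx C0 kap Mm lam Dm U Du.
Let d0 : 0 < d%:R :> R. Proof. exact: lt_le_trans d2. Qed.

(** All constants are built from the data before any [eps] or solution is introduced; uniformity
    rests on this. [CHM], [CB] and [CF] are the factors of [K^(2+mu)], [K^(1+mu)] and [K^e1] in the
    bounds of the Hamiltonian, the drift and the coupling. The added [1] makes [S] positive. *)
Let S : R := sup_value_const d al kp KP C0 U Ku + 1.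
Let CHM : R := c2 * d%:R `^ (2 + mu) + C2.
Let CB : R := Num.sqrt (C8 * (d%:R `^ mu * CHM + 1)).
Let CD : R := sup_density_const d al kp KP Mm.
Let CF : R := (CD * (1 + CB) `^ (d%:R + kp)) `^ (al / (al + 1)).
Let CT : R := 4 * S * (CF + C5 * CHM * (4 * S)).
Let ee : R := Num.max e1 (1 + mu).

Section Solution.
Variables (eps : R) (u m : E -> R).
Hypotheses (eps0 : 0 < eps) (sol : reg_solution H g eta eps T uT m0 u m).
Let us : smooth u. Proof. by have [[]] := sol. Qed.
Let ms : smooth m. Proof. by have [[]] := sol. Qed.
Let up : periodicE u. Proof. by have [_ h _ _ _] := sol; apply: periodicE_of => t; have [] := h t. Qed.
Let mp : periodicE m. Proof. by have [_ h _ _ _] := sol; apply: periodicE_of => t; have [] := h t. Qed.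
Let b i (z : E) := drift u H i z * m z.
Let ds i : smooth (drift u H i) := smooth_drift us Hs i.
Let dp i : periodicE (drift u H i) := periodicE_drift up Hp i.
Let bs i : smooth (b i) := smooth_mul (ds i) ms.
Let bp i : periodicE (b i) := periodicE_mul (dp i) mp.
Let TT : 0 <= T <= T. Proof. by rewrite lexx ltW. Qed.
Let m0E x : m (x, 0) = m0 x. Proof. by have [_ _ _ _ h] := sol; have [] := h x. Qed.
Let uTE x : u (x, T) = uT x. Proof. by have [_ _ _ _ h] := sol; have [] := h x. Qed.
Let meq x t : 0 <= t <= T -> Dt m (x, t) = Lap m (x, t) + \sum_i 'D_(dx R i) (b i) (x, t).
Proof.
by move=> tT; have [_ _ _ h _] := sol; apply/eqP; rewrite -subr_eq; apply/eqP; exact: h.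
Qed.
Let mdl : exists2 dl, 0 < dl & forall x t, 0 <= t <= T -> dl <= m (x, t).
Proof.
by apply: transport_positive (ltW T0) kap0 ms mp ds dp meq _ => x; rewrite m0E.
Qed.
Let mpos x t : 0 <= t <= T -> 0 < m (x, t).
Proof. by move=> tT; have [dl dl0 h] := mdl; exact: lt_le_trans (h x t tT). Qed.
Let v := mconvE2 eta eps m.
Let vs : smooth v := smooth_mconvE2 etaP eps0 ms.
Let vp : periodicE v := periodicE_mconvE2 etaP eps0 mp.
Let vpos x t : 0 <= t <= T -> 0 < v (x, t).
Proof.
move=> tT; have [dl dl0 h] := mdl; apply: (lt_le_trans dl0).
by apply: (mconv_ge etaP eps0 x (@slice_s R d m t ms)) => y; exact: h.
Qed.
Let Feq x t : 0 <= t <= T -> coupling H u (x, t) = mconv eta eps (fun y => v (y, t) `^ al) x.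
Proof.
move=> tT; have [_ _ h _ _] := sol; rewrite /coupling /Halong /= h // addrAC subrr add0r.
rewrite /g_eps; congr (mconv eta eps _ x); apply/funext => y.
by rewrite galE; [|exact: ltW (vpos y tT)].
Qed.
Let F0 x t : 0 <= t <= T -> 0 <= coupling H u (x, t).
Proof. by move=> tT; exact: (coupling_ge0 etaP eps0 ms Feq vpos). Qed.
Let HJ x t : 0 <= t <= T ->
  - Dt u (x, t) + H x (Dx u (x, t)) = Lap u (x, t) + coupling H u (x, t).
Proof. by move=> tT; rewrite /coupling /Halong /=; ring. Qed.
Let ulow x t : 0 <= t <= T -> - C0 <= u (x, t).
Proof.
move=> tT; apply: (hj_lower (ltW T0) us up HJ F0 CH00 H0 _ x tT) => y.
by rewrite uTE; have := uTU y; rewrite ler_norml => /andP[].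
Qed.
Let ueq x t : 0 <= t <= T ->
  - mconv eta eps (fun y => v (y, t) `^ al) x <= Dt u (x, t) + Lap u (x, t).
Proof.
move=> tT; rewrite -Feq // /coupling /Halong /=.
by have := H1 x (Dx u (x, t)); lra.
Qed.

Let energies : exists P Pd : R -> R,
  [/\ forall t : R, 0 <= t <= T -> is_derive t 1 P (Pd t),
      forall t, 0 <= t <= T -> dissipation al v t <= Pd t &
      P T - P 0 <= KP].
Proof.
exact: (energy_bound T0 al0 Hs Hp cL0 CL0 Kx0 Mm0 HL H1 Htr m0s m0p m0J kap0 m0k m0M
  lam0 m0lam m0D uTU uTD UC0 etaP eps0 us ms up mp Feq meq mpos vpos ulow m0E uTE).
Qed.

Let uS x t : 0 <= t <= T -> 0 <= u (x, t) + C0 <= S - 1.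
Proof.
move=> tT; have [P [Pd [PD PdQ PKP]]] := energies; apply/andP; split.
  by rewrite -lerBlDr sub0r ulow.
rewrite /S addrK.
apply: (sup_value al0 kp0 kp1 d2 T0 vs vp vpos PD PdQ PKP etaP eps0 thal us up ulow _ _ ueq) tT.
  by move=> y; rewrite uTE (le_trans (ler_norm _)).
move=> s sT; exact: (int_u_bound T0 al0 Hs Hp cL0 CL0 Mm0 HL H1 m0s m0p m0J kap0 m0k m0M
  lam0 m0lam uTU UC0 etaP eps0 us ms up mp Feq meq mpos vpos ulow m0E uTE).
Qed.
Let S0 : 0 < S.
Proof. have /andP[a b'] := uS 0 TT; have : 0 <= S - 1 := le_trans a b'; lra. Qed.

Let veq x t : 0 <= t <= T ->
  Dt v (x, t) = Lap v (x, t) + \sum_i 'D_(dx R i) (mconvE2 eta eps (b i)) (x, t).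
Proof.
move=> tT.
have e1' : Dt v (x, t) = mconvE2 eta eps (Dt m) (x, t).
  exact: (congr1 (fun f => f (x, t)) (derive_mconvE2 etaP eps0 ms (dt R d))).
have e2' : Lap v (x, t) = mconvE2 eta eps (Lap m) (x, t) := Lap_mconvE2 etaP eps0 (x, t) ms.
have e3' : \sum_i 'D_(dx R i) (mconvE2 eta eps (b i)) (x, t) =
    mconv eta eps (fun y => \sum_i 'D_(dx R i) (b i) (y, t)) x.
  rewrite (mconv_sum etaP eps0) => [|i]; last exact: slice_D.
  apply: eq_bigr => i _.
  exact: (congr1 (fun f => f (x, t)) (derive_mconvE2 etaP eps0 (bs i) (dx R i))).
apply: (etrans e1'); apply: esym; apply: (etrans (congr2 +%R e2' e3')).
rewrite /mconvE2 /= -(mconv_add etaP eps0).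
- by congr (mconv eta eps _ x); apply/funext => y; apply: esym; exact: meq.
- by apply: slice_s; exact: smooth_Lap.
- by apply: continuous_sum => i; exact: slice_D.
Qed.

Let CHM0 : 0 <= CHM. Proof. by rewrite addr_ge0 // mulr_ge0 // powR_ge0. Qed.
Let CB0 : 0 <= CB. Proof. exact: sqrtr_ge0. Qed.

Section Level.
(** The condition [K >= 1] lets additive constants and lower powers be absorbed in a higher power of
    [K]. *)
Variable K : R.
Hypotheses (K1 : 1 <= K)
  (uK : forall i x t, 0 <= t <= T -> `|'D_(dx R i) u (x, t)| <= K).
Let K0 : 0 < K. Proof. exact: lt_le_trans K1. Qed.

Let DuK x t : 0 <= t <= T -> enorm (Dx u (x, t)) <= d%:R * K.
Proof. by move=> tT; apply: enorm_le (ltW K0) _ => i; rewrite mxE; exact: uK. Qed.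

Let dKpow x t c : 0 <= t <= T -> 0 <= c -> enorm (Dx u (x, t)) `^ c <= d%:R `^ c * K `^ c.
Proof.
move=> tT c0; rewrite -powRM ?(ltW d0) ?(ltW K0) //.
by apply: ge0_ler_powR; rewrite ?nnegrE ?sqrtr_ge0 ?mulr_ge0 ?(ltW d0) ?(ltW K0) // DuK.
Qed.

Let Kpow_ge1 c : 0 <= c -> 1 <= K `^ c.
Proof. by move=> c0; rewrite -[leLHS](powRr0 K) ler_powR. Qed.

Let HK y x t : 0 <= t <= T -> H y (Dx u (x, t)) <= CHM * K `^ (2 + mu).
Proof.
move=> tT; have m2 : 0 <= 2 + mu by rewrite addr_ge0 // ltW.
apply: (le_trans (HU y _)); rewrite mulrDl; apply: lerD.
  by rewrite -mulrA ler_wpM2l // dKpow.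
by rewrite ler_peMr // Kpow_ge1.
Qed.

(** By (A8) the square of the drift is at most a constant times [|p|^mu H + 1], of order
    [K^(mu + 2 + mu) = (K^(1+mu))^2]. *)
Let driftK i x t : 0 <= t <= T -> `|drift u H i (x, t)| <= CB * K `^ (1 + mu).
Proof.
move=> tT; have m1 : 0 <= 1 + mu by rewrite addr_ge0 // ltW.
rewrite -(ler_sqr (R := R)) ?nnegrE ?mulr_ge0 ?powR_ge0 // real_normK ?num_real //.
apply: (le_trans (HC8 i x _)); rewrite exprMn /CB sqr_sqrtr; last first.
  by rewrite mulr_ge0 // addr_ge0 // mulr_ge0 // powR_ge0.
rewrite -mulrA ler_wpM2l // mulrDl mul1r; apply: lerD; last first.
  by rewrite exprn_ege1 // Kpow_ge1.
have -> : (K `^ (1 + mu)) ^+ 2 = K `^ mu * K `^ (2 + mu).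
  by rewrite expr2 -!powR_add //; congr (_ `^ _); ring.
have -> : d%:R `^ mu * CHM * (K `^ mu * K `^ (2 + mu)) =
    (d%:R `^ mu * K `^ mu) * (CHM * K `^ (2 + mu)) by ring.
apply: ler_pM; [exact: powR_ge0| |by apply: dKpow => //; exact: ltW|exact: HK].
by rewrite (le_trans ler01).
Qed.

Let FK x t : 0 <= t <= T -> coupling H u (x, t) <= CF * K `^ e1.
Proof.
move=> tT; have [P [Pd [PD PdQ PKP]]] := energies.
have [x0 [t0 [t0T vM]]] := torus_max (ltW T0) (smooth_cont vs) vp.
set M := v (x0, t0) in vM; set B := CB * K `^ (1 + mu).
have B0 : 0 <= B by rewrite mulr_ge0 // powR_ge0.
have M0 : 0 < M by exact: vpos.
have al10 : 0 < al + 1 by rewrite addr_gt0.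
have beB i y s : 0 <= s <= T -> `|mconvE2 eta eps (b i) (y, s)| <= B * v (y, s).
  move=> sT; apply: (mconv_abs etaP eps0) => [| |z]; [exact: slice_s|exact: slice_s|].
  rewrite /b normrM (gtr0_norm (mpos z sT)) /=; apply: ler_wpM2r (driftK i z sT).
  by rewrite ltW // mpos.
have vMm y : v (y, 0) <= Mm.
  by apply: (mconv_leC etaP eps0) => [|z]; [exact: slice_s|rewrite /= m0E].
have MB := sup_density al0 kp0 kp1 d2 T0 vs vp vpos PD PdQ PKP
  (fun i => smooth_mconvE2 etaP eps0 (bs i)) (fun i => periodicE_mconvE2 etaP eps0 (bp i))
  B0 veq beB t0T vM (erefl M) vMm.
have B1 : 0 < 1 + B by rewrite ltr_pwDl.
have CD0 : 0 < CD.
  by rewrite -(pmulr_lgt0 _ (powR_gt0 (d%:R + kp) B1)) (lt_le_trans _ MB) // powR_gt0.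
have CB1 : 0 < 1 + CB by rewrite ltr_pwDl.
have dk0 : 0 <= d%:R + kp by rewrite addr_ge0 // ltW.
have BK : (1 + B) `^ (d%:R + kp) <= (1 + CB) `^ (d%:R + kp) * K `^ ((1 + mu) * (d%:R + kp)).
  rewrite powRrM -powRM ?(ltW CB1) ?powR_ge0 //.
  apply: ge0_ler_powR; rewrite ?nnegrE ?mulr_ge0 ?(ltW CB1) ?(ltW B1) ?powR_ge0 //.
  by rewrite mulrDl mul1r lerD2r Kpow_ge1 // addr_ge0 // ltW.
have MK : M `^ (al + 1) <= CD * (1 + CB) `^ (d%:R + kp) * K `^ ((1 + mu) * (d%:R + kp)).
  by apply: (le_trans MB); rewrite -mulrA ler_wpM2l // ltW.
have MalE : M `^ al = (M `^ (al + 1)) `^ (al / (al + 1)).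
  by rewrite -powRrM mulrCA mulfV ?mulr1 // gt_eqF.
have aa0 : 0 <= al / (al + 1) by rewrite divr_ge0 // ltW.
have X0 : 0 <= CD * (1 + CB) `^ (d%:R + kp) by rewrite mulr_ge0 ?(ltW CD0) ?powR_ge0.
have FM : coupling H u (x, t) <= M `^ al.
  rewrite Feq //; apply: (mconv_leC etaP eps0) => [|z].
    by apply: smooth_cont; apply: (smooth_powR al (smooth_slicel t vs)) => z; exact: vpos.
  apply: ge0_ler_powR; rewrite ?nnegrE ?(ltW al0) ?(ltW M0) ?(ltW (vpos z tT)) //.
  exact: vM.
apply: (le_trans FM); rewrite MalE /e1 [in leRHS]powRrM /CF -powRM ?powR_ge0 //.
apply: ge0_ler_powR MK; rewrite ?nnegrE ?powR_ge0 //.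
exact: mulr_ge0 X0 (powR_ge0 _ _).
Qed.


Lemma level_bound i0 x0 t0 : 4 * G <= K -> 0 <= t0 <= T ->
  `|'D_(dx R i0) u (x0, t0)| = K -> K <= CT `^ (2 - ee)^-1.
Proof.
move=> GK t0T DK.
have FF x t : 0 <= t <= T -> 0 <= coupling H u (x, t) <= CF * K `^ e1.
  by move=> tT; rewrite F0 // FK.
have HM y x t : 0 <= t <= T -> `|DxH H y (Dx u (x, t)) 0 i0| <= C5 * (CHM * K `^ (2 + mu)).
  by move=> tT; apply: (le_trans (HC5 i0 y _)); rewrite ler_wpM2l // HK.
have term x : `|'D_(dx R i0) u (x, T)| <= G.
  have -> : 'D_(dx R i0) u (x, T) = 'D_(e_ R i0) uT x.
    rewrite -(derive_slicel u); congr ('D_(_) _ x); apply/funext => y; exact: uTE.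
  exact: uTG.
have osc x y t : 0 <= t <= T -> u (y, t) - u (x, t) <= S.
  by move=> tT; have /andP[h1 _] := uS x tT; have /andP[_ h2] := uS y tT; move: h1 h2; lra.
have := gradient_step T0 us up Hs HJ K0 S0 GK t0T DK osc term FF HM.
have -> : C5 * (CHM * K `^ (2 + mu)) * (4 * S / K) = C5 * CHM * (4 * S) * K `^ (1 + mu).
  have -> : K `^ (2 + mu) = K * K `^ (1 + mu).
    by rewrite -{2}(powRr1 (ltW K0)) -powR_add //; congr (_ `^ _); ring.
  by field; rewrite gt_eqF.
rewrite ler_pdivrMr ?mulr_gt0 // => h; apply: power_closing K1 _ _.
  rewrite /ee gt_max; apply/andP; split; first exact: e12.
  by rewrite -[ltRHS]/(1 + 1) ltrD2l.
apply: (le_trans h); rewrite [leLHS]mulrC /CT -[in leRHS]mulrA ler_pM2l ?mulr_gt0 // [leRHS]mulrDl.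
have mono a : a <= ee -> K `^ a <= K `^ ee by move=> ae; rewrite ler_powR.
apply: lerD; apply: ler_wpM2l.
- exact: powR_ge0.
- by apply: mono; rewrite le_max lexx.
- by apply: mulr_ge0; [exact: mulr_ge0|rewrite mulr_ge0 // ltW].
- by apply: mono; rewrite le_max lexx orbT.
Qed.
End Level.

Lemma solution_bound x t : 0 <= t <= T ->
  enorm (Dx u (x, t)) <= d%:R * (1 + 4 * `|G| + CT `^ (2 - ee)^-1).
Proof.
pose Du2 i (z : E) := 'D_(dx R i) u z * 'D_(dx R i) u z.
have sq i z : Du2 i z = `|'D_(dx R i) u z| ^+ 2 by rewrite real_normK ?num_real // expr2.
have maxi i : exists z : E, 0 <= z.2 <= T /\ forall x t, 0 <= t <= T -> Du2 i (x, t) <= Du2 i z.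
  have Ds : smooth ('D_(dx R i) u) := smooth_D _ us.
  have Dp : periodicE ('D_(dx R i) u) := periodicE_D _ up.
  have [x0 [t0 [t0T h]]] := torus_max (ltW T0) (smooth_cont (smooth_mul Ds Ds)) (periodicE_mul Dp Dp).
  by exists (x0, t0).
have [z zP] := choice maxi.
have dn : (0 < d)%N by rewrite -(ltr0n R).
have [i0 _ i0P] := @arg_maxP _ R 'I_d (Ordinal dn) xpredT (fun i => Du2 i (z i)) isT.
pose K := `|'D_(dx R i0) u (z i0)|.
have uK i y s : 0 <= s <= T -> `|'D_(dx R i) u (y, s)| <= K.
  move=> sT; have := le_trans ((zP i).2 y s sT) (i0P i isT).
  by rewrite !sq ler_sqr ?nnegrE.
have G0 : 0 <= `|G| := normr_ge0 G; have CT0 : 0 <= CT `^ (2 - ee)^-1 := powR_ge0 _ _.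
move=> tT; apply: enorm_le => [|i]; first by rewrite !addr_ge0 // mulr_ge0.
rewrite mxE; apply: (le_trans (uK i x t tT)).
(* Below this threshold nothing is left to prove; above it both [K >= 1] and [4 G <= K] hold, as
   [level_bound] requires. *)
have [Ks|Kb] := lerP K (1 + 4 * `|G|); first by rewrite (le_trans Ks) // lerDl.
have K1 : 1 <= K by apply: le_trans (ltW Kb); rewrite lerDl mulr_ge0.
have GK : 4 * G <= K.
  by apply: le_trans (ltW Kb); have := ler_norm G; lra.
have Kz : `|'D_(dx R i0) u ((z i0).1, (z i0).2)| = K by rewrite -surjective_pairing.
apply: (le_trans (level_bound K1 uK GK (zP i0).1 Kz)).
by rewrite lerDr addr_ge0 // mulr_ge0.
Qed.
End Solution.

Lemma gradient_bound : exists C : R, forall eps u m, 0 < eps ->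
  reg_solution H g eta eps T uT m0 u m -> forall x t, 0 <= t <= T -> enorm (Dx u (x, t)) <= C.
(* The witness is the bound of [solution_bound], in which neither [eps] nor the solution occurs. *)
Proof. by eexists => eps u m e0 sol x t tT; exact: (solution_bound e0 sol). Qed.
End GradientBound.

(** * Constants extracted from the data, choice of exponents, and conclusion *)

Section Data.
Variables (R : realType) (d : nat).
Local Notation V := 'rV[R]_d.
Local Notation E := (V * R)%type.

Lemma periodic_bound (f : V -> R) : smooth f -> periodicT f ->
  exists2 B, 0 <= B & forall x, `|f x| <= B.
Proof.
move=> fs fp; have [B B0 h] := torus_bound (lexx 0) (smooth_cont (smooth_lift fs)) (periodicE_lift fp).
by exists B => // x; apply: (h x 0); rewrite lexx.
Qed.

Lemma lift_Lap_bound (f : V -> R) : smooth f -> periodicT f ->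
  exists2 B, 0 <= B & forall z : E, `|Lap (fun z : E => f z.1) z| <= B.
Proof.
move=> fs fp; have [B B0 h] := torus_bound (lexx 0)
  (smooth_cont (smooth_Lap (smooth_lift fs))) (periodicE_Lap (periodicE_lift fp)).
exists B => // -[x t].
have -> : Lap (fun z : E => f z.1) (x, t) = Lap (fun z : E => f z.1) (x, 0).
  by apply: eq_bigr => i _; apply: derive_quot => r; apply: derive_quot => s.
by apply: h; rewrite lexx.
Qed.

Lemma gradient_coord_bound (f : V -> R) : smooth f -> periodicT f ->
  exists B, forall i x, `|'D_(e_ R i) f x| <= B.
Proof.
move=> fs fp.
have h i : exists B, 0 <= B /\ forall x, `|'D_(e_ R i) f x| <= B.
  have [|B B0 hB] := periodic_bound (smooth_D (e_ R i) fs); last by exists B.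
  by move=> x j; apply: derive_periodic => y; exact: fp.
have [B BP] := choice h; exists (\sum_i B i) => i x.
apply: (le_trans ((BP i).2 x)); rewrite (bigD1 i) //= lerDl sumr_ge0 // => j _.
exact: (BP j).1.
Qed.

Lemma fnorm_coord (A : 'M[R]_d) i j : `|A i j| <= fnorm A.
Proof.
rewrite -sqrtr_sqr ler_wsqrtr // (bigD1 i) //= (bigD1 j) //= -addrA lerDl addr_ge0 //.
  by rewrite sumr_ge0 // => k _; exact: sqr_ge0.
by rewrite sumr_ge0 // => k _; rewrite sumr_ge0 // => l _; exact: sqr_ge0.
Qed.

Lemma tr_ge_fnorm (A : 'M[R]_d) : - (d%:R * fnorm A) <= \tr A.
Proof.
have -> : d%:R * fnorm A = \sum_(i < d) fnorm A by rewrite sumr_const card_ord mulr_natl.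
rewrite lerNl -sumrN; apply: ler_sum => i _.
by rewrite (le_trans _ (fnorm_coord A i i)) // -normrN ler_norm.
Qed.
End Data.

(* With [X = d (1 + mu) - 2], the two constraints on the loss [kap] of the Hardy inequality read
   [al (d - 2 + kap) < 2] and [al X + (1 + mu) al kap < 2]. *)
Lemma exponent_choice (R : realType) (d : nat) (al mu : R) : 0 < al -> 0 < mu < 1 ->
  al < 2 / (d%:R * (1 + mu) - 2) -> exists kap : R,
  [/\ 0 < kap, kap <= 1, 2 <= d%:R :> R, (d%:R - 2 + kap) / 2 * al < 1 &
      (1 + mu) * (d%:R + kap) * (al / (al + 1)) < 2].
Proof.
move=> al0 /andP[mu0 mu1] h; pose X := d%:R * (1 + mu) - 2.
(* A nonpositive [X] would make the upper bound of [al] nonpositive, the value [0] included since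
   the inverse of [0] is [0]. As [mu < 1], positivity of [X] then forces [d >= 2]. *)
have X0 : 0 < X.
  rewrite ltNge; apply/negP => Xle; have := lt_trans al0 h.
  by rewrite ltNge mulr_ge0_le0 // invr_le0.
have aX : al * X < 2 by rewrite -ltr_pdivlMr.
have d2 : 2 <= d%:R :> R.
  rewrite (ler_nat R 2 d) ltnNge; apply/negP => d1.
  have : d%:R <= 1 :> R by rewrite (ler_nat R d 1).
  move=> d1'; have : d%:R * (1 + mu) <= 1 * (1 + mu).
    by apply: ler_wpM2r => //; rewrite addr_ge0 // ltW.
  by move: X0; rewrite /X; lra.
(* The bound [kap <= mu] gives [d - 2 + kap <= X]. The other bound gives [(1 + mu) al kap <= 2 al
   kap <= (2 - al X) / 2], half of the room left by [al X < 2]. *)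
pose kap := Num.min mu ((2 - al * X) / (4 * al)).
have kmu : kap <= mu by rewrite ge_min lexx.
have kX : kap * al <= (2 - al * X) / 4.
  rewrite -ler_pdivlMr //; apply: (@le_trans _ _ ((2 - al * X) / (4 * al))).
    by rewrite ge_min lexx orbT.
  by rewrite le_eqVlt; apply/orP; left; apply/eqP; field; rewrite gt_eqF.
have k0 : 0 < kap by rewrite lt_min mu0 /= divr_gt0 ?subr_gt0 // mulr_gt0.
exists kap; split => //; first by rewrite (le_trans kmu) // ltW.
  have : (d%:R - 2 + kap) * al <= X * al.
    rewrite ler_pM2r // /X; have : mu * 1 <= mu * d%:R by rewrite ler_pM2l //; lra.
    by rewrite mulr1 mulrDr (mulrC mu); lra.
  by rewrite [X * al]mulrC; lra.
rewrite mulrA ltr_pdivrMr ?addr_gt0 //.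
have : (1 + mu) * (kap * al) <= 2 * (kap * al).
  by rewrite ler_pM2r ?mulr_gt0 //; lra.
have -> : (1 + mu) * (d%:R + kap) * al = al * X + 2 * al + (1 + mu) * (kap * al) by rewrite /X; ring.
by move: ((1 + mu) * (kap * al)) => y; lra.
Qed.

Theorem theorem4 (R : realType) (d : nat) (T : R)
  (H : 'rV[R]_d -> 'rV[R]_d -> R) (g : R -> R) (uT m0 : 'rV[R]_d -> R)
  (alpha mu kappa0 : R) (eta : 'rV[R]_d -> R) :
  0 < T ->
  (* H is defined on T^d x R^d *)
  (forall p, periodicT (fun x => H x p)) ->
  (* (A1) *)
  smooth (fun z : ('rV[R]_d * 'rV[R]_d)%type => H z.1 z.2) ->
  (forall x p q (l : R), p != q -> 0 < l < 1 ->
     H x (l *: p + (1 - l) *: q) < l * H x p + (1 - l) * H x q) ->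
  (forall x (M : R), exists r0 : R, 0 < r0 /\
     forall p, r0 <= enorm p -> M <= H x p / enorm p) ->
  (forall x p, 1 <= H x p) ->
  (* (A2) *)
  (forall z, 0 <= z -> 0 <= g z) ->
  (forall z w, 0 <= z -> z <= w -> g z <= g w) ->
  smooth uT -> periodicT uT -> smooth m0 -> periodicT m0 ->
  (forall x, 0 <= m0 x) -> int_Td m0 = 1 ->
  (* (A3) *)
  (exists c C : R, 0 < c /\ 0 < C /\ forall x p, c * H x p - C <= Lhat H x p) ->
  (* (A4) *)
  0 < alpha -> (forall z, 0 <= z -> g z = z `^ alpha) ->
  (* (A5) *)
  (exists C : R, forall x p,
     enorm (DxH H x p) <= C * H x p + C /\ fnorm (DxxH H x p) <= C * H x p + C) ->
  (forall delta : R, 0 < delta -> exists Cd : R, forall x p (M : 'M[R]_d),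
     M^T = M ->
     \tr (DpxH H x p *m M) <= delta * \tr (DppH H x p *m (M *m M)) + Cd * H x p) ->
  (* (A6) *)
  0 < kappa0 -> (forall x, kappa0 <= m0 x) ->
  (* (A7) *)
  0 < mu < 1 ->
  (exists c1 C1 c2 C2 : R, [/\ 0 <= c1, 0 <= C1, 0 <= c2, 0 <= C2 &
     forall x p, c1 * enorm p `^ (2 + mu) + C1 <= H x p /\
                 H x p <= c2 * enorm p `^ (2 + mu) + C2]) ->
  (* (A8) *)
  (exists C : R, forall x p,
     enorm (DpH H x p) ^+ 2 <= C * enorm p `^ mu * H x p + C) ->
  (* (A9) *)
  (exists C : R, forall x p,
     fnorm (DxpH H x p) ^+ 2 <= C * H x p `^ ((2 + 2 * mu) / (2 + mu)) /\
     forall M : 'M[R]_d, M^T = M ->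
       fnorm (DppH H x p *m M) ^+ 2
         <= C * H x p `^ (mu / (2 + mu)) * \tr (DppH H x p *m (M *m M))) ->
  (* (A10) *)
  alpha < 2 / (d%:R * (1 + mu) - 2) ->
  (* eta is a standard symmetric mollifying kernel *)
  mollifier eta ->
  (* conclusion: uniform Lipschitz bound, independent of eps *)
  exists C : R, forall eps : R, 0 < eps ->
    forall u m : ('rV[R]_d * R)%type -> R,
      reg_solution H g eta eps T uT m0 u m ->
      forall x t, 0 <= t <= T -> enorm (Dx u (x, t)) <= C.
Proof.
move=> T0 Hp Hs _ _ H1 _ _ uTs uTp m0s m0p m00 m0J [cL [CL [cL0 [CL0 HL]]]] al0 galE [CA5 A5].
move=> A5tr kap0 m0k mu01 [c1 [C1 [c2 [C2 [_ _ c20 C20 A7]]]]] [C8 A8] _ A10 etaP.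
have [kp [kp0 kp1 d2 thal e12]] := exponent_choice al0 mu01 A10.
have /andP[mu0 mu1] := mu01.
have [Mm Mm0 m0M] := periodic_bound m0s m0p.
have [Dm Dm0 m0D] := lift_Lap_bound m0s m0p.
have [U U0 uTU] := periodic_bound uTs uTp.
have [Du Du0 uTD] := lift_Lap_bound uTs uTp.
have [G uTG] := gradient_coord_bound uTs uTp.
have m0M' x : m0 x <= Mm by exact: le_trans (ler_norm _) (m0M x).
(* The lower bound of [m0] turns the bound of its Laplacian into [Lap m0 <= lam m0] with
   [lam = Dm / kappa0]. *)
have lam0 : 0 <= Dm / kappa0 by rewrite divr_ge0 // ltW.
have m0lam z : Lap (fun z : 'rV[R]_d * R => m0 z.1) z <= Dm / kappa0 * m0 z.1.
  apply: (le_trans (ler_norm _)); apply: (le_trans (m0D z)).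
  by rewrite mulrAC ler_pdivlMr // ler_wpM2l.
(* As [H >= 1], additive constants are absorbed in multiples of [H]. *)
have CH x p : CA5 * H x p + CA5 <= 2 * `|CA5| * H x p.
  have h1 : CA5 * H x p <= `|CA5| * H x p.
    by apply: ler_wpM2r; [exact: le_trans ler01 (H1 x p)|exact: ler_norm].
  have h2 : CA5 <= `|CA5| * H x p by apply: (le_trans (ler_norm _)); rewrite ler_peMr.
  by move: h1 h2; rewrite -mulrA; lra.
have C50 : 0 <= 2 * `|CA5| by rewrite mulr_ge0.
have HC5 i x p : `|DxH H x p 0 i| <= 2 * `|CA5| * H x p.
  exact: le_trans (enorm_coord _ _) (le_trans (A5 x p).1 (CH x p)).
(* With [delta = 1/2], applied to [- M], twice the mixed trace is at least [- tr(DppH M M)] minus a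
   multiple of [H]; this cancels the last trace of [Htr] exactly. *)
have [|Cd CdP] := A5tr 2^-1; first by rewrite invr_gt0.
pose Kx : R := d%:R * (2 * `|CA5|) + 2 * `|Cd|.
have Kx0 : 0 <= Kx by rewrite addr_ge0 // mulr_ge0.
have Htr x p (M : 'M[R]_d) : M^T = M ->
    - Kx * H x p <= \tr (DxxH H x p) + 2 * \tr (DpxH H x p *m M) + \tr (DppH H x p *m (M *m M)).
  move=> Ms; have h1 := tr_ge_fnorm (DxxH H x p).
  have h2 : d%:R * fnorm (DxxH H x p) <= d%:R * (2 * `|CA5|) * H x p.
    by rewrite -mulrA ler_wpM2l // (le_trans (A5 x p).2).
  have MN : (- M)^T = - M by rewrite -[in RHS]Ms; apply/matrixP => i j; rewrite !mxE.
  have h3 := CdP x p (- M) MN.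
  have e1 : \tr (DpxH H x p *m - M) = - \tr (DpxH H x p *m M).
    by rewrite mulmxN; exact: raddfN.
  have e2 : - M *m - M = M *m M by rewrite mulNmx mulmxN opprK.
  rewrite e1 e2 in h3.
  have h4 : Cd * H x p <= `|Cd| * H x p.
    by apply: ler_wpM2r; [exact: le_trans ler01 (H1 x p)|exact: ler_norm].
  rewrite /Kx mulNr [(_ + _) * H x p]mulrDl -[2 * _ * H x p]mulrA.
  move: h1 h2 h3 h4; move: (\tr _) (\tr _) (\tr _) (d%:R * fnorm _) (d%:R * _ * _) (Cd * _) (`|Cd| * _).
  by move=> a1 a2 a3 a4 a5 a6 a7; lra.
have CH00 : 0 <= c2 * enorm (0 : 'rV[R]_d) `^ (2 + mu) + C2.
  by rewrite addr_ge0 // mulr_ge0 // powR_ge0.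
have HC8 i x p : DpH H x p 0 i ^+ 2 <= `|C8| * (enorm p `^ mu * H x p + 1).
  have h1 : DpH H x p 0 i ^+ 2 <= enorm (DpH H x p) ^+ 2.
    by rewrite -real_normK ?num_real // ler_sqr ?nnegrE ?sqrtr_ge0 // enorm_coord.
  apply: (le_trans h1); apply: (le_trans (A8 x p)).
  rewrite -mulrA -[X in _ + X]mulr1 -mulrDr ler_wpM2r ?ler_norm // addr_ge0 // mulr_ge0 ?powR_ge0 //.
  exact: le_trans ler01 (H1 x p).
have [C CP] := gradient_bound T0 al0 mu0 mu1 Hs Hp galE cL0 (ltW CL0) Kx0 Mm0 HL H1 Htr m0s m0p m0J
  kap0 m0k m0M' lam0 m0lam m0D uTU uTD uTG CH00 (fun x => (A7 x 0).2) C50 HC5 c20 C20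
  (fun x p => (A7 x p).2) (normr_ge0 C8) HC8 kp0 kp1 d2 thal e12 etaP.
by exists C => eps eps0 u m sol x t; exact: CP eps0 sol x t.
Qed.
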